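(* Let $(A,\mathfrak m)$ be a two-dimensional regular local ring with infinite residue class field and let $M\neq (0)$ be a finitely generated torsion-free $A$-module, regarded as a submodule of the free module $F=M^{**}$. Let $\mathcal R(M)\subseteq \operatorname{Sym}_A(F)$ be its Rees algebra with graded maximal ideal $\mathfrak M$. Then the following conditions are equivalent. (1) $\mathcal R(M)$ is a Buchsbaum ring and $\widetilde M=\overline M$. (2) $\mathcal R(M)$ is a Buchsbaum ring and $\operatorname{Proj}\mathcal R(M)$ is normal. (3) $\mathfrak m\overline M\subseteq M$ and $M\cdot\overline M=M^2$. When this is the case, one has $\mathrm H^1_{\mathfrak M}(\mathcal R(M))=\left[\mathrm H^1_{\mathfrak M}(\mathcal R(M))\right]_1\cong\overline M/M$, and $\overline{M^n}=M^n$ for every $n\geq 2$.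
   Context: Here $(-)^*=\operatorname{Hom}_A(-,A)$; $F=M^{**}$ is a finitely generated free $A$-module of rank $r>0$ and $M\subseteq F$ via the biduality map. Let $S=\operatorname{Sym}_A(F)\cong A[t_1,\dots,t_r]$ with its standard grading, $F^n=S_n$. The Rees algebra is $\mathcal R(M)=\operatorname{Im}(\operatorname{Sym}_A(M)\to S)$, a graded subring of $S$, and $M^n=[\mathcal R(M)]_n$. Products of submodules such as $M\cdot\overline M\subseteq F^2$ are taken in $S$. $\mathcal R(M)_+=\bigoplus_{n>0}M^n$ and $\mathfrak M=\mathfrak m\mathcal R(M)+\mathcal R(M)_+$. $\widetilde M=\bigcup_{\ell>0}\left[M^{\ell+1}:_F M^{\ell}\right]$ is the Ratliff–Rush closure of $M$, i.e. the set of $x\in F$ with $xM^\ell\subseteq M^{\ell+1}$ for some $\ell>0$. $\overline{M^n}\subseteq F^n$ is the degree $n$ component of the integral closure of $\mathcal R(M)$ in $S$. $\operatorname{Proj}\mathcal R(M)$ is the set of graded primes $P\not\supseteq\mathcal R(M)_+$ of $\mathcal R(M)$; it is normal if $\mathcal R(M)_P$ is normal for all such $P$. A Noetherian local ring $(R,\mathfrak n)$ is Buchsbaum if $\ell_R(R/Q)-e_Q(R)$ (length minus multiplicity) is independent of the choice of the parameter ideal $Q$ of $R$; $\mathcal R(M)$ is called Buchsbaum if the local ring $\mathcal R(M)_{\mathfrak M}$ is Buchsbaum. *)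

(* Defs.v *)
From HB Require Import structures.
From mathcomp Require Export all_boot all_order all_algebra.
From mathcomp Require Export boolp classical_sets functions cardinality.
From mathcomp Require Export mpoly.
Set Implicit Arguments.
Unset Strict Implicit.
Unset Printing Implicit Defensive.
Import Order.TTheory GRing.Theory Num.Theory.
Local Open Scope classical_set_scope.
Local Open Scope ring_scope.

(** * Commutative algebra relative to a subring

    All rings that occur ([A], the Rees algebra and its localizations) are
    subrings [B : set T] of an ambient commutative ring [T]: of [A] itself, of
    [S = A[t_1, ..., t_r]], or of the fraction field of [S].  Ideals and
    modules over [B] are then subsets of [T]. *)

Section Subrings.
Variable T : comNzRingType.
Implicit Types (B N I J P Q X : set T).

Definition subring B :=
  [/\ B 1, forall x y, B x -> B y -> B (x - y)
    & forall x y, B x -> B y -> B (x * y)].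

Definition submodule B N :=
  [/\ N 0, forall x y, N x -> N y -> N (x + y)
    & forall a x, B a -> N x -> N (a * x)].

(** the [B]-submodule of [T] generated by [X]; an ideal of [B] if [X `<=` B] *)
Definition span B X : set T := smallest (submodule B) X.

Definition mulset B N1 N2 : set T := span B [set x * y | x in N1 & y in N2].

Definition ideal B I := I `<=` B /\ submodule B I.

Definition prime_ideal B P :=
  [/\ ideal B P, ~ P 1
    & forall x y, B x -> B y -> P (x * y) -> P x \/ P y].

Definition maximal_ideal B n :=
  [/\ ideal B n, ~ n 1
    & forall J, ideal B J -> n `<=` J -> J = n \/ J 1].

Definition is_local B n :=
  maximal_ideal B n /\ (forall n', maximal_ideal B n' -> n' = n).

Definition noetherian B :=
  forall I, ideal B I -> exists s : seq T, I = span B [set` s].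

Definition strict_chain (C : set (set T)) (l : nat) (c : nat -> set T) :=
  (forall i, (i <= l)%N -> C (c i)) /\
  (forall i, (i < l)%N -> c i `<` c i.+1).

(** [l] is the supremum of the lengths of the chains in [C] *)
Definition chain_length (C : set (set T)) (l : nat) :=
  (exists c, strict_chain C l c) /\
  (forall k c, strict_chain C k c -> (k <= l)%N).

Definition krull_dim B (d : nat) := chain_length (prime_ideal B) d.

(** [N1/N2] is a [B]-module of finite length [l] *)
Definition has_length B N1 N2 (l : nat) :=
  chain_length [set N | [/\ submodule B N, N2 `<=` N & N `<=` N1]] l.

Definition regular_local B n (d : nat) :=
  [/\ subring B, noetherian B, is_local B n, krull_dim B d
    & exists a : 'I_d -> T, n = span B (range a)].

Definition idealX B Q (k : nat) : set T := iter k (mulset B Q) B.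

(** [Q] is generated by a system of parameters of the local ring [(B, n)] *)
Definition parameter_ideal B n Q :=
  exists (d : nat) (a : 'I_d -> T),
    [/\ krull_dim B d, forall i, n (a i), Q = span B (range a)
      & forall x, n x -> exists k : nat, Q (x ^+ k)].

(** The multiplicity [e_Q(B)] is [d!] times the coefficient of degree
    [d = dim B] of the Hilbert-Samuel polynomial of [Q], the polynomial giving
    the length of [B/Q^(k+1)] for large [k]. *)
Definition multiplicity B Q (e : nat) :=
  exists (d : nat) (p : {poly rat}),
    [/\ krull_dim B d, (size p <= d.+1)%N, p`_d * d`!%:R = e%:R
      & exists k0 : nat, forall k, (k0 <= k)%N ->
          exists2 l : nat, has_length B B (idealX B Q k.+1) l
                         & p.[k%:R] = l%:R].

Definition buchsbaum_local B :=
  exists n, [/\ subring B, noetherian B, is_local B n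
    & exists C : int, forall Q, parameter_ideal B n Q ->
        exists l e : nat,
          [/\ has_length B B Q l, multiplicity B Q e & l%:Z - e%:Z = C]].

Definition integral_over B (x : T) :=
  exists p : {poly T}, [/\ p \is monic, forall i, B p`_i & root p x].

End Subrings.

Section SubringsOfField.
Variable K : fieldType.
Implicit Types (B P : set K).

Definition localization B P : set K :=
  [set x | exists a s, [/\ B a, B s, ~ P s & x = a / s]].

(** the domain [B] is integrally closed in its fraction field *)
Definition normal_domain B :=
  forall a b, B a -> B b -> b != 0 -> integral_over B (a / b) -> B (a / b).

End SubringsOfField.

(** [N1/N2] and [N1'/N2'] are isomorphic [A]-modules, the scalar
    multiplications of [V] and [V'] being [act] and [act'] *)
Definition subquotient_iso (A : Type) (V V' : zmodType)
    (act : A -> V -> V) (act' : A -> V' -> V')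
    (N1 N2 : set V) (N1' N2' : set V') :=
  exists f : V -> V',
    [/\ forall x, N1 x -> N1' (f x),
        forall x y, N1 x -> N1 y -> N2' (f (x + y) - (f x + f y)),
        forall a x, N1 x -> N2' (f (act a x) - act' a (f x)),
        forall x, N1 x -> (N2' (f x) <-> N2 x)
      & forall y, N1' y -> exists2 x, N1 x & N2' (y - f x)].

(** * Modules, duals and biduals *)

Section Dual.
Variables (A : comNzRingType) (M : lmodType A).

Definition linear_pred : pred (M -> A^o) := fun f => `[< linear f >].

Fact linear_pred_submod_closed : submod_closed linear_pred.
Proof.
split=> [|a f g]; first by apply/asboolP => b x y; rewrite scaler0 addr0.
move=> /asboolP lf /asboolP lg; apply/asboolP => b x y.
rewrite -[LHS]/(a *: f (b *: x + y) + g (b *: x + y)).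
rewrite -[RHS]/(b *: (a *: f x + g x) + (a *: f y + g y)).
rewrite lf lg !scalerDr !scalerA [a * b]mulrC -!addrA; congr (_ + _).
by rewrite addrCA.
Qed.

HB.instance Definition _ :=
  GRing.isSubmodClosed.Build A (M -> A^o) linear_pred linear_pred_submod_closed.

(** [M^* = Hom_A(M, A)] *)
Record dual := Dual { dual_fun :> M -> A^o; _ : linear_pred dual_fun }.

HB.instance Definition _ := [isSub for dual_fun].
HB.instance Definition _ := [Choice of dual by <:].
HB.instance Definition _ := [SubChoice_isSubLmodule of dual by <:].

End Dual.

Section Biduality.
Variables (A : comNzRingType) (M : lmodType A).

Fact biduality_subproof (x : M) :
  linear_pred (fun f : dual M => f x : A^o).
Proof. by apply/asboolP. Qed.

Definition biduality (x : M) : dual (dual M) := Dual (biduality_subproof x).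

Definition fin_gen := exists (k : nat) (g : 'I_k -> M),
  forall x, exists c : 'I_k -> A, x = \sum_i c i *: g i.

Definition torsion_free :=
  forall (a : A) (x : M), GRing.lreg a -> a *: x = 0 -> x = 0.

Definition free_basis (r : nat) (e : 'I_r -> M) :=
  forall x, exists! c : {ffun 'I_r -> A}, x = \sum_i c i *: e i.

End Biduality.

(** the residue field [A/m], the set of cosets of [m], is infinite *)
Definition infinite_residue_field (A : comNzRingType) (m : set A) :=
  infinite_set (range (fun a : A => [set a + x | x in m])).

(** * The Rees algebra of a module *)

(** A basis [e] of [F = M^**] identifies [Sym_A(F)] with [{mpoly A[r]}] and [F]
    with its component of degree one; [inS e] is the image of [M] there. *)
Definition inS (A : comNzRingType) (M : lmodType A) (r : nat)
    (e : 'I_r -> dual (dual M)) : set {mpoly A[r]} :=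
  [set p | exists (x : M) (c : 'I_r -> A),
     biduality x = \sum_i c i *: e i /\ p = \sum_i c i *: 'X_i].

(** [A] is taken to be a domain, as every regular local ring is, so that the
    localizations of [R(M)] can be realized inside [Frac(S)]. *)
Section Rees.
Variables (A : idomainType) (r : nat).
Local Notation S := {mpoly A[r]}.
Local Notation K := {fraction S}.
Local Notation tofrac := (@FracField.tofrac S).
Implicit Types (m : set A) (M : set S).

Definition scalars : set S := range (@mpolyC r A).

(** [S_n], which is also [F^n] *)
Definition Sdeg (n : nat) : set S := [set p | p \is n.-homog].

(** the image of [Sym_A(M)] in [S] is the [A]-subalgebra generated by [M] *)
Definition Rees M : set S := smallest (@subring S) (scalars `|` M).

Definition Mpow M (n : nat) : set S := Rees M `&` Sdeg n.

Definition Rees_plus M : set S :=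
  span scalars (\bigcup_(n in [set n | (0 < n)%N]) Mpow M n).

(** [m R(M) + R(M)_+] *)
Definition Rees_max m M : set S :=
  span (Rees M) ((@mpolyC r A @` m) `|` Rees_plus M).

Definition ratliff_rush M : set S :=
  [set x | Sdeg 1 x /\ exists2 l : nat, (0 < l)%N &
             forall y, Mpow M l y -> Mpow M l.+1 (x * y)].

(** the integral closure of [M^n], in [F^n] *)
Definition Mbar M (n : nat) : set S :=
  [set x | Sdeg n x /\ integral_over (Rees M) x].

(** [R(M)_P], inside the fraction field of [S] *)
Definition Rees_loc M (P : set S) : set K :=
  localization (tofrac @` Rees M) (tofrac @` P).

Definition Rees_buchsbaum m M := buchsbaum_local (Rees_loc M (Rees_max m M)).

Definition graded_prime M (P : set S) :=
  prime_ideal (Rees M) P /\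
  (forall p n, P p -> P (pihomog mdeg n p)).

Definition Proj_normal M := forall P, graded_prime M P ->
  ~ (Rees_plus M `<=` P) -> normal_domain (Rees_loc M P).

(** ** Local cohomology

    [H^1] of the Cech complex
      [R(M) -> \prod_i R(M)_{f_i} -> \prod_{i<j} R(M)_{f_i f_j}]
    on a system [f] of nonzero homogeneous generators of the graded maximal
    ideal.  As [R(M)] is a domain, its localizations at the [f_i] and [f_i f_j]
    are subrings of the fraction field of [S]. *)

Definition homogeneous_generators m M (s : nat) (f : 'I_s -> S) :=
  (forall i, f i != 0 /\ exists n, Mpow M n (f i)) /\
  Rees_max m M = span (Rees M) (range f).

Definition Rees_away M (g : S) : set K :=
  [set x | exists (a : S) (k : nat), Rees M a /\ x = tofrac a / tofrac g ^+ k].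

(** the component of degree [n] of [R(M)_g], for [g] homogeneous *)
Definition Rees_away_deg M (g : S) (n : int) : set K :=
  [set x | exists (a : S) (d j k : nat),
     [/\ g \is d.-homog, Mpow M j a, j%:Z = n + (k * d)%:Z
       & x = tofrac a / tofrac g ^+ k]].

Section Cech.
Variables (M : set S) (s : nat) (f : 'I_s -> S).

Definition cech_d0 (x : S) : 'I_s -> K := fun=> tofrac x.

Definition cech_d1 (z : 'I_s -> K) : 'I_s -> 'I_s -> K :=
  fun i j => z j - z i.

Definition cech_Z1 : set ('I_s -> K) :=
  [set z | (forall i, Rees_away M (f i) (z i)) /\
           (forall i j : 'I_s, (i < j)%N -> cech_d1 z i j = 0)].

Definition cech_B1 : set ('I_s -> K) := cech_d0 @` Rees M.

(** components of degree [n] *)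
Definition cech_Z1_deg (n : int) : set ('I_s -> K) :=
  cech_Z1 `&` [set z | forall i, Rees_away_deg M (f i) n (z i)].

Definition cech_B1_deg (n : int) : set ('I_s -> K) :=
  cech_B1 `&` [set z | forall i, Rees_away_deg M (f i) n (z i)].

Definition cech_scale (a : A) (z : 'I_s -> K) : 'I_s -> K :=
  fun i => tofrac a%:MP * z i.

(** every class in [H^1] comes from [[H^1]_n] *)
Definition H1_concentrated (n : int) :=
  forall z, cech_Z1 z -> exists2 z', cech_Z1_deg n z' & cech_B1 (z - z').

(** [[H^1]_n] is isomorphic to [N1/N2] as an [A]-module *)
Definition H1_deg_iso (n : int) (N1 N2 : set S) :=
  subquotient_iso (fun (a : A) (x : S) => a *: x) cech_scale
    N1 N2 (cech_Z1_deg n) (cech_B1_deg n).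

End Cech.

End Rees.

(* Main.v *)
Require Import Defs.
From mathcomp Require Import perm generic_quotient ring zify.
Import Order.TTheory GRing.Theory Num.Theory.
Set Implicit Arguments.
Unset Strict Implicit.
Unset Printing Implicit Defensive.
Local Open Scope classical_set_scope.
Local Open Scope ring_scope.

(** Let [R] be the Rees algebra, [N] its integral closure, [P] the graded maximal
    ideal. As the residue field is infinite, [M] has a reduction generated by
    [r + 1] elements [u_i]. They satisfy one linear relation, whose coefficients
    [dl_i] are the maximal minors of the coordinate matrix of the reduction and
    generate an ideal primary to the maximal ideal. Blowing up the maximal ideal and
    inducting on the length of [A/(dl_i)], one gets [N_(k+1) = sum_i u_i N_k] for
    all [k >= 1]. A Koszul argument then shows that [N] has the full depth [r + 2].
    Hence [R] is Buchsbaum as soon as [P N] lies in [R]. Conversely, if [N/R] has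
    finite length, which follows from the second half of (1) as well as of (2), then
    the Buchsbaum property puts [P N] into [R]. In terms of degrees the inclusion
    [P N <= R] is condition (3), and then [N/R] is concentrated in degree 1 and
    equals the first local cohomology of [R]. *)

(** Let v be the length of N/R and d the dimension, both taken locally at P. A system of parameters
    is a regular sequence on N, so e(Q) is the length of N/QN, and the length of R/Q minus e(Q) is
    the length of QN/QR minus v. The length of QN/QR is at most d v, with equality when QN lies in
    R. High powers of parameters reach equality; so over a Buchsbaum ring every system does, and
    equality forces all parameters but the first to multiply N into R.

    The obstacle is the formula for N_(k+1). Where some dl_i is invertible, the u_i generate a
    polynomial ring, which is normal. On a chart of the blow-up the dl_i are divided by a power of
    the exceptional parameter, and at each relevant point of the fibre the colength has dropped. On
    the way back, the expressions of one element on the two charts differ by a Koszul relation on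
    the overlap; to descend it, forms over the overlap must be sums of forms over the charts.

    That F/M has finite length is derived from F being the bidual, by means of the maximal minors of
    the coordinates of M. *)

(** * Submodules and linear combinations *)

Section SubmoduleCalculus.
Variable T : comNzRingType.
Implicit Types (B N X Y Z : set T) (s t : seq T).

Lemma sr1 B : subring B -> B 1. Proof. by case. Qed.
Lemma srB B x y : subring B -> B x -> B y -> B (x - y).
Proof. by case=> _ h _; exact: h. Qed.
Lemma srM B x y : subring B -> B x -> B y -> B (x * y).
Proof. by case=> _ _ h; exact: h. Qed.
Lemma sr0 B : subring B -> B 0.
Proof. by move=> hB; rewrite -(subrr (1 : T)); apply: srB => //; exact: sr1. Qed.
Lemma srN B x : subring B -> B x -> B (- x).
Proof. by move=> hB hx; rewrite -sub0r; apply: srB => //; exact: sr0. Qed.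
Lemma srD B x y : subring B -> B x -> B y -> B (x + y).
Proof. by move=> hB hx hy; rewrite -[y]opprK; apply: srB => //; exact: srN. Qed.
Lemma srX B x n : subring B -> B x -> B (x ^+ n).
Proof.
move=> hB hx; elim: n => [|n IH]; first by exact: sr1.
by rewrite exprS; exact: srM.
Qed.
Lemma sr_sum B {I : Type} {r : seq I} {P : pred I} {F : I -> T} :
  subring B -> (forall i, P i -> B (F i)) -> B (\sum_(i <- r | P i) F i).
Proof.
by move=> hB hF; apply: (big_ind B) => //; [exact: sr0|move=> x y; exact: srD].
Qed.
Lemma sr_prod B {I : Type} {r : seq I} {P : pred I} {F : I -> T} :
  subring B -> (forall i, P i -> B (F i)) -> B (\prod_(i <- r | P i) F i).
Proof.
by move=> hB hF; apply: (big_ind B) => //; [exact: sr1|move=> x y; exact: srM].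
Qed.
Lemma sr_nat B n : subring B -> B n%:R.
Proof.
move=> hB; elim: n => [|n IH]; first exact: sr0.
by rewrite -natr1; apply: srD => //; exact: sr1.
Qed.

Lemma sm0 B N : submodule B N -> N 0. Proof. by case. Qed.
Lemma smD B N x y : submodule B N -> N x -> N y -> N (x + y).
Proof. by case=> _ h _; exact: h. Qed.
Lemma smZ B N a x : submodule B N -> B a -> N x -> N (a * x).
Proof. by case=> _ _ h; exact: h. Qed.
Lemma smN B N x : subring B -> submodule B N -> N x -> N (- x).
Proof.
move=> hB hN hx; rewrite -mulN1r; apply: (smZ hN) => //.
by apply: srN => //; exact: sr1.
Qed.
Lemma smB B N x y : subring B -> submodule B N -> N x -> N y -> N (x - y).
Proof. by move=> hB hN hx hy; apply: (smD hN) => //; exact: (smN hB). Qed.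
Lemma sm_sum B N {I : Type} {r : seq I} {P : pred I} {F : I -> T} :
  submodule B N -> (forall i, P i -> N (F i)) -> N (\sum_(i <- r | P i) F i).
Proof.
move=> hN hF; apply: (big_ind N) => //; first exact: sm0 hN.
by move=> x y; exact: (smD hN).
Qed.
Lemma smDl B N x y : subring B -> submodule B N -> N x -> N (x + y) -> N y.
Proof. by move=> hB hN hx hxy; rewrite -(addKr x y) addrC; exact: (smB hB). Qed.
Lemma smDr B N x y : subring B -> submodule B N -> N y -> N (x + y) -> N x.
Proof. by move=> hB hN hx; rewrite addrC; exact: (smDl hB hN hx). Qed.

Lemma sm_self B : subring B -> submodule B B.
Proof.
move=> hB; split; [exact: sr0|move=> x y; exact: srD|move=> x y; exact: srM].
Qed.
Lemma submoduleS B B' N : B `<=` B' -> submodule B' N -> submodule B N.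
Proof.
move=> h hN; split; [exact: sm0 hN|move=> x y; exact: (smD hN)|].
by move=> a x /h ha; exact: (smZ hN).
Qed.

Definition addm X Y : set T := [set x | exists y z, [/\ X y, Y z & x = y + z]].
Definition scm x N : set T := [set y | exists2 z, N z & y = x * z].

(** The coefficients range over a module [N]: with [N] the ring this is the module generated by [s],
    in general it is the product of that module with [N]. *)
Fixpoint lc N s : set T :=
  if s is x :: s' then addm (scm x N) (lc N s') else [set 0].

Lemma sm_zero B : submodule B [set 0].
Proof.
split=> //= [x y -> ->|a x _ ->]; first by rewrite addr0.
by rewrite mulr0.
Qed.
Lemma sm_addm B X Y : submodule B X -> submodule B Y -> submodule B (addm X Y).
Proof.
move=> hX hY; split.
- by exists 0, 0; split; rewrite ?addr0 //; [exact: sm0 hX|exact: sm0 hY].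
- move=> _ _ [x [y [hx hy ->]]] [x' [y' [hx' hy' ->]]].
  exists (x + x'), (y + y'); split; [exact: (smD hX)|exact: (smD hY)|by ring].
- move=> a _ ha [x [y [hx hy ->]]]; exists (a * x), (a * y).
  by split; [exact: (smZ hX)|exact: (smZ hY)|rewrite mulrDr].
Qed.
Lemma sm_scm B N x : submodule B N -> submodule B (scm x N).
Proof.
move=> hN; split.
- by exists 0; rewrite ?mulr0 //; exact: sm0 hN.
- move=> _ _ [y hy ->] [z hz ->]; exists (y + z); last by rewrite mulrDr.
  exact: (smD hN).
- move=> a _ ha [y hy ->]; exists (a * y); last by rewrite mulrCA.
  exact: (smZ hN).
Qed.
Lemma sm_lc B N s : submodule B N -> submodule B (lc N s).
Proof.
move=> hN; elim: s => [|x s IH] /=; first exact: sm_zero.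
by apply: sm_addm => //; exact: sm_scm.
Qed.
Lemma sm_setI B X Y : submodule B X -> submodule B Y -> submodule B (X `&` Y).
Proof.
move=> hX hY; split.
- by split; [exact: sm0 hX|exact: sm0 hY].
- by move=> x y [a b] [c d]; split; [exact: (smD hX)|exact: (smD hY)].
- by move=> a x ha [b c]; split; [exact: (smZ hX)|exact: (smZ hY)].
Qed.
Lemma sm_span B X : submodule B (span B X).
Proof.
split=> [Y [hY _]|x y hx hy Y [hY hXY]|a x ha hx Y [hY hXY]].
- exact: sm0 hY.
- by apply: (smD hY); [exact: hx|exact: hy].
- by apply: (smZ hY) => //; exact: hx.
Qed.
Lemma span_min B X N : submodule B N -> X `<=` N -> span B X `<=` N.
Proof. by move=> hN h x; apply. Qed.
Lemma sub_span B X : X `<=` span B X.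
Proof. by move=> x hx Y [_]; apply. Qed.

Lemma addml B X Y : submodule B Y -> X `<=` addm X Y.
Proof. by move=> hY x hx; exists x, 0; rewrite addr0; split=> //; exact: sm0 hY. Qed.
Lemma addmr B X Y : submodule B X -> Y `<=` addm X Y.
Proof. by move=> hX x hx; exists 0, x; rewrite add0r; split=> //; exact: sm0 hX. Qed.
Lemma addm_min B X Y N : submodule B N -> X `<=` N -> Y `<=` N -> addm X Y `<=` N.
Proof. by move=> hN h1 h2 _ [x [y [hx hy ->]]]; apply: (smD hN); auto. Qed.
Lemma addmS X Y X' Y' : X `<=` X' -> Y `<=` Y' -> addm X Y `<=` addm X' Y'.
Proof. by move=> h1 h2 _ [x [y [hx hy ->]]]; exists x, y; split; auto. Qed.
Lemma addmC X Y : addm X Y = addm Y X.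
Proof.
by rewrite eqEsubset; split=> _ [x [y [hx hy ->]]]; exists y, x; rewrite addrC.
Qed.
Lemma addmA X Y Z : addm X (addm Y Z) = addm (addm X Y) Z.
Proof.
rewrite eqEsubset; split.
- move=> _ [x [_ [hx [y [z [hy hz ->]]] ->]]].
  by exists (x + y), z; split; rewrite ?addrA //; exists x, y.
- move=> _ [_ [z [[x [y [hx hy ->]]] hz ->]]].
  by exists x, (y + z); split; rewrite ?addrA //; exists y, z.
Qed.
Lemma addmCA X Y Z : addm X (addm Y Z) = addm Y (addm X Z).
Proof. by rewrite addmA (addmC X) -addmA. Qed.
Lemma addm_idr B X Y : submodule B X -> submodule B Y -> Y `<=` X -> addm X Y = X.
Proof.
move=> hX hY h; rewrite eqEsubset; split; last exact: addml hY.
exact: (addm_min hX).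
Qed.
Lemma addm_idl B X Y : submodule B X -> submodule B Y -> X `<=` Y -> addm X Y = Y.
Proof. by move=> hX hY h; rewrite addmC (addm_idr hY hX). Qed.
Lemma addm0 X : addm X [set 0] = X.
Proof.
rewrite eqEsubset; split=> [_ [x [y [hx -> ->]]]|x hx]; first by rewrite addr0.
by exists x, 0; rewrite addr0.
Qed.

Lemma scmS x N N' : N `<=` N' -> scm x N `<=` scm x N'.
Proof. by move=> h _ [y hy ->]; exists y; auto. Qed.
Lemma scm_sub B x N : B x -> submodule B N -> scm x N `<=` N.
Proof. by move=> hx hN _ [y hy ->]; exact: (smZ hN). Qed.
Lemma lcS N N' s : N `<=` N' -> lc N s `<=` lc N' s.
Proof. by move=> h; elim: s => [|x s IH] //=; apply: addmS => //; exact: scmS. Qed.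
Lemma lc_min B N s X : submodule B X ->
  (forall x y, x \in s -> N y -> X (x * y)) -> lc N s `<=` X.
Proof.
move=> hX; elim: s => [|x s IH] h /=; first by move=> _ ->; exact: sm0 hX.
apply: (addm_min hX); first by move=> _ [y hy ->]; apply: h; rewrite ?mem_head.
by apply: IH => y z hy; apply: h; rewrite inE hy orbT.
Qed.
Lemma lc_sub B N s : (forall x, x \in s -> B x) -> submodule B N -> lc N s `<=` N.
Proof. by move=> h hN; apply: (lc_min hN) => x y /h; exact: smZ. Qed.
Lemma lc_mem B N s x y : submodule B N -> x \in s -> N y -> lc N s (x * y).
Proof.
move=> hN; elim: s => [|z s IH] //=; rewrite inE => /orP[/eqP ->|hx] hy.
  by apply: (addml (sm_lc s hN)); exists y.
by apply: (addmr (sm_scm z hN)); exact: IH.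
Qed.
Lemma lc_gen B s x : subring B -> x \in s -> lc B s x.
Proof.
move=> hB hx; rewrite -[x]mulr1; apply: (lc_mem (sm_self hB) hx).
exact: sr1.
Qed.
Lemma lc_subseq B N s t : submodule B N -> {subset s <= t} -> lc N s `<=` lc N t.
Proof.
move=> hN h; apply: (lc_min (sm_lc t hN)) => x y /h hx hy; exact: lc_mem hN hx hy.
Qed.
Lemma lc_perm B N s t : submodule B N -> s =i t -> lc N s = lc N t.
Proof.
by move=> hN h; rewrite eqEsubset; split; apply: (lc_subseq hN) => x; rewrite h.
Qed.
Lemma lc_cat B N s t : submodule B N -> lc N (s ++ t) = addm (lc N s) (lc N t).
Proof.
move=> hN; elim: s => [|x s IH] /=; last by rewrite IH addmA.
by rewrite addmC addm0.
Qed.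
Lemma lc_span B s : subring B -> span B [set` s] = lc B s.
Proof.
move=> hB; have hl := sm_lc s (sm_self hB); rewrite eqEsubset; split.
  by apply: (span_min hl) => x; exact: lc_gen.
apply: (lc_min (sm_span _ _)) => x y hx hy; rewrite mulrC.
by apply: (smZ (sm_span _ _)) => //; exact: sub_span.
Qed.
Lemma lc_sumE B N s y : submodule B N -> lc N s y <->
  exists c : nat -> T, (forall i, N (c i)) /\ y = \sum_(i < size s) c i * s`_i.
Proof.
move=> hN; split; last first.
  case=> c [hc ->]; have hs := sm_lc s hN.
  apply: (sm_sum hs) => i _; rewrite mulrC.
  by apply: (lc_mem hN) => //; exact: mem_nth.
elim: s y => [|x s IH] y /=.
  by exists (fun=> 0); rewrite big_ord0; split=> // _; exact: sm0 hN.
case=> _ [z [[w hw ->] /IH[c [hc ->]] ->]].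
exists (fun i => if i is j.+1 then c j else w); split; first by case.
by rewrite big_ord_recl mulrC.
Qed.
Lemma lc_lc B N s t : submodule B N ->
  lc (lc N s) t = lc N [seq x * y | x <- t, y <- s].
Proof.
move=> hN; have hs := sm_lc s hN; rewrite eqEsubset; split.
  set X := lc N [seq _ | _ <- _, _ <- _]; have hX : submodule B X by exact: sm_lc.
  apply: (lc_min hX) => x y hx; rewrite -[X _]/([set y | X (x * y)] y); move: y.
  apply: (@lc_min B) => [|y z hy hz /=].
    split=> /= [|y z|a y ha]; first by rewrite mulr0; exact: sm0 hX.
      by rewrite mulrDr; exact: (smD hX).
    by rewrite mulrCA; exact: (smZ hX).
  by rewrite mulrA; apply: (lc_mem hN) => //; apply/allpairsP; exists (x, y).
apply: (lc_min (sm_lc t hs)) => _ y /allpairsP[[x z] /= [hx hz ->]] hy.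
by rewrite -mulrA; apply: (lc_mem hs) => //; exact: lc_mem hN hz hy.
Qed.
Lemma lc_scale B N s x y : submodule B N -> lc N s y ->
  lc N [seq x * z | z <- s] (x * y).
Proof.
move=> hN hy; have := @lc_lc B N s [:: x] hN.
rewrite /= cats0 addm0 => <-; by exists y.
Qed.
Lemma scm_lc N s x : lc (scm x N) s = scm x (lc N s).
Proof.
elim: s => [|y s IH] /=.
  by rewrite eqEsubset; split=> [_ ->|_ [_ -> ->]]; [exists 0; rewrite ?mulr0|rewrite mulr0].
rewrite IH eqEsubset; split.
  move=> _ [_ [_ [[_ [z hz ->] ->] [w hw ->] ->]]].
  by exists (y * z + w); [exists (y * z), w; split=> //; exists z|ring].
move=> _ [_ [_ [w [[z hz ->] hw ->]]] ->].
exists (y * (x * z)), (x * w); split; [|by exists w|by ring].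
by exists (x * z) => //; exists z.
Qed.

Lemma idealP B I : ideal B I -> submodule B I. Proof. by case. Qed.
Lemma ideal_sub B I : ideal B I -> I `<=` B. Proof. by case. Qed.

End SubmoduleCalculus.

(* Membership in subrings and submodules, by structural descent on the element. *)
Ltac alg_more := fail.
Ltac alg := intros; first [done | match goal with
  | |- is_true (_ \in _ :: _) => by rewrite !inE ?eqxx ?orbT
  | |- _ (_ * 0) => rewrite mulr0; alg
  | |- _ (0 * _) => rewrite mul0r; alg
  | |- lc _ _ _ => apply: lc_gen; alg
  | |- submodule _ (lc _ _) => apply: sm_lc; alg
  | |- submodule _ (addm _ _) => apply: sm_addm; alg
  | |- submodule _ (scm _ _) => apply: sm_scm; alg
  | |- submodule _ (_ `&` _) => apply: sm_setI; alg
  | |- submodule _ (span _ _) => exact: sm_span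
  | |- submodule ?B ?B => apply: sm_self; alg
  | h : ideal ?B ?I |- submodule ?B ?I => exact: idealP h
  | h : ?X `<=` ?Y, k : ?X ?x |- ?Y ?x => exact: (h _ k)
  | h : subring ?B |- ?B 1 => exact: (sr1 h)
  | h : subring ?B |- ?B 0 => exact: (sr0 h)
  | h : subring ?B |- ?B _%:R => exact: (sr_nat _ h)
  | h : subring ?B |- ?B (_ * _) => apply: (srM h); alg
  | h : subring ?B |- ?B (_ ^+ _) => apply: (srX _ h); alg
  | h : subring ?B |- ?B (_ + _) => apply: (srD h); alg
  | h : subring ?B |- ?B (- _) => apply: (srN h); alg
  | h : subring ?B |- ?B (\sum_(_ <- _ | _) _) => apply: (sr_sum h); alg
  | h : subring ?B |- ?B (\prod_(_ <- _ | _) _) => apply: (sr_prod h); alg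
  | h : submodule _ ?N |- ?N 0 => exact: (sm0 h)
  | h : submodule _ ?N |- ?N (_ + _) => apply: (smD h); alg
  | k : subring ?B, h : submodule ?B ?N |- ?N (- _) => apply: (smN k h); alg
  | h : submodule _ ?N |- ?N (\sum_(_ <- _ | _) _) => apply: (sm_sum h); alg
  | h : submodule _ ?N |- ?N (_ * _) => apply: (smZ h); alg
  | h : submodule _ ?N |- ?N (_ * _) => rewrite mulrC; apply: (smZ h); alg
  | h : forall x, is_true (x \in _) -> ?B x |- ?B _ => apply: h; alg
  | e : ?X = lc _ _ |- ?X _ => rewrite e; apply: lc_gen; alg
  | h : submodule _ ?N |- ?N (_ * (_ * _)) => rewrite mulrCA; apply: (smZ h); alg
  | h : submodule _ ?N |- ?N (_ * _ * _) => rewrite -mulrA; apply: (smZ h); alg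
  | |- _ (_ * (_ + _)) => rewrite mulrDr; alg
  | |- _ ((_ + _) * _) => rewrite mulrDl; alg
  | |- _ (if _ then _ else _) => case: ifP; alg
  | |- _ /\ _ => split; alg
  | |- [/\ _, _ & _] => split; alg
  | |- (_ `&` _) _ => split; alg
  | |- submodule _ (mkset _) => split; rewrite /mkset; alg
  | h : _ /\ _ |- _ => case: h; alg
  | |- ideal _ _ => split; alg
  | |- _ `<=` _ => rewrite /subset /mkset; alg
  | h : ?X `<=` ?Y |- ?Y ?x => apply: h; alg
  | _ => alg_more
  end].

Lemma lc_min_scale (T : comNzRingType) (B N X : set T) s c z : submodule B X ->
  lc N s z -> (forall x y, x \in s -> N y -> X (c * (x * y))) -> X (c * z).
Proof.
move=> hX hz h; have hY : submodule B [set z | X (c * z)] by alg.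
by apply: (lc_min hY) hz => x y; exact: h.
Qed.

(** * Noetherian modules *)

Section Noetherian.
Variable T : comNzRingType.
Implicit Types (B N X Y : set T) (s t : seq T).

Definition fgm B N := exists s, N = lc B s.
Definition noethm B N := forall X, submodule B X -> X `<=` N -> fgm B X.

Lemma noetherianE B : subring B -> noetherian B <-> noethm B B.
Proof.
move=> hB; split=> h X; first by move=> hX hXB; have [//|s ->] := h X;
  exists s; rewrite lc_span.
by case=> hXB hX; have [s ->] := h X hX hXB; exists s; rewrite lc_span.
Qed.

(** Induction on the generators: the coefficients of [x] in elements of [X] form an ideal [I]. Lifts
    [w] of its generators, together with generators of the part of [X] in the remaining span,
    generate [X]. *)
Lemma noethm_lc B s : subring B -> noethm B B -> noethm B (lc B s).
Proof.
move=> hB hn; have hBB := sm_self hB.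
elim: s => [|x s IH] X hX hXs.
  exists [::] => /=; rewrite eqEsubset; split=> // _ ->; exact: sm0 hX.
have hs := sm_lc s hBB.
pose I := [set c | B c /\ exists2 y, lc B s y & X (x * c + y)].
have hI : submodule B I.
  split.
  - split; first exact: sr0.
    exists 0; alg.
  - move=> c d [hc [y hy hcy]] [hd [z hz hdz]]; split; first exact: srD.
    exists (y + z); first exact: (smD hs).
    rewrite mulrDr addrACA; alg.
  - move=> a c ha [hc [y hy hcy]]; split; first exact: srM.
    exists (a * y); first exact: (smZ hs).
    rewrite mulrCA -mulrDr; alg.
have [|t hIt] := hn I hI; first by move=> c [].
have ht c : c \in t -> exists2 y, lc B s y & X (x * c + y).
  move=> hc; have [_ //] : I c by rewrite hIt; alg.
have {ht} [w [hwX hwt]] : exists w, (forall z, z \in w -> X z) /\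
    (forall c, lc B t c -> exists2 y, lc B s y & lc B w (x * c + y)).
  elim: t {hIt} ht => [|c t IHt] ht.
    exists [::]; split=> // _ ->; exists 0; first exact: sm0 hs.
    by rewrite mulr0 addr0.
  have [|w [hwX hw]] := IHt.
    by move=> d hd; apply: ht; rewrite inE hd orbT.
  have [y hy hcy] := ht c (mem_head _ _).
  exists ((x * c + y) :: w); split.
    by move=> z; rewrite inE => /orP[/eqP ->|/hwX].
  move=> _ [_ [d [[e he ->] /hw[z hz hdz] ->]]].
  exists (e * y + z); first alg.
  exists ((x * c + y) * e), (x * d + z); split=> //; first by exists e.
  by ring.
have [||v hv] := IH (X `&` lc B s); [alg|alg|].
exists (w ++ v); rewrite eqEsubset (lc_cat _ _ hBB); split; last first.
  apply: (addm_min hX); last by rewrite -hv => ? [].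
  apply: (lc_min hX) => z c /hwX hz hc; rewrite mulrC; exact: (smZ hX).
move=> z hz; have [_ [y [[c hc ->] hy hzE]]] := hXs z hz.
have [|y' hy' hw] := hwt c.
  by rewrite -hIt; split=> //; exists y => //; rewrite -hzE.
exists (x * c + y'), (y - y'); split=> //; last by rewrite hzE; ring.
rewrite -hv; split; last exact: (smB hB).
have -> : y - y' = z - (x * c + y') by rewrite hzE; ring.
apply: (smB hB) => //; apply: (lc_min hX _ hw) => u d /hwX hu hd.
alg.
Qed.

Lemma noethm_fg B N : subring B -> noethm B B -> fgm B N -> noethm B N.
Proof. by move=> hB hn [s ->]; exact: noethm_lc. Qed.

Lemma sm_chain B (c : nat -> set T) : (forall i, submodule B (c i)) ->
  (forall i, c i `<=` c i.+1) -> submodule B (\bigcup_i c i).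
Proof.
move=> hc hi; have hle i j : (i <= j)%N -> c i `<=` c j.
  move=> /subnK <-; elim: (j - i)%N => [|k IH] //.
  by exact: subset_trans (hi _).
split; first by exists 0%N => //; exact: sm0 (hc 0%N).
- move=> x y [i _ hx] [j _ hy]; exists (maxn i j) => //.
  apply: (smD (hc _)); first exact: (hle i _ (leq_maxl i j)).
  exact: (hle j _ (leq_maxr i j)).
- by move=> a x ha [i _ hx]; exists i => //; exact: (smZ (hc _)).
Qed.

Lemma noethm_acc B N (c : nat -> set T) : subring B -> noethm B N ->
  (forall i, submodule B (c i)) -> (forall i, c i `<=` N) ->
  (forall i, c i `<=` c i.+1) -> exists k, c k.+1 `<=` c k.
Proof.
move=> hB hn hc hN hi; have hle i j : (i <= j)%N -> c i `<=` c j.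
  move=> /subnK <-; elim: (j - i)%N => [|k IH] //.
  by exact: subset_trans (hi _).
have [|s hs] := hn _ (sm_chain hc hi); first by move=> x [i _]; exact: hN.
have : forall x, x \in s -> exists i, c i x.
  move=> x hx; have : (\bigcup_i c i) x by rewrite hs; exact: lc_gen.
  by case=> i _ h; exists i.
move=> h; have [k hk] : exists k, forall x, x \in s -> c k x.
  elim: s {hs} h => [|x s IH] h; first by exists 0%N.
  have [y hy|k hk] := IH; first by apply: h; rewrite inE hy orbT.
  have [i hxi] := h x (mem_head _ _).
  exists (maxn i k) => y; rewrite inE => /orP[/eqP ->|/hk hy].
    exact: (hle i _ (leq_maxl i k)).
  exact: (hle k _ (leq_maxr i k)).
exists k => x hx; have : (\bigcup_i c i) x by exists k.+1.
rewrite hs; apply: (lc_min (hc k)) => y z /hk hy hz; rewrite mulrC.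
exact: (smZ (hc k)).
Qed.

(** Without a maximal element, a choice of larger members iterates to a chain that never becomes
    stationary. *)
Lemma noethm_max B N (F : set (set T)) X0 : subring B -> noethm B N ->
  (forall X, F X -> submodule B X /\ X `<=` N) -> F X0 ->
  exists X, [/\ F X, X0 `<=` X & forall Y, F Y -> X `<=` Y -> Y = X].
Proof.
move=> hB hn hF hX0; apply: contrapT => hno.
pose F' := [set X | F X /\ X0 `<=` X].
have step X : exists Y, F' X -> [/\ F' Y, X `<=` Y & ~ Y `<=` X].
  have [[hX hX0X]|hX] := pselect (F' X); last by exists X.
  apply: contrapT => h; apply: hno; exists X; split=> // Y hY hXY.
  rewrite eqEsubset; split=> //; apply: contrapT => hYX.
  apply: h; exists Y => _; split=> //; split=> //; exact: subset_trans hXY.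
have [f hf] := choice step.
pose c i := iter i f X0.
have hc i : F' (c i).
  by elim: i => [|i IH]; [split|rewrite /c iterS; have [] := hf _ IH].
have [i||i|k] := @noethm_acc B N c hB hn.
- by have [/hF[]] := hc i.
- by move=> i; have [/hF[]] := hc i.
- by have [] := hf _ (hc i).
- by have [_ _] := hf _ (hc k).
Qed.

End Noetherian.

(** * Primes and local rings *)

Lemma In_cat (U : Type) (x : U) (l1 l2 : seq U) :
  List.In x (l1 ++ l2) -> List.In x l1 \/ List.In x l2.
Proof. exact: List.in_app_or. Qed.

Section Primes.
Variables (T : comNzRingType) (B : set T).
Hypotheses (hB : subring B) (hn : noethm B B).
Implicit Types (N X Y I J P Q : set T) (s t : seq T).

Let hBB := sm_self hB.

Definition ann N0 w : set T := [set c | B c /\ N0 (c * w)].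

Lemma ann_ideal N0 w : submodule B N0 -> ideal B (ann N0 w).
Proof.
move=> h0; split; first by move=> x [].
split.
- split; alg.
- move=> x y [hx hxw] [hy hyw]; split; alg.
- move=> a x ha [hx hxw]; split; alg.
Qed.

Lemma ideal_max (F : set (set T)) I0 : (forall I, F I -> ideal B I) -> F I0 ->
  exists I, [/\ F I, I0 `<=` I & forall J, F J -> I `<=` J -> J = I].
Proof.
move=> h h0; apply: (noethm_max hB hn) h0 => X /h [hX hX']; by split.
Qed.

Lemma ann_prime_max N N0 w : submodule B N -> submodule B N0 -> N w -> ~ N0 w ->
  exists w', [/\ N w', ~ N0 w', ann N0 w `<=` ann N0 w', prime_ideal B (ann N0 w')
    & forall v, N v -> ~ N0 v -> ann N0 w' `<=` ann N0 v -> ann N0 v = ann N0 w'].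
Proof.
move=> hN h0 hw hw0.
pose F := [set I | exists v, [/\ N v, ~ N0 v & I = ann N0 v]].
have [||I [[v [hv hv0 ->]] hle hmax]] := @ideal_max F (ann N0 w).
- by move=> _ [v [_ _ ->]]; exact: ann_ideal.
- by exists w.
have hmax' u : N u -> ~ N0 u -> ann N0 v `<=` ann N0 u -> ann N0 u = ann N0 v.
  by move=> hu hu0 h; apply: hmax => //; exists u.
exists v; split=> //; split; first exact: ann_ideal.
  by case=> _; rewrite mul1r.
move=> x y hx hy [_ hxy]; have [hyv|hyv] := pselect (N0 (y * v)).
  by right.
left; rewrite -(hmax' (y * v)) //; first by split; rewrite // mulrA.
  alg.
move=> c [hc hcv]; split=> //; rewrite mulrCA; alg.
Qed.

Lemma sm_addI I x : ideal B I -> B x -> ideal B (addm I (scm x B)).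
Proof.
move=> [hI1 hI2] hx; split; last exact: (sm_addm hI2 (sm_scm x hBB)).
apply: (addm_min hBB hI1); exact: (scm_sub hx hBB).
Qed.

Lemma scm_self x : scm x B x.
Proof. exists 1; rewrite ?mulr1 //; alg. Qed.

(** An ideal maximal among those that miss the multiplicative set [S] is prime, because adjoining
    either of two outside elements makes it meet [S]. *)
Lemma prime_avoid I (S : set T) : ideal B I -> S 1 ->
  (forall x y, S x -> S y -> S (x * y)) -> (forall x, I x -> ~ S x) ->
  exists P, [/\ prime_ideal B P, I `<=` P & forall x, P x -> ~ S x].
Proof.
move=> hI S1 SM hIS.
pose F := [set J | ideal B J /\ forall x, J x -> ~ S x].
have [|//|P [[hP hPS] hIP hmax]] := @ideal_max F I.
  by move=> ? [].
exists P; split=> //; split=> //; first by move=> /hPS.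
move=> x y hx hy hxy; apply: contrapT => /not_orP[hPx hPy].
have meet z : B z -> ~ P z -> exists p b, [/\ P p, B b & S (p + z * b)].
  move=> hz hPz; apply: contrapT => h; apply: hPz.
  rewrite -(hmax (addm P (scm z B))).
  - by apply: (addmr (idealP hP)); exact: scm_self.
  - split; first exact: sm_addI.
    move=> _ [p [_ [hp [b hb ->] ->]]] hS; apply: h; by exists p, b.
  - by apply: (addml (sm_scm z hBB)).
have [p [b [hp hb hS]]] := meet x hx hPx.
have [q [c [hq hc hS']]] := meet y hy hPy.
apply: (hPS _ _ (SM _ _ hS hS')).
have -> : (p + x * b) * (q + y * c) = (q + y * c) * p + ((x * b) * q + (b * c) * (x * y)).
  by ring.
have hPP := idealP hP; have hPB := ideal_sub hP.

alg.
Qed.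

Lemma prime_mulX P x k : prime_ideal B P -> B x -> P (x ^+ k) -> P x.
Proof.
move=> [hP hP1 hPM] hx; elim: k => [|k IH]; first alg.
rewrite exprS => /hPM[] //; alg.
Qed.

(** Noetherian induction: an ideal maximal among those without such a finite list is proper and not
    prime, so it contains a product of two outside elements; the lists for the two enlarged ideals
    combine. *)
Lemma primes_over I : ideal B I -> exists L : seq (set T),
  (forall P, List.In P L -> prime_ideal B P /\ I `<=` P) /\
  (forall P, prime_ideal B P -> I `<=` P -> exists2 Q, List.In Q L & Q `<=` P).
Proof.
move=> hI; apply: contrapT => hno.
pose F := [set J | ideal B J /\ ~ exists L : seq (set T),
  (forall P, List.In P L -> prime_ideal B P /\ J `<=` P) /\
  (forall P, prime_ideal B P -> J `<=` P -> exists2 Q, List.In Q L & Q `<=` P)].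
have [|//|J [[hJ hJno] hIJ hmax]] := @ideal_max F I.
  by move=> ? [].
have good x : B x -> ~ J x -> exists L : seq (set T),
    (forall P, List.In P L -> prime_ideal B P /\ (J `<=` P /\ P x)) /\
    (forall P, prime_ideal B P -> J `<=` P -> P x ->
       exists2 Q, List.In Q L & Q `<=` P).
  move=> hx hJx; apply: contrapT => h; apply: hJx.
  have hs : J `<=` addm J (scm x B) by exact: (addml (sm_scm x hBB)).
  have hxs : addm J (scm x B) x by apply: (addmr (idealP hJ)); exact: scm_self.
  rewrite -(hmax (addm J (scm x B))) //.
  split; first exact: sm_addI.
  case=> L [hL1 hL2]; apply: h; exists L; split.
    move=> P /hL1[hP hPs]; split=> //; split; alg.
  move=> P hP hJP hPx; apply: hL2 => //.
  have hPP : submodule B P by case: hP => [[]].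
  apply: (addm_min hPP hJP) => _ [b hb ->]; rewrite mulrC; exact: (smZ hPP).
apply: hJno; have [[_ hJ1]|hJ1] := pselect (ideal B J /\ J 1).
  exists [::]; split=> // P [_ hP1 _] hJP; exfalso; apply: hP1; exact: hJP.
have [hJp|hJp] := pselect (prime_ideal B J).
  exists [:: J]; split=> [P [<-|[]]|P hP h]; first alg.
  by exists J => //; left.
have [x [y [hx hy hxy hJx hJy]]] :
    exists x y, [/\ B x, B y, J (x * y), ~ J x & ~ J y].
  apply: contrapT => h; apply: hJp; split=> //; first by move=> h1; apply: hJ1.
  move=> x y hx hy hxy; apply: contrapT => /not_orP[hJx hJy].
  by apply: h; exists x, y.
have [L1 [h1 h1']] := good x hx hJx; have [L2 [h2 h2']] := good y hy hJy.
exists (L1 ++ L2); split.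
  move=> P hP; have [/h1|/h2] := In_cat hP; alg.
move=> P hP hJP; have [_ _ /(_ x y hx hy (hJP _ hxy))[hPx|hPy]] := hP.
  by have [Q hQ hQP] := h1' P hP hJP hPx; exists Q => //; apply: List.in_or_app; left.
by have [Q hQ hQP] := h2' P hP hJP hPy; exists Q => //; apply: List.in_or_app; right.
Qed.

(** Prime avoidance for a coset. A prime contained in another one of the list is dropped; otherwise,
    if the element found for the rest falls into [P], it is corrected by an element of [J] that lies
    in all other primes but not in [P]. *)
Lemma avoid_coset (L : seq (set T)) x J : B x -> ideal B J ->
  (forall P, List.In P L -> prime_ideal B P /\ ~ (P x /\ J `<=` P)) ->
  exists2 y, J y & forall P, List.In P L -> ~ P (x + y).
Proof.
move=> hx hJ; have hJJ := idealP hJ.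
have [k] := ubnP (size L); elim: k L => // k IH [|P L] hk hL.
  exists 0 => //; alg.
have [[Q [hQ hQP]]|hno] := pselect (exists Q, List.In Q L /\ Q `<=` P).
  have [l1 [l2 hl]] := List.in_split _ _ hQ.
  have [||y hy hyP] := IH (P :: l1 ++ l2).
  - by move: hk; rewrite hl /= !size_cat /=; lia.
  - move=> R [<-|hR]; first by apply: hL; left.
    apply: hL; right; rewrite hl; apply: List.in_or_app.
    by have [hR'|hR'] := List.in_app_or _ _ _ hR; [left|right; right].
  exists y => // R [<-|hR]; first by apply: hyP; left.
  move: hR; rewrite hl => hR; have [{}hR|[<-|{}hR]] := In_cat hR.
  - by apply: hyP; right; apply: List.in_or_app; left.
  - by move/hQP; apply: hyP; left.
  - by apply: hyP; right; apply: List.in_or_app; right.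
have [||y hy hyL] := IH L; first alg.
  by move=> R hR; apply: hL; right.
have [hyP|hyP] := pselect (P (x + y)); last first.
  by exists y => // R [<-|/hyL].
have [[hPI hP1 hPM] hPJ] := hL P (or_introl erefl).
have hPP := idealP hPI.
have [j hj hjP] : exists2 j, J j & ~ P j.
  apply: contrapT => h; apply: hPJ; have hJP : J `<=` P.
    by move=> j hj; apply: contrapT => hjP; apply: h; exists j.
  split=> //; apply: (smDr hB hPP _ hyP); exact: hJP.
have [w [hw hwJ hwP hwL]] : exists w, [/\ B w, J w, ~ P w &
    forall R, List.In R L -> R w].
  have : forall R, List.In R L -> ideal B R /\ ~ R `<=` P.
    move=> R hR; split; first by have [[]] := hL R (or_intror hR).
    by move=> h; apply: hno; exists R.
  elim: L {hk hL hno hyL} => [|R L IHL] h.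
    by exists j; split=> //; exact: (ideal_sub hJ).
  have [|w [hw hwJ hwP hwL]] := IHL.
    by move=> R' hR'; apply: h; right.
  have [hR hRP] := h R (or_introl erefl).
  have [q hq hqP] : exists2 q, R q & ~ P q.
    by apply: contrapT => h'; apply: hRP => q hq; apply: contrapT => hqP; apply: h'; exists q.
  have hqB := ideal_sub hR hq.
  exists (w * q); split.
  - alg.
  - alg.
  - by case/hPM.
  - move=> R' [<-|hR']; first exact: (smZ (idealP hR)).
    rewrite mulrC; have [hR'I _] := h R' (or_intror hR').
    by apply: (smZ (idealP hR'I)) => //; exact: hwL.
exists (y + w); first exact: (smD hJJ).
move=> R [<-|hR]; rewrite addrA => hRw.
  by apply: hwP; apply: (smDl hB hPP hyP hRw).
have [[hRI _ _] _] := hL R (or_intror hR).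
apply: (hyL R hR); apply: (smDr hB (idealP hRI) _ hRw); exact: hwL.
Qed.

(* Enlarging the span of witnesses of maximal annihilators must stop; then every
   maximal annihilator contains the intersection of those already listed. *)
Lemma ass_list N N0 : fgm B N -> submodule B N -> submodule B N0 ->
  exists L : seq (set T),
    (forall P, List.In P L -> prime_ideal B P /\
       exists w, [/\ N w, ~ N0 w & P = ann N0 w]) /\
    (forall c w, B c -> N w -> ~ N0 w -> N0 (c * w) -> exists2 P, List.In P L & P c).
Proof.
move=> hfg hN h0.
pose good w := [/\ N w, ~ N0 w, prime_ideal B (ann N0 w)
    & forall v, N v -> ~ N0 v -> ann N0 w `<=` ann N0 v -> ann N0 v = ann N0 w].
pose F := [set X | exists s, (forall w, w \in s -> good w) /\
   X = addm (lc B s) (N0 `&` N)].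
have h0N := sm_setI h0 hN.
have [||_ [[s [hs ->]] _ hmax]] :=
    @noethm_max T B N F (addm (lc B [::]) (N0 `&` N)) hB (noethm_fg hB hn hfg).
- move=> _ [s [hs ->]]; split; first exact: sm_addm (sm_lc s hBB) h0N.
  apply: (addm_min hN); last alg.
  apply: (lc_min hN) => x y /hs[hx _ _ _] hy; rewrite mulrC; exact: (smZ hN).
- by exists [::].
exists [seq ann N0 w | w <- s]; split.
  elim: s {hmax} hs => [|w s IH] //= hs P [<-|hP]; last first.
    by apply: IH hP => v hv; apply: hs; rewrite inE hv orbT.
  by have [h1 h2 h3 _] := hs w (mem_head _ _); split=> //; exists w.
move=> c w hc hw hw0 hcw.
have [v [hv hv0 hwv hvp hvmax]] := ann_prime_max hN h0 hw hw0.
have hvc : ann N0 v c by alg.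
have hsv : addm (lc B s) (N0 `&` N) v.
  rewrite -(hmax (addm (lc B (v :: s)) (N0 `&` N))) /=.
  - apply: (addml h0N); apply: (addml (sm_lc s hBB)); exact: scm_self.
  - exists (v :: s); split=> // u; rewrite inE => /orP[/eqP ->|/hs //].
    alg.
  - apply: addmS => //; exact: (addmr (sm_scm v hBB)).
have hAs : forall d, B d -> (forall u, u \in s -> N0 (d * u)) -> ann N0 v d.
  move=> d hd h; split=> //; case: hsv => [x [y [hx [hy _] ->]]].
  rewrite mulrDr; apply: (smD h0); last exact: (smZ h0).
  apply: (lc_min_scale h0 hx) => u e /h hu he; rewrite mulrA mulrC; alg.
have [u hu huv] : exists2 u, u \in s & ann N0 u `<=` ann N0 v.
  apply: contrapT => hno; have [hvI hv1 hvM] := hvp.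
  have {}hno u : u \in s -> exists2 d, ann N0 u d & ~ ann N0 v d.
    move=> hu; apply: contrapT => h; apply: hno; exists u => // d hd.
    by apply: contrapT => hvd; apply: h; exists d.
  have [d [hd hdv hds]] : exists d, [/\ B d, ~ ann N0 v d &
      forall u, u \in s -> N0 (d * u)].
    elim: s hno {hs hmax hsv hAs} => [|u s IH] h.
      exists 1; split=> //; alg.
    have [|d [hd hdv hds]] := IH.
      by move=> z hz; apply: h; rewrite inE hz orbT.
    have [e [he heu] hev] := h u (mem_head _ _).
    exists (d * e); split; [alg|by case/hvM|].
    move=> z; rewrite inE => /orP[/eqP ->|/hds hz].
      rewrite -mulrA; alg.
    rewrite mulrAC mulrC; alg.
  by apply: hdv; exact: hAs.
have huE : ann N0 v = ann N0 u by have [_ _ _] := hs u hu; apply.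
exists (ann N0 u); last by rewrite -huE.
elim: s hu {hs hmax hsv hAs} => [|z s IH] //=; rewrite inE => /orP[/eqP ->|/IH h].
  by left.
by right.
Qed.

End Primes.

(** * Local rings: units, Nakayama's lemma, Krull's intersection theorem *)

Section Local.
Variables (T : comNzRingType) (B n : set T).
Hypotheses (hB : subring B) (hn : noethm B B) (hl : is_local B n).
Implicit Types (N X Y I J P Q : set T) (s t : seq T).

Let hBB := sm_self hB.

Lemma local_ideal : ideal B n. Proof. by case: hl => [[]]. Qed.
Let hnn := idealP local_ideal.
Let hnB := ideal_sub local_ideal.
Lemma local_proper : ~ n 1. Proof. by case: hl => [[]]. Qed.

Lemma proper_sub_local I : ideal B I -> ~ I 1 -> I `<=` n.
Proof.
move=> hI hI1; pose F := [set J | ideal B J /\ ~ J 1].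
have [|//|J [[hJ hJ1] hIJ hmax]] := @ideal_max _ _ hB hn F I; first by move=> ? [].
suff <- : J = n by [].
case: hl => _; apply; split=> // J' hJ' hJJ'.
have [|hJ'1] := pselect (J' 1); [by right|left].
by apply: hmax.
Qed.

Lemma local_unit c : B c -> ~ n c -> exists2 d, B d & c * d = 1.
Proof.
move=> hc hnc; apply: contrapT => h; apply: hnc.
apply: (@proper_sub_local (scm c B)); last exact: scm_self.
  by split; [exact: (scm_sub hc hBB)|alg].
by case=> d hd e; apply: h; exists d.
Qed.

Lemma local_unit1 a : n a -> exists2 d, B d & (1 - a) * d = 1.
Proof.
move=> ha; apply: local_unit; first alg.
move=> h; apply: local_proper; rewrite -[1](subrK a); exact: (smD hnn).
Qed.

Lemma local_prime : prime_ideal B n.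
Proof.
split; [alg|exact: local_proper|].
move=> x y hx hy hxy; have [|hnx] := pselect (n x); [by left|right].
have [d hd e] := local_unit hx hnx.
have -> : y = d * (x * y) by rewrite mulrA [d * x]mulrC e mul1r.
alg.
Qed.

Lemma unit_cancel N0 a w : submodule B N0 -> n a -> N0 (w - a * w) -> N0 w.
Proof.
move=> h0 ha h; have [d hd e] := local_unit1 ha.
have -> : w = d * (w - a * w) by rewrite -{1}[w]mul1r -e; ring.
alg.
Qed.

(** Modulo [x], induction writes the other generators as elements of [N0] plus multiples of [x].
    Substituted in the hypothesis for [x], this puts [x] times one minus an element of [n] into
    [N0]. *)
Lemma nakayama N0 s : submodule B N0 ->
  (forall x, x \in s -> addm N0 (lc n s) x) -> forall x, x \in s -> N0 x.
Proof.
elim: s N0 => [|x s IH] N0 h0 h //.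
have hBx := sm_scm x hBB; have h1 := sm_addm h0 hBx.
have hs y : y \in s -> addm N0 (scm x B) y.
  apply: IH => // z hz; have [|p [_ [hp [_ [v [[a ha ->] hv ->]]] ->]]] := h z.
    by rewrite inE hz orbT.
  exists (p + x * a), v; split=> //; last by rewrite addrA.
  exists p, (x * a); split=> //; exists a => //; alg.
have hx : N0 x.
  have [p [_ [hp [_ [v [[a ha ->] hv ->]]] e]]] := h x (mem_head _ _).
  have [q [_ [hq [b hb ->] hvE]]] : addm N0 (scm x n) v.
    move: hv; apply: (lc_min (sm_addm h0 (sm_scm x hnn))) => y c /hs.
    case=> q [_ [hq [b hb ->] ->]] hc; exists (q * c), (x * (b * c)); split.
    - alg.
    - exists (b * c) => //; alg.
    - by ring.
  apply: (@unit_cancel N0 (a + b)) => //; first exact: (smD hnn).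
  have -> : x - (a + b) * x = p + q.
    by rewrite {1}e hvE; ring.
  alg.
move=> y; rewrite inE => /orP[/eqP -> //|/hs].
case=> p [_ [hp [b hb ->] ->]]; alg.
Qed.

(** The modules [Y k] generated modulo [N0] by the first [k] cofactors become stationary. Then [v k]
    is a combination of earlier cofactors, and [c ^+ k * v k] is congruent both to [w] and to a
    multiple of [w] with coefficient in [n]. *)
Lemma krull_intersection N N0 c w : fgm B N -> submodule B N0 -> n c -> N w ->
  (forall k, exists2 v, N v & N0 (w - c ^+ k * v)) -> N0 w.
Proof.
move=> hfg h0 hc hw h.
have hNs : submodule B N by case: hfg => s ->; alg.
have /choice[v hv] : forall k, exists v, N v /\ N0 (w - c ^+ k * v).
  move=> k; by have [z hz hz0] := h k; exists z.
pose Y := fix Y k := if k is k'.+1 then addm (Y k') (scm (v k') B) else N `&` N0.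
have hY k : submodule B (Y k).
  elim: k => [|k IH] /=; alg.
(* For an earlier cofactor, [c ^+ i * v i] is congruent to [w]; any further factor [c] makes it an
   [n]-multiple of [w]. *)
have hYc k y : Y k y -> exists2 a, n a & N0 (c ^+ k * y - a * w).
  elim: k y => [|k IH] y /=.
    move=> [_ hy]; exists 0; alg.
  case=> z [_ [/IH[a ha haz] [b hb ->] ->]].
  have hcB := hnB hc.
  exists (c * a + b * c).

    alg.
  have -> : c ^+ k.+1 * (z + v k * b) - (c * a + b * c) * w =
    c * (c ^+ k * z - a * w) + (- (b * c)) * (w - c ^+ k * v k).
    by rewrite exprS; ring.
  apply: (smD h0); apply: (smZ h0) => //; last by case: (hv k).
  alg.
have [k||k hk] := @noethm_acc T B N Y hB (noethm_fg hB hn hfg) hY.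
- elim: k => [|k IH] /=; first alg.
  apply: (addm_min hNs IH) => _ [b hb ->]; rewrite mulrC; apply: (smZ hNs) => //.
  by case: (hv k).
- by move=> i; exact: (addml (sm_scm _ hBB)).
have [a ha ha0] : exists2 a, n a & N0 (c ^+ k * v k - a * w).
  by apply: hYc; apply: hk; apply: (addmr (hY k)); exact: scm_self.
apply: (unit_cancel h0 ha).
have -> : w - a * w = (w - c ^+ k * v k) + (c ^+ k * v k - a * w) by ring.
by apply: (smD h0); case: (hv k).
Qed.

Lemma radical_power I x : ideal B I ->
  (forall P, prime_ideal B P -> I `<=` P -> P x) -> exists k, I (x ^+ k).
Proof.
move=> hI h; apply: contrapT => hno.
have [|||P [hP hIP hPx]] := @prime_avoid _ B hB hn I [set y | exists k, y = x ^+ k] hI.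
- by exists 0%N.
- by move=> _ _ [i ->] [j ->]; exists (i + j)%N; rewrite exprD.
- by move=> y hy [k e]; apply: hno; exists k; rewrite -e.
apply: (hPx x); last by exists 1%N.
exact: h.
Qed.

Lemma prime_sub_local P : prime_ideal B P -> P `<=` n.
Proof. by case=> hP hP1 _; exact: proper_sub_local. Qed.

End Local.
Ltac alg_more ::= match goal with
  | h : is_local ?B ?n |- submodule ?B ?n => exact: idealP (local_ideal h)
  | h : is_local ?B ?n |- ?B _ => apply: (ideal_sub (local_ideal h)); alg
  end.

Lemma local_intro (T : comNzRingType) (B n : set T) : subring B -> ideal B n ->
  ~ n 1 -> (forall c, B c -> ~ n c -> exists2 d, B d & c * d = 1) -> is_local B n.
Proof.
move=> hB hn hn1 hu.
have key J : ideal B J -> ~ J 1 -> J `<=` n.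
  move=> hJ hJ1 c hc; apply: contrapT => hnc; apply: hJ1.
  have [d hd <-] := hu c (ideal_sub hJ hc) hnc.
  by rewrite mulrC; exact: (smZ (idealP hJ)).
split.
  split=> // J hJ hnJ; have [|hJ1] := pselect (J 1); [by right|left].
  by rewrite eqEsubset; split=> //; exact: key.
by move=> n' [hn' hn'1 hmax]; have [|->|/hn1] // := hmax n hn; exact: key.
Qed.

(** * Lengths *)

Lemma ex_max (P : nat -> Prop) k0 m : P k0 -> (forall k, P k -> (k <= m)%N) ->
  exists k, P k /\ forall j, P j -> (j <= k)%N.
Proof.
move=> h0 hm; pose p := fun k => `[< P k >].
have [|k /asboolP hk hmax] := @ex_maxnP p m (ex_intro _ k0 (asboolT h0)).
  by move=> k /asboolP; exact: hm.
by exists k; split=> // j hj; apply: hmax; exact/asboolP.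
Qed.

Section Lengths.
Variables (T : comNzRingType) (B : set T).
Hypothesis hB : subring B.
Implicit Types (N X Y Z : set T).

Let hBB := sm_self hB.

Definition itv N2 N1 := [set N | [/\ submodule B N, N2 `<=` N & N `<=` N1]].

(** A composition series. The supremum over chains in [has_length] gives nothing to induct on;
    [lengthE] identifies the two notions. *)
Inductive clen N2 : set T -> nat -> Prop :=
| clen0 : submodule B N2 -> clen N2 N2 0
| clenS X N1 l : clen N2 X l -> submodule B N1 -> X `<` N1 ->
    (forall Y, submodule B Y -> X `<=` Y -> Y `<=` N1 -> Y `<=` X \/ N1 `<=` Y) ->
    clen N2 N1 l.+1.

Lemma clen_sub N2 N1 l : clen N2 N1 l -> [/\ submodule B N2, submodule B N1 & N2 `<=` N1].
Proof.
elim=> [h|X N l' _ [h1 h2 h3] h4 [h5 _] _]; alg.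
Qed.

Lemma strict_chainW C k (c : nat -> set T) i j : strict_chain C k c ->
  (i <= j)%N -> (j <= k)%N -> c i `<=` c j.
Proof.
move=> [_ hc]; elim: j => [|j IH]; first by rewrite leqn0 => /eqP -> _ x.
rewrite leq_eqVlt => /orP[/eqP -> _ x //|]; rewrite ltnS => hij hj.
apply: subset_trans (IH hij (ltnW hj)) _; by case: (hc j hj).
Qed.

(** Intersecting a chain with the last but one term [X] of the series loses at most one strict step,
    since the top quotient is simple. *)
Lemma clen_bound N2 N1 l k c : clen N2 N1 l -> strict_chain (itv N2 N1) k c ->
  (k <= l)%N.
Proof.
move=> h; elim: h k c => [hN|X N1' l' hX IH hN [hXN hNX] hsim] k c hc.
  case: k hc => // k [hc1 hc2]; have [_] := hc2 0%N isT; case.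
  have [_ h1 _] := hc1 0%N isT; have [_ _ h2] := hc1 1%N isT.
  alg.
have [hN2 hXs hN2X] := clen_sub hX.
pose D i := c i `&` X.
have hD i : (i <= k)%N -> itv N2 X (D i).
  move=> hi; have [h1 h2 h3] := hc.1 i hi; split; first exact: sm_setI.
    split; alg.
  by move=> x [].
have hDle i : (i < k)%N -> D i `<=` D i.+1.
  move=> hi x [hx hxX]; split=> //; have [h _] := hc.2 i hi; alg.
have [[i0 [hi0 hbad]]|hno] := pselect (exists i, (i < k)%N /\ D i.+1 `<=` D i); last first.
  apply: leq_trans (leqnSn _); apply: (IH k D); split=> // i hi; split; first exact: hDle.
  by move=> h; apply: hno; exists i.
(* After a collapse the later terms are not contained in [X], so together with [X] they span [N1'];
   by the modular law a second collapse would stop the chain itself. *)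
have key i : (i < k)%N -> D i.+1 `<=` D i -> forall j, (i < j)%N -> (j < k)%N ->
    D j.+1 `<=` D j -> False.
  move=> hi hb j hij hj hbj; have [_ hcj] := hc.2 j hj; apply: hcj.
  have hcX : ~ c j `<=` X.
    move=> h; have [_] := hc.2 i hi; apply; move=> x hx.
    have [] // : D i x by apply: hb; split=> //; apply: h;
      exact: (strict_chainW hc hij (ltnW hj)) _ hx.
  have [hsj hj1 hj2] := hc.1 j (ltnW hj).
  have [hsj' hj1' hj2'] := hc.1 j.+1 hj.
  have hadd : N1' `<=` addm X (c j).
    have [||h|] // := hsim (addm X (c j)) (sm_addm hXs hsj).
    - exact: (addml hsj).
    - exact: (addm_min hN).
    - by case: hcX; apply: subset_trans h; exact: (addmr hXs).
  move=> w hw; have [x [y [hx hy e]]] := hadd w (hj2' _ hw).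
  have hyj : c j.+1 y by have [h _] := hc.2 j hj; alg.
  have [hxj _] : D j x.
    apply: hbj; split=> //; have -> : x = w - y by rewrite e addrK.
    alg.
  rewrite e; alg.
case: k hc hD hDle hi0 key => // k hc hD hDle hi0 key; rewrite ltnS.
(* The intersected chain with the index of its only collapse skipped. *)
pose c' i := if (i <= i0)%N then D i else D i.+1.
apply: (IH k c'); split=> i hi.
  by rewrite /c'; case: ifP => _; apply: hD => //; exact: leqW.
rewrite /c'; case: (ltngtP i i0) => hii0.
- split; first by apply: hDle; exact: ltnW.
  by move=> h; apply: (key i _ h i0) => //; exact: ltnW.
- split; first exact: hDle.
  by apply: (key i0 hi0 hbad i.+1) => //; exact: leqW.
- rewrite hii0; split.
    apply: subset_trans (hDle i0.+1 _); first exact: hDle.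
    by rewrite -hii0.
  move=> h; apply: (key i0 hi0 hbad i0.+1) => //; first by rewrite -hii0.
  by apply: subset_trans h _; exact: hDle.
Qed.

Lemma clen_chain N2 N1 l : clen N2 N1 l -> exists c, strict_chain (itv N2 N1) l c.
Proof.
elim=> [hN|X N1' l' hX [c hc] hN [hXN hNX] _].
  by exists (fun=> N2); split=> // i _; split.
have [hN2 hXs hN2X] := clen_sub hX.
exists (fun i => if (i <= l')%N then c i else N1'); split=> i hi.
  case: ifP => h; last by split=> //; alg.
  have [h1 h2 h3] := hc.1 i h; split=> //; alg.
have [->|{}hi] : i = l' \/ (i < l')%N.
    by move: hi; rewrite leq_eqVlt => /orP[/eqP|]; auto.
  rewrite leqnn ltnn; have [_ _ h3] := hc.1 l' (leqnn _).
  split; first exact: subset_trans hXN.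
  by move=> h; apply: hNX; apply: subset_trans h3.
by rewrite (ltnW hi) hi; exact: hc.2.
Qed.

Lemma clen_length N2 N1 l : clen N2 N1 l -> has_length B N1 N2 l.
Proof.
move=> h; split; first exact: clen_chain.
by move=> k c; exact: clen_bound h.
Qed.

Lemma strict_chain_snoc N2 N1 k c X : strict_chain (itv N2 N1) k c ->
  submodule B X -> N2 `<=` X -> N1 `<` X ->
  strict_chain (itv N2 X) k.+1 (fun i => if (i <= k)%N then c i else X).
Proof.
move=> hc hX h2 [h hN]; split=> i hi.
  case: ifP => hik; last by split.
  have [h3 h4 h5] := hc.1 i hik; split=> //; alg.
have [->|{}hi] : i = k \/ (i < k)%N.
    by move: hi; rewrite leq_eqVlt => /orP[/eqP|]; auto.
  rewrite leqnn ltnn; have [_ _ h3] := hc.1 k (leqnn _).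
  split; first exact: subset_trans h.
  move=> h'; apply: hN; alg.
by rewrite (ltnW hi) hi; exact: hc.2.
Qed.

Lemma chain1 N2 N1 : submodule B N2 -> submodule B N1 -> N2 `<=` N1 -> ~ N1 `<=` N2 ->
  strict_chain (itv N2 N1) 1 (fun i => if i is 0 then N2 else N1).
Proof. by split=> -[|i] // _; split. Qed.

(** A longest chain ending at [N1] has a simple last step, and below that step the bound on chains
    is one less. *)
Lemma bounded_clen m N2 N1 : submodule B N2 -> submodule B N1 -> N2 `<=` N1 ->
  (forall k c, strict_chain (itv N2 N1) k c -> (k <= m)%N) -> exists l, clen N2 N1 l.
Proof.
elim: m N1 => [|m IH] N1 h2 h1 h12 hm.
  exists 0%N; suff <- : N2 = N1 by exact: clen0.
  rewrite eqEsubset; split=> //; apply: contrapT => h.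
  suff : (1 <= 0)%N by [].
  exact: hm (chain1 h2 h1 h12 h).
have [h|h] := pselect (N1 `<=` N2).
  by exists 0%N; have <- : N2 = N1 by [rewrite eqEsubset]; exact: clen0.
pose P k := exists c, strict_chain (itv N2 N1) k c /\ c k = N1.
have [||k [[c [hc hck]] hmax]] := @ex_max P 1%N m.+1.
- by exists (fun i => if i is 0 then N2 else N1); split=> //; exact: chain1.
- by move=> k [c [hc _]]; exact: hm hc.
case: k hc hck hmax => [|k] hc hck hmax.
  have : (1 <= 0)%N; last by [].
  apply: hmax; exists (fun i => if i is 0 then N2 else N1); split=> //.
  exact: chain1.
have [hXs hX1 hX2] := hc.1 k (leqnSn k).
have hXN : c k `<` N1 by rewrite -hck; exact: hc.2.
have [l hl] : exists l, clen N2 (c k) l.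
  apply: IH => // k' c' hc'; rewrite -ltnS.
  exact: hm (strict_chain_snoc hc' h1 h12 hXN).
exists l.+1; apply: (clenS hl) => // Y hY hXY hYN.
apply: contrapT => /not_orP[hYX hNY].
have : (k.+2 <= k.+1)%N; last by rewrite ltnn.
apply: hmax; exists (fun i => if (i <= k)%N then c i else if i == k.+1 then Y else N1).
split; last by rewrite leqNgt leqnSn eqn_leq ltnn.
split=> i hi.
  case: ifP => hik; first by exact: hc.1 (leqW hik).
  case: ifP => _; split=> //; alg.
case: (ltngtP i k) => hik.
- by apply: hc.2; exact: leqW.
- have -> : i = k.+1 by apply/eqP; rewrite eqn_leq hik andbT.
  by rewrite eqxx ?eqn_leq ?ltnn //.
- by rewrite hik eqxx.
Qed.

Lemma lengthE N1 N2 l : submodule B N2 -> submodule B N1 -> N2 `<=` N1 ->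
  has_length B N1 N2 l <-> clen N2 N1 l.
Proof.
move=> h2 h1 h12; split; last exact: clen_length.
move=> [hex hm]; have [l' hl'] := bounded_clen h2 h1 h12 hm.
have [c hc] := hex; have h := clen_bound hl' hc.
have [c' hc'] := clen_chain hl'; have h' := hm _ _ hc'.
suff -> : l = l' by [].
by apply/eqP; rewrite eqn_leq h.
Qed.

Lemma len_uniq N1 N2 l l' : has_length B N1 N2 l -> has_length B N1 N2 l' -> l = l'.
Proof.
move=> [[c hc] hm] [[c' hc'] hm']; apply/eqP; rewrite eqn_leq.
by rewrite (hm' _ _ hc) (hm _ _ hc').
Qed.

Lemma len_sub N1 N2 l : has_length B N1 N2 l -> N2 `<=` N1.
Proof.
move=> [[c hc] _]; have [_ h1 h2] := hc.1 0%N (leq0n _); exact: subset_trans h2.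
Qed.

Lemma len_refl N : submodule B N -> has_length B N N 0.
Proof. by move=> h; apply: clen_length; exact: clen0. Qed.

Lemma len_eq0 N1 N2 : submodule B N1 -> submodule B N2 ->
  has_length B N1 N2 0 -> N1 `<=` N2.
Proof.
move=> h1 h2 h; have h12 := len_sub h.
by move/(lengthE 0 h2 h1 h12): h => h; inversion h.
Qed.

Lemma len_add N1 N2 N3 l l' : submodule B N1 -> submodule B N2 -> submodule B N3 ->
  has_length B N1 N2 l -> has_length B N2 N3 l' -> has_length B N1 N3 (l + l').
Proof.
move=> h1 h2 h3 h h'; have h12 := len_sub h; have h23 := len_sub h'.
move/(lengthE _ h2 h1 h12): h => h; move/(lengthE _ h3 h2 h23): h' => h'.
apply: clen_length; elim: h {h1 h12} => [_|X N l0 _ IH hN hXN hs] //.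
by exact: clenS hs.
Qed.

Lemma len_exists N1 N2 M1 M2 l : submodule B N1 -> submodule B N2 ->
  M2 `<=` N2 -> N2 `<=` N1 -> N1 `<=` M1 -> has_length B M1 M2 l ->
  exists l', has_length B N1 N2 l'.
Proof.
move=> h1 h2 hs2 h12 hs1 [_ hm]; have [|l' hl'] := @bounded_clen l _ _ h2 h1 h12.
  move=> k c hc; apply: (hm k c); split=> i hi; last exact: hc.2.
  have [a b d] := hc.1 i hi; split=> //; alg.
by exists l'; exact: clen_length.
Qed.

Lemma len_split N1 N2 N3 l : submodule B N1 -> submodule B N2 -> submodule B N3 ->
  N3 `<=` N2 -> N2 `<=` N1 -> has_length B N1 N3 l ->
  exists l1 l2, [/\ has_length B N1 N2 l1, has_length B N2 N3 l2 & l = (l1 + l2)%N].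
Proof.
move=> h1 h2 h3 h32 h21 h.
have [l1 hl1] := len_exists h1 h2 h32 h21 (@subset_refl _ _) h.
have [l2 hl2] := len_exists h2 h3 (@subset_refl _ _) h32 h21 h.
exists l1, l2; split=> //; exact: len_uniq h (len_add h1 h2 h3 hl1 hl2).
Qed.

Lemma len_dcc N1 N2 l (c : nat -> set T) : has_length B N1 N2 l ->
  (forall k, itv N2 N1 (c k)) -> (forall k, c k.+1 `<=` c k) ->
  exists k, c k `<=` c k.+1.
Proof.
move=> [_ hm] hc hd; apply: contrapT => hno.
have : (l.+1 <= l)%N; last by rewrite ltnn.
apply: (hm _ (fun i => c (l.+1 - i)%N)); split=> i hi; first exact: hc.
rewrite subSn // subSS; split; first exact: hd.
by move=> h; apply: hno; exists (l - i)%N.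
Qed.

(** Chains are carried across by intersecting with [N1] and by adding [N2]; the modular law keeps
    them strict. *)
Lemma len_2iso N1 N2 l : submodule B N1 -> submodule B N2 ->
  has_length B (addm N1 N2) N2 l <-> has_length B N1 (N1 `&` N2) l.
Proof.
move=> h1 h2.
have fchain k c : strict_chain (itv N2 (addm N1 N2)) k c ->
    strict_chain (itv (N1 `&` N2) N1) k (fun i => c i `&` N1).
  move=> hc; split=> i hik.
    have [a b d] := hc.1 i hik; split; [alg| |alg].
    move=> x [hx1 hx2]; alg.
  have [hlt hge] := hc.2 i hik; split; first by move=> x [hx ?]; alg.
  move=> h; apply: hge => x hx; have [a b d] := hc.1 i.+1 hik.
  have [a' b' d'] := hc.1 i (ltnW hik).
  have [y [z [hy hz e]]] := d _ hx.
  have [] : (c i `&` N1) y; last by move=> hyc _; rewrite e; alg.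
  apply: h; split=> //; have -> : y = x - z by rewrite e addrK.
  alg.
have gchain k c : strict_chain (itv (N1 `&` N2) N1) k c ->
    strict_chain (itv N2 (addm N1 N2)) k (fun i => addm (c i) N2).
  move=> hc; split=> i hik.
    have [a b d] := hc.1 i hik; split; [alg|exact: (addmr a)|].
    exact: addmS.
  have [hlt hge] := hc.2 i hik; split; first exact: addmS.
  move=> h; apply: hge => x hx; have [a b d] := hc.1 i.+1 hik.
  have [a' b' d'] := hc.1 i (ltnW hik).
  have [y [z [hy hz e]]] := h _ (addml h2 hx).
  rewrite e; apply: (smD a') => //; apply: b'; split=> //.
  have -> : z = x - y by rewrite e addrC addKr.
  alg.
split=> -[[c hc] hm]; split.
- by exists (fun i => c i `&` N1); exact: fchain.
- by move=> k d /gchain; exact: hm.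
- by exists (fun i => addm (c i) N2); exact: gchain.
- by move=> k d /fchain; exact: hm.
Qed.

End Lengths.

(** Take a largest submodule of finite length over [N0]. If it is not [N], some element has a prime
    annihilator modulo it; by nilpotency that prime contains [n], so adjoining the element adds a
    simple quotient. *)
Lemma len_finite (T : comNzRingType) (B n N N0 : set T) : subring B -> noethm B B ->
  is_local B n -> fgm B N -> submodule B N0 -> N0 `<=` N ->
  (forall c w, n c -> N w -> exists k, N0 (c ^+ k * w)) ->
  exists l, has_length B N N0 l.
Proof.
move=> hB hn hl hfg h0 h0N hnil.
have hN : submodule B N by case: hfg => s ->; alg.
pose F := [set X | X `<=` N /\ exists l, clen B N0 X l].
have [||X [[hXN [l hlX]] h0X hmax]] := @noethm_max T B N F N0 hB (noethm_fg hB hn hfg).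
- by move=> X [hX [l /clen_sub[]]].
- by split=> //; exists 0%N; exact: clen0.
have [_ hX _] := clen_sub hlX.
suff e : X = N by exists l; rewrite -e; exact: clen_length.
rewrite eqEsubset; split=> // w hw; apply: contrapT => hwX.
have [v [hv hvX _ hvp _]] := ann_prime_max hB hn hN hX hw hwX.
have hnv c : n c -> ann B X v c.
  move=> hc; have hcB := ideal_sub (local_ideal hl) hc.
  have [k hk] := hnil c v hc hv.
  apply: (prime_mulX hB hvp hcB (k := k)); split; alg.
have hBB := sm_self hB; have hBv := sm_scm v hBB.
have hXv := sm_addm hX hBv.
apply: hvX; rewrite -(hmax (addm X (scm v B))).
- by apply: (addmr hX); exact: scm_self.
- split; first by apply: (addm_min hN) => // _ [b hb ->]; alg.
  exists l.+1; apply: (clenS hlX) => //.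
    split; first exact: (addml hBv).
    move=> h; have [_ hv1 _] := hvp; apply: hv1; split; first exact: sr1.
    by rewrite mul1r; apply: h; apply: (addmr hX); exact: scm_self.
  move=> Y hY hXY hYX; have [|hne] := pselect (Y `<=` X); [by left|right].
  have [y [hy hyX]] : exists y, Y y /\ ~ X y.
    by apply: contrapT => h; apply: hne => y hy; apply: contrapT => hyX; apply: h; exists y.
  have [x [_ [hx [b hb ->] e]]] := hYX _ hy.
  have hbv : Y (b * v).
    have -> : b * v = y - x by rewrite e; ring.
    alg.
  have [d hd hbd] : exists2 d, B d & b * d = 1.
    apply: (local_unit hB hn hl) => // hnb; apply: hyX; rewrite e.
    by apply: (smD hX) => //; rewrite mulrC; have [] := hnv b hnb.
  apply: (addm_min hY) => // _ [c hc ->].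
  have -> : v * c = (c * d) * (b * v) by rewrite mulrA -[c * d * b]mulrA [d * b]mulrC hbd; ring.
  alg.
- exact: (addml hBv).
Qed.

Section FieldLengths.
Variables (K : fieldType) (B : set K).
Hypothesis hB : subring B.
Implicit Types (N X : set K).

Lemma scmK x N : x != 0 -> scm x^-1 (scm x N) = N.
Proof.
move=> hx; rewrite eqEsubset; split=> [_ [_ [y hy ->] ->]|y hy]; first by rewrite mulKf.
by exists (x * y); [exists y|rewrite mulKf].
Qed.

Lemma scm_chain x N1 N2 k c : x != 0 -> strict_chain (itv B N2 N1) k c ->
  strict_chain (itv B (scm x N2) (scm x N1)) k (fun i => scm x (c i)).
Proof.
move=> hx hc; split=> i hik.
  by have [a b d] := hc.1 i hik; split; [alg|exact: scmS|exact: scmS].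
have [hlt hge] := hc.2 i hik; split; first exact: scmS.
by move=> /(@scmS _ x^-1); rewrite !scmK.
Qed.

Lemma len_scm x N1 N2 l : x != 0 ->
  has_length B (scm x N1) (scm x N2) l <-> has_length B N1 N2 l.
Proof.
move=> hx; have hxV : x^-1 != 0 by rewrite invr_eq0.
split=> -[[c hc] hm]; split.
- by exists (fun i => scm x^-1 (c i)); move/(scm_chain hxV): hc; rewrite !scmK.
- by move=> k d hd; apply: hm (scm_chain hx hd).
- by exists (fun i => scm x (c i)); exact: scm_chain.
- move=> k d hd; have := scm_chain hxV hd; rewrite !scmK //; exact: hm.
Qed.

End FieldLengths.

(** * Localization *)

Section Localization.
Variable K : fieldType.
Implicit Types (B N X P Q S : set K).

Definition mset B S :=
  [/\ S `<=` B, S 1, forall x y, S x -> S y -> S (x * y) & ~ S 0].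

Definition loc N S : set K := [set x | exists a s, [/\ N a, S s & x = a / s]].

Lemma mset_neq0 B S s : mset B S -> S s -> s != 0.
Proof. by case=> _ _ _ h hs; apply/eqP => e; apply: h; rewrite -e. Qed.

Lemma sub_loc B N S : mset B S -> N `<=` loc N S.
Proof. by move=> [_ h _ _] x hx; exists x, 1; rewrite divr1. Qed.

Lemma loc_sub N N' S : N `<=` N' -> loc N S `<=` loc N' S.
Proof. move=> h _ [a [s [ha hs ->]]]; exists a, s; split=> //; alg. Qed.

Lemma loc_div N S a s : N a -> S s -> loc N S (a / s).
Proof. by exists a, s. Qed.

Lemma loc_common B N S x y : mset B S -> submodule B N -> loc N S x -> loc N S y ->
  exists a b s, [/\ N a, N b, S s, x = a / s & y = b / s].
Proof.
move=> hS hN [a [s [ha hs ->]]] [b [t [hb ht ->]]].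
have s0 := mset_neq0 hS hs; have t0 := mset_neq0 hS ht.
have [hSB _ hSM _] := hS.
exists (t * a), (s * b), (s * t); split.
- alg.
- alg.
- exact: hSM.
- by field; rewrite t0.
- by field; rewrite t0.
Qed.

Lemma loc_subring B S : subring B -> mset B S -> subring (loc B S).
Proof.
move=> hB hS; have [hSB h1 hSM _] := hS; split.
- apply: (sub_loc hS); alg.
- move=> x y hx hy.
  have [a [b [s [ha hb hs -> ->]]]] := loc_common hS (sm_self hB) hx hy.
  by exists (a - b), s; split=> //; [alg|rewrite mulrBl].
- move=> _ _ [a [s [ha hs ->]]] [b [t [hb ht ->]]].
  exists (a * b), (s * t); split; [alg|exact: hSM|].
  by field; rewrite (mset_neq0 hS hs) (mset_neq0 hS ht).
Qed.

Lemma loc_sm B N S : mset B S -> submodule B N -> submodule (loc B S) (loc N S).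
Proof.
move=> hS hN; have [hSB h1 hSM _] := hS; split.
- apply: (sub_loc hS); alg.
- move=> x y hx hy.
  have [a [b [s [ha hb hs -> ->]]]] := loc_common hS hN hx hy.
  exists (a + b), s; alg.
- move=> _ _ [a [s [ha hs ->]]] [b [t [hb ht ->]]].
  exists (a * b), (s * t); split; [alg|exact: hSM|].
  by field; rewrite (mset_neq0 hS hs) (mset_neq0 hS ht).
Qed.

Lemma loc_smB B N S : mset B S -> submodule (loc B S) N -> submodule B N.
Proof. by move=> hS; apply: submoduleS; exact: sub_loc hS. Qed.

Lemma loc_min B N S X : mset B S -> submodule (loc B S) X -> N `<=` X ->
  subring B -> loc N S `<=` X.
Proof.
move=> hS hX h hB _ [a [s [ha hs ->]]]; rewrite mulrC; apply: (smZ hX); last exact: h.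
by exists 1, s; split=> //; [alg|rewrite mul1r].
Qed.

Lemma loc_contract B N S X : subring B -> mset B S -> submodule B N ->
  submodule (loc B S) X -> X `<=` loc N S -> X = loc (X `&` N) S.
Proof.
move=> hB hS hN hX h; rewrite eqEsubset; split; last first.
  by apply: (loc_min hS hX _ hB) => ? [].
move=> x hx; have [a [s [ha hs e]]] := h x hx; exists a, s; split=> //; split=> //.
have -> : a = s * x by rewrite e mulrC divfK // (mset_neq0 hS).
apply: (smZ hX) => //; apply: (sub_loc hS); case: hS => hSB _ _ _; alg.
Qed.

Lemma loc_lc B N S s : subring B -> mset B S -> submodule B N ->
  loc (lc N s) S = lc (loc N S) s.
Proof.
move=> hB hS hN; rewrite eqEsubset; split.
  apply: (loc_min hS (sm_lc s (loc_sm hS hN))) => //; apply: lcS; exact: sub_loc hS.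
apply: (lc_min (loc_sm hS (sm_lc s hN))) => x _ hx [a [t [ha ht ->]]].
by rewrite mulrA; exists (x * a), t; split=> //; exact: lc_mem hN hx ha.
Qed.

Lemma loc_noeth B N S : subring B -> mset B S -> submodule B N -> noethm B N ->
  noethm (loc B S) (loc N S).
Proof.
move=> hB hS hN hn X hX hXN.
have [||s hs] := hn (X `&` N); last 1 first.
- by exists s; rewrite (loc_contract hB hS hN hX hXN) hs
    (loc_lc s hB hS (sm_self hB)).
- by apply: sm_setI => //; exact: loc_smB hS hX.
- alg.
Qed.

Lemma loc_prime B S P : subring B -> mset B S -> prime_ideal B P ->
  (forall x, P x -> ~ S x) -> prime_ideal (loc B S) (loc P S).
Proof.
move=> hB hS [hP hP1 hPM] hPS; have [hSB h1 hSM _] := hS.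
have key a s : P a -> B s -> S s -> forall t b, B b -> S t -> b / t = a / s -> P b.
  move=> ha hs hSs t b hb ht e.
  have e2 : b * s = t * a.
    have s0 := mset_neq0 hS hSs; have t0 := mset_neq0 hS ht.
    have -> : b = a / s * t by rewrite -e divfK.
    by field.
  have /hPM[] // : P (b * s).
    rewrite e2; apply: (smZ (idealP hP)) => //; alg.
  by move/hPS.
split.
- split; first by apply: loc_sub; exact: ideal_sub.
  exact: loc_sm (idealP hP).
- case=> a [s [ha hs e]]; apply: hP1; apply: (key a s ha (hSB _ hs) hs 1) => //.
    alg.
  by rewrite divr1.
- move=> _ _ [a [s [ha hs ->]]] [b [t [hb ht ->]]] [p [u [hp hu e]]].
  have /hPM[//|//|h|h] : P (a * b).
    apply: (key p u hp (hSB _ hu) hu (s * t)) => //; [alg|exact: hSM|].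
    by rewrite -e; field; rewrite (mset_neq0 hS hs) (mset_neq0 hS ht).
  - by left; exists a, s.
  - by right; exists b, t.
Qed.

Lemma loc_primeK B S P : subring B -> mset B S -> prime_ideal B P ->
  (forall x, P x -> ~ S x) -> loc P S `&` B = P.
Proof.
move=> hB hS [hP hP1 hPM] hPS; rewrite eqEsubset; split; last first.
  by move=> x hx; split; [exact: sub_loc hS _ hx|exact: (ideal_sub hP)].
move=> x [[a [s [ha hs e]]] hx]; have [hSB _ _ _] := hS.
have /hPM[] // : P (x * s); last 2 first.
- alg.
- by move/hPS.
by rewrite e divfK // (mset_neq0 hS).
Qed.

Lemma contract_prime B S Q : subring B -> mset B S -> prime_ideal (loc B S) Q ->
  prime_ideal B (Q `&` B) /\ (forall x, (Q `&` B) x -> ~ S x).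
Proof.
move=> hB hS [hQ hQ1 hQM]; split; last first.
  move=> x [hx _] hSx; apply: hQ1; rewrite -(mulVf (mset_neq0 hS hSx)).
  apply: (smZ (idealP hQ)) => //; exists 1, x; split=> //; first exact: sr1.
  by rewrite mul1r.
split.
- split; first alg.
  by apply: sm_setI (sm_self hB); exact: loc_smB hS (idealP hQ).
- by case.
- move=> x y hx hy [hxy _].
  have /hQM[] // : Q (x * y) by [].
  - exact: sub_loc hS _ hx.
  - exact: sub_loc hS _ hy.
  - by left.
  - by right.
Qed.

Definition compl B P : set K := [set x | B x /\ ~ P x].

Lemma mset_compl B P : subring B -> prime_ideal B P -> mset B (compl B P).
Proof.
move=> hB [hP hP1 hPM]; split.
- alg.
- split; alg.
- by move=> x y [hx hPx] [hy hPy]; split; [alg|case/hPM].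
- by case=> _; apply; exact: sm0 (idealP hP).
Qed.

Lemma localizationE B P : localization B P = loc B (compl B P).
Proof.
rewrite eqEsubset; split=> [_ [a [s [ha hs hP ->]]]|_ [a [s [ha [hs hP] ->]]]].
- by exists a, s.
- by exists a, s.
Qed.

Lemma local_loc B P : subring B -> prime_ideal B P ->
  is_local (loc B (compl B P)) (loc P (compl B P)).
Proof.
move=> hB hP; have hS := mset_compl hB hP.
have [hPl hPl1 _] := loc_prime hB hS hP (fun x hx h => h.2 hx).
apply: local_intro => //; first exact: loc_subring.
move=> _ [a [s [ha hs ->]]] h; have hPa : ~ P a by move=> h'; apply: h; exists a, s.
have sa : compl B P a by [].
exists (s / a); first by exists s, a; case: hs.
by field; rewrite (mset_neq0 hS sa) (mset_neq0 hS hs).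
Qed.

Lemma loc_chain B P l (c : nat -> set K) : subring B -> prime_ideal B P ->
  strict_chain (prime_ideal B) l c -> c l `<=` P ->
  strict_chain (prime_ideal (loc B (compl B P))) l (fun i => loc (c i) (compl B P)).
Proof.
move=> hB hP hc hcP; have hS := mset_compl hB hP.
have hd i : (i <= l)%N -> forall x, c i x -> ~ compl B P x.
  by move=> hi x hx [_]; apply; apply: hcP; exact: (strict_chainW hc hi (leqnn _)).
split=> i hi; first by apply: (loc_prime hB hS) (hc.1 i hi) (hd i hi).
have [h1 h2] := hc.2 i hi; split; first exact: loc_sub.
move=> h; apply: h2.
rewrite -(loc_primeK hB hS (hc.1 _ hi) (hd _ hi)).
rewrite -(loc_primeK hB hS (hc.1 i (ltnW hi)) (hd i (ltnW hi))).
move=> x [hx hxB]; alg.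
Qed.

End Localization.

(** * Dimension theory *)

Section Krull.
Variable K : fieldType.
Implicit Types (B n N X P Q S : set K) (s t : seq K).

Lemma scm_lc_sub B n s x : is_local B n -> subring B -> n x ->
  scm x (lc B s) `<=` lc n s.
Proof.
move=> hl hB hx; rewrite -scm_lc; apply: lcS => _ [b hb ->]; rewrite mulrC.
exact: (smZ (idealP (local_ideal hl))).
Qed.

(* The role of symbolic powers of [P'] is played by the contractions of the
   powers of one element of [P'] outside [P'']. *)
Lemma principal_ideal_theorem B n P' P'' x : subring B -> noethm B B -> is_local B n ->
  prime_ideal B P' -> prime_ideal B P'' -> P'' `<=` P' -> n x -> ~ n `<=` P' ->
  (forall Q, prime_ideal B Q -> P'' `<=` Q -> Q x -> n `<=` Q) -> P' `<=` P''.
Proof.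
move=> hB hn hl hP' hP'' hPP hx hnP' hmin y hy; apply: contrapT => hyP.
have hBB := sm_self hB; have hnI := local_ideal hl.
have [hI' hI'1 hM'] := hP'; have [hI'' hI''1 hM''] := hP''.
have hP0 := idealP hI''; have hxB := ideal_sub hnI hx.
have hyB := ideal_sub hI' hy.
have hxP' : ~ P' x by move=> h; apply: hnP'; exact: hmin.
pose I (k : nat) := [set z | B z /\ exists a (t : K), [/\ B a, ~ P' a, B t & P'' (a * z - y ^+ k * t)]].
have hI k : submodule B (I k).
  split.
  - split; first exact: sr0.
    exists 1, 0; split=> //; alg.
  - move=> z w [hz [a [t [ha haP ht h1]]]] [hw [b [u [hb hbP hu h2]]]].
    split; first exact: srD.
    exists (a * b), (b * t + a * u); split; [alg|by case/hM'|alg|].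
    have -> : a * b * (z + w) - y ^+ k * (b * t + a * u) =
      b * (a * z - y ^+ k * t) + a * (b * w - y ^+ k * u) by ring.
    alg.
  - move=> c z hc [hz [a [t [ha haP ht h1]]]]; split; first exact: srM.
    exists a, (c * t); split=> //; first exact: srM.
    have -> : a * (c * z) - y ^+ k * (c * t) = c * (a * z - y ^+ k * t) by ring.
    alg.
have hId k : I k.+1 `<=` I k.
  move=> z [hz [a [t [ha haP ht h1]]]]; split=> //; exists a, (y * t); split=> //.
    alg.
  by rewrite mulrA -exprSr.
have hPI k : P'' `<=` I k.
  move=> z hz; split; first exact: (ideal_sub hI'').
  exists 1, 0; split=> //; alg.
have hxs := sm_scm x hBB.
have h0 := sm_addm hP0 hxs.
have h0I : ideal B (addm P'' (scm x B)) by exact: sm_addI.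
have [l hlen] : exists l, has_length B B (addm P'' (scm x B)) l.
  apply: (len_finite hB hn hl) => //.
  - by exists [:: 1] => /=; rewrite addm0 eqEsubset; split=> [z hz|_ [b hb ->]];
      [exists z; rewrite ?mul1r|rewrite mul1r].
  - exact: ideal_sub h0I.
  - move=> c w hc hw; have [|k hk] := @radical_power _ B hB hn (addm P'' (scm x B)) c h0I.
      move=> Q hQ hIQ; apply: (hmin Q hQ) => //.
        by apply: subset_trans hIQ; exact: (addml hxs).
      by apply: hIQ; apply: (addmr hP0); exact: scm_self.
    exists k; alg.
have [||k hk] := len_dcc hlen (c := fun k => addm (I k) (scm x B)).
- move=> k; split; first exact: sm_addm.
    by apply: addmS => //.
  by apply: (addm_min hBB); [move=> ? []|exact: scm_sub hxB hBB].
- by move=> k; exact: addmS.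
have hstep z : I k z -> addm (I k.+1) (scm x (I k)) z.
  move=> hz; have [z' [_ [hz' [b hb ->] e]]] := hk z (addml hxs hz).
  exists z', (x * b); split=> //; exists b => //; split=> //.
  have [_ [a [t [ha haP ht h1]]]] : I k (x * b).
    by have -> : x * b = z - z' by [rewrite e; ring]; apply: (smB hB (hI k)) => //; exact: hId.
  exists (a * x), t; split=> //; [alg|by case/hM'|by rewrite -mulrA].
have [|s hs] := hn (I k) (hI k); first by move=> ? [].
have hIk : I k `<=` I k.+1.
  rewrite hs; apply: (lc_min (hI k.+1)) => z b hz hb; rewrite mulrC; apply: (smZ (hI _)) => //.
  move: z hz; apply: (nakayama hB hn hl (hI _)) => z hz.
  have /hstep : I k z by alg.
  by rewrite hs; apply: addmS => //; exact: scm_lc_sub.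
have [|_ [a [t [ha haP ht h1]]]] := hIk (y ^+ k).
  split; first exact: srX.
  by exists 1, 1; split=> //; [alg|alg|rewrite mul1r mulr1 subrr; exact: sm0 hP0].
have : P'' (y ^+ k * (a - y * t)).
  by have -> : y ^+ k * (a - y * t) = a * y ^+ k - y ^+ k.+1 * t by rewrite exprS; ring.
case/hM''; [alg|alg|by move/(prime_mulX hB hP'' hyB)|].
move/hPP => h; apply: haP; rewrite -(subrK (y * t) a); apply: (smD (idealP hI')) => //.
by rewrite mulrC; exact: (smZ (idealP hI')).
Qed.

(** Let [P'] be maximal among the primes above [c l] not containing [n], and let [x] in [s] lie
    outside [P']. Each other element of [s] has a power congruent modulo [x] to an element of [P'].
    By the principal ideal theorem these elements, one fewer than [s], generate an ideal with
    radical [P'] in the localization at [P'], where induction applies. *)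
Theorem krull_height B n s l c : subring B -> noethm B B -> is_local B n ->
  (forall x, x \in s -> n x) -> (forall x, n x -> exists k, lc B s (x ^+ k)) ->
  strict_chain (prime_ideal B) l c -> (l <= size s)%N.
Proof.
move em : (size s) => m; elim: m B n s l c em => [|m IH] B n s l c em hB hn hl hsn hs hc.
  case: l hc => // l hc; exfalso.
  have [h1 h2] := hc.2 0%N isT; apply: h2 => x hx.
  have hxn := prime_sub_local hB hn hl (hc.1 1%N isT) hx.
  have [k] := hs x hxn; rewrite (size0nil em) /= => e.
  have hc0 := hc.1 0%N isT.
  apply: (prime_mulX hB hc0 (ideal_sub (local_ideal hl) hxn) (k := k)).
  by rewrite e; case: hc0 => h _ _; exact: sm0 (idealP h).
case: l hc => // l hc; rewrite ltnS.
have hBB := sm_self hB; have hnI := local_ideal hl.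
have [hc1 hc2] := hc.2 l (leqnn _).
have hcl := hc.1 l (leqnSn _).
pose F := [set Q | prime_ideal B Q /\ ~ n `<=` Q].
have [||P' [[hP' hnP'] hcP' hmax]] := @ideal_max _ B hB hn F (c l).
- by move=> Q [[]].
- split=> // h; apply: hc2; apply: subset_trans h.
  exact: (prime_sub_local hB hn hl (hc.1 l.+1 (leqnn _))).
have hP'max Q : prime_ideal B Q -> P' `<=` Q -> ~ Q `<=` P' -> n `<=` Q.
  move=> hQ h1 h2; apply: contrapT => h3; apply: h2.
  by rewrite (hmax Q).
have hsub Q : prime_ideal B Q -> (forall x, x \in s -> Q x) -> n `<=` Q.
  move=> hQ h x hx; have [k hk] := hs x hx.
  apply: (prime_mulX hB hQ (ideal_sub hnI hx) (k := k)).
  have [[_ hQs] _ _] := hQ.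
  apply: (lc_min hQs) hk => z b /h hz hb; alg.
have [x hxs hxP'] : exists2 x, x \in s & ~ P' x.
  apply: contrapT => h; apply: hnP'; apply: hsub => // x hx.
  by apply: contrapT => h'; apply: h; exists x.
have hxn := hsn x hxs; have hxB := ideal_sub hnI hxn.
have [hP'I hP'1 hP'M] := hP'.
have hpow y : y \in rem x s -> exists k b, B b /\ P' (y ^+ k - x * b).
  move=> /mem_rem hy; have hI : ideal B (addm P' (scm x B)) by exact: sm_addI.
  have [|k [p [_ [hp [b hb ->] e]]]] := @radical_power _ B hB hn _ y hI.
    move=> Q hQ hIQ; apply: (hP'max Q hQ _ _ _ (hsn y hy)).
      by apply: subset_trans hIQ; exact: (addml (sm_scm x hBB)).
    move=> h; apply: hxP'; apply: h; apply: hIQ; apply: (addmr (idealP hP'I)).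
    exact: scm_self.
  by exists k, b; rewrite e addrK.
have [s' [es' hs'P hs']] : exists s', [/\ size s' = size (rem x s),
    forall z, z \in s' -> P' z &
    forall y, y \in rem x s -> exists k b, B b /\ (y ^+ k - x * b) \in s'].
  elim: (rem x s) hpow => [|y t IHt] h; first by exists [::].
  have [z hz|s' [e h1 h2]] := IHt; first by apply: h; rewrite inE hz orbT.
  have [k [b [hb hp]]] := h y (mem_head _ _).
  exists ((y ^+ k - x * b) :: s'); split; first by rewrite /= e.
    by move=> z; rewrite inE => /orP[/eqP ->|/h1].
  move=> z; rewrite inE => /orP[/eqP ->|/h2[k' [b' [hb' hz]]]].
    exists k, b; alg.
  by exists k', b'; rewrite inE hz orbT.
have hS := mset_compl hB hP'.
have hB' := loc_subring hB hS.
have hn' := loc_noeth hB hS hBB hn.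
have hl' := local_loc hB hP'.
have es'm : size s' = m by rewrite es' size_rem // em.
apply: (IH _ _ s' l _ es'm hB' hn' hl') (loc_chain hB hP' _ hcP').
- by move=> y /hs'P hy; exact: sub_loc hS _ hy.
- move=> y hy; apply: (radical_power hB' hn').
    split; last exact: sm_lc (sm_self hB').
    apply: lc_sub (sm_self hB') => z /hs'P hz.
    by apply: (sub_loc hS); exact: (ideal_sub hP'I).
  move=> Q hQ hIQ; have [hQ0 hQS] := contract_prime hB hS hQ.
  have hQP' : Q `&` B `<=` P'.
    by move=> z hz; apply: contrapT => hzP'; apply: (hQS z hz); case: hz.
  suff h : P' `<=` Q.
    have [[_ hQsm] _ _] := hQ; exact: (loc_min hS hQsm h hB).
  suff h : P' `<=` Q `&` B by move=> z /h[].
  (* A prime that contains [x] and the contraction of [Q] contains all of [s] up to powers, hence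
     contains [n]. *)
  apply: (principal_ideal_theorem hB hn hl hP' hQ0 hQP' hxn hnP') => R hR hQR hRx.
  apply: hsub => // z hz; have [/eqP -> //|hzx] := boolP (z == x).
  have [|k [b [hb hzs]]] := hs' z.
    have := perm_to_rem hxs => /perm_mem /(_ z); rewrite hz inE (negbTE hzx) /=.
    alg.
  have hzB := ideal_sub hnI (hsn z hz).
  apply: (prime_mulX hB hR hzB (k := k)).
  have [[_ hRs] _ _] := hR; rewrite -(subrK (x * b) (z ^+ k)); alg.
- by split=> i hi; [apply: hc.1; exact: leqW|apply: hc.2; exact: leqW].
Qed.

Lemma krull_dim_exists B n : subring B -> noethm B B -> is_local B n ->
  exists d, krull_dim B d.
Proof.
move=> hB hn hl; have hnI := local_ideal hl.
have [|s hs] := hn n (idealP hnI); first exact: ideal_sub.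
have [||d [[c hc] hmax]] :=
    @ex_max (fun k => exists c, strict_chain (prime_ideal B) k c) 0%N (size s).
- by exists (fun=> n); split=> // i _; exact: local_prime hB hn hl.
- move=> k [c hc]; apply: (krull_height hB hn hl _ _ hc).
    alg.
  by exists 1%N; rewrite expr1 -hs.
exists d; split; first by exists c.
by move=> k c' hc'; apply: hmax; exists c'.
Qed.

Lemma chain_cons (C : set (set K)) l c P : strict_chain C l c -> C P -> P `<` c 0%N ->
  strict_chain C l.+1 (fun i => if i is i'.+1 then c i' else P).
Proof. by move=> [h1 h2] hP hlt; split=> -[|i] hi //; [exact: h1|exact: h2]. Qed.

Lemma In_filter (U : Type) (p : pred U) (L : seq U) x :
  List.In x (filter p L) <-> List.In x L /\ p x.
Proof.
elim: L => [|y L IH] /=; first by split=> // -[].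
case: ifP => hp /=; rewrite IH; split.
- by case=> [<-|[h1 h2]]; split=> //; [left|right].
- by case=> -[->|h] hx; [left|right].
- by case=> h1 h2; split=> //; right.
- by case=> -[e|h] hx //; move: hp; rewrite e hx.
Qed.

(** [j] bounds the chains of primes above [t], in place of the dimension of the quotient. Each new
    element avoids the finitely many listed primes over [t] other than [n], which shortens those
    chains by one. *)
Lemma extend_parameters B n j t : subring B -> noethm B B -> is_local B n ->
  (forall x, x \in t -> n x) ->
  (forall l c, strict_chain (prime_ideal B) l c ->
     (forall x, x \in t -> c 0%N x) -> (l <= j)%N) ->
  exists t', [/\ size t' = j, forall x, x \in t' -> n x &
     forall x, n x -> exists k, lc B (t ++ t') (x ^+ k)].
Proof.
move=> hB hn hl; have hBB := sm_self hB; have hnI := local_ideal hl.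
have hnp := local_prime hB hn hl.
elim: j t => [|j IH] t ht hch.
  exists [::]; split=> // x hx; rewrite cats0; apply: (radical_power hB hn).
    split; last exact: sm_lc.
    apply: lc_sub hBB => z /ht; alg.
  move=> P hP hIP; apply: contrapT => hPx.
  suff : (1 <= 0)%N by [].
  apply: (hch 1%N (fun i => if i is 0 then P else n)).
    split; first by case.
    case=> // _; split; first exact: (prime_sub_local hB hn hl hP).
    move=> h; apply: hPx; alg.
  alg.
have hI : ideal B (lc B t).
  split; last exact: sm_lc.
  apply: lc_sub hBB => z /ht; alg.
have [L [hL1 hL2]] := primes_over hB hn hI.
have [|||y hy hyL] := @avoid_coset _ B hB (filter (fun P => `[< ~ n `<=` P >]) L) 0 n.
- alg.
- alg.
- move=> P /In_filter[/hL1[hP _] /asboolP h]; split=> //; by case.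
have [||t' [et' ht' hr]] := IH (rcons t y).
- by move=> x; rewrite mem_rcons inE => /orP[/eqP ->|/ht].
- move=> l c hc hct; have hc0 := hc.1 0%N (leq0n _).
  have [|Q hQ hQc] := hL2 _ hc0.
    have [[_ hcs] _ _] := hc0; apply: (lc_min hcs) => z b hz hb; rewrite mulrC.
    by apply: (smZ hcs) => //; apply: hct; rewrite mem_rcons inE hz orbT.
  have [hQp hQt] := hL1 Q hQ.
  have [hnQ|hnQ] := pselect (n `<=` Q).
    case: l hc => // l hc; exfalso; have [_] := hc.2 0%N isT; apply.
    apply: subset_trans hQc; apply: subset_trans hnQ.
    exact: (prime_sub_local hB hn hl (hc.1 1%N isT)).
  rewrite -ltnS; apply: hch; first apply: (chain_cons hc hQp); last first.
    alg.
  split=> // h; apply: (hyL Q).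
    by apply/In_filter; split=> //; exact/asboolP.
  by rewrite add0r; apply: h; apply: hct; rewrite mem_rcons mem_head.
exists (y :: t'); split.
- by rewrite /= et'.
- by move=> x; rewrite inE => /orP[/eqP ->|/ht'].
- by move=> x /hr[k hk]; exists k; rewrite -cat_rcons.
Qed.

(** In a domain the zero ideal prolongs every chain of primes above a nonzero [c] by one. *)
Lemma parameters_through B n d c : subring B -> noethm B B -> is_local B n ->
  krull_dim B d -> n c -> c != 0 ->
  exists s, [/\ size s = d.-1, (0 < d)%N, forall x, x \in s -> n x &
    forall x, n x -> exists k, lc B (c :: s) (x ^+ k)].
Proof.
move=> hB hn hl [_ hd] hc c0.
have hz : prime_ideal B [set 0].
  split; [split; [by move=> _ ->; exact: sr0|exact: sm_zero]| |].
    by move/eqP; rewrite oner_eq0.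
  by move=> x y _ _ /eqP; rewrite mulf_eq0 => /orP[]/eqP; [left|right].
have hlt P : prime_ideal B P -> P c -> [set 0] `<` P.
  move=> [hP _ _] hPc; split; first by move=> _ ->; exact: sm0 (idealP hP).
  by move=> h; move/eqP: c0; apply; exact: h.
have hd0 : (0 < d)%N.
  apply: (hd 1%N (fun i => if i is 0 then [set 0] else n)); split=> -[|i] // _.
    exact: local_prime hB hn hl.
  by apply: hlt => //; exact: local_prime hB hn hl.
have [||s [es hs hr]] := @extend_parameters B n d.-1 [:: c] hB hn hl.
- by move=> x; rewrite inE => /eqP ->.
- move=> l c' hc' hcc; rewrite -ltnS prednK //.
  apply: (hd _ _ (chain_cons hc' hz _)); apply: hlt; first exact: hc'.1.
  alg.
by exists s.
Qed.

End Krull.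

(** * Depth and regular sequences *)

Section Depth.
Variables (K : fieldType) (B n N : set K).
Hypotheses (hB : subring B) (hn : noethm B B) (hl : is_local B n).
Hypotheses (hfg : fgm B N).
Implicit Types (X Y P Q : set K) (s t : seq K).

Let hBB := sm_self hB.
Let hnI := local_ideal hl.
Let hnB := ideal_sub hnI.
Let hN : submodule B N.
Proof. case: hfg => s ->; alg. Qed.

(** No quotient is formed: [x] is a nonzerodivisor on [N/X], and dividing further by [x] means
    enlarging [X] by [x * N]. *)
Definition regular X x := forall w, N w -> X (x * w) -> X w.

Fixpoint reglist X s :=
  if s is x :: s' then regular X x /\ reglist (addm X (scm x N)) s' else True.

Fixpoint depth_ge d X :=
  if d is d'.+1 then
    exists x, [/\ n x, regular X x & depth_ge d' (addm X (scm x N))]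
  else True.

Definition socle_free X := forall w, N w -> (forall c, n c -> X (c * w)) -> X w.

Lemma depth1_socle d X : depth_ge d.+1 X -> socle_free X.
Proof. by case=> x [hx hr _] w hw h; apply: hr => //; exact: h. Qed.

Lemma regularX X x k : B x -> regular X x -> regular X (x ^+ k).
Proof.
move=> hx h; elim: k => [|k IH] w hw; first by rewrite mul1r.
rewrite exprSr -mulrA => /IH h'; apply: h => //; apply: h'; exact: (smZ hN).
Qed.

Lemma sm_addx X x : submodule B X -> submodule B (addm X (scm x N)).
Proof. alg. Qed.

(** The elements not regular on [N/X] lie in finitely many primes that annihilate an element of
    [N/X]; coset avoidance treats all modules of [L] at once. *)
Lemma regular_coset x J (L : seq (set K)) : B x -> ideal B J ->
  (forall X, List.In X L -> submodule B X /\
     forall P w, prime_ideal B P -> N w -> ~ X w -> P = ann B X w ->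
       ~ (P x /\ J `<=` P)) ->
  exists2 y, J y & forall X, List.In X L -> regular X (x + y).
Proof.
move=> hx hJ hL.
have {hL} [L' [hL' hreg]] : exists L' : seq (set K),
    (forall P, List.In P L' -> prime_ideal B P /\ ~ (P x /\ J `<=` P)) /\
    (forall c, B c -> (forall P, List.In P L' -> ~ P c) ->
      forall X, List.In X L -> regular X c).
  elim: L hL => [|X L IH] hL; first by exists [::].
  have [|L1 [h1 h2]] := IH; first by move=> Y hY; apply: hL; right.
  have [hX hXP] := hL X (or_introl erefl).
  have [L2 [h3 h4]] := ass_list hB hn hfg hN hX.
  exists (L2 ++ L1); split.
    move=> P hP; have [/h3[hPp [w [hw hwX e]]]|/h1 //] := In_cat hP.
    by split=> //; exact: hXP hPp hw hwX e.
  move=> c hc hcP Y [<- w hw hcw|hY]; last first.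
    by apply: h2 => // P hP; apply: hcP; apply: List.in_or_app; right.
  apply: contrapT => hwX; have [P hP hPc] := h4 c w hc hw hwX hcw.
  by apply: (hcP P) => //; apply: List.in_or_app; left.
have [y hy hyL] := avoid_coset hB hx hJ hL'.
exists y => //; apply: hreg => //; apply: srD => //; exact: ideal_sub hJ _ hy.
Qed.

Lemma regular_exists (L : seq (set K)) :
  (forall X, List.In X L -> submodule B X /\ socle_free X) ->
  exists2 y, n y & forall X, List.In X L -> regular X y.
Proof.
move=> hL; have [|y hy hr] := @regular_coset 0 n L (sr0 hB) hnI; last first.
  by exists y => // X hX; rewrite -[y]add0r; exact: hr.
move=> X /hL[hX hs]; split=> // P w hP hw hwX -> [_ hnP].
by apply: hwX; apply: hs => // c /hnP[].
Qed.

Lemma regular_swap X x y : submodule B X -> B x -> B y ->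
  regular X x -> regular X y -> regular (addm X (scm x N)) y ->
  regular (addm X (scm y N)) x.
Proof.
move=> hX hx hy hrx hry hrxy w hw [p [_ [hp [v hv ->] e]]].
have hv' : addm X (scm x N) v.
  apply: hrxy => //; exists (- p), (x * w); split.
  - alg.
  - by exists w.
  - by rewrite e; ring.
have [q [_ [hq [u hu ->] ev]]] := hv'.
exists (w - y * u), (y * u); split; [|by exists u|by rewrite subrK].
apply: hrx; first alg.
have -> : x * (w - y * u) = p + y * q by rewrite mulrBr e ev; ring.
alg.
Qed.

(** Depth does not depend on the regular element divided out. An element [z] regular on [N/X] and
    also modulo [x] and modulo [y] links the two: induction passes from [y] to [z] and then to [x],
    with [regular_swap] exchanging the order of the divisions. *)
Lemma depth_exchange d X x : submodule B X -> depth_ge d.+1 X -> n x ->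
  regular X x -> depth_ge d (addm X (scm x N)).
Proof.
elim: d X x => [|d IH] X x hX hd hx hrx //.
have [y [hy hry hdy]] := hd.
have hXx := sm_addx x hX; have hXy := sm_addx y hX.
have hsy := depth1_socle hdy.
(* Sending [w] to [v] with [y * w] equal to [x * v] modulo [X] carries the socle modulo [x] into the
   socle modulo [y], which is zero. *)
have hsx : socle_free (addm X (scm x N)).
  move=> w hw h; have [p [_ [hp [v hv ->] e]]] := h y hy.
  have [q [_ [hq [u hu ->] ev]]] : addm X (scm y N) v.
    apply: hsy => // c hc; have [p' [_ [hp' [v' hv' ->] e']]] := h c hc.
    exists (c * v - y * v'), (y * v'); split; [|by exists v'|by rewrite subrK].
    apply: hrx; first alg.
    have -> : x * (c * v - y * v') = y * p' - c * p.
      have -> : x * (c * v - y * v') = c * (x * v) - y * (x * v') by ring.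
      have -> : x * v = y * w - p by rewrite e; ring.
      by have -> : x * v' = c * w - p' by [rewrite e'; ring]; ring.
    alg.
  exists (w - x * u), (x * u); split; [|by exists u|by rewrite subrK].
  apply: hry; first alg.
  have -> : y * (w - x * u) = p + x * q by rewrite mulrBr e ev; ring.
  alg.
have [|z hz hr] :=
    @regular_exists [:: X; addm X (scm x N); addm X (scm y N)].
  move=> Y [<-|[<-|[<-|[]]]]; split=> //; exact: depth1_socle hd.
have hrz := hr X (or_introl erefl).
have hrzx := hr _ (or_intror (or_introl erefl)).
have hrzy := hr _ (or_intror (or_intror (or_introl erefl))).
exists z; split=> //.
rewrite -addmA (addmC (scm x N)) addmA; apply: (IH) => //; first exact: sm_addx.
  exists y; split=> //.
    apply: regular_swap => //; alg.
  rewrite -addmA (addmC (scm z N)) addmA; exact: IH.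
apply: regular_swap => //; alg.
Qed.

Lemma depth_le d d' X : (d' <= d)%N -> depth_ge d X -> depth_ge d' X.
Proof.
elim: d' d X => [|d' IH] [|d] X // hd [x [hx hr h]].
by exists x; split=> //; exact: IH h.
Qed.

Definition annm X : set K := [set a | B a /\ forall w, N w -> X (a * w)].

Lemma sm_annm X : submodule B X -> submodule B (annm X).
Proof.
move=> hX; split.
- split=> [|w hw]; alg.
- move=> a b [ha ha'] [hb hb']; split; first exact: srD.
  by move=> w hw; rewrite mulrDl; apply: (smD hX); auto.
- move=> a b ha [hb hb']; split; first exact: srM.
  by move=> w hw; rewrite -mulrA; apply: (smZ hX); auto.
Qed.

Definition parameters X s :=
  forall c, n c -> exists k, addm (lc B s) (annm X) (c ^+ k).

(** The last parameter [z] is changed by a combination of the others into an element [q] regular on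
    [N/X]. By induction [x] is regular modulo [q], and Krull's intersection theorem along the powers
    of [q] lifts this to [N/X]. *)
Lemma parameters_regular X x s : submodule B X -> (forall y, y \in x :: s -> n y) ->
  parameters X (x :: s) -> depth_ge (size s).+1 X -> regular X x.
Proof.
elim/last_ind: s X => [|s z IH] X hX hs hp hd.
  have [y [hy hr _]] := hd => w hw hxw.
  have [k [_ [al [[_ [_ [[b hb ->] -> ->]]] [hal hal'] e]]]] := hp y hy.
  apply: (regularX (k := k) (hnB hy) hr) => //.
  have -> : y ^+ k * w = b * (x * w) + al * w by rewrite e; ring.
  by apply: (smD hX); [alg|exact: hal'].
have hz : n z by apply: hs; rewrite inE mem_rcons mem_head orbT.
have hs' y : y \in x :: s -> n y.
  by move=> hy; apply: hs; move: hy; rewrite !inE mem_rcons inE => /orP[->|->]; rewrite ?orbT.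
have hJ : ideal B (lc B (x :: s)).
  by split; [apply: lc_sub hBB => y /hs'; exact: hnB|alg].
have hsplit : lc B (x :: rcons s z) = addm (scm z B) (lc B (x :: s)).
  by rewrite -rcons_cons -cats1 (lc_cat _ _ hBB) addmC [lc B [:: z]]/= addm0.
have hsoc := depth1_socle hd.
have [|j hj hrj] := @regular_coset z (lc B (x :: s)) [:: X] (hnB hz) hJ.
  (* A prime annihilator containing [z] and the other parameters would contain [n], against the
     vanishing of the socle. *)
  move=> Y [<-|[]]; split=> // P w hP hw hwX eP [hPz hJP].
  apply: hwX; apply: hsoc => // c hc.
  have [[_ hPs] _ _] := hP.
  suff : P c by rewrite eP => -[].
  have [k [q [al [hq [hal hal'] e]]]] := hp c hc.
  apply: (prime_mulX hB hP (hnB hc) (k := k)); rewrite e; apply: (smD hPs).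
    move: hq; rewrite hsplit; apply: (addm_min hPs) => // _ [b hb ->].
    alg.
  by rewrite eP; split=> //; exact: hal'.
have {hrj} hrq := hrj X (or_introl erefl); set q := z + j in hrq.
have hjn : n j.
  apply: (lc_min (idealP hnI)) hj => y b /hs' hy hb; rewrite mulrC.
  exact: (smZ (idealP hnI)).
have hqn : n q by exact: (smD (idealP hnI)).
have hqB := hnB hqn; have hxB := hnB (hs' x (mem_head _ _)).
have hXq := sm_addx q hX.
have hrx : regular (addm X (scm q N)) x.
  apply: IH => //; last first.
    by apply: depth_exchange; move: hd; rewrite size_rcons.
  move=> c hc; have [k [q0 [al [hq0 [hal hal'] e]]]] := hp c hc.
  move: hq0 e; rewrite hsplit => -[_ [j0 [[b hb ->] hj0 ->]]] e.
  exists k, (j0 - b * j), (q * b + al); split.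
  - by apply: (smB hB (idealP hJ)) => //; exact: (smZ (idealP hJ)).
  - split; first alg.
    move=> w hw; exists (al * w), (q * (b * w)); split; first exact: hal'.
      exists (b * w) => //; alg.
    by ring.
  - by rewrite e /q; ring.
move=> w hw hxw; apply: (krull_intersection hB hn hl hfg hX hqn hw) => k.
suff [v [hv hxv h]] : exists v, [/\ N v, X (x * v) & X (w - q ^+ k * v)] by exists v.
elim: k => [|k [v [hv hxv h]]].
  exists w; split; rewrite // expr0 mul1r subrr; alg.
have [p [_ [hp' [u hu ->] e]]] := hrx v hv (addml (sm_scm q hN) hxv).
exists u; split=> //.
  apply: hrq; first exact: (smZ hN).
  have -> : q * (x * u) = x * v - x * p by rewrite e; ring.
  alg.
have -> : w - q ^+ k.+1 * u = (w - q ^+ k * v) + q ^+ k * p by rewrite e exprSr; ring.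
alg.
Qed.

Lemma parameters_reglist X s : submodule B X -> (forall y, y \in s -> n y) ->
  parameters X s -> depth_ge (size s) X -> reglist X s.
Proof.
elim: s X => [|x s IH] X hX hs hp hd //=.
have hx := hs x (mem_head _ _); have hxB := hnB hx.
have hr := parameters_regular hX hs hp hd; split=> //.
apply: IH; [alg| | |exact: depth_exchange].
  by move=> y hy; apply: hs; rewrite inE hy orbT.
move=> c hc; have [k [_ [al [[_ [j [[b hb ->] hj ->]]] [hal hal'] e]]]] := hp c hc.
exists k, j, (x * b + al); split=> //; last by rewrite e; ring.
split; first alg.
move=> w hw; exists (al * w), (x * (b * w)); split; first exact: hal'.
  exists (b * w) => //; alg.
by ring.
Qed.

(** The recursions on powers of an ideal delete and permute generators, so regularity is required
    modulo every sublist and in every order. *)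
Definition perm_regular X s := forall x t w,
  perm_eq s (x :: t ++ w) -> regular (addm X (lc N t)) x.

Lemma reglist_at X t x w : submodule B X ->
  reglist X (t ++ x :: w) -> regular (addm X (lc N t)) x.
Proof.
elim: t X => [|y t IH] X hX /= [hr h].
  by rewrite addm0.
rewrite addmA; apply: IH => //; alg.
Qed.

Lemma parameters_perm_regular X s : submodule B X -> (forall y, y \in s -> n y) ->
  parameters X s -> depth_ge (size s) X -> perm_regular X s.
Proof.
move=> hX hs hp hd x t w hper; apply: (@reglist_at X t x w) => //.
have hper' : perm_eq s (t ++ x :: w).
  by apply: perm_trans hper _; rewrite -cat_rcons -cat1s perm_catCA -cats1 catA.
apply: parameters_reglist => //.
- move=> y; rewrite -(perm_mem hper'); alg.
- move=> c /hp[k h]; exists k.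
  by rewrite -(lc_perm hBB (perm_mem hper')).
- by rewrite -(perm_size hper').
Qed.

Lemma perm_regular_perm X s t : perm_eq s t -> perm_regular X s -> perm_regular X t.
Proof. by move=> h hs x u w /(perm_trans h); exact: hs. Qed.

Lemma perm_regular_head X x s : perm_regular X (x :: s) -> regular X x.
Proof. by move=> h; rewrite -[X]addm0; exact: (h x [::] s). Qed.

Lemma perm_regular_tail X x s : perm_regular X (x :: s) -> perm_regular X s.
Proof.
move=> h y t w hp; apply: (h y t (x :: w)).
rewrite -cat_cons -(perm_cons x) in hp *; apply: perm_trans hp _.
by rewrite -cat1s perm_catCA.
Qed.

Lemma perm_regular_quot X x s : perm_regular X (x :: s) ->
  perm_regular (addm X (scm x N)) s.
Proof.
move=> h y t w hp; rewrite -addmA; apply: (h y (x :: t) w).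
rewrite -(perm_cons x) in hp; apply: perm_trans hp _.
exact: (permEl (perm_catCA [:: x] [:: y] (t ++ w))).
Qed.

(** * Powers of parameter ideals *)

(** [qp s k Y] is the sum of the [x * Y], [x] a monomial of degree [k] in [s] *)
Fixpoint qp s (k : nat) Y : set K :=
  if s is x :: s' then
    (fix q k := if k is k'.+1 then addm (scm x (q k')) (qp s' k Y) else Y) k
  else if k is 0 then Y else [set 0].

Lemma qp0 s Y : qp s 0 Y = Y. Proof. by case: s. Qed.
Lemma qpS x s k Y : qp (x :: s) k.+1 Y = addm (scm x (qp (x :: s) k Y)) (qp s k.+1 Y).
Proof. by []. Qed.

Lemma sm_qp s k Y : submodule B Y -> submodule B (qp s k Y).
Proof.
move=> hY; elim: s k => [|x s IH] k; first by case: k => //= _; exact: sm_zero.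
elim: k => [|k IHk] //; rewrite qpS; apply: sm_addm; [alg|alg].
Qed.

Lemma qp_mono s k Y Y' : Y `<=` Y' -> qp s k Y `<=` qp s k Y'.
Proof.
move=> h; elim: s k => [|x s IH] k; first by case: k => [|k] // x.
elim: k => [|k IHk] //; rewrite !qpS; apply: addmS; [exact: scmS|alg].
Qed.

Lemma qp_consr x s k Y : submodule B Y -> qp s k Y `<=` qp (x :: s) k Y.
Proof.
move=> hY; case: k => [|k]; first by rewrite !qp0.
by rewrite qpS; apply: (addmr (B := B)); apply: sm_scm; exact: sm_qp.
Qed.

Lemma qp_dec s k Y : (forall x, x \in s -> B x) -> submodule B Y ->
  qp s k.+1 Y `<=` qp s k Y.
Proof.
move=> hs hY; elim: s k hs => [|x s IH] k hs.
  by move=> _ ->; exact: sm0 (sm_qp [::] k hY).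
have hs' y : y \in s -> B y by move=> hy; apply: hs; rewrite inE hy orbT.
rewrite qpS; apply: (addm_min (sm_qp (x :: s) k hY)).
  apply: scm_sub (sm_qp _ _ hY); alg.
by apply: subset_trans (IH k hs') _; exact: qp_consr.
Qed.

Lemma qp_sub s k Y : (forall x, x \in s -> B x) -> submodule B Y -> qp s k Y `<=` Y.
Proof.
move=> hs hY; elim: k => [|k IH]; first by rewrite qp0.
by apply: subset_trans IH; exact: qp_dec.
Qed.

Lemma qp_shift s k Y : submodule B Y -> qp s k.+1 Y `<=` qp s k (lc Y s).
Proof.
move=> hY; elim: s k => [|x s IH] k.
  by move=> _ ->; exact: sm0 (sm_qp [::] k (sm_lc [::] hY)).
elim: k => [|k IHk].
  rewrite qpS !qp0 /=; apply: addmS => //.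
  by have := IH 0%N; rewrite qp0.
rewrite qpS [X in _ `<=` X]qpS; apply: addmS; first exact: scmS.
apply: subset_trans (IH k.+1) _; apply: qp_mono.
apply: (addmr (B := B)); alg.
Qed.

Lemma qp_mul s k x Y : submodule B Y -> x \in s -> scm x (qp s k Y) `<=` qp s k.+1 Y.
Proof.
move=> hY; elim: s k => // z s IH k; rewrite inE => /orP[/eqP ->|hx].
  by apply: (addml (B := B)); exact: sm_qp.
elim: k => [|k IHk]; last rewrite qpS [X in _ `<=` X]qpS.
  move=> w; rewrite qp0 => hw; suff h : qp s 1 Y w by exact: (qp_consr z hY h).
  by apply: (IH 0%N hx); rewrite qp0.
move=> _ [_ [_ [v [[u hu ->] hv ->]]] ->].
exists (z * (x * u)), (x * v); split; last by ring.
  by exists (x * u) => //; apply: IHk; exists u.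
by apply: (IH k.+1 hx); exists v.
Qed.

Lemma qp_lc s k Y : submodule B Y -> qp s k.+1 Y = lc (qp s k Y) s.
Proof.
move=> hY; rewrite eqEsubset; split; last first.
  apply: (lc_min (sm_qp s k.+1 hY)) => x y hx hy; apply: qp_mul hx _ _ => //.
  by exists y.
elim: s => [|x s IH]; first by [].
rewrite qpS /=; apply: addmS => //.
by apply: subset_trans IH _; apply: lcS; exact: qp_consr.
Qed.

(** Regularity modulo sublists passes to powers. Dividing by [y] shortens [s]; what is left over is
    [y] times an element [z'], which is treated with the exponent lowered by one. *)
Lemma qp_colon X x s k z : submodule B X -> (forall y, y \in x :: s -> B y) ->
  perm_regular X (x :: s) -> N z -> addm X (qp s k N) (x * z) -> addm X (qp s k N) z.
Proof.
elim: s X x k z => [|y s IH] X x k z hX hs hr hz.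
  case: k => [|k] /=; last by rewrite addm0; apply: (perm_regular_head hr).
  by move=> _; apply: (addmr hX).
have hxB : B x by alg.
have hyB : B y by alg.
have hsB w : w \in s -> B w by move=> hw; apply: hs; rewrite !inE hw !orbT.
have hys : forall w, w \in y :: s -> B w by move=> w; rewrite inE => /orP[/eqP ->|/hsB].
elim: k z hz => [|k IHk] z hz; first by rewrite qp0 => _; exact: (addmr hX).
have hqs := sm_qp s k.+1 hN; have hqy := sm_qp (y :: s) k hN.
rewrite qpS => -[p [_ [hp [_ [v [[w hw ->] hv ->]]] e]]].
have hr' : perm_regular X (y :: x :: s).
  apply: perm_regular_perm hr.
  by rewrite -[x :: _]/([:: x] ++ [:: y] ++ s) perm_catCA.
have [p' [v' [[q [_ [hq [z' hz' ->] ->]]] hv' ez]]] :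
    addm (addm X (scm y N)) (qp s k.+1 N) z.
  apply: (IH _ x) => //; first exact: sm_addx.
  - by move=> u; rewrite inE => /orP[/eqP ->|/hsB].
  - exact: perm_regular_quot hr'.
  - exists (p + y * w), v; split=> //; last by rewrite e addrA.
    exists p, (y * w); split=> //; exists w => //; exact: qp_sub hys hN _ hw.
have h1 : addm X (qp s k.+1 N) (x * z' - w).
  apply: (IH _ y) => //; first exact: perm_regular_tail hr.
    apply: (smB hB hN); [alg|exact: qp_sub hys hN _ hw].
  exists (p - x * q), (v - x * v'); split.
  - alg.
  - alg.
  - have -> : y * (x * z' - w) = x * (q + y * z' + v') - x * q - x * v' - y * w by ring.
    by rewrite -ez e; ring.
have hsub : qp s k.+1 N `<=` qp (y :: s) k N.
  by apply: subset_trans (qp_dec (k := k) hsB hN) _; exact: qp_consr.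
have [g [u [hg hu eu]]] : addm X (qp (y :: s) k N) z'.
  apply: IHk => //; have hXq := sm_addm hX hqy.
  rewrite -(subrK w (x * z')); apply: (smD hXq); last exact: (addmr hX).
  exact: (addmS (@subset_refl _ X) hsub) h1.
exists (q + y * g), (y * u + v'); split; last by rewrite ez eu; ring.
- alg.
- by exists (y * u), v'; split=> //; exists u.
Qed.

(** With Q an ideal of [d] generators, [hilb e v d k] is the length of N/Q^k Y when N/QN has length
    [e] and N/Y has length [v]; the recursion divides out one generator. *)
Fixpoint hilb (e v d : nat) : nat -> nat :=
  if d is d'.+1 then
    fix h k := if k is k'.+1 then (h k' + hilb e v d' k)%N else v
  else fun k => if k is 0 then v else e.

Lemma hilbS e v d k : hilb e v d.+1 k.+1 = (hilb e v d.+1 k + hilb e v d k.+1)%N.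
Proof. by []. Qed.

Lemma hilbE e v d k :
  hilb e v d.+1 k = (e * 'C(k + d, d.+1) + v * 'C(k + d, d))%N.
Proof.
elim: d k => [|d IH] k.
  elim: k => [|k IHk]; first by rewrite muln0 muln1.
  by rewrite hilbS IHk /= !bin1 !bin0; lia.
elim: k => [|k IHk]; first by rewrite binn bin_small // muln0 muln1.
by rewrite hilbS IHk IH !addnS !binS; ring.
Qed.

Lemma qp_step X x s k Y : submodule B X -> X `<=` N -> B x -> submodule B Y -> Y `<=` N ->
  (forall y, y \in s -> B y) ->
  let Z := addm X (qp (x :: s) k.+1 Y) in
  [/\ submodule B Z, submodule B (addm X (qp (x :: s) k Y)),
   addm (scm x N) Z = addm (addm X (scm x N)) (qp s k.+1 Y),
   Z `<=` N /\ addm (scm x N) Z `<=` N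
   & scm x (addm X (qp (x :: s) k Y)) `<=` scm x N `&` Z].
Proof.
move=> hX hXN hx hY hYN hs Z; have hxs y : y \in x :: s -> B y.
  by rewrite inE => /orP[/eqP ->|/hs].
have hq := sm_qp (x :: s) k hY; have hq1 := sm_qp s k.+1 hY.
have hxq := sm_scm x hq; have hZ : submodule B Z by apply: sm_addm => //; exact: sm_qp.
have hqN : qp (x :: s) k Y `<=` N by apply: subset_trans hYN; exact: qp_sub.
have hq1N : qp s k.+1 Y `<=` N by apply: subset_trans hYN; exact: qp_sub.
have hxN : scm x N `<=` N by exact: (scm_sub hx hN).
have hsx := sm_scm x hN.
have hZN : Z `<=` N.
  apply: (addm_min hN) => //; rewrite qpS; apply: (addm_min hN) => //.
  by apply: subset_trans hxN; exact: scmS.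
split=> //.
- alg.
- rewrite /Z qpS addmCA !addmA; congr (addm _ _); rewrite -addmA; congr (addm X _).
  by apply: (addm_idr hsx hxq); exact: scmS.
- by split=> //; exact: (addm_min hN).
- move=> _ [_ [a [b [ha hb ->]]] ->]; split.
    exists (a + b) => //; alg.
  rewrite mulrDr; exists (x * a), (x * b); split=> //; first exact: (smZ hX).
  by apply: (addml hq1); exists b.
Qed.

(** Adding [x * N] leaves the same problem for [s] above. Below is [x * N] modulo its intersection
    with the old module, which [qp_colon] identifies with [N] modulo the previous power; the
    inclusion of [lc N s] in [Y] absorbs the remainder there. *)
Lemma length_qp X s k Y e v : submodule B X -> (forall y, y \in s -> B y /\ y != 0) ->
  submodule B Y -> X `<=` Y -> lc N s `<=` Y -> Y `<=` N -> perm_regular X s ->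
  has_length B N (addm X (lc N s)) e -> has_length B N Y v ->
  has_length B N (addm X (qp s k Y)) (hilb e v (size s) k).
Proof.
elim: s X k => [|x s IH] X k hX hs hY hXY hsY hYN hr he hv.
  case: k => [|k] //=; by rewrite (addm_idl hX hY hXY).
have hsB y : y \in s -> B y by move=> hy; have [|//] := hs y; rewrite inE hy orbT.
have [hxB hx0] := hs x (mem_head _ _).
have hXN : X `<=` N by alg.
have hsx := sm_scm x hN; have hlN := sm_lc s hN.
elim: k => [|k IHk]; first by rewrite (addm_idl hX hY hXY).
have [hZ hXq hW [hZN hWN] hsub] := qp_step k hX hXN hxB hY hYN hsB.
rewrite [size _]/= hilbS addnC; set Z := addm X (qp (x :: s) k.+1 Y) in hZ hW hZN hWN hsub *.
have h1 : has_length B N (addm (scm x N) Z) (hilb e v (size s) k.+1).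
  rewrite hW; apply: IH => //.
  - alg.
  - by move=> y hy; apply: hs; rewrite inE hy orbT.
  - by apply: (addm_min hY) => //; apply: subset_trans hsY; exact: (addml hlN).
  - by apply: subset_trans hsY; exact: (addmr hsx).
  - exact: perm_regular_quot.
  - by rewrite -addmA.
apply: (len_add hB hN (sm_addm hsx hZ) hZ h1).
apply/(len_2iso hB _ hsx hZ).
have <- : scm x (addm X (qp (x :: s) k Y)) = scm x N `&` Z.
  rewrite eqEsubset; split=> // _ [[z hz ->] [p [_ [hp [_ [u [[y hy ->] hu ->]]] e']]]].
  exists z => //; have hyN : N y.
    apply: hYN; apply: (qp_sub (s := x :: s) (k := k) _ hY hy) => w.
    by rewrite inE => /orP[/eqP ->|/hsB].
  have hzy : addm X (qp s k.+1 N) (x * (z - y)).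
    exists p, u; split=> //; last by rewrite mulrBr e'; ring.
    exact: (qp_mono (s := s) (k := k.+1) hYN hu).
  have hxsB w : w \in x :: s -> B w by rewrite inE => /orP[/eqP ->|/hsB].
  have [g [w [hg hw ew]]] := qp_colon hX hxsB hr (smB hB hN hz hyN) hzy.
  exists g, (w + y); split=> //; last by rewrite addrA -ew subrK.
  have hsN : lc N s `<=` Y by apply: subset_trans hsY; exact: (addmr hsx).
  have hw' : qp s k Y w by exact: (qp_mono (k := k) hsN (qp_shift hN hw)).
  exact: (smD (sm_qp (x :: s) k hY) (qp_consr x hY hw') hy).
by apply/(len_scm B _ _ _ hx0).
Qed.

(** Without regularity the intersection with [x * N] is only known to contain the expected module,
    which leaves an upper bound. *)
Lemma length_qp_le X s k Y e v : submodule B X -> X `<=` N ->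
  (forall y, y \in s -> B y /\ y != 0) ->
  submodule B Y -> Y `<=` N ->
  has_length B N (addm X (lc N s)) e -> has_length B N Y v ->
  exists2 l, (l <= hilb e v (size s) k)%N & has_length B N (addm X (qp s k Y)) l.
Proof.
move=> hX hXN hs hY hYN he hv; elim: s X k hX hXN hs he => [|x s IH] X k hX hXN hs he.
  case: k => [|k] /=; last by exists e.
  have hXY := sm_addm hX hY; have hXYN := addm_min hN hXN hYN.
  have [l1 [l2 [h1 _ ->]]] := len_split hB hN hXY hY (addmr hX) hXYN hv.
  by exists l1 => //; exact: leq_addr.
have hsB y : y \in s -> B y by move=> hy; have [|//] := hs y; rewrite inE hy orbT.
have [hxB hx0] := hs x (mem_head _ _).
have hsx := sm_scm x hN.
elim: k => [|k [l0 hl0 IHk]].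
  have hXY := sm_addm hX hY; have hXYN := addm_min hN hXN hYN.
  have [l1 [l2 [h1 _ e']]] := len_split hB hN hXY hY (addmr hX) hXYN hv.
  by exists l1; rewrite // e' leq_addr.
have [hZ hXq hW [hZN hWN] hsub] := qp_step k hX hXN hxB hY hYN hsB.
rewrite [size _]/= hilbS addnC; set Z := addm X (qp (x :: s) k.+1 Y) in hZ hW hZN hWN hsub *.
have [l1 hl1 h1] : exists2 l, (l <= hilb e v (size s) k.+1)%N &
    has_length B N (addm (scm x N) Z) l.
  rewrite hW; apply: IH => //.
  - alg.
  - by apply: (addm_min hN) => //; exact: (scm_sub hxB hN).
  - by move=> y hy; apply: hs; rewrite inE hy orbT.
  - by rewrite -addmA.
have hsi := sm_setI hsx hZ.
have h2 : has_length B (scm x N) (scm x (addm X (qp (x :: s) k Y))) l0.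
  by apply/(len_scm B _ _ _ hx0).
have [l2 [l3 [h3 _ e3]]] :=
  len_split hB hsx hsi (sm_scm x hXq) hsub (fun z h => h.1) h2.
exists (l1 + l2)%N.
  by rewrite leq_add // (leq_trans _ hl0) // e3 leq_addr.
apply: (len_add hB hN (sm_addm hsx hZ) hZ h1).
exact/(len_2iso hB _ hsx hZ).
Qed.

End Depth.

(** * Buchsbaum rings *)

Section BinomialPolynomials.

(** The binomial coefficient of [k + m] over [j] as a polynomial in [k]. *)
Definition binpoly (m j : nat) : {poly rat} :=
  (j`!%:R)^-1 *: \prod_(i < j) ('X - (- ((m - i)%:R))%:P).

Lemma size_binpoly m j : (size (binpoly m j) <= j.+1)%N.
Proof.
apply: leq_trans (size_scale_leq _ _) _.
by rewrite size_prod_XsubC /index_enum -enumT size_enum_ord.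
Qed.

Lemma coef_binpoly m j : (binpoly m j)`_j = (j`!%:R)^-1.
Proof.
rewrite coefZ; have := monic_prod_XsubC (index_enum 'I_j) predT
  (fun i : 'I_j => - ((m - i)%:R) : rat).
rewrite monicE /lead_coef size_prod_XsubC /index_enum -enumT size_enum_ord /= => /eqP ->.
by rewrite mulr1.
Qed.

Lemma horner_binpoly m j k : (j <= m)%N -> (binpoly m j).[k%:R] = 'C(k + m, j)%:R.
Proof.
move=> hj; rewrite hornerZ horner_prod.
have -> : \prod_(i < j) ('X - (- ((m - i)%:R))%:P).[k%:R] = ('C(k + m, j) * j`!)%:R :> rat.
  rewrite bin_ffact ffact_prod natr_prod; apply: eq_bigr => i _.
  rewrite !hornerE opprK -natrD addnBA //.
  by apply: leq_trans hj; exact: ltnW.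
by rewrite natrM mulrC mulfK // pnatr_eq0 -lt0n fact_gt0.
Qed.

Lemma eventually_pos (q : {poly rat}) d : (size q <= d.+1)%N -> 0 < q`_d ->
  exists k0 : nat, forall k, (k0 <= k)%N -> 0 < q.[k%:R].
Proof.
move=> hs hq; pose s := \sum_(i < d) `|q`_i|.
have hs0 : 0 <= s by exact: sumr_ge0.
exists (Num.bound (s / q`_d)).+1 => k hk.
have hk0 : 1 <= k%:R :> rat by rewrite ler1n; lia.
have hkp : 0 < k%:R :> rat by exact: lt_le_trans hk0.
have hks : s < q`_d * k%:R.
  rewrite mulrC -ltr_pdivrMr //; apply: lt_le_trans (archi_boundP _) _.
    by apply: divr_ge0 => //; exact: ltW.
  by rewrite ler_nat; exact: ltnW.
rewrite (horner_coef_wide _ hs) big_ord_recr /=.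
case: d hs hq @s hs0 hk hks => [|d] hs hq s hs0 hk hks.
  by rewrite big_ord0 add0r mulr1.
have h1 : - (s * k%:R ^+ d) <= \sum_(i < d.+1) q`_i * k%:R ^+ i.
  rewrite lerNl -sumrN /s mulr_suml; apply: ler_sum => i _.
  rewrite -mulNr; apply: (@le_trans _ _ (`|q`_i| * k%:R ^+ i)).
    by apply: ler_wpM2r; [exact: exprn_ge0 (ltW hkp)|rewrite -normrN; exact: ler_norm].
  by apply: ler_wpM2l => //; apply: ler_weXn2l => //; rewrite -ltnS.
apply: lt_le_trans (lerD h1 (lexx _)).
rewrite exprS mulrA addrC -mulrBl; apply: mulr_gt0; first by rewrite subr_gt0.
exact: exprn_gt0.
Qed.

(** The two bounds differ by a polynomial of degree [d], so they determine the coefficient of degree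
    [d.+1]. *)
Lemma leading_squeeze (p : {poly rat}) d e v k0 : (size p <= d.+2)%N ->
  (forall k, (k0 <= k)%N -> (e * 'C(k + d.+1, d.+1))%:R <= p.[k%:R] + v%:R) ->
  (forall k, (k0 <= k)%N ->
     p.[k%:R] + v%:R <= (e * 'C(k + d.+1, d.+1) + v * 'C(k + d.+1, d))%:R) ->
  p`_d.+1 * (d.+1)`!%:R = e%:R.
Proof.
move=> hs h1 h2; have f0 : (d.+1)`!%:R != 0 :> rat by rewrite pnatr_eq0 -lt0n fact_gt0.
pose q := p + v%:R%:P - e%:R *: binpoly d.+1 d.+1.
have hsv : (size (v%:R%:P : {poly rat}) <= d.+2)%N.
  by apply: leq_trans (size_polyC_leq1 _) _.
have hb := size_binpoly d.+1 d.+1.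
have hsq : (size q <= d.+2)%N.
  rewrite (leq_trans (size_polyD _ _)) // geq_max size_polyN.
  rewrite (leq_trans (size_polyD _ _)) ?geq_max ?hs //=.
  exact: leq_trans (size_scale_leq _ _) hb.
have hq : q`_d.+1 = p`_d.+1 - e%:R / (d.+1)`!%:R.
  by rewrite coefB coefD coefC coefZ coef_binpoly addr0.
have hqk k : q.[k%:R] = p.[k%:R] + v%:R - (e * 'C(k + d.+1, d.+1))%:R.
  by rewrite hornerD hornerN hornerD hornerZ hornerC horner_binpoly // natrM.
suff : q`_d.+1 = 0 by rewrite hq => /eqP; rewrite subr_eq0 => /eqP ->; rewrite divfK.
case: (ltrgt0P q`_d.+1) => // hlt.
- have [||k1 hk1] := @eventually_pos (q - v%:R *: binpoly d.+1 d) d.+1.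
  + rewrite (leq_trans (size_polyD _ _)) // geq_max size_polyN hsq /=.
    apply: leq_trans (size_scale_leq _ _) _.
    exact: leq_trans (size_binpoly _ _) _.
  + by rewrite coefB coefZ [(binpoly _ _)`_ _]nth_default ?size_binpoly // mulr0 subr0.
  have := hk1 (maxn k0 k1) (leq_maxr _ _).
  rewrite hornerD hornerN hornerZ hqk horner_binpoly // ltNge => /negP[].
  have := h2 (maxn k0 k1) (leq_maxl _ _).
  by rewrite -natrM -addrA -opprD subr_le0 -natrD.
- have [||k1 hk1] := @eventually_pos (- q) d.+1.
  + by rewrite size_polyN.
  + by rewrite coefN oppr_gt0.
  have := hk1 (maxn k0 k1) (leq_maxr _ _).
  rewrite hornerN hqk oppr_gt0 subr_lt0 ltNge => /negP[].
  exact: h1 (leq_maxl _ _).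
Qed.

End BinomialPolynomials.

Lemma chain_length_uniq (T : comNzRingType) (C : set (set T)) l l' :
  chain_length C l -> chain_length C l' -> l = l'.
Proof.
move=> [[c hc] hm] [[c' hc'] hm']; apply/eqP; rewrite eqn_leq.
by rewrite (hm' _ _ hc) (hm _ _ hc').
Qed.

Lemma span_rangeE (T : comNzRingType) (B : set T) d (a : 'I_d -> T) : subring B ->
  span B (range a) = lc B [seq a i | i <- enum 'I_d].
Proof.
move=> hB; rewrite -lc_span //; congr (span B _); rewrite eqEsubset; split.
  by move=> _ [i _ <-] /=; apply: map_f; rewrite mem_enum.
by move=> _ /mapP[i _ ->].
Qed.

Section Buchsbaum.
Variables (K : fieldType) (B n N : set K) (v : nat).
Hypotheses (hB : subring B) (hn : noethm B B) (hl : is_local B n).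
Hypotheses (hfg : fgm B N) (hBN : B `<=` N) (hv : has_length B N B v).
Implicit Types (X Y P Q : set K) (s t : seq K).

Let hBB := sm_self hB.
Let hnI := local_ideal hl.
Let hnB := ideal_sub hnI.
Let hN : submodule B N.
Proof. case: hfg => s ->; alg. Qed.

Definition primary s := forall c, n c -> exists k, lc B s (c ^+ k).

Lemma primary_trans s t : (forall x, x \in t -> B x) ->
  (forall x, x \in s -> n x /\ exists k, lc B t (x ^+ k)) -> primary s -> primary t.
Proof.
move=> ht hst hp c hc; apply: (radical_power hB hn).
  by split; [exact: (lc_sub ht hBB)|alg].
move=> P hP htP; have [[_ hPs] _ _] := hP.
have hsP : lc B s `<=` P.
  apply: (lc_min hPs) => x b /hst[hx [k hk]] hb; rewrite mulrC; apply: (smZ hPs) => //.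
  apply: (prime_mulX hB hP (hnB hx) (k := k)); alg.
have [k hk] := hp c hc; apply: (prime_mulX hB hP (hnB hc) (k := k)); exact: hsP.
Qed.

Lemma primary_length s : (forall x, x \in s -> n x) -> primary s ->
  exists e, has_length B N (lc N s) e.
Proof.
move=> hs hp; have hs' := sm_lc s hN.
apply: (len_finite hB hn hl hfg hs').
  apply: (lc_sub _ hN) => x /hs; alg.
move=> c w hc hw; have [k hk] := hp c hc; exists k.
rewrite mulrC; apply: (lc_min_scale hs' hk) => x b hx hb.
rewrite mulrCA; apply: (lc_mem hN) => //; alg.
Qed.

Lemma primary_parameters s : primary s -> parameters B n N [set 0] s.
Proof.
move=> h c /h[k hk]; exists k; apply: (addml (B := B)) => //.
by apply: sm_annm => //; exact: sm_zero.
Qed.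

Lemma primary_perm_regular D s : (forall x, x \in s -> n x) -> primary s ->
  (size s <= D)%N -> depth_ge n N D [set 0] -> perm_regular N [set 0] s.
Proof.
move=> hs hp hD hd; apply: (parameters_perm_regular hB hn hl hfg) => //.
- exact: sm_zero.
- exact: primary_parameters.
- exact: depth_le hD hd.
Qed.

Lemma add0m X : addm [set 0] X = X.
Proof. by rewrite addmC addm0. Qed.

Lemma perm_regular_neq0 s : perm_regular N [set 0] s -> forall x, x \in s -> x != 0.
Proof.
move=> h x hx; apply/eqP => x0; have hr := h x [::] (rem x s) (perm_to_rem hx).
rewrite addm0 in hr; have /= : [set (0 : K)] 1.
  by apply: hr; [apply: hBN; exact: sr1|rewrite x0 mul0r].
by move/eqP; rewrite oner_eq0.
Qed.

Lemma idealX_qp s k : idealX B (lc B s) k = qp s k B.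
Proof.
elim: k => [|k IH]; first by rewrite qp0.
rewrite /idealX iterS -/(idealX B (lc B s) k) IH (qp_lc _ _ hBB).
have hq := sm_qp s k hBB; have hql := sm_lc s hq.
rewrite eqEsubset; split.
  apply: (span_min hql) => _ [x hx [y hy <-]].
  rewrite mulrC; apply: (lc_min_scale hql hx) => z b hz hb.
  rewrite mulrCA; apply: (lc_mem hq) => //; alg.
apply: (lc_min (sm_span _ _)) => x y hx hy; apply: sub_span.
by exists x; [alg|exists y].
Qed.

Lemma parameter_idealP s : krull_dim B (size s) -> (forall x, x \in s -> n x) ->
  primary s -> parameter_ideal B n (lc B s).
Proof.
move=> hd hs hp; exists (size s), (fun i => s`_i); split=> //.
- by move=> i; apply: hs; exact: mem_nth.
- rewrite (span_rangeE _ hB); congr (lc B _); apply: (@eq_from_nth _ 0).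
    by rewrite size_map size_enum_ord.
  move=> i hi; rewrite (nth_map (Ordinal hi)) ?size_enum_ord //.
  by rewrite nth_enum_ord.
Qed.

(** When QN lies in [B], the module [B] is allowed as [Y] in [length_qp]; hence the Hilbert function
    of [B] is known at every [k], not only for large ones. *)
Lemma length_absorbing s d e k : size s = d.+1 -> (forall x, x \in s -> B x) ->
  perm_regular N [set 0] s -> lc N s `<=` B -> has_length B N (lc N s) e ->
  has_length B B (qp s k B) (hilb e v d.+1 k - v).
Proof.
move=> es hs hr hNB he; have hs0 := perm_regular_neq0 hr.
have h : has_length B N (qp s k B) (hilb e v d.+1 k).
  rewrite -es -[X in has_length _ _ X]add0m.
  apply: (length_qp hB hfg) => //; first exact: sm_zero.
  - by auto.
  - move=> _ ->; alg.
  - by rewrite add0m.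
have hq := sm_qp s k hBB.
have [l1 [l2 [h1 h2 ->]]] := len_split hB hN hBB hq (qp_sub hs hBB) hBN h.
by rewrite (len_uniq h1 hv) addKn.
Qed.

Lemma multiplicity_absorbing s d e : size s = d.+1 -> krull_dim B d.+1 ->
  (forall x, x \in s -> B x) ->
  perm_regular N [set 0] s -> lc N s `<=` B -> has_length B N (lc N s) e ->
  multiplicity B (lc B s) e.
Proof.
move=> es hd hs hr hNB he.
exists d.+1, (e%:R *: binpoly d.+1 d.+1 + v%:R *: binpoly d.+1 d - v%:R%:P).
have h1 := size_binpoly d.+1 d.+1; have h2 := size_binpoly d.+1 d.
split=> //.
- rewrite (leq_trans (size_polyD _ _)) // geq_max size_polyN; apply/andP; split.
    rewrite (leq_trans (size_polyD _ _)) // geq_max; apply/andP; split.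
      exact: leq_trans (size_scale_leq _ _) h1.
    by apply: leq_trans (size_scale_leq _ _) _; exact: leqW.
  exact: leq_trans (size_polyC_leq1 _) _.
- have c1 : (e%:R *: binpoly d.+1 d.+1)`_d.+1 = e%:R / (d.+1)`!%:R.
    by rewrite coefZ coef_binpoly.
  have c2 : (v%:R *: binpoly d.+1 d)`_d.+1 = 0.
    by rewrite coefZ nth_default ?mulr0.
  by rewrite coefB coefD c1 c2 coefC addr0 subr0 divfK // pnatr_eq0 -lt0n
  fact_gt0.
exists 0%N => k _; exists (hilb e v d.+1 k.+1 - v)%N.
  by rewrite idealX_qp; exact: length_absorbing.
have c1 : (e%:R *: binpoly d.+1 d.+1).[k%:R] = e%:R * 'C(k + d.+1, d.+1)%:R.
  by rewrite hornerZ horner_binpoly.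
have c2 : (v%:R *: binpoly d.+1 d).[k%:R] = v%:R * 'C(k + d.+1, d)%:R.
  by rewrite hornerZ horner_binpoly.
rewrite hornerD hornerN hornerD c1 c2 hornerC.
rewrite hilbE natrB; first by rewrite natrD !natrM !addnS.
apply: leq_trans (leq_addl _ _); rewrite leq_pmulr // bin_gt0.
exact: leq_addl.
Qed.

Theorem buchsbaum_intro D s0 : (forall c w, n c -> N w -> B (c * w)) ->
  depth_ge n N D.+1 [set 0] -> size s0 = D.+1 -> (forall x, x \in s0 -> n x) ->
  primary s0 -> buchsbaum_local B.
Proof.
move=> hnN hd es0 hs0 hp0; exists n; split=> //; first exact/noetherianE.
have [d hdim] := krull_dim_exists hB hn hl.
have hdD : (d <= D.+1)%N.
  by have [[c hc] _] := hdim; rewrite -es0; exact: (krull_height hB hn hl hs0 hp0 hc).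
(* By the closed form of [hilb] at exponent one, N/Q has length e + d v; subtracting the length v of
   N/B leaves e + (d - 1) v for B/Q. *)
exists ((v * d)%:Z - v%:Z) => _ [d' [a [hdim' ha -> hp']]].
have {d' hdim' a ha hp'} [s [es hs ->] hp] : exists2 s,
    [/\ size s = d, forall x, x \in s -> n x & span B (range a) = lc B s] & primary s.
  have ed := chain_length_uniq hdim' hdim.
  exists [seq a i | i <- enum 'I_d']; last by move=> c hc; rewrite -(span_rangeE _ hB); exact: hp'.
  split; [by rewrite size_map size_enum_ord| |by exact: span_rangeE].
  by move=> _ /mapP[i _ ->].
have hr := primary_perm_regular hs hp (_ : (size s <= D.+1)%N) hd.
have {}hr : perm_regular N [set 0] s by apply: hr; rewrite es.
have hsB x : x \in s -> B x by alg.
have [e he] := primary_length hs hp.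
have hNB : lc N s `<=` B by apply: (lc_min hBB) => x y /hs; exact: hnN.
case: d es hdim hdD => [|d] es hdim hdD.
  exfalso; have [x [hx hrx _]] := hd; have [k] := hp x hx.
  rewrite (size0nil es) => /eqP; rewrite expf_eq0 => /andP[_ /eqP x0].
  have /= : [set (0 : K)] 1.
    by apply: hrx; [apply: hBN; exact: sr1|rewrite x0 mul0r].
  by move/eqP; rewrite oner_eq0.
exists (hilb e v d.+1 1 - v)%N, e; split.
- by have := length_absorbing 1 es hsB hr hNB he; rewrite (qp_lc _ _ hBB) ?qp0.
- exact: multiplicity_absorbing es hdim hsB hr hNB he.
rewrite hilbE add1n binn muln1 binSn -subzn; last by nia.
by ring.
Qed.

(** The powers of Q on [B] lie in those on [N], which bounds the lengths from below; [length_qp_le]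
    bounds them from above with the same leading term. *)
Lemma multiplicity_eq s d e e' : size s = d.+1 -> krull_dim B d.+1 ->
  (forall x, x \in s -> B x) ->
  perm_regular N [set 0] s -> has_length B N (lc N s) e ->
  multiplicity B (lc B s) e' -> e' = e.
Proof.
move=> es hd hs hr he [d' [p [hd' hsp hpe [k0 hp]]]].
have ed := chain_length_uniq hd' hd; subst d'; have hs0 := perm_regular_neq0 hr.
have h0 : submodule B [set (0 : K)] := sm_zero B.
have hs1 y : y \in s -> B y /\ y != 0 by split; auto.
have h0N : [set 0] `<=` N by move=> _ ->; alg.
have hlNN : lc N s `<=` N by exact: (lc_sub hs hN).
have key k : (k0 <= k)%N -> exists l : nat, [/\ p.[k%:R] + v%:R = l%:R,
    (e * 'C(k + d.+1, d.+1) <= l)%N &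
    (l <= e * 'C(k + d.+1, d.+1) + v * 'C(k + d.+1, d))%N].
  move=> hk; have [l hl1 ->] := hp k hk; exists (v + l)%N; rewrite natrD addrC; split=> //.
  - have hq := sm_qp s k.+1 hBB; have hqB := qp_sub (k := k.+1) hs hBB.
    have h1 : has_length B N (qp s k.+1 B) (v + l).
      by apply: (len_add hB hN hBB hq hv); rewrite -idealX_qp.
    have h2 : has_length B N (qp s k.+1 N) (hilb e 0 d.+1 k.+1).
      rewrite -es -[X in has_length _ _ X]add0m.
      apply: (length_qp hB hfg) => //; first by rewrite add0m.
      exact: len_refl.
    have hqN := sm_qp s k.+1 hN; have hqq := qp_mono (s := s) (k := k.+1) hBN.
    have [l1 [l2 [h3 _ e2]]] := len_split hB hN hqN hq hqq (qp_sub hs hN) h1.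
    rewrite e2 (len_uniq h3 h2) hilbE mul0n addn0 addSn addnS; exact: leq_addr.
  - have he0 : has_length B N (addm [set 0] (lc N s)) e by rewrite add0m.
    have [l' hl' h] := length_qp_le hB hfg k.+1 h0 h0N hs1 hBB hBN he0 hv.
    rewrite add0m in h; have hq := sm_qp s k.+1 hBB.
    have h1 : has_length B N (qp s k.+1 B) (v + l).
      by apply: (len_add hB hN hBB hq hv); rewrite -idealX_qp.
    rewrite (len_uniq h1 h); apply: leq_trans hl' _.
    by rewrite es hilbE addnS.
have := @leading_squeeze p d e v k0 hsp; rewrite hpe => h.
apply/eqP; rewrite -(eqr_nat rat); apply/eqP; apply: h => k /key[l [-> h1 h2]].
  by rewrite ler_nat.
by rewrite ler_nat.
Qed.

(** The generators are peeled off one at a time. The first contributes the length of [N] over [B]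
    plus [lc N s], which is at most [v] and equals [v] only if [lc N s] lies in [B]. *)
Lemma absorbing_tail s : (forall x, x \in s -> B x) -> perm_regular N [set 0] s ->
  exists l, [/\ has_length B (lc N s) (lc B s) l, (l <= size s * v)%N &
    l = (size s * v)%N -> lc N (behead s) `<=` B].
Proof.
elim: s => [|x s IH] hs hr.
  exists 0%N; split=> //; first exact: (len_refl hB (sm_zero B)).
  move=> _ _ ->; alg.
have hsB y : y \in s -> B y by move=> hy; apply: hs; rewrite inE hy orbT.
have [l' [h' hl' _]] := IH hsB (perm_regular_tail hr).
have hx0 := perm_regular_neq0 hr (mem_head _ _).
have hxN := sm_scm x hN; have hxB := sm_scm x hBB.
have hNs := sm_lc s hN; have hBs := sm_lc s hBB.
have hNsN : lc N s `<=` N by exact: (lc_sub hsB hN).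
pose M2 := addm (scm x B) (lc N s); pose M3 := addm (scm x B) (lc B s).
have hM2 : submodule B M2 by exact: sm_addm.
have hM3 : submodule B M3 by exact: sm_addm.
have hBsN := addml (X := B) hNs; have hBl := sm_addm hBB hNs.
have e1 : addm (scm x N) M2 = lc N (x :: s).
  by rewrite addmA (addm_idr hxN hxB) //; exact: scmS.
have e2 : addm (lc N s) M3 = M2.
  by rewrite addmCA (addm_idr hNs hBs) //; exact: lcS.
have e3 : scm x N `&` M2 = scm x (addm B (lc N s)).
  rewrite eqEsubset; split.
    move=> _ [[z hz ->] [_ [y [[b hb ->] hy e]]]]; exists z => //.
    exists b, (z - b); split=> //; last by rewrite addrC subrK.
    have hreg := hr x s [::]; rewrite cats0 add0m in hreg; apply: hreg => //.
      alg.
    by have -> : x * (z - b) = y by rewrite mulrBr e; ring.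
  move=> _ [_ [b [y [hb hy ->]] ->]]; split.
    exists (b + y) => //; alg.
  by exists (x * b), (x * y); split; [exists b|alg|rewrite mulrDr].
have [l1 [l2 [h1 h2 ev]]] := len_split hB hN hBl hBB hBsN (addm_min hN hBN hNsN) hv.
have h3 : has_length B (lc N (x :: s)) M2 l1.
  by rewrite -e1; apply/(len_2iso hB _ hxN hM2); rewrite e3; apply/(len_scm B _ _ _ hx0).
have hi := sm_setI hNs hM3.
have [|l3 [l4 [h4 _ e4]]] := len_split hB hNs hi hBs _ (fun z h => h.1) h'.
  by move=> z hz; split; [exact: (lcS (N := B)) hz|exact: (addmr hxB)].
have h5 : has_length B M2 M3 l3 by rewrite -e2; apply/(len_2iso hB _ hNs hM3).
exists (l1 + l3)%N; split.
- exact: (len_add hB (sm_lc (x :: s) hN) hM2 hM3 h3 h5).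
- rewrite /= mulSn leq_add //; first by rewrite ev leq_addr.
  by apply: leq_trans hl'; rewrite e4 leq_addr.
move=> /= e; have l20 : l2 = 0%N.
  move: e hl' ; rewrite e4 ev mulSn => e h; lia.
rewrite l20 in h2; apply: subset_trans (len_eq0 hB hBl hBB h2).
exact: addmr hBB.
Qed.

(* In a system of parameters all of whose elements but one, [c], are replaced by
   high powers, the Buchsbaum invariant forces [c N] into [B]. *)
Theorem buchsbaum_absorb D s0 : buchsbaum_local B -> depth_ge n N D.+2 [set 0] ->
  size s0 = D.+2 -> (forall x, x \in s0 -> n x) -> primary s0 ->
  forall c w, n c -> N w -> B (c * w).
Proof.
move=> [n' [_ _ hl' [C hC]]] hd es0 hs0 hp0.
have en : n' = n by case: hl => _; apply; case: hl'.
subst n' => c w hc hw.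
have [/eqP ->|c0] := boolP (c == 0); first alg.
have [d hdim] := krull_dim_exists hB hn hl.
have hdD : (d <= D.+2)%N.
  by have [[c' hc'] _] := hdim; rewrite -es0; exact: (krull_height hB hn hl hs0 hp0 hc').
have [s [es hd0 hs hp]] := parameters_through hB hn hl hdim hc c0.
have hcs x : x \in c :: s -> n x by rewrite inE => /orP[/eqP ->|/hs].
(* In dimension one [c] alone would be primary, while N/cN still has a regular element [y]; as a
   power of [y] lies in cB, this gives N = cN and then N = 0. *)
have hd1 : (1 < d)%N.
  rewrite ltn_neqAle hd0 andbT; apply/eqP => ed.
  move: hp; rewrite (size0nil (_ : size s = 0%N)) ?es -?ed // => hp {s es hs hcs}.
  have hr : perm_regular N [set 0] [:: c].
    by apply: primary_perm_regular hd => // x; rewrite inE => /eqP ->.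
  have hrc := perm_regular_head hr.
  have h0 : submodule B [set (0 : K)] := sm_zero B.
  have := depth_exchange hB hn hl hfg h0 hd hc hrc.
  rewrite add0m => -[y [hy hry _]].
  have [k [_ [z [[b hb ->] -> e]]]] := hp y hy.
  have hyN u : N u -> scm c N u.
    move=> hu; apply: (regularX hB hfg (k := k) (hnB hy) hry) => //.
    exists (b * u); first exact: (smZ hN).
    by rewrite e addr0 mulrA.
  suff : N `<=` [set 0] by move/(_ 1 (hBN (sr1 hB)))/eqP; rewrite oner_eq0.
  have [t ht] := hfg; rewrite {1}ht; apply: (lc_min h0) => x b' hx hb' /=.
  rewrite (_ : x = 0) ?mul0r //; move: x hx; apply: (nakayama hB hn hl h0) => x hx.
  rewrite add0m; apply: (scm_lc_sub hl hB hc); rewrite -ht; apply: hyN.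
  alg.
(* The modules [B] plus [x ^+ k * u * B] descend inside the finite length of N/B; where they become
   stationary, Nakayama's argument puts [x ^+ k * u] into [B]. *)
have hpow x : n x -> exists k, forall u, N u -> B (x ^+ k * u).
  move=> hx; have hxB := hnB hx.
  have hpow1 u : N u -> exists k, B (x ^+ k * u).
    move=> hu; pose ch (k : nat) := addm B (scm (x ^+ k * u) B).
    have hxu k : N (x ^+ k * u) by alg.
    have hs1 k := sm_scm (x ^+ k * u) hBB.
    have [k||k hk] := len_dcc hv (c := ch).
    - split; [exact: sm_addm|exact: (addml (hs1 k))|].
      apply: (addm_min hN) => // _ [b hb ->]; alg.
    - move=> k; apply: addmS => // _ [b hb ->]; exists (x * b); first exact: srM.
      by rewrite exprS; ring.
    exists k; apply: (unit_cancel hB hn hl hBB (a := 0)); first exact: sm0 (idealP hnI).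
    have [p [_ [hp' [b hb ->] e]]] : ch k.+1 (x ^+ k * u).
      by apply: hk; apply: (addmr hBB); exact: scm_self.
    rewrite mul0r subr0; apply: (unit_cancel hB hn hl hBB (a := x * b)).
      by rewrite mulrC; exact: (smZ (idealP hnI)).
    by have -> : x ^+ k * u - x * b * (x ^+ k * u) = p by [rewrite {1}e exprS; ring].
  have [t ht] := hfg.
  have [k hk] : exists k, forall u, u \in t -> B (x ^+ k * u).
    have : forall u, u \in t -> N u by alg.
    elim: t {ht} => [|u t IHt] h; first by exists 0%N.
    have [z hz|k hk] := IHt; first by apply: h; rewrite inE hz orbT.
    have [j hj] := hpow1 u (h u (mem_head _ _)).
    exists (k + j)%N => z; rewrite inE => /orP[/eqP ->|/hk hz].
      rewrite exprD -mulrA; alg.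
    rewrite exprD mulrAC mulrC; alg.
  exists k; rewrite ht.
  suff h : lc B t `<=` [set u | B (x ^+ k * u)] by [].
  apply: (@lc_min _ B) => [|z b /hk hz hb /=].
    alg.
  rewrite mulrA; alg.
have /choice[kk hkk] : forall x, exists k, n x -> forall u, N u -> B (x ^+ k * u).
  move=> x; have [/hpow[k hk]|hx] := pselect (n x); first by exists k.
  by exists 0%N => /hx.
pose pw x := x ^+ (kk x).+1.
have hpn x : n x -> n (pw x).
  move=> hx; rewrite /pw exprSr; apply: (smZ (idealP hnI)) => //; alg.
have hpB x u : n x -> N u -> B (pw x * u).
  move=> hx hu; rewrite /pw exprS -mulrA; apply: srM => //; first exact: hnB.
  exact: hkk.
case: d hdim hdD hd0 hd1 es => // d hdim hdD _ hd1 es.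
have value t : size t = d.+1 -> (forall x, x \in t -> n x) -> primary t ->
    exists e l, [/\ perm_regular N [set 0] t, has_length B N (lc N t) e,
      has_length B B (lc B t) l & l%:Z - e%:Z = C].
  move=> et ht hpt; have hr : perm_regular N [set 0] t.
    by apply: primary_perm_regular hd => //; rewrite et.
  have htB x : x \in t -> B x by alg.
  have [e he] := primary_length ht hpt.
  have [|l [e' [h1 h2 h3]]] := hC (lc B t).
    by apply: parameter_idealP => //; rewrite et.
  by exists e, l; rewrite -h3 (multiplicity_eq et hdim htB hr he h2).
(* The constant is computed from a system consisting of powers that all multiply [N] into [B]. *)
have hCE : C = (v * d)%:Z.
  have [|x|x|e [l [hr he h eC]]] := value [seq pw x | x <- c :: s].
  - by rewrite size_map /= es.
  - by case/mapP=> y /hcs hy ->; exact: hpn.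
  - move: x; apply: (primary_trans _ _ hp) => [y /mapP[z /hcs hz ->]|y hy].
      by apply: hnB; exact: hpn.
    split; first exact: hcs.
    by exists (kk y).+1; apply: lc_gen => //; exact: (map_f pw hy).
  have hgB x : x \in [seq pw x | x <- c :: s] -> B x.
    by case/mapP=> y /hcs hy ->; apply: hnB; exact: hpn.
  have hgN : lc N [seq pw x | x <- c :: s] `<=` B.
    by apply: (lc_min hBB) => _ u /mapP[y /hcs hy ->] hu; exact: hpB.
  have eg : size [seq pw x | x <- c :: s] = d.+1 by rewrite size_map /= es.
  have h' := length_absorbing 1 eg hgB hr hgN he.
  rewrite (qp_lc _ _ hBB) qp0 in h'.
  rewrite -eC (len_uniq h h') hilbE add1n binn muln1 binSn -subzn; last by nia.
  by ring.
case: s es hs hp hcs {hCE}(hCE) => [|x s] /= es hs hp hcs hCE; first by rewrite -es in hd1.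
(* The element [c] is kept unchanged, but not in first place, since [absorbing_tail] speaks only of
   the tail of the list. *)
pose b := pw x :: c :: [seq pw x | x <- s].
have hbn y : y \in b -> n y.
  rewrite !inE => /or3P[/eqP -> |/eqP -> //|/mapP[z hz ->]]; apply: hpn; apply: hcs.
    alg.
  by rewrite !inE hz !orbT.
have hbB y : y \in b -> B y by alg.
have eb : size b = d.+1 by rewrite /= size_map -es.
have hpb : primary b.
  apply: (@primary_trans (c :: x :: s) b hbB _ hp) => y hy; split; first exact: hcs.
  move: hy; rewrite !inE => /or3P[/eqP ->|/eqP ->|hy].
  - by exists 1%N; apply: lc_gen => //; rewrite !inE eqxx orbT.
  - by exists (kk x).+1; apply: lc_gen => //; rewrite mem_head.
  - by exists (kk y).+1; apply: lc_gen => //; rewrite !inE (map_f pw hy) !orbT.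
have [e [l [hr he h eC]]] := value b eb hbn hpb.
have [l2 [h2 _ htail]] := absorbing_tail hbB hr.
have hbl := sm_lc b hBB; have hbN := sm_lc b hN.
have el : (v + l = e + l2)%N.
  exact: len_uniq (len_add hB hN hBB hbl hv h) (len_add hB hN hbN hbl he h2).
have hl2 : l2 = (size b * v)%N.
  rewrite eb; move: eC el; rewrite hCE => e1 e2; apply/eqP; rewrite -eqz_nat.
  have {}e2 : v%:Z + l%:Z = e%:Z + l2%:Z by rewrite -!PoszD e2.
  have -> : l2%:Z = v%:Z + (l%:Z - e%:Z) by rewrite addrA e2; ring.
  by rewrite e1; apply/eqP; ring.
by apply: (htail hl2); apply: (lc_mem hN) => //; rewrite mem_head.
Qed.

End Buchsbaum.

(** * Polynomial rings over a subring *)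

Section Transport.
Variables (T T' : comNzRingType) (f : {rmorphism T -> T'}).
Implicit Types (B N : set T).

Lemma sr_image B : subring B -> subring (f @` B).
Proof.
move=> hB; split.
- by exists 1; [alg|rewrite rmorph1].
- by move=> _ _ [x hx <-] [y hy <-]; exists (x - y); [alg|rewrite rmorphB].
- by move=> _ _ [x hx <-] [y hy <-]; exists (x * y); [alg|rewrite rmorphM].
Qed.

Lemma sm_image B N : submodule B N -> submodule (f @` B) (f @` N).
Proof.
move=> hN; split.
- by exists 0; [alg|rewrite rmorph0].
- by move=> _ _ [x hx <-] [y hy <-]; exists (x + y); [alg|rewrite rmorphD].
- by move=> _ _ [x hx <-] [y hy <-]; exists (x * y); [alg|rewrite rmorphM].
Qed.

Lemma lc_image N s : f @` (lc N s) = lc (f @` N) [seq f x | x <- s].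
Proof.
elim: s => [|x s IH] /=.
  rewrite eqEsubset; split=> [_ [y -> <-]|_ ->] /=; first exact: rmorph0.
  by exists 0; rewrite ?rmorph0.
rewrite -IH eqEsubset; split.
  move=> _ [_ [_ [z [[y hy ->] hz ->]]] <-]; rewrite rmorphD rmorphM.
  by exists (f x * f y), (f z); split; [exists (f y) => //; exists y|exists z|].
move=> _ [_ [_ [[_ [y hy <-] ->] [z hz <-] ->]]].
exists (x * y + z); last by rewrite rmorphD rmorphM.
by exists (x * y), z; split=> //; exists y.
Qed.

Lemma sm_preimage B X : subring B -> submodule (f @` B) X ->
  submodule B [set x | B x /\ X (f x)].
Proof.
move=> hB hX; split.
- by split; [alg|rewrite rmorph0; exact: sm0 hX].
- move=> x y [hx hx'] [hy hy']; split; first exact: srD.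
  rewrite rmorphD; alg.
- move=> a x ha [hx hx']; split; first exact: srM.
  rewrite rmorphM; alg.
Qed.

Lemma noeth_image B : subring B -> noethm B B -> noethm (f @` B) (f @` B).
Proof.
move=> hB hn X hX hXB.
have [|s hs] := hn _ (sm_preimage hB hX); first alg.
exists [seq f x | x <- s]; rewrite -lc_image -hs eqEsubset; split.
  by move=> y hy; have [x hx e] := hXB y hy; exists x => //; split=> //; rewrite e.
by move=> _ [x [_ hx] <-].
Qed.

End Transport.

Section Coefs.
Variables (R : comNzRingType) (B : set R).
Hypothesis hB : subring B.
Implicit Types (p q : {poly R}).

Definition coefs_in : set {poly R} := [set p | forall i, B p`_i].

Lemma sr_coefs : subring coefs_in.
Proof.
split=> [i|p q hp hq i|p q hp hq i] /=.
- rewrite coef1; alg.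
- rewrite coefB; alg.
- rewrite coefM; alg.
Qed.

Lemma coefs_C c : B c -> coefs_in c%:P.
Proof. move=> hc i; rewrite coefC; case: eqP => // _; alg. Qed.
Lemma coefs_X : coefs_in 'X.
Proof. move=> i; rewrite coefX; alg. Qed.

(* The part of low degree is finitely generated over the constants; the ideals of
   leading coefficients are all contained in the one of some degree [D]. *)
Lemma hilbert_basis : noethm B B -> noethm coefs_in coefs_in.
Proof.
move=> hn I hI hIB; have hC := sr_coefs.
pose C0 := (polyC @` B : set {poly R}).
have hC0 : subring C0 := sr_image polyC hB.
have hC0n : noethm C0 C0 := @noeth_image _ _ polyC B hB hn.
have hC0C : C0 `<=` coefs_in by move=> _ [c hc <-]; exact: coefs_C.
pose L d := [set c | exists p, [/\ I p, (size p <= d.+1)%N & p`_d = c]].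
have hL d : submodule B (L d).
  split.
  - exists 0; rewrite size_poly0 coef0; split=> //; alg.
  - move=> _ _ [p [hp hs <-]] [q [hq hs' <-]]; exists (p + q).
    by split; [alg|rewrite (leq_trans (size_polyD _ _)) // geq_max hs|rewrite coefD].
  - move=> a _ ha [p [hp hs <-]]; exists (a%:P * p).
    split; [by apply: (smZ hI) => //; exact: coefs_C| |by rewrite coefCM].
    by rewrite mul_polyC; exact: leq_trans (size_scale_leq _ _) hs.
have hLB d : L d `<=` B by move=> _ [p [hp _ <-]]; exact: hIB.
have hLS d : L d `<=` L d.+1.
  move=> _ [p [hp hs <-]]; exists (p * 'X); split.
  - by rewrite mulrC; apply: (smZ hI) => //; exact: coefs_X.
  - apply: leq_trans (size_polyMleq _ _) _; rewrite size_polyX addn2 /=.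
    alg.
  - by rewrite coefMX.
have hLle d e : (d <= e)%N -> L d `<=` L e.
  move=> /subnK <-; elim: (e - d)%N => [|k IH] //.
  by apply: subset_trans (hLS _).
have [D hD] : exists D, forall d, L d `<=` L D.
  have [||s hs] := hn (\bigcup_d L d); first exact: sm_chain hL hLS.
    by move=> x [d _]; exact: hLB.
  have [D hD] : exists D, forall x, x \in s -> L D x.
    have : forall x, x \in s -> exists d, L d x.
      by move=> x hx; have : (\bigcup_d L d) x by [rewrite hs; exact: lc_gen]; case=> d; exists d.
    elim: s {hs} => [|x s IH] h; first by exists 0%N.
    have [y hy|D hD] := IH; first by apply: h; rewrite inE hy orbT.
    have [d hd] := h x (mem_head _ _); exists (maxn d D) => y.
    rewrite inE => /orP[/eqP ->|/hD].
      exact: hLle (leq_maxl _ _) _ hd.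
    exact: hLle (leq_maxr _ _) _.
  exists D => d x hx; have : (\bigcup_d L d) x by exists d.
  rewrite hs; apply: (lc_min (hL D)) => y z /hD hy hz; rewrite mulrC.
  exact: (smZ (hL D)).
pose mon := [seq 'X^i | i <- iota 0 D.+1] : seq {poly R}.
have hlow : noethm C0 (lc C0 mon) by exact: noethm_lc.
have [||s hs] := hlow (I `&` [set p | (size p <= D.+1)%N]).
- split.
  + by split; [alg|rewrite /= size_poly0].
  + move=> p q [hp hsp] [hq hsq]; split; first exact: (smD hI).
    by rewrite /= (leq_trans (size_polyD _ _)) // geq_max hsp.
  + move=> _ p [a ha <-] [hp hsp]; split.
      by apply: (smZ hI) => //; exact: coefs_C.
    by rewrite mul_polyC; exact: leq_trans (size_scale_leq _ _) hsp.
- move=> p [hp hsp]; have hC00 := sm_self hC0.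
  have -> : p = \sum_(i < D.+1) 'X^i * (p`_i)%:P.
    apply/polyP => j; rewrite coef_sum; have [hj|hj] := ltnP j D.+1.
      rewrite (bigD1 (Ordinal hj)) //= mulrC coefCM coefXn eqxx mulr1 big1 ?addr0 // => i hi.
      rewrite mulrC coefCM coefXn; case: eqP; last by rewrite mulr0.
      by move=> e; case/eqP: hi; apply: val_inj.
    rewrite nth_default ?(leq_trans hsp) // big1 // => i _.
    rewrite mulrC coefCM coefXn gtn_eqF ?mulr0 //; exact: leq_trans (ltn_ord i) hj.
  apply: (sm_sum (sm_lc mon hC00)) => i _; apply: (lc_mem hC00).
    by apply/mapP; exists (val i); rewrite // mem_iota ltn_ord.
  by exists p`_i => //; exact: hIB.
exists s; rewrite eqEsubset; split; last first.
  apply: (lc_min hI) => p q hp hq; rewrite mulrC; apply: (smZ hI) => //.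
  by have [] : (I `&` [set p | (size p <= D.+1)%N]) p by rewrite hs; exact: lc_gen.
have hlow2 p : I p -> (size p <= D.+1)%N -> lc coefs_in s p.
  by move=> hp hsp; apply: (lcS hC0C); rewrite -hs.
move=> p; have [k] := ubnP (size p); elim: k p => // k IH p hk hp.
have [/hlow2|hD1] := leqP (size p) D.+1; first exact.
have hsl := sm_lc s (sm_self hC).
have ep : size p = (size p).-1.+1 by rewrite prednK //; exact: leq_ltn_trans hD1.
have [|q [hq hsq eq]] := hD (size p).-1 (lead_coef p).
  by exists p; rewrite -ep.
pose q' := q * 'X^((size p).-1 - D).
have hDp : (D <= (size p).-1)%N by rewrite -ltnS -ep; exact: ltnW.
have hsq' : (size q' <= size p)%N.
  apply: leq_trans (size_polyMleq _ _) _; rewrite size_polyXn addnS /=.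
  rewrite ep; apply: leq_trans (leq_add hsq (leqnn _)) _.
  by rewrite addSn subnKC.
have hXC : coefs_in 'X^((size p).-1 - D) by exact: (srX _ hC coefs_X).
have -> : p = (p - q') + q' by rewrite subrK.
apply: (smD hsl).
  apply: IH; last first.
    apply: (smB hC hI) => //; rewrite /q' mulrC; alg.
  rewrite ltnS in hk; apply: leq_trans hk; rewrite ep ltnS; apply/leq_sizeP => j hj.
  rewrite coefB; have [->|hne] := eqVneq j (size p).-1.
    by rewrite coefMXn ltnNge leq_subr subKn // eq subrr.
  have hlt : (size p <= j)%N by rewrite ep ltn_neqAle eq_sym hne.
  by rewrite !nth_default ?subrr // (leq_trans hsq').
by rewrite /q' mulrC; apply: (smZ hsl) => //; exact: hlow2.
Qed.

Definition adj (x : R) : set R := [set y | exists2 p, coefs_in p & y = p.[x]].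

Lemma adjE x : adj x = horner_eval x @` coefs_in.
Proof.
rewrite eqEsubset; split=> [_ [p hp ->]|_ [p hp <-]]; exists p => //.
Qed.

Lemma sr_adj x : subring (adj x).
Proof. by rewrite adjE; exact: sr_image sr_coefs. Qed.

Lemma noeth_adj x : noethm B B -> noethm (adj x) (adj x).
Proof. by move=> hn; rewrite adjE; apply: noeth_image sr_coefs (hilbert_basis hn). Qed.

Lemma sub_adj x : B `<=` adj x.
Proof. by move=> c hc; exists c%:P; [exact: coefs_C|rewrite hornerC]. Qed.

Lemma adj_gen x : adj x x.
Proof. by exists 'X; [exact: coefs_X|rewrite hornerX]. Qed.

Lemma adj_min x C : subring C -> B `<=` C -> C x -> adj x `<=` C.
Proof.
move=> hC hBC hx _ [p hp ->]; rewrite horner_coef; alg.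
Qed.

End Coefs.

(** * Integrality *)

#[global] Arguments lc : simpl never.

Section Integral.
Variable K : fieldType.
Implicit Types (B C L X Y S : set K) (s t : seq K).

Lemma det_in (R : comNzRingType) (C : set R) m (M : 'M[R]_m) : subring C ->
  (forall i j, C (M i j)) -> C (\det M).
Proof.
move=> hC h; apply: sr_sum => // s _; apply: srM => //; alg.
Qed.

(** Multiplication by [x] is given on [s] by a matrix over [B] with eigenvalue [x], so [x] is a root
    of its characteristic polynomial. *)
Lemma int_lc B s x : subring B -> (exists2 y, y \in s & y != 0) ->
  (forall y, y \in s -> lc B s (x * y)) -> integral_over B x.
Proof.
move=> hB [y0 hy0 y00] h; have hBB := sm_self hB.
have /choice[c hc] : forall i : 'I_(size s), exists c : nat -> K,
    (forall j, B (c j)) /\ x * s`_i = \sum_(j < size s) c j * s`_j.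
  by move=> i; apply/(lc_sumE _ _ hBB); apply: h; exact: mem_nth.
pose M := \matrix_(j < size s, i < size s) c i j.
have hev : eigenvalue M x.
  apply/eigenvalueP; exists (\row_i s`_i).
    apply/rowP => i; rewrite !mxE (hc i).2; apply: eq_bigr => j _.
    by rewrite !mxE mulrC.
  apply/eqP => e; case/eqP: y00.
  have hi : (index y0 s < size s)%N by rewrite index_mem.
  by have := congr1 (fun v : 'rV_(size s) => v 0 (Ordinal hi)) e; rewrite !mxE
  nth_index.
exists (char_poly M); split; [exact: char_poly_monic| |by rewrite -eigenvalue_root_char].
suff : coefs_in B (char_poly M) by [].
apply: det_in; first exact: sr_coefs.
move=> i j; rewrite !mxE; refine (srB (sr_coefs hB) _ _).
  case: (i == j); rewrite ?mulr1n ?mulr0n; first exact: coefs_X.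
  exact: sr0 (sr_coefs hB).
by apply: (coefs_C hB); exact: (hc j).1.
Qed.

(** Multipliers of one fixed finite module are visibly closed under differences and products; sums
    and products of integral elements are treated through them. *)
Definition stable B s x := forall y, lc B s y -> lc B s (x * y).

Lemma stableP B s x : subring B -> (forall y, y \in s -> lc B s (x * y)) -> stable B s x.
Proof.
move=> hB h; have hs := sm_lc s (sm_self hB).
suff : lc B s `<=` [set y | lc B s (x * y)] by [].
apply: (@lc_min _ B) => [|y b /h hy hb /=].
  alg.
rewrite mulrA mulrC; alg.
Qed.

Lemma stable_sub B s x y : subring B -> stable B s x -> stable B s y -> stable B s (x - y).
Proof.
move=> hB hx hy z hz; rewrite mulrBl.
by apply: (smB hB (sm_lc s (sm_self hB))); [exact: hx|exact: hy].
Qed.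

Lemma stable_mul B s x y : stable B s x -> stable B s y -> stable B s (x * y).
Proof. by move=> hx hy z hz; rewrite -mulrA; apply: hx; exact: hy. Qed.

Lemma stable_base B s b : subring B -> B b -> stable B s b.
Proof. by move=> hB hb y hy; exact: (smZ (sm_lc s (sm_self hB))). Qed.

Lemma stable_int B s x : subring B -> 1 \in s -> stable B s x -> integral_over B x.
Proof.
move=> hB h1 h; apply: (int_lc hB (s := s)); first by exists 1; rewrite ?oner_neq0.
move=> y hy; apply: h; alg.
Qed.

Lemma int_pow (R : comNzRingType) (C : set R) x : subring C -> integral_over C x ->
  exists2 m, (0 < m)%N & exists c : nat -> R, (forall i, C (c i)) /\
    x ^+ m = \sum_(i < m) c i * x ^+ i.
Proof.
move=> hC [p [hm hp /eqP hr]].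
have ep : size p = (size p).-1.+1.
  by rewrite prednK // lt0n size_poly_eq0; exact: monic_neq0.
move: hr; rewrite horner_coef ep big_ord_recr /= -[p`_(size p).-1]/(lead_coef p).
rewrite (monicP hm) mul1r => h.
exists (size p).-1; last first.
  exists (fun i => - p`_i); split; first alg.
  apply/eqP; rewrite -subr_eq0; apply/eqP; rewrite -[RHS]h addrC; congr (_ + _).
  by rewrite -sumrN; apply: eq_bigr => i _; rewrite mulNr opprK.
rewrite lt0n; apply/eqP => e0; move: h; rewrite e0 big_ord0 expr0 add0r.
by move/eqP; rewrite oner_eq0.
Qed.

Lemma int_stable B x : subring B -> integral_over B x ->
  exists2 s, 1 \in s & stable B s x.
Proof.
move=> hB hx; have [m m0 [c [hc e]]] := int_pow hB hx.
have hBB := sm_self hB.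
pose s := [seq x ^+ i | i <- iota 0 m].
have hs i : (i < m)%N -> x ^+ i \in s by move=> hi; apply: map_f; rewrite mem_iota.
exists s; first by rewrite -(expr0 x); exact: hs.
apply: stableP => // _ /mapP[i hi ->]; rewrite -exprS.
move: hi; rewrite mem_iota /= add0n leq_eqVlt => /orP[/eqP ->|hi].
  rewrite e; apply: (sm_sum (sm_lc s hBB)) => j _; rewrite mulrC.
  by apply: (lc_mem hBB) => //; exact: hs.
by apply: lc_gen => //; exact: hs.
Qed.

Lemma stable_allpairs B s t x : subring B -> stable B s x ->
  stable B [seq a * b | a <- t, b <- s] x.
Proof.
move=> hB h; have hBB := sm_self hB; have hs := sm_lc s hBB.
rewrite /stable -(lc_lc s t hBB) => y hy.
apply: (lc_min_scale (sm_lc t hs) hy) => a b ha hb; by rewrite mulrCA; apply: (lc_mem hs) => //; exact: h.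
Qed.

Lemma allpairs_perm_stable B s t x : subring B -> stable B s x ->
  stable B [seq a * b | a <- s, b <- t] x.
Proof.
move=> hB h; have hBB := sm_self hB.
have e : lc B [seq a * b | a <- s, b <- t] = lc B [seq a * b | a <- t, b <- s].
  apply: (lc_perm hBB) => z; apply/allpairsP/allpairsP => -[[u w] /= [hu hw ->]];
    by exists (w, u); rewrite mulrC.
by rewrite /stable e; exact: stable_allpairs.
Qed.

Lemma int_stable_list B (l : seq K) : subring B -> (forall x, x \in l -> integral_over B x) ->
  exists2 s, 1 \in s & forall x, x \in l -> stable B s x.
Proof.
move=> hB; elim: l => [|x l IH] h; first by exists [:: 1]; alg.
have [y hy|s h1 hs] := IH; first by apply: h; rewrite inE hy orbT.
have [t ht1 ht] := int_stable hB (h x (mem_head _ _)).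
exists [seq a * b | a <- s, b <- t].
  by apply/allpairsP; exists (1, 1); rewrite mulr1.
move=> y; rewrite inE => /orP[/eqP ->|/hs hy]; first exact: stable_allpairs.
exact: allpairs_perm_stable.
Qed.

Lemma int_base B x : subring B -> B x -> integral_over B x.
Proof.
move=> hB hx; apply: (stable_int hB (s := [:: 1])); first alg.
exact: stable_base.
Qed.

Lemma int_sub B x y : subring B -> integral_over B x -> integral_over B y ->
  integral_over B (x - y).
Proof.
move=> hB hx hy; have [z|s h1 hs] := @int_stable_list B [:: x; y] hB.
  by rewrite !inE => /orP[/eqP ->|/eqP ->].
apply: (stable_int hB h1); apply: stable_sub => //; apply: hs; rewrite !inE eqxx ?orbT //.
Qed.

Lemma int_mul B x y : subring B -> integral_over B x -> integral_over B y ->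
  integral_over B (x * y).
Proof.
move=> hB hx hy; have [z|s h1 hs] := @int_stable_list B [:: x; y] hB.
  by rewrite !inE => /orP[/eqP ->|/eqP ->].
apply: (stable_int hB h1); apply: stable_mul => //; apply: hs; rewrite !inE eqxx ?orbT //.
Qed.

Definition iclosure B : set K := [set x | integral_over B x].

Lemma sr_iclosure B : subring B -> subring (iclosure B).
Proof.
move=> hB; split.
- apply: int_base => //; alg.
- by move=> x y; exact: int_sub.
- by move=> x y; exact: int_mul.
Qed.

Lemma int_mono (R : comNzRingType) (C C' : set R) x :
  C `<=` C' -> integral_over C x -> integral_over C' x.
Proof. move=> h [p [hm hp hr]]; exists p; alg. Qed.

Lemma int_trans B C x : subring B -> subring C -> (forall c, C c -> integral_over B c) ->
  integral_over C x -> integral_over B x.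
Proof.
move=> hB hC h hx; have hBB := sm_self hB.
have [m m0 [c [hc e]]] := int_pow hC hx.
have [z|s h1 hs] := @int_stable_list B [seq c i | i <- iota 0 m] hB.
  by case/mapP=> i _ ->; exact: h.
have hcs i : (i < m)%N -> stable B s (c i).
  by move=> hi; apply: hs; apply: map_f; rewrite mem_iota.
pose t := [seq x ^+ i | i <- iota 0 m].
have ht i : (i < m)%N -> x ^+ i \in t by move=> hi; apply: map_f; rewrite mem_iota.
have hls := sm_lc s hBB; have hlt := sm_lc t hls.
have h1t : 1 \in t by rewrite -(expr0 x); exact: ht.
apply: (int_lc hB (s := [seq a * b | a <- t, b <- s])).
  by exists 1; rewrite ?oner_neq0 //; apply/allpairsP; exists (1, 1); rewrite mulr1.
move=> _ /allpairsP[[u w] /= [/mapP[i hi ->] hw ->]]; rewrite -(lc_lc _ _ hBB) mulrA -exprS.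
have hwl : lc B s w by alg.
move: hi; rewrite mem_iota /= add0n leq_eqVlt => /orP[/eqP ->|hi].
  rewrite e mulr_suml; apply: (sm_sum hlt) => j _; rewrite mulrAC mulrC.
  by apply: (lc_mem hls); [exact: ht|apply: hcs].
by apply: (lc_mem hls) => //; exact: ht.
Qed.

(** With [a] a common denominator of an equation of degree m, the element [a * x] satisfies the
    equation in which the coefficient of degree i is multiplied by a^(m - i). *)
Lemma int_loc B S x : subring B -> mset B S -> integral_over (loc B S) x ->
  exists2 a, S a & integral_over B (a * x).
Proof.
move=> hB hS [p [hm hp hr]]; have [hSB hS1 hSM _] := hS.
have [a ha hap] : exists2 a, S a & forall i, B (a * p`_i).
  suff [a ha hap] : exists2 a, S a & forall i, (i < size p)%N -> B (a * p`_i).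
    exists a => // i; have [/hap //|hi] := ltnP i (size p).
    rewrite nth_default // mulr0; alg.
  elim: (size p) => [|k [a ha hap]]; first by exists 1.
  have [b [t [hb ht e]]] := hp k; have t0 := mset_neq0 hS ht.
  exists (t * a); first exact: hSM.
  move=> i; rewrite ltnS leq_eqVlt => /orP[/eqP ->|/hap hi].
    have -> : t * a * p`_k = a * b by rewrite e; field.
    alg.
  rewrite -mulrA; alg.
exists a => //.
have ep : size p = (size p).-1.+1.
  by rewrite prednK // lt0n size_poly_eq0; exact: monic_neq0.
set m := (size p).-1 in ep.
have hlc : p`_m = 1 by rewrite -(monicP hm).
pose q := \poly_(i < m.+1) (p`_i * a ^+ (m - i)).
have hq i : q`_i = if (i < m.+1)%N then p`_i * a ^+ (m - i) else 0 by rewrite coef_poly.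
exists q; split.
- have hsq : size q = m.+1.
    by apply: size_poly_eq; rewrite hlc subnn mulr1 oner_neq0.
  by apply/monicP; rewrite lead_coefE hsq hq ltnSn subnn mulr1.
- move=> i; rewrite hq; case: ifP => hi; last exact: sr0.
  move: hi; rewrite ltnS leq_eqVlt => /orP[/eqP ->|hi].
    rewrite hlc subnn expr0 mulr1; alg.
  rewrite -(subnSK hi) exprS mulrA [p`_i * a]mulrC; alg.
- apply/rootP; have /rootP e := hr.
  rewrite (@horner_coef_wide _ m.+1) ?size_poly //.
  suff -> : \sum_(i < m.+1) q`_i * (a * x) ^+ i = a ^+ m * p.[x] by rewrite e mulr0.
  rewrite horner_coef ep mulr_sumr; apply: eq_bigr => i _.
  rewrite hq ltn_ord exprMn.
  have -> : a ^+ m = a ^+ (m - i) * a ^+ i by rewrite -exprD subnK // -ltnS.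
  by ring.
Qed.

Definition icl L C := forall x, L x -> integral_over C x -> C x.

Lemma icl_loc L C S : subring L -> C `<=` L -> subring C -> mset C S ->
  icl L C -> icl L (loc C S).
Proof.
move=> hL hCL hC hS h x hx /(int_loc hC hS)[a ha hax]; have [hSC _ _ _] := hS.
exists (a * x), a; split=> //.
  apply: h => //; apply: srM => //; apply: hCL; alg.
by rewrite mulrAC mulfV ?mul1r // (mset_neq0 hS).
Qed.

Definition powers y J : seq K := [seq y ^+ j | j <- iota 0 J.+1].

Lemma powers_mul B y i J J' z : subring B -> (i + J <= J')%N ->
  lc B (powers y J) z -> lc B (powers y J') (y ^+ i * z).
Proof.
move=> hB hJ; have hBB := sm_self hB => hz.
apply: (lc_min_scale (sm_lc _ hBB) hz) => _ b /mapP[j hj ->] hb.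
rewrite mulrA -exprD; apply: (lc_mem hBB) => //; apply: map_f.
by move: hj; rewrite !mem_iota; lia.
Qed.

Lemma powers_mulp B y J J' J'' w z : subring B -> (J + J' <= J'')%N ->
  lc B (powers y J) w -> lc B (powers y J') z -> lc B (powers y J'') (w * z).
Proof.
move=> hB hJ hw hz; have hBB := sm_self hB; have hl := sm_lc (powers y J'') hBB.
rewrite mulrC; apply: (lc_min_scale hl hw) => _ b /mapP[j hj ->] hb.
rewrite mulrA mulrC; apply: (smZ hl) => //; rewrite mulrC.
by apply: powers_mul hz => //; move: hj; rewrite mem_iota; lia.
Qed.

(* In an integral equation over [B[y]] the degree in [y] of the expression of
   [x^(m+t)] by lower powers of [x] grows linearly in [t]. *)
Lemma adj_int_pow B x y : subring B -> integral_over (adj B y) x ->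
  exists m N : nat, forall t : nat, lc (lc B (powers y (N * t.+1))) [seq x ^+ i | i <- iota 0 m.+1]
    (x ^+ (m.+1 + t)).
Proof.
move=> hB hx; have hBB := sm_self hB.
have [[|m] // _ [c [hc e]]] := int_pow (sr_adj hB y) hx; exists m.
have [N hN] : exists N, forall i, (i < m.+1)%N -> lc B (powers y N) (c i).
  elim: (m.+1) => [|k [N hN]]; first by exists 0%N.
  have [p hp ep] := hc k; exists (maxn N (size p)) => i.
  rewrite ltnS leq_eqVlt => /orP[/eqP ->|/hN hi].
    rewrite ep horner_coef; apply: (sm_sum (sm_lc _ hBB)) => j _; rewrite mulrC.
    apply: (lc_mem hBB) => //; apply: map_f; rewrite mem_iota /= add0n.
    by apply: leq_trans (ltn_ord j) _; exact: leqW (leq_maxr _ _).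
  rewrite -[c i]mul1r -(expr0 y); apply: powers_mul hi => //; exact: leq_maxl.
exists N => t; pose M J := lc (lc B (powers y J)) [seq x ^+ i | i <- iota 0 m.+1].
have hsm J : submodule B (lc B (powers y J)) by alg.
have hM J : submodule B (M J) by exact: sm_lc.
have hxi i : (i <= m)%N -> x ^+ i \in [seq x ^+ i | i <- iota 0 m.+1].
  by move=> hi; apply: map_f; rewrite mem_iota.
have hmul J J' w z : (J + N <= J')%N -> lc B (powers y J) w -> M N z -> M J' (w * z).
  move=> hJ hw hz; apply: (lc_min_scale (hM J') hz) => u b hu hb.
  by rewrite mulrCA; apply: (lc_mem (hsm _)) => //; exact: powers_mulp hw hb.
have hbase : M N (x ^+ m.+1).
  rewrite e; apply: (sm_sum (hM N)) => i _; rewrite mulrC.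
  apply: (lc_mem (hsm _)); [by apply: hxi; rewrite -ltnS|exact: hN].
elim: t => [|t IH]; first by rewrite addn0 muln1.
rewrite addnS exprS.
apply: (lc_min_scale (hM _) IH) => _ b /mapP[i hi ->] hb.
rewrite mulrA -exprS; move: hi; rewrite mem_iota /= add0n ltnS leq_eqVlt => /orP[/eqP ->|hi].
  rewrite mulrC; apply: (hmul (N * t.+1)%N) hbase => //.
  by rewrite [X in (_ <= X)%N]mulnS addnC.
apply: (lc_mem (hsm _)); first exact: hxi.
rewrite -[b]mul1r -(expr0 y); apply: powers_mul hb => //.
by lia.
Qed.

(** The products of bounded powers of [x] and [y] span a module stable under [x]: a top power of [x]
    is reduced by the equation over B[y] when the exponent of [y] is small and by the one over
    B[1/y] when it is large. *)
Lemma int_glue B x y : subring B -> y != 0 -> integral_over (adj B y) x ->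
  integral_over (adj B y^-1) x -> integral_over B x.
Proof.
move=> hB y0 h1 h2; have hBB := sm_self hB.
have [m1 [N1 hm1]] := adj_int_pow hB h1; have [m2 [N2 hm2]] := adj_int_pow hB h2.
(* [J2] bounds the negative powers of [y] coming from the second equation, which exponents above
   [J2] absorb; below, the first equation raises the exponent by at most [J - J2]. *)
pose m := (m1.+1 + m2.+1)%N; pose J2 := (N2 * m1.+2)%N; pose J := (N1 * m2.+2 + J2)%N.
pose t := [seq x ^+ i | i <- iota 0 m].
have hsm : submodule B (lc B (powers y J)) by alg.
have hxt i : (i < m)%N -> x ^+ i \in t by move=> hi; apply: map_f; rewrite mem_iota.
have hlt := sm_lc t hsm.
apply: (int_lc hB (s := [seq a * b | a <- t, b <- powers y J])).
  exists 1; rewrite ?oner_neq0 //; apply/allpairsP; exists (1, 1); rewrite mulr1; split=> //.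
    by rewrite -(expr0 x); apply: hxt.
  by rewrite /= -(expr0 y); apply: map_f.
suff hstep i j : i \in iota 0 m -> j \in iota 0 J.+1 ->
    lc B [seq a * b | a <- t, b <- powers y J] (x * (x ^+ i * y ^+ j)).
  move=> _ /allpairsP[[u w] [/mapP[i hi eu] /mapP[j hj ew] ->]].
  by rewrite eu ew; exact: hstep.
move=> hi hj.
rewrite -(lc_lc _ _ hBB) mulrA -exprS; move: hi hj; rewrite !mem_iota /= !add0n ltnS => hi hj.
move: hi; rewrite leq_eqVlt => /orP[/eqP ei|hi]; last first.
  apply: (lc_mem hsm); first exact: hxt.
  by apply: lc_gen => //; apply: map_f; rewrite mem_iota.
rewrite ei mulrC.
have [hjJ|hjJ] := leqP j J2.
  apply: (lc_min_scale hlt (hm1 m2.+1)) => _ b /mapP[k hk ->] hb.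
  rewrite mulrCA; apply: (lc_mem hsm).
    by apply: hxt; move: hk; rewrite mem_iota; lia.
  by apply: powers_mul hb => //; lia.
have := hm2 m1.+1; rewrite [(m2.+1 + _)%N]addnC => hm2'.
apply: (lc_min_scale hlt hm2') => _ b /mapP[k hk ->] hb.
rewrite mulrCA; apply: (lc_mem hsm).
  by apply: hxt; move: hk; rewrite mem_iota; lia.
apply: (lc_min_scale hsm hb) => _ c /mapP[l hl ->] hc.
have hlj : (l <= j)%N by move: hl; rewrite mem_iota; lia.
rewrite mulrA -[in y ^+ j](subnK hlj) exprD exprVn -mulrA mulrA mulfK ?expf_neq0 //.
apply: (lc_mem hBB) => //; apply: map_f; rewrite mem_iota /= add0n ltnS.
by apply: leq_trans (leq_subr _ _) _.
Qed.

End Integral.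

(** * Forms with coefficients in a module *)

Section Forms.
Variables (K : fieldType) (C : set K) (m : nat).
Hypothesis hC : subring C.
Local Notation P := {mpoly K[m]}.
Implicit Types (X : set K) (p q : P) (J : pred 'I_m).

Definition PX X n : set P :=
  [set p | forall a, X p@_a /\ (mdeg a != n -> p@_a = 0)].

(** Forms of degree one less than [n], with only zero in degree minus one; these are the cofactors
    of a variable in forms of degree [n]. *)
Definition PXp X n : set P := if n is n'.+1 then PX X n' else [set 0].

Lemma mnm_split (a : 'X_{1..m}) k : (0 < a k)%N -> a = (U_(k) + (a - U_(k)))%MM.
Proof.
move=> h; apply/mnmP => i; rewrite mnmDE mnmBE mnm1E.
by case: eqP => [<-|_] /=; rewrite ?subn0 ?subnKC.
Qed.
Lemma mcoeffXmul k p a : ('X_k * p)@_a = if (0 < a k)%N then p@_(a - U_(k)) else 0.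
Proof.
rewrite mulrC; case: ifP => h.
  by rewrite {1}(mnm_split h) mcoeffMX.
rewrite [p]mpolyE mulr_suml (raddf_sum (mcoeff a)) big1 // => b _ /=.
rewrite -mul_mpolyC -mulrA -mpolyXD mcoeffCM mcoeffX; case: eqP; last by rewrite mulr0.
by move=> e; move: h; rewrite -e mnmDE mnm1E eqxx addn1.
Qed.

Lemma PX0 X n : X 0 -> PX X n 0.
Proof. by move=> h a; rewrite mcoeff0. Qed.
Lemma PXD X n p q : submodule C X -> PX X n p -> PX X n q -> PX X n (p + q).
Proof.
move=> hX hp hq a; rewrite mcoeffD; have [h1 h2] := hp a; have [h3 h4] := hq a.
by split; [alg|move=> h; rewrite h2 // h4 // addr0].
Qed.
Lemma PXZ X n c p : submodule C X -> C c -> PX X n p -> PX X n (c *: p).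
Proof.
move=> hX hc hp a; rewrite mcoeffZ; have [h1 h2] := hp a.
by split; [alg|move=> h; rewrite h2 // mulr0].
Qed.
Lemma PXZr X n c p : submodule C X -> X c -> PX C n p -> PX X n (c *: p).
Proof.
move=> hX hc hp a; rewrite mcoeffZ; have [h1 h2] := hp a.
by split; [rewrite mulrC; exact: (smZ hX)|move=> h; rewrite h2 // mulr0].
Qed.
Lemma PXN X n p : submodule C X -> PX X n p -> PX X n (- p).
Proof. move=> hX hp; rewrite -scaleN1r; apply: PXZ => //; alg. Qed.
Lemma PXB X n p q : submodule C X -> PX X n p -> PX X n q -> PX X n (p - q).
Proof. by move=> hX hp hq; apply: PXD => //; exact: PXN. Qed.
Lemma PX_sum X n (I : Type) (r : seq I) (Q : pred I) (F : I -> P) : submodule C X ->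
  (forall i, Q i -> PX X n (F i)) -> PX X n (\sum_(i <- r | Q i) F i).
Proof.
move=> hX h; apply: big_ind => //; first by apply: PX0; alg.
by move=> p q; exact: PXD.
Qed.
Lemma PX_mono X n c a : submodule C X -> X c -> mdeg a = n -> PX X n (c *: 'X_[a]).
Proof.
move=> hX hc ha b; rewrite mcoeffZ mcoeffX; case: eqP => [<-|_].
  by rewrite mulr1 ha eqxx.
rewrite mulr0; split=> //; alg.
Qed.
Lemma PXS X Y n : X `<=` Y -> PX X n `<=` PX Y n.
Proof. move=> h p hp a; have [h1 h2] := hp a; split=> //; alg. Qed.
Lemma PX_X X n k p : submodule C X -> PXp X n p -> PX X n ('X_k * p).
Proof.
move=> hX; case: n => [->|n hp a]; first by rewrite mulr0; apply: PX0; alg.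
rewrite mcoeffXmul; case: ifP => h; last alg.
have [h1 h2] := hp (a - U_(k))%MM; split=> // hd; apply: h2; apply: contra_neq hd => e.
by rewrite (mnm_split h) mdegD mdeg1 e.
Qed.
Lemma PXp0 X n : X 0 -> PXp X n 0.
Proof. by case: n => [|n] h //; exact: PX0. Qed.
Lemma PXpD X n p q : submodule C X -> PXp X n p -> PXp X n q -> PXp X n (p + q).
Proof. by case: n => [|n] hX; [move=> -> ->; rewrite /= addr0|exact: PXD]. Qed.
Lemma PXpN X n p : submodule C X -> PXp X n p -> PXp X n (- p).
Proof. by case: n => [|n] hX; [move=> -> /=; rewrite oppr0|exact: PXN]. Qed.

Lemma PX_ind X n (Q : P -> Prop) : Q 0 -> (forall p q, Q p -> Q q -> Q (p + q)) ->
  (forall c a, X c -> mdeg a = n -> Q (c *: 'X_[a])) -> forall p, PX X n p -> Q p.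
Proof.
move=> Q0 QD Qm p hp; rewrite [p]mpolyE big_seq.
apply: big_ind => // a ha; have [h1 h2] := hp a; apply: Qm => //.
by apply/eqP; apply: contraLR ha => /h2; rewrite mcoeff_msupp => ->; rewrite eqxx.
Qed.

Definition freeof J p := forall (a : 'X_{1..m}) k, J k -> (0 < a k)%N -> p@_a = 0.

Lemma freeof0 J : freeof J 0. Proof. by move=> a k _ _; rewrite mcoeff0. Qed.
Lemma freeofD J p q : freeof J p -> freeof J q -> freeof J (p + q).
Proof. by move=> h h' a k hk ha; rewrite mcoeffD (h a k) // (h' a k) // addr0. Qed.
Lemma freeofZ J c p : freeof J p -> freeof J (c *: p).
Proof. by move=> h a k hk ha; rewrite mcoeffZ (h a k) // mulr0. Qed.
Lemma freeofN J p : freeof J p -> freeof J (- p).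
Proof. by move=> h a k hk ha; rewrite mcoeffN (h a k) // oppr0. Qed.
Lemma freeof_sum J (I : Type) (r : seq I) (Q : pred I) (F : I -> P) :
  (forall i, Q i -> freeof J (F i)) -> freeof J (\sum_(i <- r | Q i) F i).
Proof. by apply: big_ind; [exact: freeof0|exact: freeofD]. Qed.
Lemma freeofX J k p : ~~ J k -> freeof J p -> freeof J ('X_k * p).
Proof.
move=> hk h a l hl ha; rewrite mcoeffXmul; case: ifP => // _; apply: (h _ l) => //.
by rewrite mnmBE mnm1E; case: eqP => [e|_]; [rewrite e hl in hk|rewrite subn0].
Qed.

Lemma split_form X n J p : submodule C X -> PX X n p ->
  exists p0 (g : 'I_m -> P), [/\ PX X n p0, freeof J p0, forall k, PXp X n (g k) &
    p = p0 + \sum_(k | J k) 'X_k * g k].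
Proof.
move=> hX hp; have h0 := sm0 hX; move: p hp; apply: (@PX_ind X n).
- exists 0, (fun=> 0); split; [exact: PX0|exact: freeof0|by move=> _; exact: PXp0|].
  by rewrite big1 ?addr0 // => k _; rewrite mulr0.
- move=> p q [p0 [g [h1 h2 h3 ->]]] [q0 [f [h4 h5 h6 ->]]].
  exists (p0 + q0), (fun k => g k + f k); split.
  + exact: PXD.
  + exact: freeofD.
  + by move=> k; exact: PXpD.
  + rewrite addrACA -big_split /=; congr (_ + _).
    apply: eq_bigr => k _; alg.
move=> c a hc ha.
have [/existsP[k /andP[hk hak]]|hno] := boolP [exists k, J k && (0 < a k)%N]; last first.
  exists (c *: 'X_[a]), (fun=> 0); split.
  + exact: PX_mono.
  + move=> b k hk hb; rewrite mcoeffZ mcoeffX; case: eqP => [e|_]; last by rewrite mulr0.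
    by move: hno; rewrite negb_exists => /forallP /(_ k); rewrite hk e hb.
  + by move=> _; exact: PXp0.
  + by rewrite big1 ?addr0 // => k _; rewrite mulr0.
have ea := mnm_split hak.
exists 0, (fun l => if l == k then c *: 'X_[a - U_(k)] else 0); split.
- exact: PX0.
- exact: freeof0.
- move=> l; case: eqP => _; last exact: PXp0.
  move: ha; rewrite {1}ea mdegD mdeg1; case: n => [|n] //; rewrite add1n => -[ha].
  exact: PX_mono.
- rewrite add0r (bigD1 k) //= eqxx big1 ?addr0.
    by rewrite -scalerAr -mpolyXD -ea.
  by move=> l /andP[_ /negbTE ->]; rewrite mulr0.
Qed.

Lemma split_zero J p0 (g : 'I_m -> P) : freeof J p0 ->
  p0 + \sum_(k | J k) 'X_k * g k = 0 -> p0 = 0.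
Proof.
move=> hf e; apply/mpolyP => a; rewrite mcoeff0.
have [/existsP[k /andP[hk ha]]|hno] := boolP [exists k, J k && (0 < a k)%N].
  exact: hf hk ha.
have := congr1 (mcoeff a) e; rewrite mcoeffD mcoeff0 (raddf_sum (mcoeff a)) big1 ?addr0 //.
move=> k hk /=; rewrite mcoeffXmul; case: ifP => // ha.
by move: hno; rewrite negb_exists => /forallP /(_ k); rewrite hk ha.
Qed.

(** Exactness of the Koszul complex of the variables with coefficients in [X]. The part of [q i]
    free of the other variables has to vanish; the cofactors [g] of the rest are moved to the other
    entries, which then satisfy a relation without [i]. *)
Lemma koszul_poly X n J (q : 'I_m -> P) : submodule C X ->
  (forall k, PX X n (q k)) -> \sum_(k | J k) 'X_k * q k = 0 ->
  exists h : 'I_m -> 'I_m -> P, [/\ forall k l, PXp X n (h k l),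
    forall k l, h k l = - h l k, forall k, h k k = 0, forall k l, ~~ J k -> h k l = 0 &
    forall k, J k -> q k = \sum_(l | J l) 'X_l * h k l].
Proof.
move=> hX; have h0 := sm0 hX.
have [s] := ubnP #|J|; elim: s J q => // s IH J q hs hq e.
have [i hi|hno] := pickP J; last first.
  exists (fun _ _ => 0); split=> [k l|k l|//|//|k]; [exact: PXp0|by rewrite oppr0|].
  by rewrite hno.
pose J' := [pred k | J k && (k != i)].
have hcard : (#|J'| < s)%N.
  rewrite -ltnS; apply: leq_trans hs; rewrite ltnS.
  rewrite [X in (_ < X)%N](cardD1 i) -[i \in J]/(J i) hi add1n ltnS.
  by apply: subset_leq_card; apply/fintype.subsetP => k; rewrite !inE => /andP[h1 ->].
have eJ (F : 'I_m -> P) : \sum_(k | J k) F k = F i + \sum_(k | J' k) F k.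
  by rewrite (bigD1 i).
have [p0 [g [hp0 hf hg eq]]] := split_form J' hX (hq i).
have e' : 'X_i * p0 + \sum_(k | J' k) 'X_k * (q k + 'X_i * g k) = 0.
  rewrite -[RHS]e eJ eq mulrDr -addrA; congr (_ + _).
  rewrite mulr_sumr -big_split /=; apply: eq_bigr => k _.
  by rewrite mulrDr [RHS]addrC; rewrite mulrCA.
have hXp0 : 'X_i * p0 = 0.
  by apply: split_zero e'; apply: freeofX hf; rewrite /= eqxx andbF.
have hp00 : p0 = 0.
  move/eqP: hXp0; rewrite mulf_eq0 => /orP[/eqP hX0|/eqP //].
  have := congr1 (mcoeff U_(i)) hX0; rewrite mcoeffX eqxx mcoeff0 => /eqP.
  by rewrite oner_eq0.
rewrite hXp0 add0r in e'.
have [|h [h1 h2 hd h3 h4]] := IH J' (fun k => q k + 'X_i * g k) hcard _ e'.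
  by move=> k; apply: PXD => //; exact: PX_X.
pose h' k l := if k == i then (if J' l then g l else 0)
               else if l == i then (if J' k then - g k else 0) else h k l.
have hJi : J' i = false by rewrite /= eqxx andbF.
exists h'; split.
- move=> k l; rewrite /h'; case: ifP => _; first by case: ifP => _ //; exact: PXp0.
  by case: ifP => _ //; case: ifP => _; [exact: PXpN|exact: PXp0].
- move=> k l; rewrite /h'; case: (eqVneq k i) => [ek|hk]; case: (eqVneq l i) => [el|hl].
  + by rewrite ek el hJi oppr0.
  + by case: (J' l); rewrite ?opprK ?oppr0.
  + by case: (J' k); rewrite ?oppr0.
  + alg.
- by move=> k; rewrite /h'; case: eqP => [->|_]; [rewrite hJi|alg].
- move=> k l hk; have hki : k != i by apply: contraNneq hk => ->.
  have hJk : J' k = false by rewrite /= (negbTE hk).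
  by rewrite /h' (negbTE hki) hJk; case: ifP => // _; apply: h3; rewrite hJk.
move=> k hk; rewrite eJ /h'; have [->|hki] := eqVneq k i.
  rewrite hJi mulr0 add0r eq hp00 add0r; apply: eq_bigr => l hl.
  by rewrite hl.
have hJk : J' k by rewrite /= hk.
rewrite eqxx hJk mulrN -[LHS](addrK ('X_i * g k)) addrC; congr (_ + _).
rewrite h4 //; apply: eq_bigr => l hl.
by have /andP[_ /negbTE ->] := hl.
Qed.

Variable u : 'I_m -> K.
Local Notation ev p := (p.@[u]).

(** The values at [u] of the forms of degree [n], that is, the product of [X] with the [n]-th power
    of the span of the [u i]. *)
Definition Un X n : set K := [set z | exists2 p, PX X n p & z = ev p].
Definition us := [seq u i | i <- enum 'I_m].

Lemma mem_us i : u i \in us. Proof. by apply: map_f; rewrite mem_enum. Qed.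

Lemma lc_usP X z : submodule C X -> lc X us z <->
  exists c : 'I_m -> K, (forall i, X (c i)) /\ z = \sum_i c i * u i.
Proof.
move=> hX; split; last first.
  case=> c [hc ->]; apply: (sm_sum (sm_lc us hX)) => i _; rewrite mulrC.
  exact: (lc_mem hX (mem_us i) (hc i)).
suff h : lc X us `<=` [set z | exists c : 'I_m -> K, (forall i, X (c i)) /\
    z = \sum_i c i * u i] by exact: h.
apply: (@lc_min _ C) => [|_ y /mapP[i _ ->] hy /=].
  split=> /= [|_ _ [c [hc ->]] [d [hd ->]]|a _ ha [c [hc ->]]].
  - exists (fun=> 0); split; first alg.
    by rewrite big1 // => i _; rewrite mul0r.
  - exists (fun i => c i + d i); split; first alg.
    rewrite -big_split; apply: eq_bigr => i _; alg.
  - exists (fun i => a * c i); split; first alg.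
    by rewrite mulr_sumr; apply: eq_bigr => i _; rewrite mulrA.
exists (fun j => if j == i then y else 0); split.
  move=> j; case: ifP => _ //; alg.
rewrite (bigD1 i) //= eqxx big1 ?addr0; first by rewrite mulrC.
by move=> j /negbTE ->; rewrite mul0r.
Qed.

Lemma sm_Un X n : submodule C X -> submodule C (Un X n).
Proof.
move=> hX; split.
- by exists 0; [apply: PX0; exact: sm0 hX|rewrite meval0].
- move=> _ _ [p hp ->] [q hq ->]; exists (p + q); [exact: PXD|by rewrite mevalD].
- move=> a _ ha [p hp ->]; exists (a *: p); [exact: PXZ|by rewrite mevalZ].
Qed.

Lemma Un0 X : submodule C X -> Un X 0 = X.
Proof.
move=> hX; rewrite eqEsubset; split=> [_ [p hp ->]|x hx].
  suff -> : p = (p@_0)%:MP by rewrite mevalC; have [] := hp 0%MM.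
  apply/mpolyP => a; rewrite mcoeffC; case: eqP => [->|/eqP ha]; first by rewrite mulr1.
  by rewrite mulr0; have [_ ->] := hp a; rewrite // mdeg_eq0.
exists x%:MP; last by rewrite mevalC.
move=> a; rewrite mcoeffC mdeg_eq0; case: eqP => _; rewrite ?mulr1 ?mulr0; alg.
Qed.

Lemma UnS X n : submodule C X -> Un X n.+1 = lc (Un X n) us.
Proof.
move=> hX; have hU := sm_Un n hX; rewrite eqEsubset; split; last first.
  apply: (lc_min (sm_Un n.+1 hX)) => _ _ /mapP[i _ ->] [p hp ->].
  by exists ('X_i * p); [exact: PX_X|rewrite mevalM mevalXU].
move=> _ [p hp ->]; have [p0 [g [h1 h2 h3 ->]]] := split_form predT hX hp.
have -> : p0 = 0.
  apply/mpolyP => a; rewrite mcoeff0; have [ha|/(h1 a).2 //] := eqVneq (mdeg a) n.+1.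
  have [i hi] : exists i, (0 < a i)%N.
    apply/existsP; apply: contraLR (_ : (0 < mdeg a)%N); last by rewrite ha.
    rewrite negb_exists => /forallP h; rewrite -leqNgt leqn0 mdegE big1 // => i _.
    by apply/eqP; rewrite -leqn0 leqNgt.
  exact: (h2 _ i).
rewrite add0r raddf_sum; apply/lc_usP => //; exists (fun i => ev (g i)); split.
  by move=> i; exists (g i) => //; exact: h3.
by apply: eq_bigr => i _ /=; rewrite mevalM mevalXU mulrC.
Qed.

Lemma UnSS X Y n : X `<=` Y -> Un X n `<=` Un Y n.
Proof. by move=> h _ [p hp ->]; exists p => //; exact: PXS hp. Qed.

Definition alg : set K := [set z | exists2 p : P, (forall a, C p@_a) & z = ev p].

Lemma sr_mcoefs : subring [set p : P | forall a, C p@_a].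
Proof.
split=> [a|p q hp hq a|p q hp hq a] /=.
- rewrite mcoeff1; alg.
- rewrite mcoeffB; alg.
- rewrite mcoeffM; alg.
Qed.

Lemma sr_alg : subring alg.
Proof.
have -> : alg = meval u @` [set p : P | forall a, C p@_a].
  by rewrite eqEsubset; split=> [_ [p hp ->]|_ [p hp <-]]; exists p.
exact: sr_image sr_mcoefs.
Qed.

Lemma sub_alg : C `<=` alg.
Proof.
move=> c hc; exists c%:MP; last by rewrite mevalC.
move=> a; rewrite mcoeffC; alg.
Qed.

Lemma alg_gen i : alg (u i).
Proof.
exists 'X_i; last by rewrite mevalXU.
move=> a; rewrite mcoeffX; alg.
Qed.

Lemma alg_min D : subring D -> C `<=` D -> (forall i, D (u i)) -> alg `<=` D.
Proof.
move=> hD hCD hu _ [p hp ->]; rewrite mevalE; alg.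
Qed.

Lemma Un_alg n : Un C n `<=` alg.
Proof. by move=> _ [p hp ->]; exists p => // a; have [] := hp a. Qed.

End Forms.

(** * Linear forms with one relation *)

Definition isfield (K : fieldType) (L : set K) :=
  subring L /\ forall x, L x -> L x^-1.

Section NormalForms.
Variables (K : fieldType) (L : set K) (m : nat) (u : 'I_m -> K).
Hypothesis hL : isfield L.
Implicit Types (C : set K) (p q : {mpoly K[m]}) (J : pred 'I_m).

Lemma freeofM J p q : freeof J p -> freeof J q -> freeof J (p * q).
Proof.
move=> hp hq a i hi ha; rewrite mcoeffM big1 // => k' /eqP ek.
have e1 : a i = (k'.1 i + k'.2 i)%N.
  by have := congr1 (fun b : 'X_{1..m} => b i) ek; rewrite mnmDE.
have [h|h] := ltnP 0 (k'.1 i); first by rewrite (hp _ _ hi h) mul0r.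
have h2 : (0 < k'.2 i)%N.
  by move: ha; rewrite e1; move: h; rewrite leqn0 => /eqP ->.
by rewrite (hq _ _ hi h2) mulr0.
Qed.

(** Algebraic independence over [L] of the [u i] with [i] outside [J]. *)
Definition indep J := forall p, (forall a, L p@_a) -> freeof J p -> p.@[u] = 0 -> p = 0.

Definition fractions C := forall x, L x -> exists d, [/\ C d, d != 0 & C (d * x)].

Lemma common_denominator C p : subring C -> fractions C -> (forall a, L p@_a) ->
  exists d, [/\ C d, d != 0 & forall a, C (d * p@_a)].
Proof.
move=> hC hf hp.
suff [d [hd d0 h]] : exists d, [/\ C d, d != 0 & forall a, a \in msupp p -> C (d * p@_a)].
  exists d; split=> // a; have [/h //|ha] := boolP (a \in msupp p).
  rewrite memN_msupp_eq0 // mulr0; alg.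
elim: (msupp p) => [|a s [d [hd d0 h]]].
  exists 1; split; rewrite ?oner_neq0 //; alg.
have [e [he e0 h']] := hf _ (hp a); exists (e * d); split.
- alg.
- by rewrite mulf_neq0.
move=> b; rewrite inE => /orP[/eqP ->|/h hb].
  rewrite mulrAC mulrC; alg.
rewrite -mulrA; alg.
Qed.

Lemma almost_integral C d x : subring C -> noethm C C -> d != 0 ->
  (forall k, C (d * x ^+ k)) -> integral_over C x.
Proof.
move=> hC hn d0 h; have hCC := sm_self hC.
have hsm k := sm_lc (powers x k) hCC.
have hmem k i : (i <= k)%N -> lc C (powers x k) (x ^+ i).
  by move=> hi; apply: lc_gen => //; apply: map_f; rewrite mem_iota.
have [k|k|k hk] := @noethm_acc _ C (lc C [:: d^-1]) (fun k => lc C (powers x k)) hC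
    (@noethm_lc _ C [:: d^-1] hC hn) hsm.
- have hd := sm_lc [:: d^-1] hCC.
  apply: (lc_min hd) => _ b /mapP[i hi ->] hb; rewrite mulrC; apply: (smZ hd) => //.
  have -> : x ^+ i = d^-1 * (d * x ^+ i) by rewrite mulKf.
  alg.
- apply: (lc_min (hsm k.+1)) => _ b /mapP[i hi ->] hb; rewrite mulrC.
  apply: (smZ (hsm _)) => //; apply: hmem; move: hi; rewrite mem_iota /=; lia.
apply: (int_lc hC (s := powers x k)).
  exists 1; rewrite ?oner_neq0 //; apply/mapP; exists 0%N; rewrite ?expr0 //.
move=> _ /mapP[i hi ->]; rewrite -exprS; apply: hk; apply: hmem.
by move: hi; rewrite mem_iota.
Qed.

(* The coefficient of the leading monomial of an integral form is almost integral. *)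
Lemma integral_coefs C J p : subring C -> C `<=` L -> noethm C C -> icl L C ->
  fractions C -> indep J ->
  (forall z, alg C u z -> exists q, [/\ forall a, C q@_a, freeof J q & z = q.@[u]]) ->
  (forall a, L p@_a) -> freeof J p -> integral_over (alg C u) p.@[u] ->
  forall a, C p@_a.
Proof.
move=> hC hCL hn hicl hf hJ hal; have [hLs _] := hL.
have halg : subring (alg C u) := sr_alg hC u.
have [s] := ubnP (size (msupp p)); elim: s p => // s IH p hs hp hfp hint.
have [->|p0] := eqVneq p 0; first by move=> a; rewrite mcoeff0; alg.
have hpX k : (forall a, L (p ^+ k)@_a) /\ freeof J (p ^+ k).
  elim: k => [|k [IHk1 IHk2]].
    rewrite expr0; split=> [a|a i _ ha].
      rewrite mcoeff1; alg.
    by rewrite mcoeff1; case: eqP => // e; rewrite e mnm0E in ha.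
  rewrite exprS; split; first exact: srM (sr_mcoefs m hLs) hp IHk1.
  exact: freeofM.
have evX k : (p ^+ k).@[u] = p.@[u] ^+ k by rewrite (rmorphXn (meval u)).
have [M M0 [c [hc e]]] := int_pow halg hint.
have [d [hd d0 hdk]] : exists d, [/\ C d, d != 0 &
    forall i, (i < M)%N -> alg C u (d * p.@[u] ^+ i)].
  elim: (M) => [|k [d [hd d0 h]]]; first by exists 1; split; rewrite ?oner_neq0
  //; alg.
  have [e1 [he1 e10 h1]] := common_denominator hC hf (hpX k).1.
  exists (e1 * d); split; [alg|by rewrite mulf_neq0|].
  move=> i; rewrite ltnS leq_eqVlt => /orP[/eqP ->|/h hi].
    rewrite mulrAC mulrC; apply: srM => //; first exact: sub_alg.
    rewrite -evX -mevalZ; exists (e1 *: p ^+ k) => // a; by rewrite mcoeffZ.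
  by rewrite -mulrA; apply: srM => //; exact: sub_alg.
have hall k : alg C u (d * p.@[u] ^+ k).
  have [k'] := ubnP k; elim: k' k => // k' IHk k hk.
  have [/hdk //|hMk] := ltnP k M.
  have ek : k = (M + (k - M))%N by rewrite subnKC.
  rewrite ek exprD e mulr_suml mulr_sumr; apply: sr_sum => // i _.
  have -> : d * (c i * p.@[u] ^+ i * p.@[u] ^+ (k - M)) = c i * (d * p.@[u] ^+ (i + (k - M))).
    by rewrite exprD; ring.
  apply: srM => //; apply: IHk; apply: (leq_trans (n := k)); last by [].
  by rewrite -{2}(subnKC hMk) -addSn leq_add2r.
set lam := mleadc p.
have hlam : C lam.
  apply: hicl; first exact: hp.
  apply: (almost_integral hC hn d0) => k.
  have [q [hq hfq eq]] := hal _ (hall k).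
  have -> : d * lam ^+ k = (d *: p ^+ k)@_(mlead p *+ k) by rewrite mcoeffZ mleadcX.
  suff -> : d *: p ^+ k = q by [].
  apply/eqP; rewrite -subr_eq0; apply/eqP; apply: hJ.
  - move=> a; rewrite mcoeffB mcoeffZ; apply: srB => //; last exact: hCL.
    by apply: srM => //; [alg|exact: (hpX k).1].
  - by apply: freeofD; [apply: freeofZ; exact: (hpX k).2|exact: freeofN].
  - by rewrite mevalB mevalZ evX -eq subrr.
pose p1 := p - lam *: 'X_[mlead p].
have ep : p = p1 + lam *: 'X_[mlead p] by rewrite subrK.
have hXf : freeof J (lam *: 'X_[mlead p]).
  move=> a i hi ha; rewrite mcoeffZ mcoeffX; case: eqP => [e'|_]; last by rewrite mulr0.
  by move: (hfp a i hi ha); rewrite -e' -/lam => ->; rewrite mul0r.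
have hXC a : C (lam *: 'X_[mlead p])@_a.
  rewrite mcoeffZ mcoeffX; apply: srM => //; exact: sr_nat.
have hp1 : forall a, C p1@_a.
  apply: IH.
  - have hm : mlead p \in msupp p by rewrite mlead_supp.
    have := perm_size (msupp_rem p (mlead p)); rewrite -/p1 => ->.
    rewrite size_rem //; move: hs; case: (msupp p) hm => //= x t _; exact.
  - by move=> a; rewrite mcoeffB; apply: srB => //; apply: hCL.
  - by apply: freeofD => //; exact: freeofN.
  - rewrite mevalB; apply: int_sub => //; apply: int_base => //.
    by exists (lam *: 'X_[mlead p]).
move=> a; rewrite ep mcoeffD; alg.
Qed.

End NormalForms.

Section Relation.
Variables (K : fieldType) (L : set K) (m : nat) (u dl : 'I_m -> K).
Implicit Types (C X : set K) (p q : {mpoly K[m]}).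
Local Notation P := {mpoly K[m]}.

(** the kernel of [L[X] -> K, X_i |-> u_i] is generated by [\sum_i dl_i X_i] *)
Definition relation :=
  [/\ isfield L, forall i, L (dl i), exists j, dl j != 0, \sum_i dl i * u i = 0
    & forall j, dl j != 0 -> indep L u (pred1 j)].

Hypothesis hrel : relation.
Let hLf : isfield L. Proof. by case: hrel. Qed.
Let hL : subring L. Proof. by case: hLf. Qed.
Let hLL := sm_self hL.
Let hdlL i : L (dl i). Proof. by case: hrel. Qed.
Let hdl0 : exists j, dl j != 0. Proof. by case: hrel. Qed.
Let hsum : \sum_i dl i * u i = 0. Proof. by case: hrel. Qed.
Let hind j : dl j != 0 -> indep L u (pred1 j).
Proof. by case: hrel => _ _ _ _; apply. Qed.

Definition ell : P := \sum_i dl i *: 'X_i.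

Lemma ev_ell : ell.@[u] = 0.
Proof.
rewrite raddf_sum -[RHS]hsum; apply: eq_bigr => i _ /=.
by rewrite mevalZ mevalXU.
Qed.

Lemma ell_neq0 : ell != 0.
Proof.
have [j hj] := hdl0; apply: contraNneq hj => e.
have := congr1 (mcoeff U_(j)) e; rewrite mcoeff0 (raddf_sum (mcoeff U_(j))) /=.
rewrite (bigD1 j) //= mcoeffZ mcoeffX eqxx mulr1 big1 ?addr0 => [->//|i hi].
rewrite mcoeffZ mcoeffX; case: eqP => [e'|_]; last by rewrite mulr0.
by have := congr1 (fun a : 'X_{1..m} => a j) e'; rewrite !mnm1E eqxx (negbTE hi).
Qed.

(** Modulo [ell], the product of [dl j] and the variable of index [j] is a combination of the other
    variables, so each factor [dl j] removes one occurrence of that variable. *)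
Lemma division C j n q : subring C -> (forall i, C (dl i)) -> PX C n q ->
  exists (k : nat) h q', [/\ PXp C n h, PX C n q', freeof (pred1 j) q' &
    dl j ^+ k *: q = ell * h + q'].
Proof.
move=> hC hdl; have hCC := sm_self hC.
elim: n q => [|n IH] q hq.
  exists 0%N, 0, q; split=> //; last by rewrite scale1r mulr0 add0r.
  move=> a i _ ha; have [_ -> //] := hq a.
  by rewrite mdeg_eq0; apply: contraTneq ha => ->; rewrite mnm0E.
have [q0 [g [hq0 hf hg ->]]] := split_form (pred1 j) hCC hq.
have hgj : PX C n (g j) := hg j.
rewrite big_pred1_eq; have [k [h [g' [h1 h2 h3 h4]]]] := IH _ hgj.
exists k.+1, (dl j ^+ k *: g j - \sum_(i | i != j) dl i *: ('X_i * h)),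
  (dl j ^+ k.+1 *: q0 - \sum_(i | i != j) dl i *: ('X_i * g')); split.
- have hk : PX C n (dl j ^+ k *: g j) by apply: (PXZ hCC) => //; alg.
  have hs : PX C n (\sum_(i | i != j) dl i *: ('X_i * h)).
    by apply: (PX_sum _ hCC) => i _; apply: (PXZ hCC (hdl i)); exact: (PX_X i hCC h1).
  exact: (PXB hC hCC hk hs).
- apply: (PXB hC hCC) => //; first by apply: (PXZ hCC) => //; alg.
  by apply: (PX_sum _ hCC) => i _; apply: (PXZ hCC (hdl i)); exact: (PX_X (n := n.+1) i hCC h2).
- apply: freeofD; first exact: freeofZ.
  by apply/freeofN/freeof_sum => i hi; apply: freeofZ; exact: freeofX.
have eS (F : P) : \sum_(i | i != j) dl i *: ('X_i * F) = (ell - dl j *: 'X_j) * F.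
  rewrite /ell [X in _ = (X - _) * _](bigD1 j) //= addrAC subrr add0r mulr_suml; apply: eq_bigr => i _.
  by rewrite -scalerAl.
rewrite !eS scalerDr exprS -scalerA -[dl j ^+ k *: g j]/(_) -!mul_mpolyC.
rewrite -!mul_mpolyC in h4.
rewrite [(dl j * _)%:MP]mpolyCM.
have -> : (dl j)%:MP * (dl j ^+ k)%:MP * ('X_j * g j) =
  (dl j)%:MP * 'X_j * ((dl j ^+ k)%:MP * g j) by ring.
by rewrite h4; ring.
Qed.

Lemma kernel C j n q : subring C -> C `<=` L -> (forall i, C (dl i)) -> PX C n q ->
  dl j != 0 -> q.@[u] = 0 -> exists (k : nat) h, PXp C n h /\ dl j ^+ k *: q = ell * h.
Proof.
move=> hC hCL hdl hq hj e; have [k [h [q' [h1 h2 h3 h4]]]] := division j hC hdl hq.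
exists k, h; split=> //; rewrite h4 (_ : q' = 0) ?addr0 //; apply: (hind hj) => //.
  by move=> a; apply: hCL; have [] := h2 a.
have := congr1 (meval u) h4.
by rewrite mevalZ e mulr0 mevalD mevalM ev_ell mul0r add0r.
Qed.

(** Subtracting the multiple of [dl] that agrees with [a] at [j] leaves a relation without [u j],
    which is trivial by independence. *)
Lemma linear_relation (a : 'I_m -> K) : (forall i, L (a i)) -> \sum_i a i * u i = 0 ->
  exists2 g, L g & forall i, a i = dl i * g.
Proof.
move=> ha e; have [j hj] := hdl0; exists (a j / dl j).
  by apply: srM => //; apply: hLf.2.
pose p : P := \sum_i (a i - dl i * (a j / dl j)) *: 'X_i.
have hp i : p@_U_(i) = a i - dl i * (a j / dl j).
  rewrite (raddf_sum (mcoeff U_(i))) (bigD1 i) //= mcoeffZ mcoeffX eqxx mulr1 big1 ?addr0 //.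
  move=> k hk; rewrite mcoeffZ mcoeffX; case: eqP => [e'|_]; last by rewrite mulr0.
  by have := congr1 (fun b : 'X_{1..m} => b i) e'; rewrite !mnm1E eqxx (negbTE hk).
suff p0 : p = 0 by move=> i; apply/eqP; rewrite -subr_eq0 -hp p0 mcoeff0.
apply: (hind hj).
- move=> b; rewrite (raddf_sum (mcoeff b)); apply: sr_sum => // i _ /=.
  rewrite mcoeffZ mcoeffX; apply: srM => //; last exact: sr_nat.
  by apply: srB => //; apply: srM => //; apply: srM => //; apply: hLf.2.
- move=> b k /eqP -> hb; rewrite (raddf_sum (mcoeff b)) big1 // => i _ /=.
  rewrite mcoeffZ mcoeffX; case: eqP => [e'|_]; last by rewrite mulr0.
  move: hb; rewrite -e' mnm1E; case: eqP => [->|//] _.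
  by rewrite mulr1 mulrCA mulfV // mulr1 subrr.
- have -> : p.@[u] = \sum_i (a i * u i - a j / dl j * (dl i * u i)).
    rewrite raddf_sum; apply: eq_bigr => i _ /=; rewrite mevalZ mevalXU; ring.
  by rewrite big_split /= sumrN -mulr_sumr hsum mulr0 subr0.
Qed.

(** ** Integral closures of forms *)

(** In positive degree, the component of degree [n] of the integral closure of C[u] in L[u]; degree
    zero is set to be [C]. *)
Definition Wn C n : set K :=
  if n is 0 then C else [set z | Un u L n z /\ integral_over (alg C u) z].

Lemma sm_Wn C n : subring C -> C `<=` L -> submodule C (Wn C n).
Proof.
move=> hC hCL; case: n => [|n]; first exact: sm_self.
have hU : submodule C (Un u L n.+1).
  exact: submoduleS hCL (sm_Un u n.+1 hLL).
have ha := sr_alg hC u; have hi := sr_iclosure ha; split.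
- split; alg.
- move=> x y [h1 h2] [h3 h4]; split; alg.
- move=> a x hca [h1 h2]; split; first exact: (smZ hU).
  by apply: (srM hi) => //; apply: int_base => //; exact: sub_alg.
Qed.

Lemma Un_Wn C n : subring C -> C `<=` L -> Un u C n `<=` Wn C n.
Proof.
move=> hC hCL; case: n => [|n]; first by rewrite (Un0 u (sm_self hC)).
move=> z hz; split; first exact: UnSS hCL _ hz.
by apply: int_base; [exact: sr_alg|exact: Un_alg hz].
Qed.

Lemma Wn_mono C C' n : C `<=` C' -> Wn C n `<=` Wn C' n.
Proof.
move=> h; case: n => [|n] // z [h1 h2]; split=> //; apply: int_mono h2.
move=> _ [p hp ->]; exists p => // a; exact: h.
Qed.

Lemma Wn_mul C n : subring C -> C `<=` L -> lc (Wn C n) (us u) `<=` Wn C n.+1.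
Proof.
move=> hC hCL; have ha := sr_alg hC u; have hi := sr_iclosure ha.
apply: (lc_min (sm_Wn n.+1 hC hCL)) => _ z /mapP[i _ ->] hz; split.
  rewrite (UnS u n hLL); apply: (lc_mem (sm_Un u n hLL)); first exact: mem_us.
  case: n hz => [|n] hz; last by case: hz.
  rewrite (Un0 u hLL); alg.
apply: (srM hi); first by apply: int_base => //; exact: alg_gen.
by case: n hz => [|n] hz; [apply: int_base => //; exact: sub_alg|case: hz].
Qed.

Lemma mset_alg C S : subring C -> mset C S -> mset (alg C u) S.
Proof. by move=> hC [h1 h2 h3 h4]; split=> //; apply: subset_trans h1 _; exact: sub_alg. Qed.

Lemma alg_loc C S : subring C -> mset C S -> alg (loc C S) u `<=` loc (alg C u) S.
Proof.
move=> hC hS; have hS' := mset_alg hC hS; have ha := sr_alg hC u.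
apply: (alg_min (loc_subring ha hS')) => [|i].
  exact: loc_sub (@sub_alg _ _ _ hC u).
by apply: (sub_loc hS'); exact: alg_gen.
Qed.

Lemma Wn_loc C S n z : subring C -> C `<=` L -> mset C S -> Wn (loc C S) n z ->
  exists2 a, S a & Wn C n (a * z).
Proof.
move=> hC hCL hS; have [hSC hS1 _ _] := hS; case: n => [|n].
  case=> a [s [ha hs ->]]; exists s => //.
  by rewrite mulrC divfK // (mset_neq0 hS).
case=> h1 h2; have h3 := int_mono (alg_loc hC hS) h2.
have [a ha h4] := int_loc (sr_alg hC u) (mset_alg hC hS) h3.
exists a => //; split=> //; apply: (smZ (sm_Un u n.+1 hLL)) => //; alg.
Qed.

Definition normal_in C := [/\ subring C, C `<=` L, noethm C C, icl L C & fractions L C].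

Lemma normal_loc C S : normal_in C -> mset C S -> normal_in (loc C S).
Proof.
move=> [hC hCL hn hi hf] hS; have [hSC hS1 _ _] := hS; split.
- exact: loc_subring.
- move=> _ [a [s [ha hs ->]]]; apply: srM => //; first exact: hCL.
  apply: hLf.2; apply: hCL; alg.
- apply: loc_noeth => //; alg.
- exact: icl_loc.
- move=> x /hf[d [h1 h2 h3]]; exists d.
  by split=> //; exact: sub_loc hS _ _.
Qed.

(** With [dl j] invertible, [u j] is a combination of the other [u i], which are independent. So
    C[u] is a polynomial ring over a normal ring, and [integral_coefs] applies. *)
Lemma Wn_base C j n : normal_in C -> (forall i, C (dl i)) -> dl j != 0 -> C (dl j)^-1 ->
  Wn C n `<=` Un u C n.
Proof.
move=> [hC hCL hn hi hf] hdl hj hjV; have hCC := sm_self hC.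
case: n => [|n]; first by rewrite (Un0 u hCC).
move=> _ [[p hp ->] hint].
have [k [h [p' [h1 h2 h3 h4]]]] := division j hL hdlL hp.
have hk : dl j ^+ k != 0 by rewrite expf_neq0.
pose p1 := (dl j ^+ k)^-1 *: p'.
have ep : p.@[u] = p1.@[u].
  rewrite mevalZ; have := congr1 (meval u) h4.
  rewrite mevalZ mevalD mevalM ev_ell mul0r add0r => <-.
  by rewrite mulKf.
have hp1 a : L p1@_a.
  rewrite mcoeffZ; apply: srM => //; last by have [] := h2 a.
  apply: hLf.2; alg.
rewrite ep in hint *; exists p1 => // a; split; last first.
  by move=> ha; rewrite mcoeffZ; have [_ ->] := h2 a; rewrite ?mulr0.
move: a; apply: (integral_coefs hLf hC hCL hn hi hf (hind hj) _ hp1 (freeofZ _ h3) hint).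
pose D := [set z | exists q, [/\ forall a, C q@_a, freeof (pred1 j) q & z = q.@[u]]].
suff hs : alg C u `<=` D by [].
have hD : subring D.
  split.
  - exists 1; split; last by rewrite meval1.
      move=> a; rewrite mcoeff1; alg.
    by move=> a i _ ha; rewrite mcoeff1; case: eqP => // e; rewrite e mnm0E in ha.
  - move=> _ _ [q [hq hfq ->]] [q' [hq' hfq' ->]]; exists (q - q'); split.
    + move=> a; rewrite mcoeffB; alg.
    + by apply: freeofD => //; exact: freeofN.
    + by rewrite mevalB.
  - move=> _ _ [q [hq hfq ->]] [q' [hq' hfq' ->]]; exists (q * q'); split.
    + exact: (srM (sr_mcoefs m hC)).
    + exact: freeofM.
    + by rewrite mevalM.
have hCD : C `<=` D.
  move=> c hc; exists c%:MP; split; last by rewrite mevalC.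
    move=> a; rewrite mcoeffC; alg.
  move=> a i _ ha; rewrite mcoeffC; case: eqP => [e|_]; last by rewrite mulr0.
  by rewrite e mnm0E in ha.
have hDu i : i != j -> D (u i).
  move=> hij; exists 'X_i; split; last by rewrite mevalXU.
    move=> a; rewrite mcoeffX; alg.
  move=> a l /eqP -> ha; rewrite mcoeffX; case: eqP => // e.
  by move: ha; rewrite -e mnm1E (negbTE hij).
apply: (alg_min hD hCD) => i; have [->|] := eqVneq i j; last exact: hDu.
have -> : u j = - ((dl j)^-1 * \sum_(i | i != j) dl i * u i).
  have := hsum; rewrite (bigD1 j) //= => /eqP; rewrite addr_eq0 => /eqP e.
  by rewrite -mulrN -e mulKf.
apply: (srN hD); apply: (srM hD); first exact: hCD.
by apply: (sr_sum hD) => l hl; apply: (srM hD); [exact: hCD|exact: hDu].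
Qed.

(** An extension property of depth two: an element of [L] that lies in [C] off the zero locus of the
    [dl j] lies in [C]. *)
Definition dep C := forall y, L y -> (forall j, exists N : nat, C (dl j ^+ N * y)) -> C y.

Definition chart C := [/\ normal_in C, forall i, C (dl i) & dep C].

Definition pows (x : K) : set K := [set y | exists k : nat, y = x ^+ k].

Lemma mset_pows C x : subring C -> C x -> x != 0 -> mset C (pows x).
Proof.
move=> hC hx x0; split.
- move=> _ [k ->]; alg.
- by exists 0%N.
- by move=> _ _ [i ->] [j ->]; exists (i + j)%N; rewrite exprD.
- by case=> k /esym/eqP; rewrite expf_eq0 (negbTE x0) andbF.
Qed.

Lemma Wn_away C n j z : normal_in C -> (forall i, C (dl i)) -> Wn C n z ->
  exists N : nat, Un u C n (dl j ^+ N * z).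
Proof.
move=> hnC hdl hz; have [hC hCL _ _ _] := hnC; have hCC := sm_self hC.
have [e|hj] := eqVneq (dl j) 0.
  exists 1%N; rewrite e expr1 mul0r; exact: sm0 (sm_Un u n hCC).
have hS := mset_pows hC (hdl j) hj.
have hsub := sub_loc hS (N := C).
have [p hp ->] : Un u (loc C (pows (dl j))) n z.
  apply: (Wn_base (normal_loc hnC hS) _ hj).
  - alg.
  - exists 1, (dl j); split; [alg|by exists 1%N|by rewrite mul1r].
  - exact: Wn_mono hsub _ hz.
suff [N hN] : exists N : nat, PX C n (dl j ^+ N *: p).
  by exists N; rewrite -mevalZ; exists (dl j ^+ N *: p).
move: p hp; apply: PX_ind.
- exists 0%N; rewrite scaler0; apply: PX0; alg.
- move=> p q [N hN] [M hM]; exists (N + M)%N; rewrite scalerDr; apply: (PXD hCC) => //.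
    rewrite addnC exprD -scalerA; apply: (PXZ hCC) => //; alg.
  rewrite exprD -scalerA; apply: (PXZ hCC) => //; alg.
move=> _ a [b [_ [hb [N ->] ->]]] ha; exists N; rewrite scalerA.
rewrite mulrC divfK ?expf_neq0 //; exact: (PX_mono hCC).
Qed.

(** Where [dl j] is inverted, elements of [Wn C 1] are combinations of the [u i], so a solution
    exists up to a power of [dl j]. Solutions over [L] are unique; hence the local ones agree, and
    [dep] puts their coefficients into [C]. *)
Lemma linear_syzygy C n p : chart C -> PX (Wn C 1) n p -> p.@[u] = 0 ->
  exists c : 'I_m -> P, [/\ forall i, PX C n (c i), p = \sum_i u i *: c i &
    \sum_i 'X_i * c i = 0].
Proof.
move=> [hnC hdl hdep] hp ep; have [hC hCL _ _ _] := hnC.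

have lift D j : subring D -> D `<=` L -> (forall i, D (dl i)) ->
    (forall w, Wn C 1 w -> exists N : nat, Un u D 1 (dl j ^+ N * w)) -> dl j != 0 ->
    exists (N : nat) (c : 'I_m -> P), [/\ forall i, PX D n (c i),
      dl j ^+ N *: p = \sum_i u i *: c i & \sum_i 'X_i * c i = 0].
  move=> hD hDL hDdl hDW hj; have hDD := sm_self hD.
  have [N [c [hc e]]] : exists (N : nat) (c : 'I_m -> P), (forall i, PX D n (c i)) /\
      dl j ^+ N *: p = \sum_i u i *: c i.
    move: p hp {ep}; apply: PX_ind.
    - exists 0%N, (fun=> 0); split; first by move=> _; apply: PX0; alg.
      by rewrite scaler0 big1 // => i _; rewrite scaler0.
    - move=> p q [N [c [hc e1]]] [M [d [hd e2]]].
      exists (N + M)%N, (fun i => dl j ^+ M *: c i + dl j ^+ N *: d i); split.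
        move=> i; apply: (PXD hDD) => //; apply: (PXZ hDD) => //; alg.
      rewrite scalerDr {1}addnC !exprD -!scalerA e1 e2 !scaler_sumr -big_split /=.
      by apply: eq_bigr => i _; rewrite scalerDr !scalerA; congr (_ *: _ + _ *: _); ring.
    - move=> w a /hDW[N]; rewrite (UnS u 0 hDD) (Un0 u hDD) => /(lc_usP u _ hDD)[c [hc e]] ha.
      exists N, (fun i => c i *: 'X_[a]); split; first by move=> i; exact: (PX_mono hDD).
      rewrite scalerA e scaler_suml; apply: eq_bigr => i _.
      by rewrite scalerA mulrC.
  have hq : PX D n.+1 (\sum_i 'X_i * c i).
    by apply: (PX_sum _ hDD) => i _; exact: (PX_X (n := n.+1) i hDD (hc i)).
  have eq : (\sum_i 'X_i * c i).@[u] = 0.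
    have := congr1 (meval u) e; rewrite mevalZ ep mulr0 => h; rewrite [RHS]h.
    rewrite !raddf_sum; apply: eq_bigr => i _ /=.
    by rewrite mevalM mevalXU mevalZ.
  have [k [h [hh eh]]] := kernel hD hDL hDdl hq hj eq.
  (* The sum of the ['X_i * c i] vanishes at [u], so up to a power of [dl j] it is [ell * h].
     Subtracting [dl i *: h] cancels it and does not change the combination with the [u i]. *)
  exists (k + N)%N, (fun i => dl j ^+ k *: c i - dl i *: h); split.
  - move=> i; apply: (PXB hD hDD) => //; apply: (PXZ hDD) => //; alg.
  - rewrite exprD -scalerA e scaler_sumr.
    have -> : \sum_i u i *: (dl j ^+ k *: c i - dl i *: h) =
        \sum_i dl j ^+ k *: (u i *: c i) - (\sum_i dl i * u i) *: h.
      rewrite scaler_suml -sumrN -big_split /=; apply: eq_bigr => i _.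
      by rewrite scalerBr !scalerA; congr (_ *: _ - _ *: _); ring.
    by rewrite hsum scale0r subr0.
  - have -> : \sum_i 'X_i * (dl j ^+ k *: c i - dl i *: h) =
        dl j ^+ k *: (\sum_i 'X_i * c i) - ell * h.
      rewrite scaler_sumr mulr_suml -sumrN -big_split /=; apply: eq_bigr => i _.
      by rewrite -!mul_mpolyC; ring.
    by rewrite eh subrr.
(* Coefficient by coefficient a solution of the homogeneous system is proportional to [dl], so it is
   [dl i *: g] with [ell * g = 0]. *)
have uniq (c : 'I_m -> P) : (forall i, PX L n (c i)) -> \sum_i u i *: c i = 0 ->
    \sum_i 'X_i * c i = 0 -> forall i, c i = 0.
  move=> hc e1 e2; have [j hj] := hdl0; pose g := (dl j)^-1 *: c j.
  have hg i : c i = dl i *: g.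
    apply/mpolyP => a; have [||b hb h] := @linear_relation (fun i => (c i)@_a).
    - by move=> l; have [] := hc l a.
    - have := congr1 (mcoeff a) e1; rewrite mcoeff0 (raddf_sum (mcoeff a)) => h.
      by rewrite -[RHS]h; apply: eq_bigr => l _ /=; rewrite mcoeffZ mulrC.
    by rewrite !mcoeffZ (h j) mulKf.
  have h0 : ell * g = 0.
    rewrite -[RHS]e2 mulr_suml; apply: eq_bigr => i _.
    by rewrite hg -!mul_mpolyC; ring.
  move=> i; rewrite hg; move/eqP: h0; rewrite mulf_eq0 (negbTE ell_neq0) /= => /eqP ->.
  by rewrite scaler0.
have [j hj] := hdl0.
have [|N [c0 [hc0 e0 x0]]] := lift L j hL (fun _ h => h) hdlL _ hj.
  move=> w [[q hq ->] _]; exists 0%N; rewrite expr0 mul1r; by exists q.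
pose c i := (dl j ^+ N)^-1 *: c0 i.
have hN : dl j ^+ N != 0 by rewrite expf_neq0.
have hcL i : PX L n (c i).
  apply: (PXZ hLL) => //; apply: hLf.2; alg.
have ec : p = \sum_i u i *: c i.
  have -> : \sum_i u i *: c i = (dl j ^+ N)^-1 *: \sum_i u i *: c0 i.
    by rewrite scaler_sumr; apply: eq_bigr => i _; rewrite !scalerA mulrC.
  by rewrite -e0 scalerA mulVf // scale1r.
have xc : \sum_i 'X_i * c i = 0.
  have -> : \sum_i 'X_i * c i = (dl j ^+ N)^-1 *: \sum_i 'X_i * c0 i.
    by rewrite scaler_sumr; apply: eq_bigr => i _; rewrite scalerAr.
  by rewrite x0 scaler0.
exists c; split=> // i a; split; last by have [] := hcL i a.
apply: hdep; first by have [] := hcL i a.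
move=> l; have [e|hl] := eqVneq (dl l) 0.
  exists 1%N; rewrite e expr1 mul0r; alg.
have [|M [d [hd ed xd]]] := lift C l hC hCL hdl _ hl.
  by move=> w; exact: Wn_away.
exists M; suff e : dl l ^+ M *: c i = d i by rewrite -mcoeffZ e; have [] := hd i a.
apply/eqP; rewrite -subr_eq0; apply/eqP.
apply: (uniq (fun i => dl l ^+ M *: c i - d i)).
- move=> k; apply: (PXB hL hLL) => //; last exact: PXS hCL _ (hd k).
  apply: (PXZ hLL) => //; alg.
- transitivity (dl l ^+ M *: (\sum_i u i *: c i) - \sum_i u i *: d i).
    rewrite scaler_sumr -sumrN -big_split /=; apply: eq_bigr => k _.
    by rewrite scalerBr !scalerA [u k * _]mulrC.
  by rewrite -ec ed subrr.
- transitivity (dl l ^+ M *: (\sum_i 'X_i * c i) - \sum_i 'X_i * d i).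
    rewrite scaler_sumr -sumrN -big_split /=; apply: eq_bigr => k _.
    by rewrite mulrBr scalerAr.
  by rewrite xc xd scaler0 subrr.
Qed.

Definition generated C := forall n, Wn C n.+2 `<=` lc (Wn C n.+1) (us u).

Lemma generatedE C n : subring C -> C `<=` L -> generated C -> Wn C n.+1 = Un u (Wn C 1) n.
Proof.
move=> hC hCL hg; have hW k := sm_Wn k hC hCL.
elim: n => [|n IH]; first by rewrite (Un0 u (hW 1%N)).
rewrite (UnS u n (hW 1%N)) -IH eqEsubset; split; first exact: hg.
exact: Wn_mul.
Qed.

(** Writing the [x k] as values of forms [p k] over the degree one part turns the relation into a
    form vanishing at [u]. [linear_syzygy] replaces it by forms over [C], and the exactness for the
    variables can then be applied. *)
Theorem koszul C n (J : pred 'I_m) (x : 'I_m -> K) : chart C -> generated C ->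
  (J =1 predT \/ exists2 j, ~~ J j & dl j != 0) ->
  (forall k, Wn C n.+1 (x k)) -> \sum_(k | J k) u k * x k = 0 ->
  exists w : 'I_m -> 'I_m -> K, [/\ forall k l, Wn C n (w k l),
    forall k l, w k l = - w l k, forall k, w k k = 0 & forall k, J k -> x k = \sum_(l | J l) u l * w k l].
Proof.
move=> hch hg hJ hx ex; have [hnC hdl hdep] := hch; have [hC hCL _ _ _] := hnC.
have hCC := sm_self hC; have hW k := sm_Wn k hC hCL.
have /choice[p hp] : forall k, exists p : P, PX (Wn C 1) n p /\ x k = p.@[u].
  by move=> k; have := hx k; rewrite (generatedE n hC hCL hg) => -[p hp ->]; exists p.
pose q := \sum_(k | J k) 'X_k * p k.
have hq : PX (Wn C 1) n.+1 q.
  by apply: PX_sum => // k _; apply: (PX_X _ (n := n.+1) (hW 1%N)); exact: (hp k).1.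
have eq : q.@[u] = 0.
  rewrite raddf_sum -[RHS]ex; apply: eq_bigr => k _ /=.
  by rewrite mevalM mevalXU (hp k).2.
have [c [hc ec xc]] := linear_syzygy hch hq eq.
have /choice[c0 hc0] : forall i, exists r : P * ('I_m -> P),
    [/\ PX C n.+1 r.1, freeof J r.1, forall k, PX C n (r.2 k) &
      c i = r.1 + \sum_(k | J k) 'X_k * r.2 k].
  move=> i; have [r [g [h1 h2 h3 h4]]] := split_form J hCC (hc i).
  by exists (r, g).
pose f i := (c0 i).1; pose g i := (c0 i).2.
have hf i : PX C n.+1 (f i) by have [] := hc0 i.
have hfJ i : freeof J (f i) by have [] := hc0 i.
have hgP i k : PX C n (g i k) by have [_ _ h _] := hc0 i; exact: h.
have ecf i : c i = f i + \sum_(k | J k) 'X_k * g i k by have [] := hc0 i.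
have ef : \sum_i u i *: f i = 0.
  apply: (@split_zero _ _ J _ (fun k => \sum_i u i *: g i k - p k)).
    by apply: freeof_sum => i _; exact: freeofZ.
  transitivity (\sum_i u i *: c i - q); last by rewrite -ec subrr.
  transitivity (\sum_i u i *: f i + (\sum_i \sum_(k | J k) u i *: ('X_k * g i k) - q)).
    congr (_ + _); rewrite exchange_big -sumrN -big_split /=; apply: eq_bigr => k _.
    rewrite mulrBr mulr_sumr; congr (_ - _); apply: eq_bigr => i _.
    by rewrite scalerAr.
  rewrite addrA -big_split /=; congr (_ - _); apply: eq_bigr => i _.
  by rewrite ecf scalerDr scaler_sumr.
(* If [J] is everything, a form of positive degree free of all variables is zero. Otherwise [f] is
   proportional to [dl], say to [dl] times [b], and [b] is killed by a linear form in the variables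
   outside [J] which is nonzero at the missing index. *)
have f0 i : f i = 0.
  have [hall|[j hjJ hj]] := hJ.
    apply/mpolyP => a; rewrite mcoeff0.
    have [ha|/(hf i a).2 //] := eqVneq (mdeg a) n.+1.
    have [k hk] : exists k, (0 < a k)%N.
      apply/existsP; apply: contraLR (_ : (0 < mdeg a)%N); last by rewrite ha.
      rewrite negb_exists => /forallP h; rewrite -leqNgt leqn0 mdegE big1 // => k _.
      by apply/eqP; rewrite -leqn0 leqNgt.
    by apply: (hfJ i a k).
  pose b := (dl j)^-1 *: f j.
  have hb k : f k = dl k *: b.
    apply/mpolyP => a; have [||e he h] := @linear_relation (fun i => (f i)@_a).
    - by move=> l; apply: hCL; have [] := hf l a.
    - have := congr1 (mcoeff a) ef; rewrite mcoeff0 (raddf_sum (mcoeff a)) => h.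
      by rewrite -[RHS]h; apply: eq_bigr => l _ /=; rewrite mcoeffZ mulrC.
    by rewrite !mcoeffZ (h j) mulKf.
  have hbJ : freeof J b by exact: freeofZ.
  have e1 : (\sum_(k | ~~ J k) dl k *: 'X_k) * b = 0.
    apply: (@split_zero _ _ J _ (fun k => f k + \sum_i 'X_i * g i k)).
      rewrite mulr_suml; apply: freeof_sum => k hk.
      by rewrite -scalerAl; apply: freeofZ; exact: freeofX.
    have q1 : \sum_(k | J k) 'X_k * (f k + \sum_i 'X_i * g i k) =
        \sum_(k | J k) 'X_k * f k + \sum_i \sum_(k | J k) 'X_i * ('X_k * g i k).
      rewrite [in RHS]exchange_big -big_split /=; apply: eq_bigr => k _.
      by rewrite mulrDr mulr_sumr; congr (_ + _); apply: eq_bigr => l _; rewrite mulrCA.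
    have q2 : (\sum_(k | ~~ J k) dl k *: 'X_k) * b = \sum_(k | ~~ J k) 'X_k * f k.
      rewrite mulr_suml; apply: eq_bigr => k _; rewrite hb -!mul_mpolyC; ring.
    rewrite q1 q2 addrA [X in X + _]addrC -(bigID J predT) /= -[RHS]xc -big_split /=.
    by apply: eq_bigr => l _; rewrite ecf mulrDr mulr_sumr.
  rewrite hb; move/eqP: e1; rewrite mulf_eq0 => /orP[/eqP e1|/eqP ->]; last by rewrite scaler0.
  have := congr1 (mcoeff U_(j)) e1; rewrite mcoeff0 (raddf_sum (mcoeff U_(j))) /=.
  rewrite (bigD1 j) //= mcoeffZ mcoeffX eqxx mulr1 big1 ?addr0 => [/eqP|k /andP[_ hk]].
    by rewrite (negbTE hj).
  rewrite mcoeffZ mcoeffX; case: eqP => [e'|_]; last by rewrite mulr0.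
  by have := congr1 (fun a : 'X_{1..m} => a j) e'; rewrite !mnm1E eqxx (negbTE hk).
(* [e] and the differences [p k - p' k] satisfy separate Koszul relations, over [C] and over the
   degree one part. As [e k] and [p' k] have the same value at [u], the two families of cofactors
   add up to one for [x]. *)
pose e k := \sum_i 'X_i * g i k.
have [||h [h1 h2 h3 _ h4]] := @koszul_poly K C m hC C n.+1 J e hCC.
- by move=> k; apply: (PX_sum _ hCC) => l _; exact: (PX_X (n := n.+1) l hCC (hgP l k)).
- rewrite -[RHS]xc; transitivity (\sum_i \sum_(k | J k) 'X_i * ('X_k * g i k)).
    rewrite exchange_big /=; apply: eq_bigr => k _; rewrite mulr_sumr.
    by apply: eq_bigr => i _; ring.
  by apply: eq_bigr => i _; rewrite ecf f0 add0r mulr_sumr.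
have hu1 i : Wn C 1 (u i).
  apply: Un_Wn => //; rewrite (UnS u 0 hCC) (Un0 u hCC).
  by apply: lc_gen => //; exact: mem_us.
pose p' k := \sum_i u i *: g i k.
have hp' k : PX (Wn C 1) n (p' k) by apply: (PX_sum _ (hW 1%N)) => l _; exact: (PXZr (hW 1%N) (hu1 l) (hgP l k)).
have [||d [d1 d2 d3 _ d4]] := @koszul_poly K C m hC (Wn C 1) n J (fun k => p k - p' k) (hW 1%N).
- by move=> k; exact: (PXB hC (hW 1%N) (hp k).1 (hp' k)).
- have -> : \sum_(k | J k) 'X_k * (p k - p' k) = q - \sum_i u i *: c i.
    transitivity (q - \sum_(k | J k) 'X_k * p' k).
      by rewrite -sumrN -big_split; apply: eq_bigr => k _; rewrite mulrBr.
    congr (_ - _); transitivity (\sum_i \sum_(k | J k) u i *: ('X_k * g i k)).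
      rewrite exchange_big /=; apply: eq_bigr => k _; rewrite mulr_sumr.
      by apply: eq_bigr => i _; rewrite scalerAr.
    by apply: eq_bigr => i _; rewrite ecf f0 add0r scaler_sumr.
  by rewrite -ec subrr.
exists (fun k l => (h k l + d k l).@[u]); split.
- move=> k l; rewrite mevalD; apply: (smD (hW n)).
    by apply: Un_Wn => //; exists (h k l) => //; exact: h1.
  suff hev N q' : PXp (Wn C 1) N q' -> Wn C N q'.@[u] by exact: hev (d1 k l).
  case: N => [->|N hd]; first by rewrite meval0; alg.
  by rewrite (generatedE N hC hCL hg); exists q'.
- by move=> k l; rewrite h2 d2 -mevalN opprD.
- by move=> k; rewrite h3 d3 addr0 meval0.
- move=> k hk; rewrite (hp k).2 -[p k](subrK (p' k)) d4 // mevalD addrC.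
  have -> : (p' k).@[u] = (e k).@[u].
    by rewrite !raddf_sum; apply: eq_bigr => i _ /=; rewrite mevalZ mevalM mevalXU.
  rewrite h4 // !raddf_sum -big_split /=; apply: eq_bigr => l _.
  by rewrite !mevalM !mevalXU mevalD mulrDr.
Qed.

End Relation.

(** * Two-dimensional regular local rings and their blow-ups *)

Section PolyDiv.
Variables (K : fieldType) (O : set K).
Hypothesis hO : subring O.
Implicit Types p q : {poly K}.

Lemma coefs_lead q : coefs_in O q ->
  coefs_in O (q - lead_coef q *: 'X^((size q).-1)) /\
  (size (q - lead_coef q *: 'X^((size q).-1))%R <= (size q).-1)%N.
Proof.
move=> hq; split=> [i|].
  rewrite coefB coefZ coefXn; apply: srB => //; apply: srM => //; first exact: hq.
  alg.
apply/leq_sizeP => j hj; rewrite coefB coefZ coefXn.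
have [->|h] := eqVneq j (size q).-1; first by rewrite mulr1 subrr.
rewrite mulr0 subr0 nth_default //; move: h hj; case: (size q) => [|s] //=.
by rewrite leq_eqVlt eq_sym => /negbTE ->.
Qed.

Lemma poly_div_unit p q : coefs_in O p -> coefs_in O q -> p != 0 -> O (lead_coef p)^-1 ->
  exists h r, [/\ coefs_in O h, coefs_in O r, (size r < size p)%N & q = h * p + r].
Proof.
move=> hp hq p0 hlp; have hc := sr_coefs hO.
have [s] := ubnP (size q); elim: s q hq => // s IH q hq hs.
have [hlt|hge] := ltnP (size q) (size p).
  by exists 0, q; split=> //; [alg|rewrite mul0r add0r].
have sp : (0 < size p)%N by rewrite size_poly_gt0.
have sq : (0 < size q)%N by exact: leq_trans hge.
pose c := lead_coef q / lead_coef p; pose X := c *: 'X^(size q - size p) : {poly K}.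
have hc' : O c by apply: srM => //; exact: hq.
have hX : coefs_in O X.
  move=> i; rewrite coefZ coefXn; alg.
have hd : (size (q - X * p)%R < s)%N.
  rewrite ltnS in hs; apply: leq_trans hs; rewrite -(prednK sq) ltnS.
  apply/leq_sizeP => j hj; rewrite coefB -scalerAl coefZ [_ * p]mulrC coefMXn.
  have hjd : (j < size q - size p)%N = false.
    apply/negbTE; rewrite -leqNgt; apply: leq_trans hj; rewrite -subn1.
    exact: leq_sub2l.
  rewrite hjd; have [->|hne] := eqVneq j (size q).-1.
    have -> : ((size q).-1 - (size q - size p))%N = (size p).-1.
      by lia.
    by rewrite divfK ?subrr ?lead_coef_eq0.
  have hj' : (size q <= j)%N by lia.
  have aux (s1 s2 i : nat) : (s1 <= s2 -> s2 <= i -> s1 <= i - (s2 - s1))%N by lia.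
  by rewrite (nth_default _ (aux _ _ _ hge hj')) (nth_default _ hj') mulr0 subrr.
have [h [r [h1 h2 h3 h4]]] := IH _ (srB hc hq (srM hc hX hp)) hd.
exists (h + X), r; split=> //; first exact: (srD hc).
by rewrite mulrDl addrAC -h4 subrK.
Qed.

End PolyDiv.

Section TwoGenerators.
Variables (K : fieldType) (O n : set K) (a b : K).
Hypothesis hO : subring O.
Hypothesis hN : noethm O O.
Hypothesis hl : is_local O n.
Hypothesis en : n = lc O [:: a; b].
Let hOO := sm_self hO.
Let nb : n b. Proof. rewrite en; alg. Qed.
Let Ob : O b. Proof. alg. Qed.
Let saO := sm_scm a hOO.

Lemma two_gen x : n x -> exists v w, [/\ O v, O w & x = a * v + b * w].
Proof.
rewrite en; suff h : lc O [:: a; b] `<=` [set x | exists v w, [/\ O v, O w & x = a * v + b * w]].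
  exact: h.
have hS : submodule O [set x | exists v w, [/\ O v, O w & x = a * v + b * w]].
  split.
  - exists 0, 0; split; rewrite ?mulr0 ?addr0 //; alg.
  - move=> _ _ [v [w [h1 h2 ->]]] [v' [w' [h3 h4 ->]]]; exists (v + v'), (w + w').
    by split; [alg|alg|ring].
  - move=> c _ hc [v [w [h1 h2 ->]]]; exists (c * v), (c * w).
    by split; [alg|alg|ring].
apply: (lc_min hS) => x' y; rewrite !inE => /orP[/eqP ->|/eqP ->] hy.
  exists y, 0; split; rewrite ?mulr0 ?addr0 //; alg.
exists 0, y; split; rewrite ?mulr0 ?add0r //; alg.
Qed.

(** If there were no expansion, every cofactor along the powers of [b] would lie in [n], and [x]
    would lie in aO plus each power of [b], hence in aO. *)
Lemma two_gen_expand x : O x -> ~ scm a O x ->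
  exists t c g, [/\ O c, ~ n c, O g & x = c * b ^+ t + a * g].
Proof.
move=> hx hax; apply: contrapT => hno; apply: hax.
have hfg := hN hOO (fun _ h => h).
apply: (krull_intersection hO hN hl hfg saO nb hx).
elim=> [|t [v hv [g hg e]]]; first by exists x => //; rewrite expr0 mul1r
subrr; alg.
have hnv : n v.
  apply: contrapT => hnv; apply: hno; exists t, v, g; split=> //.
  by rewrite -e mulrC addrC subrK.
have [v1 [v2 [h1 h2 ev]]] := two_gen hnv; exists v2 => //.
exists (g + b ^+ t * v1).
  alg.
by rewrite mulrDr -e ev exprS; ring.
Qed.

End TwoGenerators.

Section Reg2.
Variables (K : fieldType) (O n : set K) (a b : K).

(** Regularity in dimension two as a regular sequence generating the maximal ideal, a form that
    [blow_fiber] checks at points of the blow-up without computing dimensions. *)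
Definition reg2 := [/\ subring O, noethm O O, is_local O n, n = lc O [:: a; b] &
  a != 0 /\ forall x, O x -> scm a O (b * x) -> scm a O x].

Hypothesis hr : reg2.
Lemma reg2_ring : subring O. Proof. by case: hr. Qed.
Lemma reg2_noeth : noethm O O. Proof. by case: hr. Qed.
Lemma reg2_local : is_local O n. Proof. by case: hr. Qed.
Lemma reg2_gens : n = lc O [:: a; b]. Proof. by case: hr. Qed.
Lemma reg2_neq0 : a != 0. Proof. by case: hr => _ _ _ _ []. Qed.
Lemma reg2_sub : n `<=` O. Proof. exact: ideal_sub (local_ideal reg2_local). Qed.
Lemma reg2_l : n a. Proof. case: hr => hO _ _ ->; alg. Qed.
Lemma reg2_r : n b. Proof. case: hr => hO _ _ ->; alg. Qed.
Let hO := reg2_ring.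
Let hN := reg2_noeth.
Let hl := reg2_local.
Let en := reg2_gens.
Let a0 := reg2_neq0.
Let snO := reg2_sub.
Let na := reg2_l.
Let nb := reg2_r.
Let hreg x : O x -> scm a O (b * x) -> scm a O x.
Proof. by case: hr => _ _ _ _ [_]; apply. Qed.
Let hOO := sm_self hO.
Let sn : submodule O n. Proof. alg. Qed.
Let n1 : ~ n 1. Proof. exact: local_proper hl. Qed.
Let Oa : O a := snO na.
Let Ob : O b := snO nb.
Let saO := sm_scm a hOO.
Let aOO x : scm a O x -> O x. Proof. exact: (scm_sub Oa hOO). Qed.
Let aOn x : scm a O x -> n x.
Proof. case=> z hz ->; alg. Qed.

Lemma reg2_n x : n x -> exists v w, [/\ O v, O w & x = a * v + b * w].
Proof. by exact: two_gen. Qed.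

Lemma local_inv c : O c -> ~ n c -> O c^-1.
Proof.
move=> hc hnc; have [d hd e] := local_unit hO hN hl hc hnc.
suff -> : c^-1 = d by [].
have c0 : c != 0 by apply: contra_notN hnc => /eqP ->; alg.
by apply: (mulfI c0); rewrite mulfV.
Qed.

Lemma nonmem_neq0 c : ~ n c -> c != 0.
Proof. apply: contra_notN => /eqP ->; alg. Qed.

Lemma reg_pow k x : O x -> scm a O (b ^+ k * x) -> scm a O x.
Proof.
elim: k => [|k IH] hx; first by rewrite mul1r.
rewrite exprS -mulrA => /hreg h; apply: IH => //; apply: h; alg.
Qed.

(* [O/aO] is a discrete valuation ring with parameter [b]. *)
Lemma reg2_expand x : O x -> ~ scm a O x ->
  exists t c g, [/\ O c, ~ n c, O g & x = c * b ^+ t + a * g].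
Proof. by exact: two_gen_expand. Qed.

Lemma reg2_prime x y : O x -> O y -> scm a O (x * y) -> scm a O x \/ scm a O y.
Proof.
move=> hx hy h; apply: contrapT => /not_orP[nx ny].
have [t [c [g [hc hnc hg ex]]]] := reg2_expand hx nx.
have [t' [c' [g' [hc' hnc' hg' ey]]]] := reg2_expand hy ny.
have [_ _ hp] := local_prime hO hN hl.
have hcc : ~ n (c * c') by move=> /(hp _ _ hc hc') [].
apply: hcc; apply/aOn/(@reg_pow (t + t')); first exact: srM.
have -> : b ^+ (t + t') * (c * c') = x * y - a * (g * y + c * b ^+ t * g').
  by rewrite ey ex exprD; ring.
apply: (smB hO saO) => //; exists (g * y + c * b ^+ t * g') => //.

alg.
Qed.

Lemma reg2_adic x : O x -> x != 0 -> exists e x', [/\ O x', ~ scm a O x' & x = a ^+ e * x'].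
Proof.
move=> hx x0; apply: contrapT => hno; move/eqP: x0; apply.
have hfg := hN hOO (fun _ h => h).
apply: (krull_intersection hO hN hl hfg (sm_zero O) na hx).
elim=> [|t [v hv /eqP]]; first by exists x => //; rewrite mul1r subrr.
rewrite subr_eq0 => /eqP e.
have [v' hv' ev] : scm a O v by apply: contrapT => h; apply: hno; exists t, v.
by exists v' => //; rewrite e ev exprSr mulrA subrr.
Qed.

Lemma a_notin1 : ~ scm a O 1.
Proof. by move/aOn. Qed.

Lemma reg2_primeX k x : O x -> ~ scm a O x -> ~ scm a O (x ^+ k).
Proof.
move=> hx h; elim: k => [|k IH]; first by exact: a_notin1.
by rewrite exprS => /(reg2_prime hx (srX k hO hx)) [].
Qed.

Lemma reg2_primeXl e x y : O x -> O y -> ~ scm a O x -> scm (a ^+ e) O (x * y) -> scm (a ^+ e) O y.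
Proof.
move=> hx hy hax; elim: e y hy => [|e IH] y hy; first by exists y; rewrite
?mul1r.
case=> z hz ez.
have [//|[y' hy' ey]] : scm a O x \/ scm a O y.
  apply: reg2_prime => //; rewrite ez exprS -mulrA; exists (a ^+ e * z) => //.
  alg.
have [|z' hz' ez'] := IH _ hy'.
  exists z => //; by apply: (mulfI a0); rewrite mulrCA -ey ez exprS mulrA.
by exists z' => //; rewrite ey ez' mulrA -exprS.
Qed.

(** Complete integral closedness, by comparing orders: first along [a], then along [b] in the
    discrete valuation ring O/aO. This yields [p] modulo [a], and an iteration with Krull's
    intersection theorem finishes. *)
Lemma reg2_quot c p q : O c -> O p -> O q -> c != 0 -> q != 0 ->
  (forall k, scm (q ^+ k) O (c * p ^+ k)) -> scm q O p.
Proof.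
move=> hc0 hp0 hq0 c0 q0 h0.
have [f [c' [hc hac ec]]] := reg2_adic hc0 c0.
have [e [q' [hq haq eq]]] := reg2_adic hq0 q0.
have q'0 : q' != 0 by apply: contraNneq q0 => e'; rewrite eq e' mulr0.
(* The factors [a] are split off from [c] and [q]; it suffices to treat [c'] and [q'], which [a]
   does not divide. *)
suff main p' : O p' -> (forall k, scm (q' ^+ k) O (c' * p' ^+ k)) -> scm q' O p'.
  have hae : scm (a ^+ e) O p.
    have [->|p0] := eqVneq p 0; first exact: sm0 (sm_scm _ hOO).
    have [s [p1 [hp1 hap1 ep1]]] := reg2_adic hp0 p0.
    have [hes|hse] := leqP e s.
      exists (a ^+ (s - e) * p1); first alg.
      by rewrite mulrA -exprD subnKC.
    (* If the order [s] of [p] along [a] were less than the order [e] of [q], then at exponent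
       [f.+1] the order [f + s * f.+1] of the left side would be less than [e * f.+1]. *)
    have [z hz ez] := h0 f.+1; exfalso.
    have h1 : scm a O (c' * p1 ^+ f.+1).
      exists (a ^+ ((e - s) * f.+1 - f.+1) * q' ^+ f.+1 * z).
        alg.
      have ha : a ^+ (f + s * f.+1) != 0 by rewrite expf_neq0.
      apply: (mulfI ha); move: ez; rewrite ec ep1 eq !exprMn -!exprM => ez.
      transitivity (a ^+ f * c' * (a ^+ (s * f.+1) * p1 ^+ f.+1)); first by rewrite exprD; ring.
      rewrite ez.
      have -> : (e * f.+1 = (f + s * f.+1) + 1 + ((e - s) * f.+1 - f.+1))%N.
        have : (f.+1 <= (e - s) * f.+1)%N by rewrite leq_pmull // subn_gt0.
        have : (e * f.+1 = (e - s) * f.+1 + s * f.+1)%N by rewrite -mulnDl subnK // ltnW.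
        by lia.
      by rewrite !exprD; ring.
    by have [//|] := reg2_prime hc (srX f.+1 hO hp1) h1; exact: reg2_primeX.
  case: hae => p' hp' ep'; have [k|z hz ez] := main p' hp'; last first.
    by exists z => //; rewrite ep' ez eq mulrA.
  have [z hz ez] := h0 k.
  have h1 : scm (a ^+ f) O (q' ^+ k * z).
    exists (c' * p' ^+ k); first alg.
    have ha : a ^+ (e * k) != 0 by rewrite expf_neq0.
    apply: (mulfI ha); move: ez; rewrite ec ep' eq !exprMn -!exprM => ez.
    by rewrite mulrA -ez; ring.
  have [z' hz' ez'] := reg2_primeXl (srX k hO hq) hz (reg2_primeX hq haq) h1.
  exists z' => //; have ha : a ^+ (f + e * k) != 0 by rewrite expf_neq0.
  apply: (mulfI ha); move: ez; rewrite ec ep' eq !exprMn -!exprM ez' exprD => ez.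
  transitivity (a ^+ f * c' * (a ^+ (e * k) * p' ^+ k)); first by ring.
  by rewrite ez; ring.
(* Modulo [a] the element [w0] is a multiple of [q']; the remainder divided by [a] inherits the
   hypothesis, by the binomial expansion of the powers of [w0 - q' * y]. *)
have step w0 : O w0 -> (forall k, scm (q' ^+ k) O (c' * w0 ^+ k)) ->
    exists y w1, [/\ O y, O w1, w0 = q' * y + a * w1 &
      forall k, scm (q' ^+ k) O (c' * w1 ^+ k)].
  move=> hw0 hk.
  have [y [w1 [hy hw1 e1]]] : exists y w1, [/\ O y, O w1 & w0 = q' * y + a * w1].
    have [[g hg eg]|hap] := pselect (scm a O w0).
      exists 0, g; split; rewrite ?mulr0 ?add0r //; alg.
    have [t [d [g [hd hnd hg ex]]]] := reg2_expand hw0 hap.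
    have [w [d1 [g1 [hd1 hnd1 hg1 ec1]]]] := reg2_expand hc hac.
    have [s [d2 [g2 [hd2 hnd2 hg2 eq2]]]] := reg2_expand hq haq.
    have hi2 := local_inv hd2 hnd2; have d20 := nonmem_neq0 hnd2.
    have [hst|hts] := leqP s t.
      exists (d / d2 * b ^+ (t - s)), (g - d / d2 * b ^+ (t - s) * g2); split.
      - alg.
      - apply: srB => //; apply: srM => //; apply: srM => //; [alg|alg].
      - have eb : b ^+ t = b ^+ s * b ^+ (t - s) by rewrite -exprD subnKC.
        rewrite ex eq2 eb -[d in LHS](divfK d20); ring.
    (* The same comparison along [b] in O/aO, where [w], [t] and [s] are the orders of [c'], [w0]
       and [q']. *)
    have [z hz ez] := hk w.+1; exfalso.
    have hmod : scm a O (b ^+ (w + t * w.+1) * (d1 * d ^+ w.+1 - d2 ^+ w.+1 * z * b ^+ (s * w.+1 - (w + t * w.+1)))).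
      have eqm (x y : K) m : O x -> O y -> scm a O (x - y) -> scm a O (x ^+ m - y ^+ m).
        move=> hx hy hxy; rewrite subrXX mulrC; alg.
      have h1 : scm a O (w0 ^+ w.+1 - (d * b ^+ t) ^+ w.+1).
        apply: eqm => //; first alg.
        by exists g => //; rewrite ex addrAC subrr add0r.
      have h2 : scm a O (q' ^+ w.+1 - (d2 * b ^+ s) ^+ w.+1).
        apply: eqm => //; first alg.
        by exists g2 => //; rewrite eq2 addrAC subrr add0r.
      have -> : b ^+ (w + t * w.+1) * (d1 * d ^+ w.+1 - d2 ^+ w.+1 * z * b ^+ (s * w.+1 - (w + t * w.+1))) =
          z * (q' ^+ w.+1 - (d2 * b ^+ s) ^+ w.+1) - d1 * b ^+ w * (w0 ^+ w.+1 - (d * b ^+ t) ^+ w.+1)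
          - w0 ^+ w.+1 * (a * g1).
        have hle : (w + t * w.+1 <= s * w.+1)%N.
          have : (t.+1 * w.+1 <= s * w.+1)%N by rewrite leq_pmul2r.
          by lia.
        have eb : b ^+ (s * w.+1) = b ^+ (w + t * w.+1) * b ^+ (s * w.+1 - (w + t * w.+1)).
          by rewrite -exprD subnKC.
        have -> : z * (q' ^+ w.+1 - (d2 * b ^+ s) ^+ w.+1) =
            (d1 * b ^+ w + a * g1) * w0 ^+ w.+1 - z * (d2 * b ^+ s) ^+ w.+1.
          by rewrite -ec1 ez mulrBr; rewrite mulrC.
        rewrite !exprMn -!exprM eb exprD; ring.
      apply: (smB hO saO); last first.
        apply: (smZ saO); [alg|by exists g1].

      alg.
    have hno : ~ n (d1 * d ^+ w.+1 - d2 ^+ w.+1 * z * b ^+ (s * w.+1 - (w + t * w.+1))).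
      have [_ _ hp] := local_prime hO hN hl.
      have hX k : ~ n (d ^+ k).
        by elim: k => [|k IH]; rewrite // exprS => /(hp _ _ hd (srX k hO hd))
        [].
      have hlt : (0 < s * w.+1 - (w + t * w.+1))%N.
        have : (t.+1 * w.+1 <= s * w.+1)%N by rewrite leq_pmul2r.
        by lia.
      move=> hh; have : n (d1 * d ^+ w.+1).
        rewrite -[X in n X](subrK (d2 ^+ w.+1 * z * b ^+ (s * w.+1 - (w + t * w.+1)))).
        apply: (smD sn) => //; rewrite -(prednK hlt) [b ^+ _]exprSr mulrA; alg.
      by move/(hp _ _ hd1 (srX _ hO hd)) => [//|]; exact: hX.
    apply/hno/aOn/(reg_pow _ hmod).

    alg.
  exists y, w1; split=> // k.
  have h1 : scm (q' ^+ k) O (c' * (w0 - q' * y) ^+ k).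
    rewrite exprBn mulr_sumr; apply: (sm_sum (sm_scm _ hOO)) => i _.
    have [z hz ez] := hk (k - i)%N; exists ((-1) ^+ i * z * y ^+ i *+ 'C(k, i)).
      rewrite -mulr_natr; apply: srM => //; alg.
    have -> : q' ^+ k = q' ^+ (k - i) * q' ^+ i by rewrite -exprD subnK // -ltnS.
    rewrite exprMn.
    transitivity (c' * w0 ^+ (k - i) * (((-1) ^+ i * (q' ^+ i * y ^+ i)) *+ 'C(k, i))); last by rewrite ez; ring.
    by ring.
  case: h1 => z hz ez.
  have e2 : w0 - q' * y = a * w1 by rewrite e1 addrAC subrr add0r.
  have [|z' hz' ez'] := reg2_primeXl (e := k) (srX k hO hq) hz (reg2_primeX hq haq).
    exists (c' * w1 ^+ k); first alg.
    by rewrite -ez e2 exprMn; ring.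
  exists z' => //; have ha : a ^+ k != 0 by rewrite expf_neq0.
  by apply: (mulfI ha); move: ez; rewrite e2 exprMn ez' => ez; rewrite mulrCA ez; ring.
move=> hp' hk.
have hfg := hN hOO (fun _ h => h).
apply: (krull_intersection hO hN hl hfg (sm_scm q' hOO) na hp') => k.
suff [v [hv h _]] : exists v, [/\ O v, scm q' O (p' - a ^+ k * v) &
    forall k, scm (q' ^+ k) O (c' * v ^+ k)] by exists v.
elim: k => [|k [v [hv [g hg eg] hvk]]].
  by exists p'; split=> //; rewrite mul1r subrr; exact: sm0 (sm_scm _ hOO).
have [y [v' [hy hv' ev hv'k]]] := step v hv hvk; exists v'; split=> //.
exists (g + a ^+ k * y); first alg.
by rewrite mulrDr -eg ev exprSr; ring.
Qed.

Lemma reg2_icl L : isfield L -> O `<=` L -> fractions L O -> icl L O.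
Proof.
move=> [hL hLV] hOL hf x hx hint; have [q [hq q0 hqx]] := hf x hx.
have [M M0 [c [hc e]]] := int_pow hO hint.
have hall k : O (q ^+ M * x ^+ k).
  have [k'] := ubnP k; elim: k' k => // k' IH k hk.
  have [hkM|hMk] := ltnP k M.
    have -> : q ^+ M * x ^+ k = q ^+ (M - k) * (q * x) ^+ k.
      by rewrite exprMn mulrA -exprD subnK // ltnW.
    alg.
  have -> : k = (M + (k - M))%N by rewrite subnKC.
  rewrite exprD e mulr_suml mulr_sumr; apply: sr_sum => // i _.
  have -> : q ^+ M * (c i * x ^+ i * x ^+ (k - M)) = c i * (q ^+ M * x ^+ (i + (k - M))).
    by rewrite exprD; ring.
  apply: srM => //; apply: IH; apply: (leq_trans (n := k)); last by [].
  by rewrite -{2}(subnKC hMk) -addSn leq_add2r.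
have [||k|z hz ez] := @reg2_quot (q ^+ M) (q * x) q _ hqx hq _ q0.
- alg.
- by rewrite expf_neq0.
- by exists (q ^+ M * x ^+ k) => //; rewrite exprMn; ring.
by have -> : x = z by exact: (mulfI q0).
Qed.

Lemma reg2_glue i j x : O (a ^+ i * x) -> O (b ^+ j * x) -> O x.
Proof.
move=> h1 h2; elim: i h1 => [|i IH]; first by rewrite mul1r.
move=> h1; apply: IH; have [|z hz ez] := @reg_pow j _ h1.
  exists (a ^+ i * (b ^+ j * x)); first alg.
  by rewrite exprS; ring.
by have <- : z = a ^+ i * x by apply: (mulfI a0); rewrite -ez exprS mulrA.
Qed.

End Reg2.

Lemma reg2_sym (K : fieldType) (O n : set K) a b : reg2 O n a b -> reg2 O n b a.
Proof.
move=> hr; have [hO hN hl en [a0 hreg]] := hr; have hOO := sm_self hO.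
split=> //.
  by rewrite en; apply: (lc_perm hOO) => z; rewrite !inE orbC.
split.
  apply/eqP => b0; apply: (a_notin1 hr); apply: hreg; first exact: sr1.
  by rewrite b0 mul0r; exact: sm0 (sm_scm _ hOO).
move=> x hx [y hy e]; have [|z hz ez] := hreg y hy; first by exists x.
by exists z => //; apply: (mulfI a0); rewrite e ez; ring.
Qed.

(** * The chart O[b/a] of the blow-up *)

Section Blowup.
Variables (K : fieldType) (O n : set K) (a b : K).
Hypothesis hr : reg2 O n a b.
Implicit Types p q : {poly K}.
Let hO := reg2_ring hr.
Let hN := reg2_noeth hr.
Let hl := reg2_local hr.
Let en := reg2_gens hr.
Let a0 := reg2_neq0 hr.
Let hOO := sm_self hO.
Let snO := reg2_sub hr.
Let sn : submodule O n. Proof. alg. Qed.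
Let n1 : ~ n 1. Proof. exact: local_proper hl. Qed.
Let na := reg2_l hr.
Let nb := reg2_r hr.
Let Oa : O a := snO na.
Let Ob : O b := snO nb.
Let saO := sm_scm a hOO.
Let y := b / a.
Let O1 := adj O y.
Let hO1 : subring O1. Proof. exact: sr_adj. Qed.
Let hO11 := sm_self hO1.
Let hc := sr_coefs hO.
Let O1y : O1 y. Proof. exact: adj_gen. Qed.
Let OO1 : O `<=` O1. Proof. exact: sub_adj. Qed.
Let sa1 := sm_scm a hO11.
Let eb : b = a * y. Proof. by rewrite mulrC divfK. Qed.
Let np : prime_ideal O n. Proof. exact: local_prime. Qed.

Lemma blow_expand N p : (size p <= N.+1)%N ->
  a ^+ N * p.[y] = \sum_(i < N.+1) p`_i * b ^+ i * a ^+ (N - i).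
Proof.
move=> hs; rewrite (horner_coef_wide y hs) mulr_sumr; apply: eq_bigr => i _.
have -> : a ^+ N = a ^+ (N - i) * a ^+ i by rewrite -exprD subnK // -ltnS.
by rewrite [in RHS]eb [in RHS]exprMn; ring.
Qed.

(** [b ^+ N.+1] times the top coefficient lies in aO, so the coefficient does, [b] being regular
    modulo [a]. Since [a * y] is [b], the top term can be rewritten one degree lower, changing
    coefficients only by elements of [n]. *)
Lemma blow_step N p : coefs_in O p -> (size p <= N.+2)%N -> O (a ^+ N * p.[y]) ->
  exists p', [/\ coefs_in O p', (size p' <= N.+1)%N, p'.[y] = p.[y] & forall i, n (p - p')`_i].
Proof.
move=> hp hs h.
have e : b ^+ N.+1 * p`_N.+1 = a * (a ^+ N * p.[y] - \sum_(i < N.+1) p`_i * b ^+ i * a ^+ (N - i)).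
  rewrite mulrBr mulrA -exprS (blow_expand hs) big_ord_recr /= subnn expr0 mulr1.
  rewrite addrAC mulr_sumr -sumrB big1 ?add0r => [|i _]; first by rewrite mulrC.
  by rewrite subSn ?exprS; [ring|rewrite -ltnS].
have [|c hc' ec] := @reg_pow _ _ _ _ _ hr N.+1 p`_N.+1 (hp _).
  exists (a ^+ N * p.[y] - \sum_(i < N.+1) p`_i * b ^+ i * a ^+ (N - i)) => //.

  alg.
have hX k c0 : O c0 -> coefs_in O (c0 *: 'X^k).
  move=> h0 i; rewrite coefZ coefXn; alg.
have hcb : O (c * b) by alg.
exists (p - p`_N.+1 *: 'X^(N.+1) + (c * b) *: 'X^N); split.
- by apply: (srD hc); [apply: (srB hc) => //|]; apply: hX.
- apply/leq_sizeP => j hj; rewrite coefD coefB !coefZ !coefXn.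
  have -> : (j == N) = false by apply/negbTE; rewrite neq_ltn hj orbT.
  have [->|hne] := eqVneq j N.+1; first by rewrite mulr1 mulr0 subrr addr0.
  by rewrite !mulr0 subr0 addr0 nth_default //; apply: leq_trans hs _; rewrite ltn_neqAle eq_sym hne.
- rewrite !hornerE ec [in X in _ + X]eb exprS; ring.
- move=> i; rewrite opprD opprB addrA addrCA subrr addr0 coefB !coefZ !coefXn.
  apply: (smB hO sn); rewrite mulrC; apply: (smZ sn); try exact: sr_nat.
    rewrite ec mulrC; alg.
  alg.
Qed.

Lemma blow_reduce N p : coefs_in O p -> O (a ^+ N * p.[y]) ->
  exists p', [/\ coefs_in O p', (size p' <= N.+1)%N, p'.[y] = p.[y] & forall i, n (p - p')`_i].
Proof.
have [s] := ubnP (size p); elim: s p => // s IH p hs hp h.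
have [hle|hlt] := leqP (size p) N.+1.
  exists p; split=> // i; rewrite subrr coef0; alg.
have e : size p = (size p).-2.+2 by move: hlt; case: (size p) => [|[]].
have [||p1 [h1 h2 h3 h4]] := @blow_step (size p).-2 p hp.
- by rewrite -e.
- have hle : (N <= (size p).-2)%N by move: hlt; rewrite e.
  have -> : a ^+ (size p).-2 = a ^+ ((size p).-2 - N) * a ^+ N by rewrite -exprD subnK.
  rewrite -mulrA; alg.
have [|//||p2 [h5 h6 h7 h8]] := IH p1.
- by apply: leq_ltn_trans h2 _; move: hs; rewrite {1}e.
- by rewrite h3.
exists p2; split=> //; first by rewrite h7.
move=> i; rewrite -(subrK p1 p) -addrA coefD; alg.
Qed.

(** This identifies O1/aO1 with the polynomial ring over the residue field: a polynomial with value
    zero at [y] reduces to zero by steps that change coefficients by elements of [n]. *)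
Lemma blow_coefs p : coefs_in O p -> scm a O1 p.[y] <-> forall i, n p`_i.
Proof.
move=> hp; split.
  case=> _ [q hq ->] e; have hd : coefs_in O (p - a *: q).
    apply: (srB hc) => // i; rewrite coefZ; alg.
  have e0 : (p - a *: q).[y] = 0 by rewrite !hornerE e subrr.
  have [|p' [h1 h2 h3 h4]] := @blow_reduce 0 _ hd; first by rewrite e0 mulr0;
  alg.
  have p'0 : p' = 0.
    rewrite e0 in h3; move: h3; rewrite (size1_polyC h2) hornerC => ->.
    alg.
  move=> i; rewrite -(subrK (a *: q) p) coefD coefZ; apply: (smD sn).
    by have := h4 i; rewrite p'0 subr0.
  alg.
move=> h; rewrite horner_coef; apply: (sm_sum sa1) => i _; rewrite mulrC; apply: (smZ sa1).
  alg.
have [v [w [hv hw ->]]] := reg2_n hr (h i); exists (v + y * w).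
  alg.
by rewrite eb; ring.
Qed.

Lemma blow_lead q : coefs_in O q -> exists p, [/\ coefs_in O p, (size p <= size q)%N,
  scm a O1 (q.[y] - p.[y]) & p = 0 \/ ~ n (lead_coef p)].
Proof.
have [s] := ubnP (size q); elim: s q => // s IH q hs hq.
have [->|q0] := eqVneq q 0; first by exists 0; split; [exact: sr0|by []|rewrite subrr; exact: sm0 sa1|left].
have [hn|hn] := pselect (n (lead_coef q)); last first.
  by exists q; split=> //; [rewrite subrr; exact: sm0 sa1|right].
have [h1 h2] := coefs_lead hO hq; set q' := q - _ in h1 h2.
have sq : (0 < size q)%N by rewrite size_poly_gt0.
have hlt : (size q' < size q)%N by rewrite -(prednK sq).
have [|//|p [h3 h4 h5 h6]] := IH q'; first exact: leq_trans hlt _.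
exists p; split=> //; first by apply: leq_trans h4 _; exact: ltnW.
have -> : q.[y] - p.[y] = (q'.[y] - p.[y]) + (q - q').[y] by rewrite (hornerD q (- q')) (hornerN q'); ring.
apply: (smD sa1) => //; apply/blow_coefs; first exact: (srB hc).
move=> i; rewrite opprB addrC subrK coefZ coefXn mulrC; apply: (smZ sn) => //; exact: sr_nat.
Qed.

Lemma blow_lead_notin p : coefs_in O p -> ~ n (lead_coef p) -> ~ scm a O1 p.[y].
Proof. by move=> hp h /(blow_coefs hp) /(_ (size p).-1). Qed.

Lemma blow_prime x z : O1 x -> O1 z -> scm a O1 (x * z) -> scm a O1 x \/ scm a O1 z.
Proof.
move=> [q hq ->] [q' hq' ->] h.
have [p [hp _ hqp [p0|hlp]]] := blow_lead hq.
  by left; move: hqp; rewrite p0 horner0 subr0.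
have [p' [hp' _ hqp' [p0|hlp']]] := blow_lead hq'.
  by right; move: hqp'; rewrite p0 horner0 subr0.
exfalso; apply: (@blow_lead_notin (p * p')); first exact: (srM hc).
  by rewrite lead_coefM; have [_ _ hP] := np; move=> /(hP _ _ (hp _) (hp' _)) [].
have hpO r : coefs_in O r -> O1 r.[y] by exists r.
rewrite hornerM.
have -> : p.[y] * p'.[y] = q.[y] * q'.[y] - q'.[y] * (q.[y] - p.[y]) - p.[y] * (q'.[y] - p'.[y]) by ring.
by apply: (smB hO1 sa1); [apply: (smB hO1 sa1) => //|]; apply: (smZ sa1) => //; exact: hpO.
Qed.

Lemma blow_1 : ~ scm a O1 1.
Proof.
rewrite -(hornerC 1 y); apply: blow_lead_notin; last by rewrite lead_coefC.
exact: (sr1 hc).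
Qed.

Lemma blow_y : ~ scm a O1 y.
Proof.
rewrite -(hornerX y); apply: blow_lead_notin; last by rewrite lead_coefX.
move=> i; rewrite coefX; alg.
Qed.

Lemma blow_primeX k x : O1 x -> ~ scm a O1 x -> ~ scm a O1 (x ^+ k).
Proof.
move=> hx h; elim: k => [|k IH]; first by exact: blow_1.
by rewrite exprS => /(blow_prime hx (srX k hO1 hx)) [].
Qed.

(** Inverting [a] gives a localization of the normal ring [O], so an integral element is multiplied
    into [O1] by a power of [a]. As aO1 is prime, an integral equation shows that the factors [a]
    cancel one by one. *)
Lemma blow_normal L : isfield L -> O `<=` L -> fractions L O -> normal_in L O1.
Proof.
move=> hL hOL hf; have [hLs hLV] := hL.
have hO1L : O1 `<=` L.
  by apply: (adj_min hLs hOL); apply: srM => //; [alg|apply: hLV; exact: hOL].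
split=> //; first exact: noeth_adj; last first.
  move=> x /hf[d [h1 h2 h3]]; exists d; split=> //; alg.
have hS := mset_pows hO Oa a0.
have hsub : O1 `<=` loc O (pows a).
  apply: (adj_min (loc_subring hO hS) (sub_loc hS)).
  by exists b, a; split=> //; exists 1%N.
move=> x hx hint.
have [w [_ [hw [N ->] ex]]] : loc O (pows a) x.
  apply: (icl_loc hLs hOL hO hS (reg2_icl hr hL hOL hf) hx).
  exact: int_mono hsub hint.
have : O1 (a ^+ N * x) by rewrite ex mulrC divfK ?expf_neq0 //; alg.
elim: N {ex} => [|N IH] h; first by rewrite expr0 mul1r in h.
apply: IH; set v := a ^+ N.+1 * x in h.
have [M M0 [c [hc1 e]]] := int_pow hO1 hint.
have [z hz ez] : scm a O1 v.
  apply: contrapT => hv; apply: (blow_primeX (k := M) h hv).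
  have -> : v ^+ M = \sum_(i < M) a * (a ^+ (N.+1 * (M - i)).-1 * (c i * v ^+ i)).
    rewrite /v exprMn -exprM e mulr_sumr; apply: eq_bigr => i _.
    have hi : (0 < N.+1 * (M - i))%N by rewrite muln_gt0 subn_gt0 ltn_ord.
    rewrite mulrA -exprS prednK // exprMn -exprM.
    have -> : a ^+ (N.+1 * M) = a ^+ (N.+1 * (M - i)) * a ^+ (N.+1 * i).
      by rewrite -exprD -mulnDr subnK // ltnW.
    by ring.
  apply: (sm_sum sa1) => i _; exists (a ^+ (N.+1 * (M - i)).-1 * (c i * v ^+ i)) => //.

  alg.
by have <- : z = a ^+ N * x by apply: (mulfI a0); rewrite -ez /v exprS mulrA.
Qed.

Lemma blow_contract N x : O x -> scm (a ^+ N) O1 x ->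
  exists p, [/\ coefs_in O p, (size p <= N.+1)%N & x = a ^+ N * p.[y]].
Proof.
move=> hx [_ [q hq ->] e]; have [|p [h1 h2 h3 _]] := @blow_reduce N _ hq.
  by rewrite -e.
by exists p; rewrite h3.
Qed.

(** An element of [O] divisible by [a ^+ (k + N)] in [O1] is a form of that degree in [a] and [b],
    so it lies in the ideal of [a ^+ N] and [b ^+ k]; two applications of Krull's intersection
    theorem give zero. *)
Lemma blow_separated x : O x -> (forall k, scm (a ^+ k) O1 x) -> x = 0.
Proof.
move=> hx h; have hfg := hN hOO (fun _ h => h).
apply: (krull_intersection hO hN hl hfg (sm_zero O) na hx) => N.
suff [z hz ez] : scm (a ^+ N) O x by exists z => //; rewrite ez subrr.
apply: (krull_intersection hO hN hl hfg (sm_scm (a ^+ N) hOO) nb hx) => k.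
have [p [hp hs ->]] := blow_contract hx (h (k + N)%N).
rewrite (blow_expand hs).
exists (\sum_(i < (k + N).+1 | (k <= i)%N) p`_i * b ^+ (i - k) * a ^+ (k + N - i)).

  alg.
rewrite (bigID (fun i : 'I_(k + N).+1 => (k <= i)%N)) /= addrAC mulr_sumr -sumrB big1 ?add0r => [|i hi].
  apply: (sm_sum (sm_scm _ hOO)) => i; rewrite -ltnNge => hi.
  exists (p`_i * b ^+ i * a ^+ (k - i)).
    alg.
  have -> : (k + N - i = N + (k - i))%N by lia.
  by rewrite exprD; ring.
have -> : b ^+ i = b ^+ k * b ^+ (i - k) by rewrite -exprD subnKC.
by ring.
Qed.

Lemma blow_order m (dl : 'I_m -> K) : (forall j, O (dl j)) -> (exists j, dl j != 0) ->
  exists o : nat, (forall j, O1 (dl j / a ^+ o)) /\ exists j, ~ scm a O1 (dl j / a ^+ o).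
Proof.
move=> hd [j0 hj0]; apply: contrapT => hno.
have hall k : forall j, O1 (dl j / a ^+ k).
  elim: k => [|k IH] j; first by rewrite divr1; alg.
  apply: contrapT => hj; apply: hno; exists k; split=> //; exists j => -[z hz ez].
  apply: hj; suff -> : dl j / a ^+ k.+1 = z by [].
  by apply: (mulfI a0); rewrite exprS invfM mulrCA mulVKf.
move/eqP: hj0; apply; apply: blow_separated (hd j0) _ => k.
by exists (dl j0 / a ^+ k) => //; rewrite mulrC divfK // expf_neq0.
Qed.

End Blowup.

(** * The transform of the ideal and the drop of its colength *)

Section BlowupIdeal.
Variables (K : fieldType) (O n : set K) (a b : K) (m : nat) (dl : 'I_m -> K) (o : nat) (j0 : 'I_m).
Hypothesis hr : reg2 O n a b.
Let O1 := adj O (b / a).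
Let dl' j := dl j / a ^+ o.
Hypothesis hOd : forall j, O (dl j).
Hypothesis hd1 : forall j, O1 (dl' j).
Hypothesis hj0 : ~ scm a O1 (dl' j0).
Hypothesis haK : exists k, lc O (us dl) (a ^+ k).
Let hO := reg2_ring hr.
Let hN := reg2_noeth hr.
Let hl := reg2_local hr.
Let en := reg2_gens hr.
Let a0 := reg2_neq0 hr.
Let hOO := sm_self hO.
Let snO := reg2_sub hr.
Let sn : submodule O n. Proof. alg. Qed.
Let na := reg2_l hr.
Let nb := reg2_r hr.
Let Oa : O a := snO na.
Let hO1 : subring O1. Proof. exact: sr_adj. Qed.
Let hO11 := sm_self hO1.
Let OO1 : O `<=` O1. Proof. exact: sub_adj. Qed.
Let hc := sr_coefs hO.
Let ad j : dl j = a ^+ o * dl' j.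
Proof. by rewrite mulrC divfK // expf_neq0. Qed.

(** The module n^o divided by a^o. *)
Definition blow_forms : set K :=
  [set z | exists p, [/\ coefs_in O p, (size p <= o.+1)%N & z = p.[b / a]]].

Lemma sm_blow_forms : submodule O blow_forms.
Proof.
split.
- exists 0; rewrite size_poly0 horner0; split=> //; alg.
- move=> _ _ [p [h1 h2 ->]] [q [h3 h4 ->]]; exists (p + q); rewrite hornerD; split=> //.
    alg.
  by apply: leq_trans (size_polyD _ _) _; rewrite geq_max h2.
- move=> c _ h0 [p [h1 h2 ->]]; exists (c *: p); rewrite hornerZ; split=> //.
    move=> i; rewrite coefZ; alg.
  exact: leq_trans (size_scale_leq _ _) h2.
Qed.

Lemma blow_forms_dl j : blow_forms (dl' j).
Proof.
have [|p [h1 h2 e]] := blow_contract hr (N := o) (hOd j).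
  by exists (dl' j); first exact: hd1.
by exists p; split=> //; apply: (mulfI (expf_neq0 o a0)); rewrite -e.
Qed.

Lemma blow_radical : exists k, lc O1 (us dl') (a ^+ k).
Proof.
have [k /(lc_usP _ _ hOO)[c [h1 h2]]] := haK; exists k.
apply/(lc_usP _ _ hO11); exists (fun i => c i * a ^+ o); split.
  move=> i; apply: srM => //; apply: OO1 => //; alg.
by rewrite h2; apply: eq_bigr => i _; rewrite ad mulrA.
Qed.

(** Modulo [a], [dl' j0] is a polynomial of degree at most [o] in [b / a] with unit leading
    coefficient. Division by it leaves a remainder in [blow_forms] and an error in aO1, which is
    treated again until the power of [a] lies in the transformed ideal. *)
Lemma blow_gen : O1 `<=` addm blow_forms (lc O1 (us dl')).
Proof.
pose Y := addm blow_forms (lc O1 (us dl')).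
have sJ := sm_lc (us dl') hO11; have sJO := submoduleS OO1 sJ.
have sY : submodule O Y := sm_addm sm_blow_forms sJO.
have [p [hp hps ep]] := blow_forms_dl j0.
have [p' [hp' hs' hpp' [p'0|hlp]]] := blow_lead hr hp.
  by case: hj0; rewrite ep; move: hpp'; rewrite p'0 horner0 subr0.
have p'0 : p' != 0 by apply: contra_notN hlp => /eqP ->; rewrite lead_coef0;
alg.
have hi := local_inv hr (hp' _) hlp.
have step z : O1 z -> exists v w, [/\ Y v, O1 w & z = v + a * w].
  case=> q hq ->; have [h [r [hh hrO hrs ->]]] := poly_div_unit hO hp' hq p'0 hi.
  have [g hg eg] := hpp'; have hh1 : O1 h.[b / a] by exists h.
  exists (r.[b / a] + dl' j0 * h.[b / a]), (- (h.[b / a] * g)); split.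
  - apply: (smD sY).
      apply: (addml sJO); exists r; split=> //.
      by apply: leq_trans (ltnW hrs) _; exact: leq_trans hs' hps.
    by apply: (addmr sm_blow_forms); apply: (lc_mem hO11) => //; exact: mem_us.
  - alg.
  - rewrite hornerD hornerM ep.
    have -> : p'.[b / a] = p.[b / a] - a * g by rewrite -eg opprB addrC subrK.
    by ring.
have hall k z : O1 z -> exists v w, [/\ Y v, O1 w & z = v + a ^+ k * w].
  elim: k z => [|k IH] z hz.
    by exists 0, z; split=> //; [alg|rewrite add0r mul1r].
  have [v [w [h1 h2 ->]]] := IH z hz; have [v' [w' [h3 h4 ->]]] := step w h2.
  exists (v + a ^+ k * v'), w'; split=> //; last by rewrite exprSr; ring.
  alg.
have [k hk] := blow_radical.
move=> z /(hall k)[v [w [h1 h2 ->]]]; apply: (smD sY) => //.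
apply: (addmr sm_blow_forms); alg.
Qed.

(* A chain over the blow-up restricts to [a^o * blow_forms = n^o]; as [o > 0], the
   ring [O] itself can be appended to the resulting chain. *)
Lemma blow_bound S l : mset O1 S -> (forall j, n (dl j)) ->
  (forall k c, strict_chain (itv O (lc O (us dl)) O) k c -> (k <= l.+1)%N) ->
  forall k c, strict_chain (itv (loc O1 S) (lc (loc O1 S) (us dl')) (loc O1 S)) k c -> (k <= l)%N.
Proof.
move=> hS hn hb k c [hc1 hc2]; set O' := loc O1 S in hc1 hc2.

have O1' : O1 `<=` O' := sub_loc hS.
have hcO i : (i <= k)%N -> submodule O1 (c i).
  by move=> hi; have [h _ _] := hc1 i hi; exact: submoduleS O1' h.
have hcJ i : (i <= k)%N -> forall z, lc O1 (us dl') z -> c i z.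
  by move=> hi z hz; have [_ h _] := hc1 i hi; apply: h; exact: lcS O1' _ hz.
pose d i := [set x | [/\ O x, blow_forms (x / a ^+ o) & c i (x / a ^+ o)]].
have ho : (0 < o)%N.
  rewrite lt0n; apply/eqP => o0; apply: hj0; rewrite /dl' o0 expr0 divr1.
  have [v [w [hv hw ->]]] := reg2_n hr (hn j0); exists (v + b / a * w).
    apply: srD => //; first exact: OO1.
    by apply: srM => //; [exact: adj_gen|alg].
  by field.
have hdn i : d i `<=` n.
  move=> x [_ [p [hp hs e]] _].
  have -> : x = a ^+ o * p.[b / a] by rewrite -e mulrC divfK // expf_neq0.
  rewrite (blow_expand hr hs); apply: (sm_sum sn) => i' _.
  have [h|h] := posnP i'.
    rewrite h expr0 mulr1 subn0 -(prednK ho) exprSr mulrA; alg.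
  rewrite -(prednK h) exprSr mulrA mulrAC; alg.
have hdi i : (i <= k)%N -> itv O (lc O (us dl)) n (d i).
  move=> hi; have hci := hcO i hi; have hciO := submoduleS OO1 hci.
  have hdO : submodule O (d i).
    split.
    - by split; rewrite ?mul0r; [alg|exact: sm0 sm_blow_forms|alg].
    - move=> x y [h1 h2 h3] [h4 h5 h6]; split; first exact: srD.
        by rewrite mulrDl; exact: (smD sm_blow_forms).
      rewrite mulrDl; alg.
    - move=> r x hr' [h1 h2 h3]; split; first exact: srM.
        by rewrite -mulrA; exact: (smZ sm_blow_forms).
      rewrite -mulrA; alg.
  split=> //.
  apply: (lc_min hdO) => _ y /mapP[j _ ->] hy; rewrite mulrC; apply: (smZ hdO) => //.
  split=> //; first exact: blow_forms_dl.
  apply: (hcJ i hi); apply: lc_gen => //.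
  by exact: mem_us.
have hd : strict_chain (itv O (lc O (us dl)) n) k d.
  split=> // i hi; have [hlt hnle] := hc2 i hi; split.
    move=> x [h1 h2 h3]; split=> //; alg.
  move=> hle; apply: hnle => x hx.
  have [hsm _ hsub] := hc1 i.+1 hi; have [hsmi _ _] := hc1 i (ltnW hi).
  have [w [s [hw hs ex]]] := hsub _ hx.
  have hs0 := mset_neq0 hS hs; have [hS1 _ _ _] := hS.
  suff hwi : c i w.
    rewrite ex mulrC; apply: (smZ hsmi) => //.
    exists 1, s; rewrite mul1r; split=> //; alg.
  have hwi1 : c i.+1 w.
    have -> : w = s * x by rewrite ex mulrC divfK.
    apply: (smZ hsm) => //; apply: O1'; alg.
  have [p [j [hp hj e]]] := blow_gen hw.
  have hpi : c i.+1 p.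
    have -> : p = w - j by rewrite e addrK.
    by apply: (smB hO1 (hcO _ hi)) => //; exact: hcJ.
  have ep : p = (a ^+ o * p) / a ^+ o by rewrite mulrC mulKf // expf_neq0.
  have [|_ _ h] := hle (a ^+ o * p).
    split; rewrite -?ep //; case: hp => q [hq hqs ->]; rewrite (blow_expand hr hqs).

    alg.
  rewrite e; apply: (smD hsmi); first by rewrite ep.
  exact: (hcJ _ (ltnW hi)).
have hnO : n `<` O by split=> // h; apply: (local_proper hl); alg.
have := hb _ _ (strict_chain_snoc hd hOO _ hnO); apply.
by apply: (lc_sub _ hOO) => _ /mapP[j _ ->].
Qed.

(** O1/aO1 is a polynomial ring over a field, so [P] is generated by [a] and by a polynomial of
    least degree with unit leading coefficient. *)
Lemma blow_fiber P z0 : prime_ideal O1 P -> P a -> P z0 -> ~ scm a O1 z0 ->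
  exists f, reg2 (loc O1 (compl O1 P)) (loc P (compl O1 P)) a f.
Proof.
move=> hP Pa Pz hz0; have [[hPO sP] P1 _] := hP.
pose Q k := exists p, [/\ coefs_in O p, size p = k, P p.[b / a] & ~ n (lead_coef p)].
have hQr q : coefs_in O q -> P q.[b / a] -> ~ scm a O1 q.[b / a] ->
    exists2 k, (k <= size q)%N & Q k.
  move=> hq hPq haq; have [p [hp hps hqp [p0|hlp]]] := blow_lead hr hq.
    by move: hqp; rewrite p0 horner0 subr0.
  exists (size p) => //; exists p; split=> //.
  have -> : p.[b / a] = q.[b / a] - (q.[b / a] - p.[b / a]) by rewrite subKr.
  apply: (smB hO1 sP) => //; case: hqp => g hg ->; alg.
have [k0 hk0] : exists k, `[< Q k >].
  case: (hPO _ Pz) => q hq eq; rewrite eq in Pz hz0.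
  by have [k _ h] := hQr q hq Pz hz0; exists k; exact/asboolP.
have [k /asboolP[p [hp sp hPp hlp]] hmin]
  := @ex_minnP (fun k => `[< Q k >]) (ex_intro _ k0 hk0).
set f := p.[b / a] in hPp.
have p0 : p != 0 by apply: contra_notN hlp => /eqP ->; rewrite lead_coef0; alg.
have haf : ~ scm a O1 f by exact: (blow_lead_notin hr hp hlp).
have hPf z : P z -> exists v w, [/\ O1 v, O1 w & z = a * v + f * w].
  move=> hz; case: (hPO _ hz) => q hq eq.
  have [h [r [hh hrO hrs eqr]]] := poly_div_unit hO hp hq p0 (local_inv hr (hp _) hlp).
  have hh1 : O1 h.[b / a] by exists h.
  have er : z = h.[b / a] * f + r.[b / a] by rewrite eq eqr hornerD hornerM.
  have [g hg eg] : scm a O1 r.[b / a].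
    apply: contrapT => har; have [|k' hk' hQk] := hQr r hrO _ har.
      have -> : r.[b / a] = z - h.[b / a] * f by rewrite er addrAC subrr add0r.
      alg.
    have := hmin k' (asboolT hQk); rewrite -sp leqNgt => /negP; apply.
    exact: leq_ltn_trans hk' hrs.
  by exists g, h.[b / a]; split=> //; rewrite er eg; ring.
have hS := mset_compl hO1 hP; set S := compl O1 P in hS *.
have hO' : subring (loc O1 S) by exact: loc_subring.
have hO'O' := sm_self hO'.
exists f; split=> //.
- by apply: loc_noeth => //; exact: noeth_adj.
- exact: local_loc.
- rewrite eqEsubset; split.
    move=> _ [z [s [/hPf[v [w [hv hw ->]]] hs ->]]].
    rewrite mulrDl -!mulrA; apply: (smD (sm_lc _ hO'O')).
      by apply: (lc_mem hO'O'); [rewrite !inE eqxx|exists v, s].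
    by apply: (lc_mem hO'O'); [rewrite !inE eqxx orbT|exists w, s].
  have sP' := loc_sm hS sP.
  apply: (lc_min sP') => x y; rewrite !inE => hx hy; rewrite mulrC; apply: (smZ sP') => //.
  by case/orP: hx => /eqP ->; exact: (sub_loc hS).
split=> // _ [v [s [hv hs ->]]] [_ [v' [s' [hv' hs' ->]]] e].
have [[hs1 hs2] [hs1' hs2']] := (hs, hs').
have s0 := mset_neq0 hS hs; have s0' := mset_neq0 hS hs'.
have [//|[g hg eg]] : scm a O1 f \/ scm a O1 (v * s').
  apply: (blow_prime hr); [alg|alg|].
  exists (v' * s); first exact: srM.
  transitivity (s * s' * (f * (v / s))); first by field.
  by rewrite e; field.
exists (g / (s * s')).
  exists g, (s * s'); split=> //; have [_ _ h _] := hS; exact: h.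
transitivity (v * s' / (s * s')); first by field; rewrite s0'.
by rewrite eg mulrA.
Qed.

End BlowupIdeal.

(** If no power of [x] lay in the ideal, its sums with the powers of [x] would form a strict chain
    of length [l.+1]. *)
Lemma bound_primary (K : fieldType) (B n : set K) (s : seq K) l :
  subring B -> noethm B B -> is_local B n -> (forall x, x \in s -> B x) ->
  (forall k c, strict_chain (itv B (lc B s) B) k c -> (k <= l)%N) -> primary B n s.
Proof.
move=> hB hN hl hs hb x hx; have hBB := sm_self hB.
have [hnB _] := local_ideal hl; have hxB := hnB _ hx.
have sJ := sm_lc s hBB; apply: contrapT => hno.
pose c i := addm (scm (x ^+ (l.+1 - i)) B) (lc B s).
have sc i : submodule B (c i) := sm_addm (sm_scm _ hBB) sJ.
suff hc : strict_chain (itv B (lc B s) B) l.+1 c by have := hb _ _ hc; rewrite ltnn.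
split=> [i _|i hi].
  split=> //; first exact: (addmr (sm_scm _ hBB)).
  by apply: (addm_min hBB); [apply: (scm_sub _ hBB); exact: srX|exact: (lc_sub hs hBB)].
have ek : (l.+1 - i = (l.+1 - i.+1).+1)%N by lia.
split.
  apply: (addm_min (sc _)); last exact: (addmr (sm_scm _ hBB)).
  move=> _ [v hv ->]; apply: (addml sJ); exists (x * v); first exact: srM.
  by rewrite ek exprSr mulrA.
move=> h; apply: hno; exists (l.+1 - i.+1)%N.
have [|_ [w [[v hv ->] hw e]]] := h (x ^+ (l.+1 - i.+1)).
  by apply: (addml sJ); exists 1; [alg|rewrite mulr1].
have hxv : n (x * v) by rewrite mulrC; exact: smZ (idealP (local_ideal hl)) _ _.
apply: (unit_cancel hB hN hl sJ hxv).
by rewrite {1}e ek exprSr -mulrA [X in X - _]addrC [x * v * _]mulrC addrK.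
Qed.

(** * Generation of the integral closure in degrees at least two *)

Section Generation.
Variables (K : fieldType) (L : set K) (m : nat) (u : 'I_m -> K).
Implicit Types (C D O n : set K) (dl : 'I_m -> K).
Local Notation P := {mpoly K[m]}.
Local Notation Wn := (Wn L u).

Lemma relation_scale dl c : relation L u dl -> L c -> c != 0 ->
  relation L u (fun j => dl j / c).
Proof.
move=> [[hL hLV] hdl [j hj] hs hi] hc c0; split=> //.
- by move=> i; apply: srM => //; exact: hLV.
- by exists j; rewrite mulf_neq0 // invr_eq0.
- transitivity ((\sum_i dl i * u i) / c); last by rewrite hs mul0r.
  by rewrite mulr_suml; apply: eq_bigr => i _; rewrite mulrAC.
- by move=> i; rewrite mulf_eq0 negb_or => /andP[h _]; exact: hi.
Qed.

Lemma generated_base dl C j : relation L u dl -> normal_in L C -> (forall i, C (dl i)) ->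
  dl j != 0 -> C (dl j)^-1 -> generated L u C.
Proof.
move=> hrel hn hd hj hV n z hz; have [hC hCL _ _ _] := hn.
have := Wn_base hrel hn hd hj hV hz; rewrite (UnS u n.+1 (sm_self hC)).
by apply: lcS; exact: Un_Wn.
Qed.

Lemma mset_mulP C S x y : mset C S -> S x -> S y -> S (x * y).
Proof. by case=> _ _ h _; exact: h. Qed.

Lemma generated_loc dl C S : relation L u dl -> normal_in L C -> mset C S ->
  generated L u C -> generated L u (loc C S).
Proof.
move=> hrel hn hS hg n z hz; have [hC hCL _ _ _] := hn.
have [hC' hCL' _ _ _] := normal_loc hrel hn hS.
have [a ha h] := Wn_loc hrel hC hCL hS hz.
have [c [hc e]] := (lc_usP u _ (sm_Wn hrel n.+1 hC hCL)).1 (hg _ _ h).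
have hW' := sm_Wn hrel n.+1 hC' hCL'.
have a0 := mset_neq0 hS ha.
apply/(lc_usP u _ hW'); exists (fun i => a^-1 * c i); split.
  move=> i; apply: (smZ hW'); first by exists 1, a; rewrite mul1r; alg.
  by apply: Wn_mono (hc i); exact: (sub_loc hS).
rewrite -[z](mulKf a0) e mulr_sumr; apply: eq_bigr => i _; by rewrite mulrA.
Qed.

(** The elements that multiply [z] into the span form an ideal. A prime above it that contains all
    [dl j] is excluded by hypothesis, and any other one because a power of some [dl j] multiplies
    [z] into a form over [C]. *)
Lemma generated_local dl C : relation L u dl -> normal_in L C -> (forall i, C (dl i)) ->
  (forall Q, prime_ideal C Q -> (forall j, Q (dl j)) -> generated L u (loc C (compl C Q))) ->
  generated L u C.
Proof.
move=> hrel hn hd hloc k z hz; have [hC hCL hN _ _] := hn.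
have hCC := sm_self hC; have hW := sm_Wn hrel k.+1 hC hCL.
set X := lc (Wn C k.+1) (us u).
have sX : submodule C X := sm_lc _ hW.
pose I := [set c | C c /\ X (c * z)].
have hI : ideal C I.
  split=> [c []//|]; split.
  - split; alg.
  - move=> x y [h1 h2] [h3 h4]; split; alg.
  - move=> x y hx [h1 h2]; split; alg.
have [Q hQ hIQ|N [_]] := radical_power (x := 1) hC hN hI; last first.
  by rewrite expr1n mul1r.
exfalso; have [hPs|] := pselect (forall j, Q (dl j)); last first.
  apply; move=> j; have [N hU] := Wn_away hrel j hn hd hz.
  apply: (prime_mulX hC (k := N) hQ (hd j)); apply: hIQ; split; first exact: srX.
  rewrite (UnS u k.+1 hCC) in hU; apply: lcS hU; exact: Un_Wn.
have hS := mset_compl hC hQ; set S := compl C Q in hS.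
have [hC' hCL' _ _ _] := normal_loc hrel hn hS.
have hz' : Wn (loc C S) k.+2 z by apply: Wn_mono hz; exact: (sub_loc hS).
have [c [hc e]] := (lc_usP u _ (sm_Wn hrel k.+1 hC' hCL')).1 (hloc Q hQ hPs _ _ hz').
have /choice[s hs] : forall i, exists s, S s /\ Wn C k.+1 (s * c i).
  by move=> i; have [s h1 h2] := Wn_loc hrel hC hCL hS (hc i); exists s.
have [hSC hS1 _ _] := hS.
have hSs : S (\prod_i s i).
  apply: (big_ind S) => // [x y|i _]; first exact: (mset_mulP hS).
  exact: (hs i).1.
have [_ hnQ] := hSs; apply: hnQ; apply: hIQ; split; first exact: hSC.
apply/(lc_usP u _ hW); exists (fun i => (\prod_j s j) * c i); split.
  move=> i; rewrite (bigD1 i) //= [s i * _]mulrC -mulrA; apply: (smZ hW); last exact: (hs i).2.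
  by apply: sr_prod => // l _; apply: hSC; exact: (hs l).1.
by rewrite e mulr_sumr; apply: eq_bigr => i _; rewrite mulrA.
Qed.

Lemma colon_power dl C X a k x : subring C -> noethm C C -> submodule C X -> C a ->
  lc C (us dl) (a ^+ k) -> (forall j, C (dl j)) ->
  (forall j, exists N : nat, X (dl j ^+ N * x)) -> exists N : nat, X (a ^+ N * x).
Proof.
move=> hC hN sX ha hak hd hX.
pose I := [set c | C c /\ X (c * x)].
have hI : ideal C I.
  split=> [c []//|]; split.
  - split; alg.
  - move=> y z [h1 h2] [h3 h4]; split; alg.
  - move=> y z hy [h1 h2]; split; alg.
have [Q hQ hIQ|N [_ h]] := radical_power (x := a) hC hN hI; last by exists N.
have [[_ sQ] _ _] := hQ; apply: (prime_mulX hC (k := k) hQ ha).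
move: hak; apply: (lc_min sQ) => _ y /mapP[j _ ->] hy; rewrite mulrC; apply: (smZ sQ) => //.
have [N h] := hX j; apply: (prime_mulX hC (k := N) hQ (hd j)); apply: hIQ.
split=> //; alg.
Qed.

(** The terms cancel in pairs across the diagonal; in characteristic two skew symmetry does not
    control the diagonal, hence its separate hypothesis. *)
Lemma alternating_sum (F : 'I_m -> 'I_m -> K) : (forall k l, F k l = - F l k) ->
  (forall k, F k k = 0) -> \sum_k \sum_l F k l = 0.
Proof.
move=> h1 h2.
have -> : \sum_k \sum_l F k l = \sum_(k < m) \sum_(l < m | (l < k)%N) F k l +
    \sum_(k < m) \sum_(l < m | (k < l)%N) F k l.
  rewrite -big_split /=; apply: eq_bigr => k _; rewrite (bigD1 k) //= h2 add0r.
  rewrite (bigID (fun l : 'I_m => (l < k)%N)) /=; congr (_ + _); apply: eq_bigl => l.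
    by rewrite andbC; case: ltnP => //= h; apply: contraTneq h => ->; rewrite ltnn.
  by rewrite -leqNgt [RHS]ltn_neqAle eq_sym.
rewrite [X in _ + X](exchange_big_dep predT) //= -big_split /= big1 // => k _.
by rewrite -big_split /= big1 // => l _; rewrite h1 addNr.
Qed.

(** * Gluing over the two charts of the blow-up *)

Section Overlap.
Variables (O n : set K) (a b : K) (dl : 'I_m -> K) (j0 : 'I_m).
Hypothesis hr : reg2 O n a b.
Hypothesis hrel : relation L u dl.
Hypothesis hOL : O `<=` L.
Hypothesis hf : fractions L O.
Let y := b / a.
Let O1 := adj O y.
Let O2 := adj O (a / b).
Let O12 := loc O1 (pows y).
Hypothesis hd1 : forall j, O1 (dl j).
Hypothesis hj0 : ~ scm a O1 (dl j0).
Hypothesis haK : exists k, lc O1 (us dl) (a ^+ k).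
Let hO := reg2_ring hr.
Let hl := reg2_local hr.
Let en := reg2_gens hr.
Let a0 := reg2_neq0 hr.
Let b0 := reg2_neq0 (reg2_sym hr).
Let y0 : y != 0. Proof. by rewrite mulf_neq0 // invr_eq0. Qed.
Let hOO := sm_self hO.
Let Oa : O a.
Proof.

alg.
Qed.
Let hO1 : subring O1. Proof. exact: sr_adj. Qed.
Let hO2 : subring O2. Proof. exact: sr_adj. Qed.
Let hO11 := sm_self hO1.
Let hO22 := sm_self hO2.
Let OO1 : O `<=` O1. Proof. exact: sub_adj. Qed.
Let OO2 : O `<=` O2. Proof. exact: sub_adj. Qed.
Let O1y : O1 y. Proof. exact: adj_gen. Qed.
Let hLf : isfield L. Proof. by case: hrel. Qed.
Let hn1 : normal_in L O1. Proof. exact: (blow_normal hr hLf hOL hf). Qed.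
Let hO1L : O1 `<=` L. Proof. by case: hn1. Qed.
Let hS : mset O1 (pows y). Proof. exact: mset_pows. Qed.
Let hn12 : normal_in L O12. Proof. exact: (normal_loc hrel hn1 hS). Qed.
Let hO12 : subring O12. Proof. by case: hn12. Qed.
Let hO12L : O12 `<=` L. Proof. by case: hn12. Qed.
Let O1O12 : O1 `<=` O12. Proof. exact: (sub_loc hS). Qed.
Let O12yV : O12 y^-1.
Proof. by exists 1, y; rewrite mul1r; split=> //; [alg|exists 1%N; rewrite expr1]. Qed.
Let O2L : O2 `<=` L.
Proof.
have [hL hLV] := hLf; apply: (adj_min hL hOL).
rewrite -[a / b]invf_div; alg.
Qed.

(** Nonnegative powers of [y] belong to one chart and negative ones to the other; this is the
    vanishing of the first cohomology of the structure sheaf. *)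
Lemma blow_sum : O12 `<=` addm O1 O2.
Proof.
have s1 : submodule O O1 := submoduleS OO1 hO11.
have s2 : submodule O O2 := submoduleS OO2 hO22.
move=> _ [_ [_ [[q hq ->] [N ->] ->]]].
rewrite horner_coef mulr_suml; apply: (sm_sum (sm_addm s1 s2)) => i _.
rewrite -mulrA; apply: (smZ (sm_addm s1 s2)); first exact: hq.
have [h|h] := leqP N i.
  apply: (addml s2); rewrite -(subnK h) exprD mulfK ?expf_neq0 //; exact: srX.
apply: (addmr s1); rewrite -(subnKC (ltnW h)) exprD invfM mulrA mulfV ?expf_neq0 // mul1r.
by rewrite -exprVn invf_div; apply: srX => //; exact: adj_gen.
Qed.

Lemma Un_split k : Un u O12 k `<=` addm (Un u O1 k) (Un u O2 k).
Proof.
have s1 : submodule O (Un u O1 k) := submoduleS OO1 (sm_Un u k hO11).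
have s2 : submodule O (Un u O2 k) := submoduleS OO2 (sm_Un u k hO22).
move=> _ [p hp ->]; move: p hp; apply: PX_ind.
- by rewrite meval0; exact: sm0 (sm_addm s1 s2).
- by move=> p q h1 h2; rewrite mevalD; exact: (smD (sm_addm s1 s2)).
move=> c e /blow_sum[c1 [c2 [h1 h2 ->]]] he; rewrite mevalZ mulrDl.
exists (c1 * ('X_[e]).@[u]), (c2 * ('X_[e]).@[u]); split=> //.
  by exists (c1 *: 'X_[e]); rewrite ?mevalZ //; exact: (PX_mono hO11).
by exists (c2 *: 'X_[e]); rewrite ?mevalZ //; exact: (PX_mono hO22).
Qed.

(** The lowest term of [z] as a polynomial over the residue field: constant coefficients in [n] are
    moved into aO1 and a factor [y] is split off. *)
Lemma blow_low z : O1 z -> ~ scm a O1 z -> exists p c g h,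
  [/\ O c, ~ n c, O1 g, O1 h & z = y ^+ p * (c + y * g) + a * h].
Proof.
case=> q hq ->; elim/poly_ind: q hq => [|q c0 IH] hq haq.
  by case: haq; rewrite horner0; exact: sm0 (sm_scm _ hO11).
have hq' : coefs_in O q by move=> i; have := hq i.+1; rewrite coefD coefC addr0 coefMX.
have hc0 : O c0 by have := hq 0%N; rewrite coefD coefC coefMX add0r.
have e : (q * 'X + c0%:P).[y] = q.[y] * y + c0 by rewrite !hornerE.
rewrite e in haq *; have [hn|hn] := pselect (n c0); last first.
  exists 0%N, c0, q.[y], 0; split=> //; [by exists q|alg|].
  by ring.
have [v [w [hv hw ec]]] := reg2_n hr hn.

have ec1 : c0 = a * (v + y * w).
  by rewrite mulrDr mulrA [a * y]mulrC divfK.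
have [|p [c [g [h [h1 h2 h3 h4 h5]]]]] := IH hq'.
  case=> g hg eg; apply: haq; exists (g * y + (v + y * w)).
    alg.
  by rewrite eg ec1; ring.
exists p.+1, c, g, (h * y + (v + y * w)); split=> //.
  alg.
by rewrite h5 ec1 exprS; ring.
Qed.

(* A form over the overlap is brought into [Wn O1 k] by a power of [y], and some
   [f] outside [aO1] as well as a power of [a] multiply the latter into [O1[u]];
   descending on the power of [a], the lowest term of [f] modulo [a] removes the
   negative powers of [y] one at a time. *)
Lemma Wn_split k : Wn O12 k `<=` addm (Wn O1 k) (Wn O2 k).
Proof.
case: k => [|k]; first exact: blow_sum.
move=> w hw; have [_ [N ->] hw1] := Wn_loc hrel hO1 hO1L hS hw.
set w1 := _ * w in hw1.
pose X := addm (Wn O1 k.+1) (Un u O12 k.+1).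
have sW1 := sm_Wn hrel k.+1 hO1 hO1L.
have sU12 := sm_Un u k.+1 (sm_self hO12).
have sU12' : submodule O1 (Un u O12 k.+1) := submoduleS O1O12 sU12.
have sX : submodule O1 X := sm_addm sW1 sU12'.
suff : X w.
  case=> v1 [v2 [h1 /Un_split[v3 [v4 [h2 h3 ->]]] ->]].
  exists (v1 + v3), v4; rewrite addrA; split=> //.
    by apply: (smD sW1) => //; exact: Un_Wn h2.
  exact: Un_Wn h3.
have [_ _ hN1 _ _] := hn1.
have [M hM] : exists M : nat, Un u O1 k.+1 (a ^+ M * w1).
  have [K0 hK] := haK.
  apply: (colon_power hO1 hN1 (sm_Un u k.+1 hO11) (OO1 Oa) hK hd1) => j.
  exact: (Wn_away hrel j hn1 hd1 hw1).
have [N1 hf1] := Wn_away hrel j0 hn1 hd1 hw1.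
have [|p [c [g [h [h1 h2 h3 h4 ef]]]]] := @blow_low (dl j0 ^+ N1) (srX N1 hO1 (hd1 j0)).
  exact: (blow_primeX hr (hd1 j0) hj0).
have U12 z s i : Un u O1 k.+1 z -> X (a ^+ s * y^-1 ^+ i * z).
  move=> hz; apply: (addmr sW1); apply: (smZ sU12); last exact: UnSS O1O12 _ hz.
  apply: srM => //; apply: srX => //; apply: O1O12; exact: OO1.
have main d : forall i, X (a ^+ (M - d) * y^-1 ^+ i * w1).
  elim: d => [|d IHd] i.
    have -> : a ^+ (M - 0) * y^-1 ^+ i * w1 = a ^+ 0 * y^-1 ^+ i * (a ^+ M * w1).
      by rewrite subn0; ring.
    exact: U12.
  have [hMd|hdM] := leqP M d.
    have -> : (M - d.+1 = M - d)%N by lia.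
    alg.
  have eM : (M - d = (M - d.+1).+1)%N by lia.
  elim: i => [|i IHi].
    rewrite expr0 mulr1; apply: (addml sU12'); alg.
  have c0 : c != 0 := nonmem_neq0 hr h2.
  set t := _ * w1.
  (* The expansion of the power of [dl j0] is solved for its lowest term: the first summand is
     already a form over the overlap, the [g] term has one factor [y^-1] less, the [h] term one
     factor [a] more. *)
  have -> : t = c^-1 * (a ^+ (M - d.+1) * y^-1 ^+ (i.+1 + p) * (dl j0 ^+ N1 * w1)
     - g * (a ^+ (M - d.+1) * y^-1 ^+ i * w1) - h * (a ^+ (M - d) * y^-1 ^+ (i.+1 + p) * w1)).
    apply: (mulfI c0); rewrite mulVKf // ef eM /t exprD !exprS !exprVn.
    have yp0 : y ^+ p != 0 by rewrite expf_neq0.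
    have yi0 : y ^+ i != 0 by rewrite expf_neq0.
    move: (y ^+ p) yp0 (y ^+ i) yi0 y0 => yp yp0 yi yi0.
    by move: y => y1 y10; field; rewrite yp0 yi0.
  apply: (smZ sX); first by apply: OO1; exact: (local_inv hr).
  apply: (smB hO1 sX); last alg.
  by apply: (smB hO1 sX); [exact: U12|apply: (smZ sX)].
have := main M N; rewrite subnn expr0 mul1r /w1 mulrA -exprMn mulVf // expr1n mul1r.
alg.
Qed.

Lemma overlap_prime f z : O1 f -> ~ scm a O1 f -> O12 z -> scm a O12 (f * z) -> scm a O12 z.
Proof.
move=> hf1 haf [v [_ [hv [N ->] ->]]] [_ [v' [_ [hv' [N' ->] ->]]] e].
have yX k : y ^+ k != 0 by rewrite expf_neq0.
have [//|h] : scm a O1 f \/ scm a O1 (v * y ^+ N').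
  apply: (blow_prime hr) => //; first alg.
  exists (v' * y ^+ N); first alg.
  transitivity (y ^+ N * y ^+ N' * (f * (v / y ^+ N))).
    by field.
  by rewrite e; field.
have [[g hg eg]|h'] := blow_prime hr hv (srX N' hO1 O1y) h; last first.
  by case: (blow_primeX (k := N') hr O1y (blow_y hr)).
exists (g / y ^+ N); last by rewrite eg mulrA.
by exists g, (y ^+ N); split=> //; exists N.
Qed.

(** A power of [a] lies in the ideal of the [dl j], so it multiplies [x] into [O12]; as [a] is prime
    there and does not divide [dl j0], these factors cancel. *)
Lemma overlap_chart : chart L dl O12.
Proof.
split=> //; first alg.
move=> x hx hdep; have [_ _ hN12 _ _] := hn12; have [K0 hK] := haK.
have [M hM] : exists M : nat, O12 (a ^+ M * x).
  apply: (colon_power (dl := dl) (k := K0) hO12 hN12 (sm_self hO12)) => //.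
  - apply: O1O12; alg.
  - exact: lcS O1O12 _ hK.
  - alg.
have [N hfN] := hdep j0.
elim: M hM => [|M IH] hM; first by rewrite expr0 mul1r in hM.
apply: IH; have [||z hz ez] := @overlap_prime (dl j0 ^+ N) _ (srX N hO1 (hd1 j0)) _ hM.
- exact: (blow_primeX hr (hd1 j0) hj0).
- exists (a ^+ M * (dl j0 ^+ N * x)); last by rewrite exprS; ring.
  apply: srM => //; apply: srX => //; apply: O1O12; alg.
by have <- : z = a ^+ M * x by apply: (mulfI a0); rewrite -ez exprS mulrA.
Qed.

(** In degree zero the intersection of the charts is [O], since [a] and [b] form a regular sequence;
    in higher degrees integrality descends by [int_glue]. *)
Lemma Wn_glue k : Wn O1 k `&` Wn O2 k `<=` Wn O k.
Proof.
case: k => [|k] x [h1 h2].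
  case: h1 h2 => [p hp ep] [q hq eq].
  apply: (reg2_glue (i := size p) (j := size q) hr).
    have hs : (size p <= (size p).+1)%N by [].
    rewrite ep (blow_expand hr hs); alg.
  have hs : (size q <= (size q).+1)%N by [].
  rewrite eq (blow_expand (reg2_sym hr) hs); alg.
case: h1 h2 => [hU h1] [_ h2]; split=> //.
have ha := sr_alg hO u.
have hsub x1 : alg (adj O x1) u `<=` adj (alg O u) x1.
  apply: (alg_min (sr_adj ha x1)) => [|i]; last by apply: (sub_adj ha); exact: alg_gen.
  apply: (adj_min (sr_adj ha x1)); last exact: adj_gen.
  by move=> c hc; apply: (sub_adj ha); exact: sub_alg.
apply: (int_glue ha y0); first exact: int_mono (hsub _) h1.
by rewrite invf_div; exact: int_mono (hsub _) h2.
Qed.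

(** The coefficients [d] and [e] of [z] on the two charts differ by a Koszul relation on the
    overlap. Its skew matrix [w] is split into parts on the charts, and [d] corrected by the first
    part [V] agrees with [e] corrected by the second, so it lies in both charts. *)
Lemma generated_glue : generated L u O1 -> generated L u O2 -> generated L u O.
Proof.
move=> hg1 hg2 k z hz.
have sW1 j := sm_Wn hrel j hO1 hO1L; have sW2 j := sm_Wn hrel j hO2 O2L.
have sW := sm_Wn hrel k.+1 hO hOL.
have [d [hd ed]] := (lc_usP u _ (sW1 k.+1)).1 (hg1 _ _ (Wn_mono OO1 hz)).
have [e [he ee]] := (lc_usP u _ (sW2 k.+1)).1 (hg2 _ _ (Wn_mono OO2 hz)).
have O2O12 : O2 `<=` O12.
  apply: (adj_min hO12); first alg.
  by rewrite -invf_div.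
have [||w [hw w1 w2 w3]] := @koszul _ _ _ _ _ hrel O12 k predT (fun i => d i - e i)
  overlap_chart (generated_loc hrel hn1 hS hg1) (or_introl (fun _ => erefl)).
- move=> i; apply: (smB hO12 (sm_Wn hrel k.+1 hO12 hO12L)).
    exact: Wn_mono O1O12 _ (hd i).
  exact: Wn_mono O2O12 _ (he i).
- transitivity (\sum_i d i * u i - \sum_i e i * u i); last by rewrite -ed -ee subrr.
  by rewrite -sumrB; apply: eq_bigr => i _; rewrite mulrBr ![u i * _]mulrC.
have /choice[v hv] : forall ij : 'I_m * 'I_m, exists v, Wn O1 k v /\ Wn O2 k (w ij.1 ij.2 - v).
  move=> [i j]; have [v [v' [h1 h2 ->]]] := Wn_split (hw i j); exists v.
  by rewrite addrAC subrr add0r.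
(* Only the entries above the diagonal are split; the rest is forced, so that [V] is alternating and
   the correction does not change the sum. *)
pose V (i j : 'I_m) := if (i < j)%N then v (i, j) else if (j < i)%N then - v (j, i) else 0.
have hV1 i j : Wn O1 k (V i j).
  rewrite /V; case: ifP => _; first exact: (hv (i, j)).1.
  case: ifP => _; last exact: sm0 (sW1 k).
  by apply: (smN hO1 (sW1 k)); exact: (hv (j, i)).1.
have hV2 i j : Wn O2 k (w i j - V i j).
  rewrite /V; case: ltngtP => h; first exact: (hv (i, j)).2.
    rewrite w1 -opprD; apply: (smN hO2 (sW2 k)); exact: (hv (j, i)).2.
  have -> : i = j by exact: val_inj.
  by rewrite w2 subrr; exact: sm0 (sW2 k).
have hVa i j : V i j = - V j i.
  by rewrite /V; case: ltngtP => _; rewrite ?opprK ?oppr0.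
have hVd i : V i i = 0 by rewrite /V ltnn.
have hmul (C : set K) (x : 'I_m -> K) : subring C -> C `<=` L -> (forall l, Wn C k (x l)) ->
    Wn C k.+1 (\sum_l u l * x l).
  move=> hC hCL hx; apply: (Wn_mul hrel hC hCL).
  apply/(lc_usP u _ (sm_Wn hrel k hC hCL)); exists x; split=> //.
  by apply: eq_bigr => l _; rewrite mulrC.
apply/(lc_usP u _ sW); exists (fun i => d i - \sum_l u l * V i l); split.
  move=> i; apply: Wn_glue; split.
    by apply: (smB hO1 (sW1 k.+1)) => //; exact: hmul.
  have -> : d i - \sum_l u l * V i l = e i + \sum_l u l * (w i l - V i l).
    have -> : d i = e i + (d i - e i) by rewrite addrC subrK.
    rewrite w3 // -addrA -sumrB; congr (_ + _).
    by apply: eq_bigr => l _; rewrite mulrBr.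
  by apply: (smD (sW2 k.+1)) => //; exact: hmul.
rewrite ed -[LHS]subr0; transitivity (\sum_i d i * u i - \sum_i \sum_l u i * u l * V i l).
  congr (_ - _); rewrite alternating_sum // => [i j|i]; last by rewrite hVd mulr0.
  by rewrite hVa mulrN [u i * u j]mulrC.
rewrite -sumrB; apply: eq_bigr => i _; rewrite mulrBl; congr (_ - _).
by rewrite mulr_suml; apply: eq_bigr => l _; ring.
Qed.

End Overlap.

(** Induction on a bound [l] for the colength of the ideal of the [dl j]. If this ideal is proper,
    the points of both charts that contain its transform have a smaller bound by [blow_bound], and
    [generated_glue] returns to [O]. *)
Theorem Wn_generated l O n a b dl : reg2 O n a b -> relation L u dl -> O `<=` L ->
  fractions L O -> (forall j, O (dl j)) ->
  (forall k c, strict_chain (itv O (lc O (us dl)) O) k c -> (k <= l)%N) -> generated L u O.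
Proof.
elim: l O n a b dl => [|l IH] O n a b dl hr hrel hOL hf hd hb.
all: have [hO hN hl en [a0 _]] := hr; have hOO := sm_self hO.
all: have [hLf _ hdl0 _ _] := hrel; have [hL hLV] := hLf.
all: have hnO : normal_in L O by split=> //; exact: (reg2_icl hr).
all: have [hn|/existsNP[j hj]] := pselect (forall j, n (dl j)); last first.
all: try exact: (generated_base hrel hnO hd (nonmem_neq0 hr hj) (local_inv hr (hd j) hj)).
  (* For [l = 0] the ideal cannot be proper, as it would give a chain of length one. *)
  have hlt : lc O (us dl) `<` O.
    have [hnO' sn] := local_ideal hl; have hJn : lc O (us dl) `<=` n.
      apply: (lc_min sn) => _ y /mapP[j _ ->] hy; alg.
    split; first exact: subset_trans hJn hnO'.
    move=> h; apply: (local_proper hl); apply: hJn; apply: h; alg.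
  suff : (1 <= 0)%N by [].
  apply: (hb 1%N (fun i => if i is 0 then lc O (us dl) else O)).
  by split=> [[|i] _|[]//]; split=> //; [alg|exact: (proj1 hlt)|exact: (proj1 hlt)].
have hdO z : z \in us dl -> O z by case/mapP=> j _ ->.
have hprim := bound_primary hO hN hl hdO hb.
have half a' b' : reg2 O n a' b' -> exists o j0 dl', [/\ forall j : 'I_m, adj O (b' / a') (dl' j),
    ~ scm a' (adj O (b' / a')) (dl' j0), exists k, lc (adj O (b' / a')) (us dl') (a' ^+ k),
    dl' = (fun j => dl j / a' ^+ o) & generated L u (adj O (b' / a'))].
  move=> hr'; have [_ _ _ en' [a0' _]] := hr'.
  have [o [h1 [j0 h2]]] := blow_order hr' hd hdl0.
  have na' : n a' by alg.
  have Oa' : O a' by alg.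
  have haK := hprim _ na'.
  have hrad := blow_radical o hr' haK.
  exists o, j0, (fun j => dl j / a' ^+ o); split=> //.
  have hn1 := blow_normal hr' hLf hOL hf; have [hO1 _ _ _ _] := hn1.
  have hrel' : relation L u (fun j => dl j / a' ^+ o).
    by apply: relation_scale => //; [apply: srX => //; exact: hOL|exact: expf_neq0].
  apply: (generated_local hrel' hn1 h1) => Q hQ hQd.
  have [[_ sQ] _ _] := hQ.
  have Qa : Q a'.
    have [k hk] := hrad.
    apply: (prime_mulX hO1 (k := k) hQ); first exact: sub_adj.
    move: hk; apply: (lc_min sQ) => _ y /mapP[j _ ->] hy; alg.
  have [f hrf] := blow_fiber hr' hQ Qa (hQd j0) h2.
  have hS := mset_compl hO1 hQ.
  have [_ hCL _ _ hff] := normal_loc hrel' hn1 hS.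
  apply: (IH _ _ _ _ _ hrf hrel' hCL hff).
    by move=> j; apply: (sub_loc hS).
  exact: (blow_bound hr' hd h1 h2 haK hS hn hb).
have [o [j0 [dl' [h1 h2 h3 e1 hg1]]]] := half a b hr.
have [_ [_ [_ [_ _ _ _ hg2]]]] := half b a (reg2_sym hr).
have Oa : O a.

  alg.
have hrel' : relation L u dl'.
  by rewrite e1; apply: relation_scale => //; [apply: srX => //; exact: hOL|exact: expf_neq0].
exact: (generated_glue hr hrel' hOL hf h1 h2 h3 hg1 hg2).
Qed.

End Generation.

(** Were [b] not regular modulo [a], the expansion of a witness would put a power of [b] into aO;
    then [a] alone would be primary, against the height theorem in dimension two. *)
Lemma reg2_intro (K : fieldType) (O n : set K) a b : subring O -> noethm O O ->
  is_local O n -> krull_dim O 2 -> n = lc O [:: a; b] -> reg2 O n a b.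
Proof.
move=> hO hN hl [[c hc] _] en; have hOO := sm_self hO.
have na : n a by alg.
have nb : n b by alg.
have [hnO _] := local_ideal hl; have Oa := hnO _ na; have Ob := hnO _ nb.
have hone x : n x -> ~ primary O n [:: x].
  move=> hx hp; have := krull_height (s := [:: x]) hO hN hl _ hp hc.
  by move=> h; have : (2 <= 1)%N by apply: h => y; rewrite inE => /eqP ->.
have lc1 x z : O z -> lc O [:: x] (x * z).
  move=> hz; apply: (lc_mem hOO) => //; alg.
have a0 : a != 0.
  apply/eqP => a0; apply: (hone b nb) => x /(two_gen hO en)[v [w [hv hw ->]]].
  by exists 1%N; rewrite a0 mul0r add0r; exact: lc1.
split=> //; split=> // x hx [z hz e]; apply: contrapT => hax.
have [t [d [g [hd hnd hg ex]]]] := two_gen_expand hO hN hl en hx hax.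
apply: (hone a na) => y /(two_gen hO en)[v [w [hv hw ->]]].
have [d' hd' edd] := local_unit hO hN hl hd hnd.
have hb : scm a O (b ^+ t.+1).
  exists (d' * (z - b * g)); first alg.
  have -> : a * (d' * (z - b * g)) = d' * (a * z - b * (a * g)) by ring.
  rewrite -e ex; transitivity (d * d' * b ^+ t.+1); first by rewrite edd mul1r.
  by rewrite exprS; ring.
exists t.+1; suff [w' hw' ->] : scm a O ((a * v + b * w) ^+ t.+1) by exact: lc1.
have sa := sm_scm a hOO.
have hOw := srM hO Ob hw; have hOv : O (a * v + b * w) by apply: srD => //; exact: srM.
rewrite -[_ ^+ t.+1](subrK ((b * w) ^+ t.+1)); apply: (smD sa).
  rewrite subrXX addrK; exists (v * \sum_(i < t.+1) (a * v + b * w) ^+ (t.+1.-1 - i) * (b * w) ^+ i).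
    alg.
  by rewrite mulrA.
rewrite exprMn mulrC; alg.
Qed.

(** * The base ring embedded in a field *)

Section ImageRegular.
Variables (A : comNzRingType) (K : fieldType) (f : {rmorphism A -> K}) (m : set A).
Hypothesis f_inj : injective f.
Hypothesis regA : regular_local [set: A] m 2.
Local Notation O := (f @` [set: A]).
Local Notation n := (f @` m).

Lemma image_mem N a : (f @` N) (f a) -> N a.
Proof. by case=> b hb /f_inj <-. Qed.

Lemma image_prime P : prime_ideal [set: A] P -> prime_ideal O (f @` P).
Proof.
case=> [[_ sP] P1 hP]; split.
- split; last exact: sm_image.
  by move=> _ [x _ <-].
- by rewrite -(rmorph1 f) => /image_mem.
- move=> _ _ [x _ <-] [y _ <-]; rewrite -rmorphM => /image_mem /(hP _ _ I I)[h|h].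
    by left.
  by right.
Qed.

Lemma preimage_prime Q : prime_ideal O Q -> prime_ideal [set: A] (f @^-1` Q).
Proof.
case=> [[_ sQ] Q1 hQ]; split.
- split=> //; split.
  + rewrite /preimage /= rmorph0; alg.
  + move=> x y; rewrite /preimage /= rmorphD; alg.
  + move=> x y _; rewrite /preimage /= rmorphM; alg.
- by rewrite /= rmorph1.
- move=> x y _ _; rewrite /preimage /= rmorphM; apply: hQ; by [exists x|exists y].
Qed.

Lemma image_krull_dim d : krull_dim [set: A] d -> krull_dim O d.
Proof.
move=> [[c [hc1 hc2]] hb]; split.
  exists (fun i => f @` c i); split=> [i hi|i hi]; first exact/image_prime/hc1.
  have [h1 h2] := hc2 i hi; split; first exact: image_subset.
  move=> h; apply: h2 => x hx; apply: image_mem; apply: h; by exists x.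
move=> k c' [hc1' hc2']; apply: (hb k (fun i => f @^-1` c' i)); split=> [i hi|i hi].
  exact/preimage_prime/hc1'.
have [h1 h2] := hc2' i hi; split; first by move=> x; exact: h1.
move=> h; apply: h2 => x hx; have [[hO _] _ _] := hc1' i.+1 hi.
by have [y _ e] := hO x hx; rewrite -e in hx *; exact: h.
Qed.

Lemma image_local : is_local O n.
Proof.
have [hA /(noetherianE hA) hN hl _ _] := regA.
have [_ sm] := local_ideal hl.
apply: local_intro; first exact: sr_image.
- by split; [move=> _ [x _ <-]; exists x|exact: sm_image].
- by rewrite -(rmorph1 f) => /image_mem; exact: local_proper hl.
- move=> _ [x _ <-] hx; have [|d _ e] := local_unit hA hN hl (c := x) I.
    alg.
  by exists (f d); [exists d|rewrite -rmorphM e rmorph1].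
Qed.

Lemma image_reg2 : exists a b, reg2 O n a b.
Proof.
have [hA /(noetherianE hA) hN hl hd [g eg]] := regA.
exists (f (g ord0)), (f (g (lift ord0 ord0))); apply: reg2_intro.
- exact: sr_image.
- exact: noeth_image.
- exact: image_local.
- exact: image_krull_dim.
- by rewrite eg (span_rangeE _ hA) lc_image !enum_ordSl enum_ord0.
Qed.

End ImageRegular.

(* A nonzero prime other than the maximal ideal is minimal over each of its nonzero
   elements, hence associated to the ideal they generate. *)
Lemma height_one_socle (K : fieldType) (O n P : set K) c : subring O -> noethm O O ->
  is_local O n -> krull_dim O 2 -> prime_ideal O P -> ~ (n `<=` P) -> P c -> c != 0 ->
  exists x, [/\ O x, ~ scm c O x & forall p, P p -> scm c O (x * p)].
Proof.
move=> hO hN hl [_ hdim] hP hnP Pc c0; have hOO := sm_self hO.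
have hS := mset_compl hO hP; set S := compl O P in hS.
have [[hPO sP] P1 hPM] := hP.
have hlP := local_loc hO hP; rewrite -/S in hlP.
have hO' : subring (loc O S) by exact: loc_subring.
have hO'O' := sm_self hO'.
have hN' : noethm (loc O S) (loc O S) by exact: loc_noeth.
have Oc := hPO _ Pc; have Oc' := sub_loc hS Oc.
have hcrad x : loc P S x -> exists k : nat, scm c (loc O S) (x ^+ k).
  move=> hx; have [[hPO' _] _ _] := local_prime hO' hN' hlP.
  apply: (radical_power hO' hN') => [|Q hQ hcQ].
    by split; [exact: (scm_sub Oc' hO'O')|alg].
  have [hQ0 hQS] := contract_prime hO hS hQ.
  have hQ0P : Q `&` O `<=` P.
    move=> z hz; apply: contrapT => hnz; apply: (hQS z hz); split=> //; by case: hz.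
  have hQ0c : (Q `&` O) c.
    split=> //; apply: hcQ; exists 1; rewrite ?mulr1 //; exact: sr1.
  suff hPQ : P `<=` Q `&` O.
    have [[_ sQ] _ _] := hQ; case: hx => w [s [hw hs ->]]; rewrite mulrC.
    apply: (smZ sQ); last by case: (hPQ _ hw).
    exists 1, s; rewrite mul1r; alg.
  apply: contrapT => hPQ.
  (* Otherwise zero, the contraction of [Q], [P] and [n] would form a chain of length three. *)
  have := hdim 3%N (fun i => match i with 0 => [set 0] | 1 => Q `&` O | 2 => P | _ => n end).
  have hz : prime_ideal O [set 0].
    split; first by split; [move=> _ ->; exact: sr0|exact: sm_zero].
      by move/eqP; rewrite oner_eq0.
    by move=> x' y _ _ /eqP; rewrite mulf_eq0 => /orP[/eqP ->|/eqP ->]; [left|right].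
  move=> h; have : (3 <= 2)%N; last by [].
  apply: h; split=> [[|[|[|i]]] _|[|[|[|i]]]] //.
  - exact: local_prime hO hN hl.
  - move=> _; split; first by move=> _ ->; have [[_ h0] _ _] := hQ0; alg.
    by move=> /(_ _ hQ0c) /eqP; rewrite (negbTE c0).
  - move=> _; split=> //; exact: (proper_sub_local hO hN hl).
(* A regular element of the maximal ideal on the quotient by [c] would have a power that is zero
   there. *)
have hns : ~ socle_free (loc P S) (loc O S) (scm c (loc O S)).
  move=> hs; have hfg := hN' _ hO'O' (fun _ h => h).
  have [|y hy hreg] := regular_exists hO' hN' hlP hfg (L := [:: scm c (loc O S)]).
    move=> X [<-|//]; alg.
  have hy1 := hreg _ (or_introl erefl).
  have [k hk] := hcrad y hy; elim: k hk => [|k IH]; last first.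
    rewrite exprS => /hy1 h; apply: IH; apply: h; alg.
  rewrite expr0 => -[z hz e]; apply: (local_proper hlP); rewrite e mulrC.
  by apply: (smZ (idealP (local_ideal hlP))) => //; exact: sub_loc hS _ Pc.
have /existsNP[w0 /not_implyP[hw0 /not_implyP[hsoc hcw]]] := hns.
have [w [s0 [hw hs0 ew]]] := hw0.
have s00 := mset_neq0 hS hs0; have [hSO hS1 hSM _] := hS.
have hcw' : ~ scm c (loc O S) w.
  move=> h; apply: hcw; rewrite ew mulrC; apply: (smZ (sm_scm c hO'O')) => //.
  exists 1, s0; rewrite mul1r; alg.
have hsocw p : P p -> exists2 s, S s & scm c O (s * (w * p)).
  move=> hp; have [z [z1 [s [hz hs ->]] e]] := hsoc p (sub_loc hS hp).
  exists s => //; exists (z1 * s0); first alg.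
  have s1 := mset_neq0 hS hs.
  have ep : p * w = c * (z1 / s) * s0 by rewrite -e ew; field.
  by rewrite [w * p]mulrC ep; field.
have [ps eps] := hN _ sP hPO.
have [s hs hall] : exists2 s, S s & forall p, p \in ps -> scm c O (s * (w * p)).
  have : forall p, p \in ps -> P p by alg.
  elim: (ps) => [_|p qs IH hqs]; first by exists 1.
  have [|s hs h] := IH; first by move=> q hq; apply: hqs; rewrite inE hq orbT.
  have [s' hs' h'] := hsocw p (hqs p (mem_head _ _)).
  exists (s * s'); first exact: hSM.
  move=> q; rewrite inE => /orP[/eqP ->|hq].
    rewrite -mulrA; apply: (smZ (sm_scm c hOO)) => //; alg.
  rewrite [s * s']mulrC -mulrA; apply: (smZ (sm_scm c hOO)); [alg|exact: h].
exists (s * w); split; first alg.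
  case=> z hz e; apply: hcw'; exists (z / s); first by exists z, s.
  by rewrite mulrA -e mulrAC mulfV ?mul1r // (mset_neq0 hS hs).
move=> p; rewrite eps; suff h : lc O ps `<=` [set p | O p /\ scm c O (s * w * p)].
  by move=> /h[].
have hsub : submodule O [set p | O p /\ scm c O (s * w * p)].
  have sc := sm_scm c hOO; split.
  - split; alg.
  - move=> x y [h1 h2] [h3 h4]; split; alg.
  - move=> x y hx [h1 h2]; split; alg.
apply: (lc_min hsub) => q x hq hx; rewrite [q * x]mulrC; apply: (smZ hsub) => //; split.
  alg.
by rewrite -mulrA; exact: hall.
Qed.

(** * The image of a module in its bidual *)

Section Coordinates.
Variables (A : idomainType) (M : lmodType A) (r : nat) (e : 'I_r -> dual (dual M)).
Hypothesis basis_e : free_basis e.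

Lemma dual_ext (V : lmodType A) (f g : dual V) : (forall x, f x = g x) -> f = g.
Proof. by move=> h; apply: val_inj; apply: funext. Qed.

Lemma dual_sumE (V : lmodType A) k (c : 'I_k -> A) (f : 'I_k -> dual V) x :
  (\sum_i c i *: f i : dual V) x = \sum_i c i * f i x.
Proof.
pose ev (g : dual V) : A := g x.
have h : forall s : seq 'I_k, ev (\sum_(i <- s) c i *: f i) = \sum_(i <- s) c i * ev (f i).
  by elim=> [|i s IH]; rewrite ?big_nil // !big_cons -IH.
exact: h.
Qed.

Lemma dual_sum (V : lmodType A) (f : dual V) k (c : 'I_k -> A) (x : 'I_k -> V) :
  f (\sum_i c i *: x i) = \sum_i c i * f (x i) :> A.
Proof.
have lf : linear (f : V -> A^o) by case: f => f0 /= /asboolP.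
have f0 : f 0 = 0 :> A.
  by have := lf (-1) 0 0; rewrite scaler0 addr0 scaleN1r addNr.
have h : forall s : seq 'I_k, f (\sum_(i <- s) c i *: x i) = \sum_(i <- s) c i * f (x i) :> A.
  by elim=> [|i s IH]; rewrite ?big_nil // !big_cons lf IH.
alg.
Qed.

Lemma dualD (V : lmodType A) (f : dual V) x y a : f (a *: x + y) = a * f x + f y :> A.
Proof. by case: f => f0 /= /asboolP ->. Qed.

Definition coords (x : M) : 'rV[A]_r := \row_i sval (cid (basis_e (biduality x))) i.

Lemma coordsP x : biduality x = \sum_i coords x 0 i *: e i.
Proof.
rewrite /coords; case: cid => c [hc _] /=; rewrite hc.
by apply: eq_bigr => i _; rewrite mxE.
Qed.

Lemma coords_uniq x (v : 'rV[A]_r) : biduality x = \sum_i v 0 i *: e i -> coords x = v.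
Proof.
move=> h; rewrite /coords; case: cid => c [hc hu] /=; apply/rowP => i; rewrite mxE.
rewrite (hu [ffun i => v 0 i]) ?ffunE // h.
by apply: eq_bigr => j _; rewrite ffunE.
Qed.

Lemma coords_linear : linear coords.
Proof.
move=> a x y; apply: coords_uniq; apply: dual_ext => f.
have ex := congr1 (fun g : dual (dual M) => g f : A) (coordsP x).
have ey := congr1 (fun g : dual (dual M) => g f : A) (coordsP y).
rewrite !dual_sumE in ex ey *; rewrite [LHS]dualD [f x]ex [f y]ey mulr_sumr -big_split /=.
by apply: eq_bigr => i _; rewrite !mxE mulrDl mulrA.
Qed.

Lemma functional_coords (f : dual M) x : f x = \sum_i coords x 0 i * e i f :> A.
Proof.
have := congr1 (fun g : dual (dual M) => g f : A) (coordsP x).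
by rewrite dual_sumE.
Qed.

Fact coord_subproof (j : 'I_r) : linear_pred (fun x : M => coords x 0 j : A^o).
Proof. by apply/asboolP => a x y; rewrite coords_linear !mxE. Qed.

Definition coord (j : 'I_r) : dual M := Dual (coord_subproof j).

(* The coordinates form a basis of the dual of [M], dual to [e]. *)
Lemma coord_dual i j : e i (coord j) = (i == j)%:R :> A.
Proof.
have [c [_ hu]] := basis_e (e i).
have h1 : e i = \sum_k [ffun k => (i == k)%:R] k *: e k.
  apply: dual_ext => f; rewrite dual_sumE (bigD1 i) //= ffunE eqxx mul1r big1 ?addr0 //.
  by move=> k hk; rewrite ffunE eq_sym (negbTE hk) mul0r.
have h2 : e i = \sum_k [ffun k => e i (coord k) : A] k *: e k.
  apply: dual_ext => f; rewrite dual_sumE.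
  have ef : f = \sum_k (e k f : A) *: coord k.
    apply: dual_ext => x; rewrite dual_sumE functional_coords.
    by apply: eq_bigr => k _; rewrite mulrC.
  by rewrite [in LHS]ef dual_sum; apply: eq_bigr => k _; rewrite ffunE mulrC.
have := congr1 (fun g : {ffun 'I_r -> A} => g j) (etrans (esym (hu _ h1)) (hu _ h2)).
by rewrite !ffunE => <-.
Qed.

Lemma coords_orthogonal (v : 'I_r -> A) : (forall x, \sum_i v i * coords x 0 i = 0) ->
  forall i, v i = 0.
Proof.
move=> h i; have e0 : \sum_k v k *: coord k = 0 :> dual M.
  by apply: dual_ext => x; rewrite dual_sumE h.
have := dual_sum (e i) v coord; rewrite e0.
have -> : e i 0 = 0 :> A by have := dual_sum (e i) (fun _ : 'I_0 => 0) (fun _ => 0); rewrite !big_ord0.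
rewrite (bigD1 i) //= coord_dual eqxx mulr1 big1 ?addr0 // => k hk.
by rewrite coord_dual eq_sym (negbTE hk) mulr0.
Qed.

Definition coord_image : set 'rV[A]_r := range coords.

Lemma coord_imageD v w : coord_image v -> coord_image w -> coord_image (v + w).
Proof.
move=> [x _ <-] [y _ <-]; exists (x + y) => //.
by have := coords_linear 1 x y; rewrite !scale1r.
Qed.

Lemma coord_imageZ a v : coord_image v -> coord_image (a *: v).
Proof.
move=> [x _ <-]; have h0 : coords 0 = 0.
  by have := coords_linear (-1) 0 0; rewrite scaler0 addr0 scaleN1r addNr.
by exists (a *: x); have := coords_linear a x 0; rewrite h0 !addr0.
Qed.

Lemma coord_image0 : coord_image 0.
Proof. by rewrite -(scale0r (coords 0)); apply: coord_imageZ; exists 0. Qed.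

Lemma coord_image_sum (I : Type) (s : seq I) (P : pred I) (F : I -> 'rV[A]_r) :
  (forall i, P i -> coord_image (F i)) -> coord_image (\sum_(i <- s | P i) F i).
Proof. by apply: big_ind; [exact: coord_image0|exact: coord_imageD]. Qed.

(** The maximal minors of coordinate matrices of elements of [M]. By Cramer's rule they multiply the
    free module into the image of [M], and by [minors_colon] no principal proper ideal has room for
    all of them. *)
Definition minors : set A :=
  [set d | exists W : 'M[A]_r, (forall i, coord_image (row i W)) /\ d = \det W].

(* One row at a time is replaced by an arbitrary one: as a function of that row on the
   image of [M] the quotient is a functional, hence has coefficients in [A]. *)
Lemma minors_colon c x : c != 0 -> (forall d, minors d -> exists z, x * d = c * z) ->
  exists z, x = c * z.
Proof.
move=> c0 h.
suff main k : (k <= r)%N -> forall W : 'M[A]_r,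
    (forall i : 'I_r, (k <= i)%N -> coord_image (row i W)) -> exists z, x * \det W = c * z.
  have [|z] := main r (leqnn r) 1%:M; last by rewrite det1 mulr1 => e1; exists z.
  by move=> i; rewrite leqNgt ltn_ord.
elim: k => [|k IH] hk W hW.
  by apply: h; exists W; split=> // i; apply: hW.
pose j := Ordinal hk.
pose W' (w : 'rV[A]_r) := \matrix_(i, l) (if i == j then w 0 l else W i l).
have hcof w l : cofactor (W' w) j l = cofactor W j l.
  rewrite /cofactor; congr (_ * \det _); apply/matrixP => i i'; rewrite !mxE.
  by rewrite eq_sym (negbTE (neq_lift _ _)).
have hdet w : \det (W' w) = \sum_l w 0 l * cofactor W j l.
  rewrite (expand_det_row _ j); apply: eq_bigr => l _.
  by rewrite hcof mxE eqxx.
have /choice[phi hphi] : forall y, exists z, x * (\sum_l coords y 0 l * cofactor W j l) = c * z.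
  move=> y; rewrite -hdet; apply: (IH (ltnW hk)) => i hi.
  have [->|hij] := eqVneq i j.
    have -> : row j (W' (coords y)) = coords y by apply/rowP => l; rewrite !mxE eqxx.
    by exists y.
  have -> : row i (W' (coords y)) = row i W by apply/rowP => l; rewrite !mxE (negbTE hij).
  by apply: hW; rewrite ltn_neqAle hi andbT eq_sym.
have hlin : linear_pred (fun y => phi y : A^o).
  apply/asboolP => a y z; apply: (mulfI c0); rewrite -hphi coords_linear.
  transitivity (a * (x * (\sum_l coords y 0 l * cofactor W j l)) +
      x * (\sum_l coords z 0 l * cofactor W j l)).
    rewrite !mulr_sumr -big_split /=; apply: eq_bigr => l _.
    by rewrite !mxE; ring.
  by rewrite !hphi; rewrite -[a *: _]/(a * _); ring.
have hcoef l : x * cofactor W j l = c * e l (Dual hlin).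
  apply/eqP; rewrite -subr_eq0; apply/eqP.
  apply: (coords_orthogonal (v := fun l => x * cofactor W j l - c * e l (Dual hlin))) => y.
  transitivity (x * (\sum_l coords y 0 l * cofactor W j l) - c * phi y); last first.
    by rewrite hphi subrr.
  rewrite -[phi y]/(Dual hlin y : A) functional_coords !mulr_sumr -sumrB.
  by apply: eq_bigr => i _; ring.
exists (\sum_l W j l * e l (Dual hlin)).
rewrite (expand_det_row _ j) !mulr_sumr; apply: eq_bigr => l _.
by rewrite mulrCA hcoef mulrCA.
Qed.

Lemma minors_mul d v : minors d -> coord_image (d *: v).
Proof.
move=> [W [hW ->]]; have -> : \det W *: v = (v *m \adj W) *m W.
  by rewrite -mulmxA mul_adj_mx mul_mx_scalar.
by rewrite mulmx_sum_row; apply: coord_image_sum => i _; apply: coord_imageZ.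
Qed.

(** Otherwise a prime other than the maximal ideal contains all minors. Then some [x] outside the
    ideal of a nonzero minor [d0] multiplies that prime into this ideal, against [minors_colon]. *)
Theorem conductor_power m f : regular_local [set: A] m 2 -> m f ->
  exists k, forall v, coord_image (f ^+ k *: v).
Proof.
move=> regA mf; pose iota : {rmorphism A -> {fraction A}} := @FracField.tofrac A.
have iota_inj : injective iota by move=> x y /eqP; rewrite tofrac_eq => /eqP.
have [hA /(noetherianE hA) hNA hlA hdA _] := regA.
pose O := iota @` [set: A]; pose n := iota @` m.
have hO : subring O by exact: sr_image.
have hN : noethm O O by exact: noeth_image.
have hl : is_local O n by exact: image_local.
have hd : krull_dim O 2 by exact: image_krull_dim.
have OA a : O (iota a) by exists a.
pose X := [set y | O y /\ exists2 a, y = iota a & forall v, coord_image (a *: v)].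
have sX : submodule O X.
  split.
  - split; first exact: sr0; exists 0; first alg.
    by move=> v; rewrite scale0r; exact: coord_image0.
  - move=> _ _ [_ [a -> ha]] [_ [b -> hb]]; split; first exact: srD.
    exists (a + b); first by rewrite rmorphD.
    by move=> v; rewrite scalerDl; apply: coord_imageD.
  - move=> _ _ [b _ <-] [_ [a -> ha]]; split; first exact: srM.
    exists (b * a); first by rewrite rmorphM.
    by move=> v; rewrite -scalerA; apply: coord_imageZ.
have hX : ideal O X by split=> // y [].
have hDX d : minors d -> X (iota d).
  by split=> //; exists d => // v; exact: minors_mul.
have [P hP hXP|k [_ [a ea ha]]] := radical_power hO hN (x := iota f) hX; last first.
  by exists k => v; have -> : f ^+ k = a by apply: iota_inj; rewrite rmorphXn.
apply: contrapT => hPf.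
have hnP : ~ (n `<=` P) by move=> h; apply: hPf; apply: h; exists f.
have colon c x : c != 0 -> (forall d, minors d -> scm (iota c) O (iota x * iota d)) ->
    scm (iota c) O (iota x).
  move=> c0 h; have [d hmd|z ->] := minors_colon c0 (x := x); last by exists (iota z) => //; rewrite rmorphM.
  have [_ [z _ <-] e1] := h d hmd; exists z; apply: iota_inj.
  by rewrite !rmorphM.
have [d0 hd0 d00] : exists2 d, minors d & d != 0.
  apply: contrapT => hno.
  have [a [b [_ _ _ en [a0 _]]]] := image_reg2 iota_inj regA.
  have : (iota @` m) a by alg.
  case=> c mc ec; have c0 : c != 0 by apply: contraNneq a0 => c0; rewrite -ec c0 rmorph0.
  have [d hmd|_ [z _ <-]] := colon c 1 c0.
    have -> : d = 0 by apply: contrapT => /eqP h; apply: hno; exists d.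
    by rewrite mulr0; exact: sm0 (sm_scm _ (sm_self hO)).
  rewrite -rmorphM => /iota_inj e1; apply: (local_proper hlA); rewrite e1 mulrC.
  exact: smZ (idealP (local_ideal hlA)) _ _.
have [|x [[x' _ <-] hx1 hx2]] := height_one_socle (c := iota d0) hO hN hl hd hP hnP (hXP _ (hDX _ hd0)).
  by apply: contraNneq d00 => e0; apply/eqP/iota_inj.
apply: hx1; apply: colon => // d hmd; apply: hx2; apply: hXP; exact: hDX.
Qed.

End Coordinates.

(** * Reductions *)

Section GeneratorCount.
Variables (K : fieldType) (O n : set K) (a b : K).
Hypothesis hr : reg2 O n a b.
Let hO := reg2_ring hr.
Let hN := reg2_noeth hr.
Let hl := reg2_local hr.
Let en := reg2_gens hr.
Let hOO := sm_self hO.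
Let snO := reg2_sub hr.
Let sn : submodule O n. Proof. alg. Qed.
Let Oa : O a. Proof. alg. Qed.
Let Ob : O b. Proof. alg. Qed.

(** O/aO is a discrete valuation ring: an element of [I] of least order in [b] generates modulo
    [a]. *)
Lemma principal_mod I : submodule O I -> I `<=` O -> I `<=` scm a O \/
  exists2 c0, I c0 & forall c, I c -> exists d e, [/\ O d, O e & c = c0 * d + a * e].
Proof.
move=> sI hIO; have [h|hno] := pselect (I `<=` scm a O); [by left|right].
pose Q t := exists c g, [/\ O c, ~ n c, O g & I (c * b ^+ t + a * g)].
have hQ c : I c -> ~ scm a O c ->
    exists t d g, [/\ O d, ~ n d, O g & c = d * b ^+ t + a * g].
  by move=> hc hac; have := reg2_expand hr (hIO _ hc) hac.
have [t0 ht0] : exists t, `[< Q t >].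
  have /existsNP[c /not_implyP[hc hac]] := hno.
  have [t [d [g [h1 h2 h3 e]]]] := hQ c hc hac; exists t; apply/asboolP.
  by exists d, g; rewrite -e.
have [t /asboolP[c [g [hc hnc hg hI]]] hmin] :=
  @ex_minnP (fun t => `[< Q t >]) (ex_intro _ t0 ht0).
have c0 := nonmem_neq0 hr hnc; have hcV := local_inv hr hc hnc.
exists (c * b ^+ t + a * g) => // c1 hc1.
have [[z hz ->]|hac] := pselect (scm a O c1).
  by exists 0, z; split=> //; [alg|rewrite mulr0 add0r].
have [t' [d [g' [h1 h2 h3 e]]]] := hQ c1 hc1 hac.
have htt : (t <= t')%N by apply: hmin; apply/asboolP; exists d, g'; rewrite -e.
have hx : O (d / c * b ^+ (t' - t)) by alg.
exists (d / c * b ^+ (t' - t)), (g' - g * (d / c * b ^+ (t' - t))); split=> //.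
  alg.
have eb : b ^+ t' = b ^+ t * b ^+ (t' - t) by rewrite -exprD subnKC.
by rewrite e eb; field.
Qed.

(** The classical argument for submodules of free modules over a principal ideal ring, here O/aO:
    the coefficients of one generator form a principal ideal, and the rest has one generator
    less. *)
Lemma gens_mod gs N X : submodule O N -> submodule O X -> (forall g, g \in gs -> X (a * g)) ->
  N `<=` addm (lc O gs) X -> exists hs, [/\ (size hs <= size gs)%N,
    forall h, h \in hs -> N h & N `<=` addm (lc O hs) X].
Proof.
elim: gs N => [|g gs IH] N sN sX hX hNX; first by exists [::].
have hX' g' : g' \in gs -> X (a * g') by move=> h; apply: hX; rewrite inE h orbT.
have sY : submodule O (addm (lc O gs) X) := sm_addm (sm_lc gs hOO) sX.
pose I := [set c | O c /\ exists2 v, addm (lc O gs) X v & N (c * g + v)].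
have sI : submodule O I.
  split.
  - split; first exact: sr0; exists 0; alg.
  - move=> x y [hx [v hv hv']] [hy [w hw hw']]; split; first exact: srD.
    exists (v + w); first exact: (smD sY).
    rewrite mulrDl addrACA; alg.
  - move=> x y hx [hy [v hv hv']]; split; first exact: srM.
    by exists (x * v); [alg|rewrite -mulrA -mulrDr; exact: (smZ sN)].
have hNg x : N x -> exists c v, [/\ O c, addm (lc O gs) X v & x = c * g + v].
  move=> /hNX[_ [w [[_ [z [[c hc ->] hz ->]]] hw ->]]].
  by exists c, (z + w); split=> //; [exists z, w|rewrite [g * c]mulrC addrA].
have [hIa|[c0 [hc0 [v0 hv0 hn0]] hI]] := principal_mod sI (fun c h => proj1 h).
  have [|hs [h1 h2 h3]] := IH N sN sX hX'.
    move=> x hx; have [c [v [hc hv e]]] := hNg x hx.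
    have [|z hz ez] := hIa c; first by split=> //; exists v => //; rewrite -e.
    rewrite e; apply: (smD sY) => //; apply: (addmr (sm_lc gs hOO)).
    rewrite ez mulrAC mulrC; apply: (smZ sX) => //; apply: hX; exact: mem_head.
  by exists hs; split=> //; exact: leqW.
have [||hs [h1 h2 h3]] := IH (N `&` addm (lc O gs) X) _ sX hX'.
- alg.
- alg.
exists ((c0 * g + v0) :: hs); split=> //.
  by move=> h; rewrite inE => /orP[/eqP ->|/h2 []].
move=> x hx; have [c [v [hc hv e]]] := hNg x hx.
have [|d [e' [hd he' ec]]] := hI c; first by split=> //; exists v => //; rewrite -e.
have [|y [z [hy hz ez]]] := h3 (x - d * (c0 * g + v0)).
  split; first alg.
  have -> : x - d * (c0 * g + v0) = e' * (a * g) + (v - d * v0) by rewrite e ec; ring.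
  apply: (smD sY); last alg.
  apply: (addmr (sm_lc gs hOO)); apply: (smZ sX) => //; apply: hX; exact: mem_head.
exists ((c0 * g + v0) * d + y), z; split=> //.
  by exists ((c0 * g + v0) * d), y; split=> //; exists d.
by rewrite -addrA -ez; ring.
Qed.

(** Generators of [N] are generators modulo [a] times the span of [gs], together with [a] times
    generators of [N1], for which [s] has dropped by one. *)
Lemma gens_bound s gs N : submodule O N -> N `<=` lc O gs ->
  scm (a ^+ s) (lc O gs) `<=` N -> exists2 hs, N = lc O hs & (size hs <= size gs * s.+1)%N.
Proof.

have sG := sm_lc gs hOO; have saG := sm_scm a sG.
elim: s N => [|s IH] N sN hNG hsN.
  exists gs; last by rewrite muln1.
  by rewrite eqEsubset; split=> // x hx; apply: hsN; exists x; rewrite ?mul1r.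
pose N1 := [set x | lc O gs x /\ N (a * x)].
have [|||hs1 e1 hs1s] := IH N1.
- split.
  + split; alg.
  + move=> x y [h1 h2] [h3 h4]; split; alg.
  + move=> c x hc [h1 h2]; split; alg.
- by move=> x [].
- move=> _ [x hx ->]; split; first alg.
  by apply: hsN; exists x => //; rewrite exprS mulrA.
have [||hs0 [h1 h2 h3]] := gens_mod (gs := gs) (N := N) (X := scm a (lc O gs)) sN saG.
- move=> g hg; exists g => //; alg.
- by apply: subset_trans hNG _; exact: (addml saG).
exists (hs0 ++ [seq a * h | h <- hs1]); last first.
  by rewrite size_cat size_map mulnS leq_add.
rewrite eqEsubset; split.
  move=> x hx; have [y [_ [hy [z hz ->] ex]]] := h3 x hx.
  have hy' : N y by apply: (lc_min sN _ hy) => g c /h2 hg hc; alg.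
  rewrite ex; apply: (smD (sm_lc _ hOO)).
    by apply: (lc_subseq hOO) hy => t ht; rewrite mem_cat ht.
  have hz1 : N1 z.
    split=> //; have -> : a * z = x - y by [rewrite ex addrAC subrr add0r]; alg.
  rewrite e1 in hz1; have := lc_scale a hOO hz1; apply: (lc_subseq hOO) => t ht.
  by rewrite mem_cat ht orbT.
apply: (lc_min sN) => x c hx hc; rewrite mulrC; apply: (smZ sN) => //.
move: hx; rewrite mem_cat => /orP[/h2 //|/mapP[h hh ->]].
have : N1 h by alg.
by case.
Qed.

(* Gaussian elimination over the residue field *)
Lemma dependent_mod (I : eqType) (s : seq I) (v : I -> K) hs : uniq s -> (size hs < size s)%N ->
  (forall i, i \in s -> lc O hs (v i)) -> exists c : I -> K,
    [/\ forall i, O (c i), exists2 i, i \in s & ~ n (c i) & lc n hs (\sum_(i <- s) c i * v i)].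
Proof.
have n1 := local_proper hl.
elim: hs s v => [|h hs IH] s v us hsz hv.
  case: s us hsz hv => // i s _ _ hv; exists (fun=> 1); split=> //; first alg.
    exists i => //; alg.
  by rewrite big_seq big1 // => j /hv /= ->; rewrite mulr0.
have hv' i : exists xv : K * K, i \in s -> [/\ O xv.1, lc O hs xv.2 & v i = h * xv.1 + xv.2].
  have [hi|hi] := boolP (i \in s); last by exists (0, 0).
  by have [_ [z [[c hc ->] hz e]]] := hv i hi; exists (c, z).
have /choice[f hf] := hv'.
have [hall|] := pselect (forall i, i \in s -> n (f i).1).
  have [i0 [s' es]] : exists i0 s', s = i0 :: s' by case: (s) hsz => // i0 s' _; exists i0, s'.
  have us' : uniq s' by move: us; rewrite es => /andP[].
  have hs's i : i \in s' -> i \in s by rewrite es inE => ->; rewrite orbT.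
  have [||c [h1 [i hi h2] h3]] := IH s' (fun i => (f i).2) us'.
  - by move: hsz; rewrite es.
  - by move=> i /hs's /hf [].
  have hi0 : i0 \notin s' by move: us; rewrite es => /andP[].
  exists (fun i => if i == i0 then 0 else c i); split.
  - move=> j; case: ifP => _ //; alg.
  - exists i; first exact: hs's.
    by case: eqP hi => // ->; rewrite (negbTE hi0).
  rewrite es big_cons eqxx mul0r add0r.
  have -> : \sum_(j <- s') (if j == i0 then 0 else c j) * v j =
      h * (\sum_(j <- s') c j * (f j).1) + \sum_(j <- s') c j * (f j).2.
    rewrite mulr_sumr -big_split /= !big_seq; apply: eq_bigr => j hj.
    have [_ _ ->] := hf j (hs's j hj); case: eqP hj => [->|_ _]; first by rewrite (negbTE hi0).
    by ring.
  exists (h * (\sum_(j <- s') c j * (f j).1)), (\sum_(j <- s') c j * (f j).2); split=> //.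
  exists (\sum_(j <- s') c j * (f j).1) => //; rewrite big_seq; apply: (sm_sum sn) => j hj.
  by apply: (smZ sn) => //; exact: hall (hs's j hj).
move=> /existsNP[j0 /not_implyP[hj0 hnj]].
have [ha hb hvj] := hf j0 hj0; have x0 := nonmem_neq0 hr hnj; have hxV := local_inv hr ha hnj.
pose s' := rem j0 s; have us' : uniq s' by exact: rem_uniq.
have hs's i : i \in s' -> i \in s by exact: mem_rem.
have hmem i : (i \in s') = (i != j0) && (i \in s) by rewrite mem_rem_uniq.
pose v' i := v i - (f i).1 / (f j0).1 * v j0.
have [||c [h1 [i hi h2] h3]] := IH s' v' us'.
- by rewrite size_rem; move: hsz => /=; case: (size s) => // k.
- move=> i /hs's hi; have [ha' hb' hvi] := hf i hi.
  have -> : v' i = (f i).2 - (f i).1 / (f j0).1 * (f j0).2 by rewrite /v' hvi hvj; field.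
  have sL := sm_lc hs hOO; apply: (smB hO sL) => //; apply: (smZ sL) => //; exact: srM.
have hc0 : O (- \sum_(i <- s') c i * ((f i).1 / (f j0).1)).
  apply: srN => //; rewrite big_seq; apply: sr_sum => // j hj; apply: srM => //; apply: srM => //.
  by have [] := hf j (hs's j hj).
exists (fun i => if i == j0 then - \sum_(i <- s') c i * ((f i).1 / (f j0).1) else c i); split.
- alg.
- exists i; first exact: hs's.
  by move: hi; rewrite hmem => /andP[/negbTE ->].
rewrite (perm_big _ (perm_to_rem hj0)) big_cons eqxx -/s' /=.
have -> : \sum_(j <- s') (if j == j0 then - \sum_(i <- s') c i * ((f i).1 / (f j0).1) else c j) * v j =
    \sum_(j <- s') c j * v j.
  rewrite !big_seq; apply: eq_bigr => j; rewrite hmem => /andP[/negbTE -> _] //.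
have -> : - (\sum_(i <- s') c i * ((f i).1 / (f j0).1)) * v j0 + \sum_(j <- s') c j * v j =
    \sum_(j <- s') c j * v' j.
  rewrite mulNr mulr_suml -sumrN -big_split /=; apply: eq_bigr => j _.
  by rewrite /v'; ring.
apply: (lc_subseq sn) h3 => t ht; by rewrite inE ht orbT.
Qed.

End GeneratorCount.

(** As a function of [d] the left side grows with exponent [r.+1] and the right side with exponent
    [r.+2]. The left side will bound the generators of a power of [M], the right side counts
    monomials. *)
Lemma many_monomials k r : exists d, ('C(d + r, d) * (k * d).+1 < 'C(d + r.+2, d))%N.
Proof.
pose d := (k.+1 * (r.+1 * r.+2))%N; exists d.
have e1 : ('C(d + r, d) = 'C(d + r, r))%N by rewrite -(bin_sub (leq_addl d r)) addnK.
have e2 : ('C(d + r.+2, d) = 'C(d + r.+2, r.+2))%N by rewrite -(bin_sub (leq_addl d r.+2)) addnK.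
have h1 := mul_bin_diag (d + r.+1) r; have h2 := mul_bin_diag (d + r.+2) r.+1.
rewrite addnS /= in h1; rewrite [in X in X = _](addnS d r.+1) /= addnS in h2.
rewrite -(ltn_pmul2l (_ : 0 < r.+1 * r.+2)%N) //.
have hC : (0 < 'C(d + r, r))%N by rewrite bin_gt0 leq_addl.
have -> : (r.+1 * r.+2 * 'C(d + r.+2, d) = (d + r).+2 * (d + r).+1 * 'C(d + r, r))%N.
  by rewrite e2 -mulnA -h2 mulnCA -h1 mulnA.
rewrite e1 mulnCA mulnC ltn_pmul2r //.
have hd : (0 < d)%N by [].
have h3 : (r.+1 * r.+2 * (k * d).+1 <= d * d)%N.
  have -> : (d * d = r.+1 * r.+2 * (k.+1 * d))%N by rewrite {1}/d mulnAC mulnC.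
  by rewrite leq_pmul2l // mulSn -add1n leq_add2r.
apply: leq_ltn_trans h3 _; rewrite -addn1; nia.
Qed.

Section FormProducts.
Variables (K : fieldType) (O : set K).
Hypothesis hO : subring O.
Let hOO := sm_self hO.

Lemma Un_mul m (u : 'I_m -> K) (i j : nat) x y : Un u O i x -> Un u O j y -> Un u O (i + j)%N (x * y).
Proof.
elim: i x => [|i IH] x; first by rewrite (Un0 u hOO); exact: (smZ (sm_Un u j hOO)).
rewrite addSn !(UnS u _ hOO) => hx hy; have sX := sm_lc (us u) (sm_Un u (i + j)%N hOO).
rewrite mulrC; apply: (lc_min_scale sX hx) => v w hv hw; rewrite mulrCA.
by apply: (lc_mem (sm_Un u _ hOO)) => //; rewrite mulrC; exact: IH.
Qed.

Lemma Un_mul1 m (u : 'I_m -> K) d x y : Un u O 1 x -> Un u O d y -> Un u O d.+1 (x * y).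
Proof. by rewrite -[d.+1]add1n; exact: Un_mul. Qed.

Lemma Un_exp m (u : 'I_m -> K) d x : Un u O 1 x -> Un u O d (x ^+ d).
Proof.
move=> hx; elim: d => [|d IH]; first by rewrite (Un0 _ hOO) expr0; alg.
by rewrite exprS; exact: Un_mul1.
Qed.

Lemma Un1 m (u : 'I_m -> K) : Un u O 1 = lc O (us u).
Proof. by rewrite (UnS u 0 hOO) (Un0 u hOO). Qed.

Lemma Un_gen m (u : 'I_m -> K) i : Un u O 1 (u i).
Proof. by rewrite Un1; apply: lc_gen => //; exact: mem_us. Qed.

Lemma Un_trans m m' (u : 'I_m -> K) (w : 'I_m' -> K) d : (forall i, Un u O 1 (w i)) ->
  Un w O d `<=` Un u O d.
Proof.
move=> h; elim: d => [|d IH]; first by rewrite !(Un0 _ hOO).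
rewrite (UnS w d hOO); apply: (lc_min (sm_Un u d.+1 hOO)) => _ y /mapP[i _ ->] hy.
apply: Un_mul1 => //; alg.
Qed.

Lemma Un_scale m m' (u : 'I_m -> K) (t : 'I_m' -> K) c d : O c ->
  (forall i, Un u O 1 (c * t i)) -> scm (c ^+ d) (Un t O d) `<=` Un u O d.
Proof.
move=> hc h; suff H y : Un t O d y -> Un u O d (c ^+ d * y) by move=> _ [y hy ->]; exact: H.
elim: d y => [|d IH] y; first by rewrite !(Un0 _ hOO) mul1r.
rewrite (UnS t d hOO) => hy.
apply: (lc_min_scale (sm_Un u d.+1 hOO) hy) => _ z /mapP[i _ ->] hz.
by rewrite exprS mulrACA; apply: Un_mul1 => //; exact: IH.
Qed.

Lemma Un_fg m (u : 'I_m -> K) d : fgm O (Un u O d).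
Proof.
elim: d => [|d [s IH]].
  exists [:: 1]; rewrite (Un0 _ hOO) eqEsubset; split=> [x hx|].
    rewrite -[x]mul1r; apply: (lc_mem hOO) => //; alg.
  apply: (lc_min hOO) => x y; rewrite inE => /eqP ->; alg.
by rewrite (UnS u d hOO) IH (lc_lc _ _ hOO); eexists.
Qed.

Lemma Un_basis m (u : 'I_m.+1 -> K) d :
  exists2 s : seq K, Un u O d = lc O s & size s = 'C(d + m, d).
Proof.
exists [seq ('X_[a]).@[u] | a <- [seq s2m t | t : d.-tuple 'I_m.+1 <- enum (basis m.+1 d)]];
  last by rewrite size_map size_basis.
rewrite eqEsubset; split.
  move=> _ [p hp ->]; move: p hp; have sL := sm_lc _ hOO.
  apply: PX_ind; first by rewrite meval0; exact: sm0 (sL _).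
    by move=> p q h1 h2; rewrite mevalD; exact: (smD (sL _)).
  move=> c a hc ha; rewrite mevalZ mulrC; apply: (lc_mem hOO) => //.
  by apply: map_f; rewrite -basis_cover ha.
apply: (lc_min (sm_Un u d hOO)) => _ c /mapP[a ha ->] hc; rewrite mulrC -mevalZ.
exists (c *: 'X_[a]) => //; apply: (PX_mono hOO) => //; apply/eqP.
by rewrite basis_cover.
Qed.

Lemma Un_values m (u : 'I_m -> K) d : (forall i, O (u i)) -> Un u O d `<=` O.
Proof.
move=> h; elim: d => [|d IH]; first by rewrite (Un0 _ hOO).
rewrite (UnS u d hOO); apply: (lc_min hOO) => _ y /mapP[i _ ->] hy.
alg.
Qed.

Lemma split_vars m d (q : {mpoly K[m]}) : PX O d.+1 q ->
  exists h, (forall k, PX O d (h k)) /\ q = \sum_k 'X_k * h k.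
Proof.
move=> hq; have [q0 [h [hq0 hf hh ->]]] := split_form predT hOO hq.
exists h; split=> //; rewrite (_ : q0 = 0) ?add0r //.
apply/mpolyP => e; rewrite mcoeff0; have [he|/(hq0 e).2 //] := eqVneq (mdeg e) d.+1.
have /existsP[k hk] : [exists k, (0 < e k)%N].
  apply: contraLR (_ : (0 < mdeg e)%N); last by rewrite he.
  rewrite negb_exists => /forallP h'; rewrite -leqNgt leqn0 mdegE big1 // => k _.
  by apply/eqP; rewrite -leqn0 leqNgt.
exact: hf hk.
Qed.

End FormProducts.

Section Reduction.
Variables (K : fieldType) (O n : set K) (a b : K) (r p : nat) (t : 'I_r -> K) (g : 'I_p -> K).
Hypothesis hr : reg2 O n a b.
Hypothesis residue_infinite : forall s : seq K, (forall z, z \in s -> O z) ->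
  exists2 c, O c & forall z, z \in s -> ~ n (c - z).
Hypothesis gt : forall i, Un t O 1 (g i).
Hypothesis ag : exists k : nat, forall i, Un g O 1 (a ^+ k * t i).
Let hO := reg2_ring hr.
Let hN := reg2_noeth hr.
Let hl := reg2_local hr.
Let en := reg2_gens hr.
Let hOO := sm_self hO.
Let snO := reg2_sub hr.
Let sn : submodule O n. Proof. alg. Qed.
Let np : prime_ideal O n. Proof. exact: local_prime. Qed.
Let n1 : ~ n 1. Proof. exact: local_proper hl. Qed.
Let Oa : O a. Proof. alg. Qed.
Local Notation Mn d := (Un g O d).
Let sM d : submodule O (Mn d) := sm_Un g d hOO.

(** For some degree the monomials in [r.+2] elements outnumber the generators of that power of [M],
    so they are dependent over the residue field; this bounds the analytic spread by [r.+1]. *)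
Lemma relation_exists (w : 'I_r.+2 -> K) : (forall i, Mn 1 (w i)) ->
  exists d (q : {mpoly K[r.+2]}) hs, [/\ PX O d.+1 q, exists a0, ~ n q@_a0,
    Mn d.+1 = lc O hs & lc n hs q.@[w]].
Proof.
move=> hw.
(* In rank zero all [w i] vanish and a variable is a relation; otherwise the rank is [r'.+1] and the
   monomials in [r'.+3] elements are counted. *)
have [k hk] := ag; case er: r t gt hk w hw => [|r'] t' gt' hk w hw.
  have [hs ehs] := Un_fg hO g 1; exists 0%N, 'X_ord0, hs; split=> //.
  - by rewrite -[X in PX O 1 X]scale1r; apply: (PX_mono hOO); [alg|exact: mdeg1].
  - by exists U_(ord0)%MM; rewrite mcoeffX eqxx.
  - rewrite mevalXU; suff -> : w ord0 = 0 by exact: sm0 (sm_lc _ sn).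
    have := Un_trans hO gt' (hw ord0); rewrite (Un1 hO).
    by move/(lc_usP t' _ hOO) => [c [_ ->]]; rewrite big_ord0.
have [[|d] hd] := many_monomials k r'; first by move: hd; rewrite !bin0.
have [gs egs sgs] := Un_basis hO t' d.+1.
have [|| hs ehs shs] := gens_bound hr (s := (k * d.+1)%N) (gs := gs) (sM d.+1).
- by rewrite -egs; exact: Un_trans.
- rewrite -egs exprM; apply: (Un_scale hO) => //; alg.
pose s := [seq s2m u | u : d.+1.-tuple 'I_r'.+3 <- enum (basis r'.+3 d.+1)].
have ss : size s = 'C(d.+1 + r'.+2, d.+1) by exact: size_basis.
have us : uniq s := uniq_basis r'.+3 d.+1.
have [||c [h1 [a0 ha0 h2] h3]] := @dependent_mod _ _ _ _ _ hr _ s (fun m => ('X_[m]).@[w]) hs us.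
- by rewrite ss; apply: leq_ltn_trans shs _; rewrite sgs.
- move=> m hm; rewrite -ehs; apply: (Un_trans hO hw); exists 'X_[m] => //.
  rewrite -[X in PX _ _ X]scale1r; apply: (PX_mono hOO); first exact: sr1.
  by apply/eqP; rewrite basis_cover.
pose q : {mpoly K[r'.+3]} := \sum_(m <- s) c m *: 'X_[m].
exists d, q, hs; split=> //.
- rewrite /q big_seq; apply: (PX_sum _ hOO) => m hm; apply: (PX_mono hOO) => //.
  by apply/eqP; rewrite basis_cover.
- exists a0; suff -> : q@_a0 = c a0 by [].
  rewrite (raddf_sum (mcoeff a0)) (bigD1_seq a0) //= mcoeffZ mcoeffX eqxx mulr1.
  rewrite big1 ?addr0 // => m hm; rewrite mcoeffZ mcoeffX; case: eqP => [e|_]; last exact: mulr0.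
  by rewrite e eqxx in hm.
- by rewrite raddf_sum /=; under eq_bigr => m _ do rewrite mevalZ.
Qed.

Lemma poly_nonvanishing (P : {poly K}) : coefs_in O P -> (exists i, ~ n P`_i) ->
  exists2 c, O c & ~ n P.[c].
Proof.
move=> hP [i hi]; apply: contrapT => hno.
have hall c : O c -> n P.[c] by move=> hc; apply: contrapT => h; apply: hno; exists c.
have [s] := ubnP (size P).
(* The induction exempts finitely many residue classes, because dividing by ['X - c0%:P] loses the
   class of [c0]. *)
have : exists zs : seq K, (forall z, z \in zs -> O z) /\
    forall c, O c -> (forall z, z \in zs -> ~ n (c - z)) -> n P.[c].
  by exists [::]; split=> // c hc _; exact: hall.
elim: s P hP i hi {hno hall} => // s IH P hP i hi [zs [hzs hall]] hs.
have [c0 hc0 hcz] := residue_infinite hzs; have hPc := hall _ hc0 hcz.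
have hXc : coefs_in O ('X - c0%:P).
  move=> j; rewrite coefB coefX coefC; apply: srB => //; alg.
have [|Q [R [hQ hR sR ePQ]]] := poly_div_unit hO hXc hP (negbT (polyXsubC_eq0 c0)).
  rewrite lead_coefXsubC invr1; alg.
rewrite size_XsubC ltnS in sR; have eR := size1_polyC sR.
have eRc : R`_0 = P.[c0] by rewrite ePQ hornerD hornerM hornerXsubC subrr mulr0
add0r eR hornerC coefC.
have hOP : forall j, O P`_j by [].
have hnR : n R`_0 by rewrite eRc.
have [j hj] : exists j, ~ n Q`_j.
  apply: contrapT => /forallNP hQn; apply: hi.
  have hQn' k : n Q`_k by apply: contrapT.
  rewrite ePQ coefD mulrBr coefB coefMX coefMC eR coefC; alg.
apply: (IH Q hQ j hj).
  exists (c0 :: zs); split=> [z|c hc hz]; first by rewrite inE => /orP[/eqP ->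
  //|]; alg.
  have h1 : n (Q.[c] * (c - c0)).
    have -> : Q.[c] * (c - c0) = P.[c] - R`_0.
      by rewrite ePQ hornerD hornerM hornerXsubC [in R.[c]]eR hornerC addrK.
    apply: (smB hO sn) => //; apply: hall => // z hz'; apply: hz; by rewrite inE hz' orbT.
  have [_ _ hM] := np; have hOQ : O Q.[c].
    rewrite horner_coef; alg.
  have [//|h2] := hM _ _ hOQ (srB hO hc hc0) h1.
  by case: (hz c0 (mem_head _ _)).
have Q0 : Q != 0 by apply: contra_notN hj => /eqP ->; rewrite coef0; alg.
move: hs; rewrite ePQ size_polyDl; last first.
  by rewrite size_mul ?polyXsubC_eq0 // size_XsubC addn2 ltnS (leq_trans sR) //
  size_poly_gt0.
by rewrite size_mul ?polyXsubC_eq0 // size_XsubC addn2.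
Qed.

Lemma base_expansion B m (f f' : nat -> nat) : (forall i, (f i < B)%N) -> (forall i, (f' i < B)%N) ->
  (\sum_(i < m) f i * B ^ i = \sum_(i < m) f' i * B ^ i)%N -> forall i, (i < m)%N -> f i = f' i.
Proof.
move=> hf hf'; elim: m f f' hf hf' => // m IH f f' hf hf'.
rewrite !big_ord_recl !expn0 !muln1.
have e (h : nat -> nat) : (\sum_(i < m) h (bump 0 i) * B ^ bump 0 i = B * \sum_(i < m) h i.+1 * B ^ i)%N.
  by rewrite big_distrr; apply: eq_bigr => i _; rewrite expnS mulnCA.
have B0 : (0 < B)%N by apply: leq_ltn_trans (hf 0%N).
rewrite !e => he; have e0 : f 0%N = f' 0%N.
  have := congr1 (modn^~ B) he.
  by rewrite ![(_ + B * _)%N]addnC ![(B * _)%N]mulnC !modnMDl !modn_small.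
case=> [|i] hi //; apply: (IH (fun i => f i.+1) (fun i => f' i.+1)) => //.
move/eqP: he; rewrite e0 eqn_add2l eqn_pmul2l // => /eqP; exact.
Qed.

(* Kronecker's substitution of powers of one element for the variables. *)
Lemma form_nonvanishing m (q : {mpoly K[m]}) d : PX O d q -> (exists e, ~ n q@_e) ->
  exists z : 'I_m -> K, (forall i, O (z i)) /\ ~ n q.@[z].
Proof.
move=> hq [e0 he0].
pose phi (e : 'X_{1..m}) := (\sum_(i < m) e i * d.+1 ^ i)%N.
have hdeg e i : ~ n q@_e -> (e i < d.+1)%N.
  move=> he; have [_ h] := hq e; have ed : mdeg e = d.
    apply/eqP; apply: contra_notT he => /h ->; alg.
  by rewrite -ed mdegE (bigD1 i) //= leq_addr.
have hdeg' e i : q@_e != 0 -> (e i < d.+1)%N.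
  move=> he; have [_ h] := hq e; have ed : mdeg e = d.
    by apply/eqP; apply: contraNT he => /h ->.
  by rewrite -ed mdegE (bigD1 i) //= leq_addr.
have he0' : q@_e0 != 0 by apply: contra_notN he0 => /eqP ->; alg.
pose P : {poly K} := \sum_(e <- msupp q) q@_e *: 'X^(phi e).
have hP : coefs_in O P.
  move=> i; rewrite coef_sum; apply: sr_sum => // e _; rewrite coefZ coefXn.
  by apply: srM => //; [have [] := hq e|alg].
have eP : P`_(phi e0) = q@_e0.
  rewrite coef_sum (bigD1_seq e0) ?msupp_uniq ?mcoeff_msupp //= coefZ coefXn eqxx mulr1.
  rewrite big_seq_cond big1 ?addr0 // => e /andP[]; rewrite mcoeff_msupp => he hne.
  rewrite coefZ coefXn; case: eqP => [h|_]; last exact: mulr0.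
  case/eqP: hne; apply/mnmP => i.
  pose F (e : 'X_{1..m}) (k : nat) := if insub k is Some j then e j else 0%N.
  have hF e1 k : q@_e1 != 0 -> (F e1 k < d.+1)%N.
    by rewrite /F; case: insubP => // j _ _; exact: hdeg'.
  have eF e1 : phi e1 = (\sum_(j < m) F e1 j * d.+1 ^ j)%N.
    by apply: eq_bigr => j _; rewrite /F valK.
  have := @base_expansion d.+1 m (F e) (F e0) (fun k => hF e k he) (fun k => hF e0 k he0').
  rewrite -!eF => /(_ (esym h) i (ltn_ord i)).
  by rewrite /F valK.
have [|c hc hPc] := poly_nonvanishing hP; first by exists (phi e0); rewrite eP.
exists (fun i : 'I_m => c ^+ (d.+1 ^ i)); split=> [i|]; first exact: srX.
suff -> : q.@[fun i : 'I_m => c ^+ (d.+1 ^ i)] = P.[c] by [].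
rewrite mevalE horner_sum; apply: eq_bigr => e _; rewrite hornerZ hornerXn.
congr (_ * _); rewrite expr_sum; apply: eq_bigr => i _.
by rewrite -exprM mulnC.
Qed.

Lemma form_difference m (w z : 'I_m -> K) x s d (q : {mpoly K[m]}) : (forall i, Mn 1 (w i)) ->
  (forall i, O (z i)) -> Mn 1 x -> (forall y, y \in s -> Mn 1 y) ->
  (forall i, w i - z i * x \in s \/ w i - z i * x = 0) -> PX O d.+1 q ->
  lc (Mn d) s (q.@[w] - q.@[z] * x ^+ d.+1).
Proof.
move=> hw hz hx hs hws; elim: d q => [|d IH] q /(split_vars hO)[h [hh ->]].
all: rewrite !raddf_sum /= mulr_suml -sumrB; apply: (sm_sum (sm_lc _ (sM _))) => i _.
all: rewrite !mevalM !mevalXU.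
all: have hterm e v : Mn e v -> lc (Mn e) s ((w i - z i * x) * v) by
    move=> hv; case: (hws i) => [hi|->]; [exact: (lc_mem (sM _))|rewrite mul0r; exact: sm0 (sm_lc _ (sM _))].
  have hv : Mn 0 (h i).@[w] by apply: (Un_trans hO hw); exists (h i).
  suff -> : w i * (h i).@[w] - z i * (h i).@[z] * x ^+ 1 = (w i - z i * x) * (h i).@[w] by exact: hterm.
  suff -> : (h i).@[z] = (h i).@[w] by ring.
  have [c ->] : exists c, h i = c%:MP.
    exists (h i)@_0; apply/mpolyP => e; rewrite mcoeffC; have [->|he] := eqVneq e 0%MM.
      by rewrite mulr1.
    by rewrite mulr0; have [_ ->] := hh i e; rewrite ?mdeg_eq0.
  by rewrite !mevalC.
have hv : Mn d.+1 (h i).@[w] by apply: (Un_trans hO hw); exists (h i).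
have -> : w i * (h i).@[w] - z i * (h i).@[z] * x ^+ d.+2 =
    (w i - z i * x) * (h i).@[w] + z i * (x * ((h i).@[w] - (h i).@[z] * x ^+ d.+1)).
  by rewrite [x ^+ d.+2]exprS; ring.
have sL := sm_lc s (sM d.+1); apply: (smD sL); first exact: hterm.
apply: (smZ sL) => //; apply: (lc_min_scale sL (IH (h i) (hh i))) => y v hy hv'.
by rewrite mulrCA; apply: (lc_mem (sM _)) => //; exact: Un_mul1.
Qed.

(** At a point [z] where the relation [q] has a unit value, the elements are replaced by
    [w i - z i * x] with [x = w j] and [z j = 1], so one disappears. The relation then puts a unit
    multiple of a power of [x] into the new reduction modulo [n], and Nakayama's lemma removes
    [n]. *)
Lemma reduction_step s d : (r.+1 < size s)%N -> (forall y, y \in s -> Mn 1 y) ->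
  Mn d.+1 `<=` lc (Mn d) s -> exists s' d', [/\ (size s' < size s)%N,
    forall y, y \in s' -> Mn 1 y & Mn d'.+1 `<=` lc (Mn d') s'].
Proof.
move=> hsz hs hd.
pose w (i : 'I_r.+2) := nth 0 s i.
have hws i : w i \in s by apply: mem_nth; apply: leq_trans hsz.
have hw i : Mn 1 (w i) by alg.
have [N [q [hs0 [hq hqn eM hqw]]]] := relation_exists hw.
have [z0 [hz0 hqz0]] := form_nonvanishing hq hqn.
(* A form of positive degree takes a value in [n] at a point with all coordinates in [n]. *)
have [j hj] : exists j, ~ n (z0 j).
  apply: contrapT => /forallNP hall; apply: hqz0.
  have [h [hh ->]] := split_vars hO hq.
  rewrite raddf_sum /=; apply: (sm_sum sn) => i _; rewrite mevalM mevalXU mulrC.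
  apply: (smZ sn); last by apply: contrapT.
  by apply: (Un_values hO hz0 (d := N)); exists (h i).
have zj0 := nonmem_neq0 hr hj; have zjV := local_inv hr (hz0 j) hj.
pose z i := z0 i / z0 j.
have hz i : O (z i) by exact: srM.
pose x := w j; pose s' := [seq w i - z i * x | i <- rem j (enum 'I_r.+2)] ++ drop r.+2 s.
have hzj : z j = 1 by rewrite /z mulfV.
have hs' y : y \in s' -> Mn 1 y.
  rewrite mem_cat => /orP[/mapP[i _ ->]|/mem_drop /hs //].
  by apply: (smB hO (sM 1)) => //; exact: (smZ (sM 1) (hz i) (hw j)).
have hws' i : w i - z i * x \in s' \/ w i - z i * x = 0.
  have [->|hij] := eqVneq i j; first by right; rewrite hzj mul1r subrr.
  left; rewrite mem_cat; apply/orP; left; apply: map_f.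
  by rewrite mem_rem_uniq ?enum_uniq // inE hij mem_enum.
have hsplit e : lc (Mn e) s `<=` addm (lc (Mn e) s') (scm x (Mn e)).
  have sY := sm_addm (sm_lc s' (sM e)) (sm_scm x (sM e)).
  apply: (lc_min sY) => y v hy hv.
  have [h|h] := ltnP (index y s) r.+2.
    have -> : y = (w (Ordinal h) - z (Ordinal h) * x) + z (Ordinal h) * x.
      by rewrite subrK /w nth_index.
    rewrite mulrDl; apply: (smD sY).
      apply: (addml (sm_scm x (sM e))); case: (hws' (Ordinal h)) => [hi|->].
        exact: (lc_mem (sM e)).
      by rewrite mul0r; exact: sm0 (sm_lc _ (sM e)).
    apply: (addmr (sm_lc s' (sM e))); exists (z (Ordinal h) * v); last by ring.
    exact: (smZ (sM e)).
  apply: (addml (sm_scm x (sM e))); apply: (lc_mem (sM e)) => //.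
  rewrite mem_cat; apply/orP; right; rewrite -(nth_index 0 hy) -(subnKC h) -nth_drop.
  apply: mem_nth; rewrite size_drop ltn_sub2r ?index_mem //.
  by apply: leq_ltn_trans h _; rewrite index_mem.
have sub1 e v : Mn e v -> Mn e.+1 (x * v).
  by apply: Un_mul1 => //; exact: hw.
have hde e : (d <= e)%N -> Mn e.+1 `<=` lc (Mn e) s.
  elim: e => [|e IH]; first by rewrite leqn0 => /eqP <-.
  rewrite leq_eqVlt => /orP[/eqP <- //|]; rewrite ltnS => /IH h.
  rewrite (UnS g e.+1 hOO); apply: (lc_min (sm_lc s (sM _))) => _ y /mapP[i _ ->] /h hy.
  apply: (lc_min_scale (sm_lc s (sM e.+1)) hy) => y1 v hy1 hv; rewrite mulrCA.
  by apply: (lc_mem (sM _)) => //; apply: Un_mul1 => //; exact: Un_gen.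
(* Modulo [s'] only products with a high power of [x] survive, and the relation controls these. *)
have hk k : Mn (d + k)%N.+1 `<=` addm (lc (Mn (d + k)%N) s') (scm (x ^+ k.+1) (Mn d)).
  elim: k => [|k IH]; first by rewrite addn0; exact: subset_trans hd (hsplit d).
  have sL := sm_lc s' (sM (d + k)%N.+1); have sX := sm_scm (x ^+ k.+2) (sM d).
  rewrite addnS; apply: subset_trans (hde _ (leqW (leq_addr k d))) _; apply: subset_trans (hsplit _) _.
  apply: (addm_min (sm_addm sL sX)); first exact: (addml sX).
  move=> _ [v /IH[y [_ [hy [v' hv' ->] ->]]] ->]; rewrite mulrDr.
  apply: (smD (sm_addm sL sX)); last first.
    by apply: (addmr sL); exists v'; rewrite // mulrA.
  apply: (addml sX); apply: (lc_min_scale sL hy) => y1 v1 hy1 hv1; rewrite mulrCA.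
  by apply: (lc_mem (sM _)) => //; exact: sub1.
exists s', (d + N)%N; split=> //.
  rewrite size_cat size_map size_rem ?mem_enum // size_enum_ord size_drop /=.
  by rewrite -addSn subnKC.
have [hs1 e1] := Un_fg hO g (d + N).+1.
have sL := sm_lc s' (sM (d + N)%N).
suff hgen y : y \in hs1 -> lc (Mn (d + N)%N) s' y.
  rewrite e1; apply: (lc_min sL) => y c hy hc; rewrite mulrC; apply: (smZ sL) => //; exact: hgen.
apply: (nakayama hO hN hl sL) => {}y hy.
have [y1 [_ [hy1 [v hv ->] ->]]] : addm (lc (Mn (d + N)%N) s') (scm (x ^+ N.+1) (Mn d)) y.
  apply: hk; alg.
have sn1 := sm_lc hs1 sn; have sY := sm_addm sL sn1.
apply: (smD sY); first exact: (addml sn1).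
have hqz : q.@[z] = q.@[z0] / z0 j ^+ N.+1.
  rewrite /z !mevalE mulr_suml; apply: eq_big_seq => e he; rewrite -mulrA; congr (_ * _).
  have ed : mdeg e = N.+1.
    apply/eqP; have [_ h] := hq e; rewrite mcoeff_msupp in he.
    by apply: contraNT he => /h ->.
  rewrite -ed mdegE -exprVn expr_sum -big_split /=; apply: eq_bigr => i _.
  by rewrite exprMn.
have hnqz : ~ n q.@[z].
  have [_ _ hM] := np; move=> h; apply: hqz0.
  have -> : q.@[z0] = z0 j ^+ N.+1 * q.@[z] by rewrite hqz mulrC divfK // expf_neq0.
  alg.
have hOqz : O q.@[z].
  by apply: (Un_values hO hz (d := N.+1)); exists q.
have hqV := local_inv hr hOqz hnqz; have qz0 := nonmem_neq0 hr hnqz.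
have hdif := form_difference hw hz (hw j) hs' hws' hq; rewrite -/x in hdif.
have -> : x ^+ N.+1 * v = (q.@[z])^-1 * (v * q.@[w] - v * (q.@[w] - q.@[z] * x ^+ N.+1)).
  by apply: (mulfI qz0); rewrite mulVKf //; ring.
apply: (smZ sY) => //; apply: (smB hO sY).
  apply: (addmr sL); apply: (lc_min_scale sn1 hqw) => y2 c hy2 hc; rewrite mulrA mulrC.
  apply: (scm_lc_sub (s := hs1) hl hO hc); exists (v * y2) => //; rewrite -e1 -addnS.
  apply: Un_mul => //; alg.
apply: (addml sn1); apply: (lc_min_scale sL hdif) => y2 c hy2 hc; rewrite mulrCA.
by apply: (lc_mem (sM _)) => //; exact: Un_mul.
Qed.

Theorem reduction_exists : exists u : 'I_r.+1 -> K, (forall i, Mn 1 (u i)) /\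
  exists d, Mn d.+1 `<=` lc (Mn d) (us u).
Proof.
suff [s [d [hsz hs hd]]] : exists s d, [/\ (size s <= r.+1)%N, forall y, y \in s -> Mn 1 y &
    Mn d.+1 `<=` lc (Mn d) s].
  exists (fun i : 'I_r.+1 => nth 0 s i); split.
    move=> i; have [h|h] := ltnP i (size s); first by apply: hs; exact: mem_nth.
    by rewrite nth_default //; exact: sm0 (sM 1).
  exists d; apply: subset_trans hd _; apply: (lc_subseq (sM d)) => y hy.
  have hi : (index y s < r.+1)%N by apply: leq_trans hsz; rewrite index_mem.
  apply/mapP; exists (Ordinal hi); first by rewrite mem_enum.
  by rewrite nth_index.
have : exists s d, (forall y, y \in s -> Mn 1 y) /\ Mn d.+1 `<=` lc (Mn d) s.
  exists (us g), 0%N; split; first by move=> _ /mapP[i _ ->]; exact: Un_gen.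
  by rewrite (UnS g 0 hOO).
case=> s [d [hs hd]]; have [k] := ubnP (size s); elim: k s d hs hd => // k IH s d hs hd hk.
have [h|h] := leqP (size s) r.+1; first by exists s, d.
have [s' [d' [h1 h2 h3]]] := reduction_step h hs hd.
by apply: (IH s' d') => //; exact: leq_trans h1 _.
Qed.

End Reduction.

(** * The relation among the generators of a reduction *)

Section ReductionRelation.
Variables (K : fieldType) (L O n : set K) (a b : K) (r : nat) (t : 'I_r -> K) (u : 'I_r.+1 -> K).
Hypothesis hr : reg2 O n a b.
Hypothesis hLf : isfield L.
Hypothesis hOL : O `<=` L.
Hypothesis t_indep : forall p, (forall e, L p@_e) -> p.@[t] = 0 -> p = 0.
Hypothesis ut : forall i, Un t O 1 (u i).
Hypothesis t_red : forall f, n f ->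
  exists e N : nat, forall i, lc (Un t O N) (us u) (f ^+ e * t i ^+ N.+1).
Let hO := reg2_ring hr.
Let hN := reg2_noeth hr.
Let hl := reg2_local hr.
Let en := reg2_gens hr.
Let a0 := reg2_neq0 hr.
Let hOO := sm_self hO.
Let hL : subring L. Proof. by case: hLf. Qed.
Let hmL := sr_mcoefs r hL.

Let exG : exists G : 'M[K]_(r.+1, r), (forall i k, O (G i k)) /\ forall i, u i = \sum_k G i k * t k.
Proof.
have /choice[c hc] : forall i, exists c : 'I_r -> K, (forall k, O (c k)) /\ u i = \sum_k c k * t k.
  by move=> i; have := ut i; rewrite (Un1 hO) => /(lc_usP t _ hOO).
exists (\matrix_(i, k) c i k); split=> [i k|i]; first by rewrite mxE; exact: (hc i).1.
by rewrite (hc i).2; apply: eq_bigr => k _; rewrite mxE.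
Qed.
Let G := sval (cid exG).
Let GO i k : O (G i k). Proof. by have [h _] := svalP (cid exG). Qed.
Let uG i : u i = \sum_k G i k * t k. Proof. by have [_ h] := svalP (cid exG). Qed.

(** The coordinate matrix bordered by the column of the [u i]; the cofactors along that column are
    the signed maximal minors of [G]. *)
Let H : 'M[K]_r.+1 := \matrix_(i, k) if unlift ord_max k is Some k' then G i k' else u i.
Let dl i := cofactor H i ord_max.

Let colH : col' ord_max H = G.
Proof. by apply/matrixP => i k; rewrite !mxE liftK. Qed.

Let dlE i : dl i = (-1) ^+ (i + (ord_max : 'I_r.+1)) * \det (row' i G).
Proof. by rewrite /dl /cofactor colH. Qed.

Let dlO i : O (dl i).
Proof.
rewrite dlE; apply: srM => //; first alg.
by apply: det_in => // j k; rewrite !mxE.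
Qed.

(** The vector with entries [t] and -1 is in the kernel of [H], so the expansion of its determinant
    along the last column is zero. *)
Lemma bordered_relation : \sum_i dl i * u i = 0.
Proof.
have : \det H == 0.
  rewrite -det_tr; apply/det0P; pose v : 'rV[K]_r.+1 := \row_k (if unlift ord_max k is Some k' then t k' else -1).
  exists v.
    apply/eqP => /rowP /(_ ord_max); rewrite !mxE unlift_none => /eqP.
    by rewrite oppr_eq0 oner_eq0.
  apply/rowP => i; rewrite !mxE (bigD1 ord_max) //= !mxE unlift_none mulN1r.
  apply/eqP; rewrite addrC subr_eq0 uG; apply/eqP.
  rewrite (reindex_omap (lift ord_max) (unlift ord_max)) /=; last first.
    by move=> k hk; case: unliftP hk => [j ->|->]; rewrite ?eqxx.
  apply: eq_big => [k|k _]; first by rewrite liftK eqxx eq_sym neq_lift.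
  by rewrite !mxE liftK mulrC.
rewrite (expand_det_col _ ord_max) => /eqP; apply: etrans; apply: eq_bigr => i _.
by rewrite [H i _]mxE unlift_none mulrC.
Qed.

(** Rows and columns are chosen by arbitrary maps, as the induction on the size of minors requires:
    a repetition gives zero, and otherwise the minor is one of the [dl i] up to sign. *)
Lemma minor_in (X : set K) (f : 'I_r -> 'I_r.+1) (g : 'I_r -> 'I_r) : submodule O X ->
  (forall i, X (dl i)) -> X (\det (mxsub f g G)).
Proof.
move=> sX hX; have X0 := sm0 sX.
have [/injectiveP ig|/injectivePn[i [j hij e]]] := boolP (injectiveb g); last first.
  rewrite -det_tr (_ : \det _ = 0) //; apply: (determinant_alternate hij) => k.
  by rewrite !mxE e.
have [/injectiveP fi|/injectivePn[i [j hij e]]] := boolP (injectiveb f); last first.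
  by rewrite (_ : \det _ = 0) //; apply: (determinant_alternate hij) => k; rewrite !mxE e.
have [j hj] : exists j, j \notin codom f.
  apply/existsP; rewrite -negb_forall; apply/negP => /forallP h.
  have := uniq_leq_size (enum_uniq 'I_r.+1) (fun k _ => h k : k \in codom f).
  by rewrite size_codom card_ord size_enum_ord ltnn.
pose s i := odflt i (unlift j (f i)).
have hs i : f i = lift j (s i).
  rewrite /s; case: unliftP => //= e; case/negP: hj; rewrite -e; exact: codom_f.
have si : injective s by move=> i i' e; apply: fi; rewrite !hs e.
have -> : mxsub f g G = row_perm (perm si) (col_perm (perm ig) (row' j G)).
  by apply/matrixP => i k; rewrite !mxE !permE hs.
rewrite row_permE col_permE !det_mulmx !det_perm mulrCA mulrC.
have hs1 (k : nat) : O ((-1) ^+ k) by alg.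
have -> : \det (row' j G) = (-1) ^+ (j + (ord_max : 'I_r.+1)) * dl j.
  by rewrite dlE mulrA -expr2 sqrr_sign mul1r.
rewrite mulrA; apply: (smZ sX) => //; apply: srM => //; exact: srM.
Qed.

(* At a prime containing all the maximal minors of [G], the [(k+1)]-minors give points
   killed by [G], hence trivial ones, so the [k]-minors vanish there as well. *)
Lemma relation_primary : primary O n (us dl).
Proof.
move=> f hf; have [hnO _] := local_ideal hl; have fO := hnO _ hf.
have hI : ideal O (lc O (us dl)).
  split; last exact: (sm_lc _ hOO).
  move=> x /(lc_usP dl _ hOO)[c [hc ->]]; alg.
apply: (radical_power hO hN hI) => P hP hdP; apply: contrapT => hPf.
have [[hPO sP] P1 hPM] := hP.
(* The reduction writes [f ^+ e] times a power of each [t k] as a combination of the [u i]. As the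
   [t k] are independent this is an identity of polynomials, and it can be evaluated at [x]. *)
have triv (x : 'I_r -> K) : (forall k, O (x k)) -> (forall i, P (\sum_k G i k * x k)) ->
    forall k, P (x k).
  move=> hx hGx k; have [e [N h]] := t_red hf.
  have [c [hc ec]] := (lc_usP u _ (sm_Un t N hOO)).1 (h k).
  have /choice[q hq] : forall i, exists q : {mpoly K[r]}, PX O N q /\ c i = q.@[t].
    by move=> i; have [q h1 h2] := hc i; exists q.
  pose l i : {mpoly K[r]} := \sum_k G i k *: 'X_k.
  have hl' i (z : 'I_r -> K) : (l i).@[z] = \sum_k G i k * z k.
    by rewrite raddf_sum; apply: eq_bigr => j _ /=; rewrite mevalZ mevalXU.
  have e0 : f ^+ e *: 'X_k ^+ N.+1 - \sum_i q i * l i = 0.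
    apply: t_indep.
      apply: (srB hmL).
        move=> m; rewrite mcoeffZ; apply: srM => //; first alg.
        apply: (srX _ hmL) => m'; rewrite mcoeffX; alg.
      apply: (sr_sum hmL) => i _; apply: (srM hmL).
        by move=> m; apply: hOL; have [] := (hq i).1 m.
      apply: (sr_sum hmL) => j _ m; rewrite mcoeffZ mcoeffX; apply: srM => //;
      alg.
    rewrite mevalB mevalZ rmorphXn /= mevalXU ec [meval _ (\sum_(_ | _) _)]raddf_sum /=; apply/eqP; rewrite subr_eq0.
    by apply/eqP/eq_bigr => i _; rewrite mevalM hl' -uG (hq i).2.
  have := congr1 (meval x) e0.
  rewrite mevalB mevalZ rmorphXn /= mevalXU [meval _ (\sum_(_ | _) _)]raddf_sum meval0 => /eqP; rewrite subr_eq0 => /eqP e1.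
  apply: (prime_mulX hO (k := N.+1) hP (hx k)).
  have hfx : P (f ^+ e * x k ^+ N.+1).
    rewrite e1; apply: (sm_sum sP) => i _ /=; rewrite mevalM hl'; apply: (smZ sP) => //.
    by apply: (Un_values hO hx (d := N)); exists (q i) => //; exact: (hq i).1.
  by case: (hPM _ _ (srX _ hO fO) (srX _ hO (hx k)) hfx) => // /(prime_mulX hO hP fO).
have main k : (k <= r)%N -> forall (g : 'I_(r - k) -> 'I_r.+1) (h : 'I_(r - k) -> 'I_r),
    P (\det (mxsub g h G)).
  elim: k => [|k IH] hk.
    rewrite subn0 => g h; apply: minor_in => // i; apply: hdP; apply: lc_gen => //.
    by exact: mem_us.
  have ek : (r - k = (r - k.+1).+1)%N by lia.
  rewrite ek in IH; move: (r - k.+1)%N ek IH => q ek IH g h.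
  have [c hc] : exists c, c \notin codom h.
    apply/existsP; rewrite -negb_forall; apply/negP => /forallP hh.
    have := uniq_leq_size (enum_uniq 'I_r) (fun k _ => hh k : k \in codom h).
    by rewrite size_codom card_ord size_enum_ord; lia.
  pose g' (i0 : 'I_r.+1) (i : 'I_q.+1) := if unlift ord0 i is Some i' then g i' else i0.
  pose h' (i : 'I_q.+1) := if unlift ord0 i is Some i' then h i' else c.
  pose cof i := cofactor (mxsub (g' ord0) h' G) ord0 i.
  have hcof i0 i : cofactor (mxsub (g' i0) h' G) ord0 i = cof i.
    rewrite /cof /cofactor; congr (_ * \det _); apply/matrixP => i1 i2; rewrite !mxE.
    by rewrite /g' liftK.
  have hdet i0 : \det (mxsub (g' i0) h' G) = \sum_i G i0 (h' i) * cof i.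
    rewrite (expand_det_row _ ord0); apply: eq_bigr => i _; rewrite hcof mxE /g' unlift_none //.
  (* The cofactors along a free first row: paired with a row of [G] they give a minor of the larger
     size, and the entry at the new column [c] is the given minor. *)
  pose x k0 := \sum_(i | h' i == k0) cof i.
  have hx k0 : P (x k0).
    apply: triv => [k1|i].
      apply: sr_sum => // i _; apply: srM => //; first alg.
      by apply: det_in => // i1 i2; rewrite !mxE.
    have -> : \sum_k1 G i k1 * x k1 = \det (mxsub (g' i) h' G); last exact: (IH (ltnW hk)).
    rewrite hdet (partition_big h' predT) //=; apply: eq_bigr => k1 _.
    by rewrite mulr_sumr; apply: eq_bigr => i1 /eqP ->.
  have := hx c; rewrite /x (big_pred1 ord0) => [|i].
    rewrite /cof /cofactor expr0 mul1r; suff -> : row' ord0 (col' ord0 (mxsub (g' ord0) h' G)) = mxsub g h G by [].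
    by apply/matrixP => i1 i2; rewrite !mxE /g' /h' !liftK.
  rewrite /h'; case: unliftP => [j ->|->] /=; last by rewrite !eqxx.
  rewrite [in RHS]eq_sym (negbTE (neq_lift _ _)); apply/negbTE; apply: contraNneq hc => <-.
  exact: codom_f.
have := main r (leqnn r); rewrite subnn.
have ff (i : 'I_0) : False by case: i.
by move=> /(_ (fun=> ord0) (fun i => False_rect _ (ff i))); rewrite det_mx00.
Qed.

(** Without row [j] the matrix [G] is invertible, so the remaining [u i] arise from the independent
    [t k] by a linear change of variables, which [lV] undoes. *)
Lemma relation_indep j : dl j != 0 -> indep L u (pred1 j).
Proof.
move=> hj p hp hfp ep.
have hu : row' j G \in unitmx.
  rewrite unitmxE unitfE; apply: contraNneq hj => e; by rewrite dlE e mulr0.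
pose lG : r.+1.-tuple {mpoly K[r]} := [tuple \sum_k G i k *: 'X_k | i < r.+1].
pose lV : r.-tuple {mpoly K[r.+1]} := [tuple \sum_i invmx (row' j G) k i *: 'X_(lift j i) | k < r].
have q0 : p \mPo lG = 0.
  apply: t_indep.
    suff: [set q : {mpoly K[r]} | forall e, L q@_e] (p \mPo lG) by [].
    rewrite comp_mpolyEX; apply: (sr_sum hmL) => m _ e /=; rewrite mcoeffZ; apply: srM => //.
    suff: [set q : {mpoly K[r]} | forall e, L q@_e] ('X_[m] \mPo lG) by [].
    rewrite comp_mpolyX.
    have : [set q : {mpoly K[r]} | forall e, L q@_e] (\prod_(i < r.+1) tnth lG i ^+ m i).
      apply: (sr_prod hmL) => i _; apply: (srX _ hmL); rewrite tnth_mktuple.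
      apply: (sr_sum hmL) => k _ e'; rewrite mcoeffZ mcoeffX; apply: srM => //;
      alg.
    alg.
  rewrite comp_mpoly_meval -[RHS]ep; apply: meval_eq => i; rewrite tnth_mktuple raddf_sum uG.
  by apply: eq_bigr => k _ /=; rewrite mevalZ mevalXU.
have := congr1 (comp_mpoly lV) q0; rewrite raddf0 => <-.
rewrite [RHS](_ : _ = \sum_(m <- msupp p) p@_m *: 'X_[m]); first exact: mpolyE.
rewrite (comp_mpolyEX p lG) [LHS]raddf_sum /= big_seq [RHS]big_seq; apply: eq_bigr => m hm.
rewrite comp_mpolyZ; congr (_ *: _); rewrite comp_mpolyX rmorph_prod [RHS]mpolyXE_id; apply: eq_bigr => i _ /=.
have [eij|hij] := eqVneq i j.
  suff -> : m i = 0%N by rewrite rmorph1.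
  apply/eqP; rewrite -leqn0 leqNgt; apply/negP => h.
  by move: hm; rewrite mcoeff_msupp (hfp m i) ?eqxx //= eij.
rewrite rmorphXn /=; congr (_ ^+ _); rewrite tnth_mktuple raddf_sum /=.
transitivity (\sum_k G i k *: \sum_i' invmx (row' j G) k i' *: 'X_(lift j i') : {mpoly K[r.+1]}).
  apply: eq_bigr => k _; rewrite comp_mpolyZ comp_mpolyXU; congr (_ *: _).
  by rewrite -tnth_nth tnth_mktuple.
have [i1 e1] : exists i1, i = lift j i1.
  by case: (unliftP j i) hij => [i1 -> _|->]; [exists i1|rewrite eqxx].
transitivity (\sum_i' (\sum_k G i k * invmx (row' j G) k i') *: 'X_(lift j i') : {mpoly K[r.+1]}).
  under eq_bigr => k _ do rewrite scaler_sumr.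
  rewrite exchange_big /=; apply: eq_bigr => i' _; rewrite scaler_suml.
  by apply: eq_bigr => k _; rewrite scalerA.
have hmul i' : \sum_k G i k * invmx (row' j G) k i' = (i1 == i')%:R.
  have := congr1 (fun A : 'M_r => A i1 i') (mulmxV hu); rewrite !mxE => <-.
  by apply: eq_bigr => k _; rewrite [row' j G i1 k]mxE e1.
rewrite (bigD1 i1) //= hmul eqxx scale1r big1 ?addr0 ?e1 // => k hk.
by rewrite -e1 hmul eq_sym (negbTE hk) scale0r.
Qed.

Lemma forms_in_span j k : dl j != 0 -> Un u L 1 (t k).
Proof.
move=> hj; have hu : row' j G \in unitmx.
  rewrite unitmxE unitfE; apply: contraNneq hj => e; by rewrite dlE e mulr0.
have hLL := sm_self hL; have [_ hLV] := hLf.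
have GL i i' : L (G i i') by alg.
rewrite (Un1 hL); apply/(lc_usP u _ hLL).
exists (fun i => if unlift j i is Some i' then invmx (row' j G) k i' else 0); split=> [i|].
  case: unliftP => [i' _|_]; last exact: sr0.
  rewrite /invmx hu !mxE; apply: (srM hL).
    by apply: hLV; apply: det_in => // i1 i2; rewrite !mxE.
  apply: (srM hL); first alg.
  by apply: det_in => // i1 i2; rewrite !mxE.
have := congr1 (fun A : 'M_r => \sum_k' A k k' * t k') (mulVmx hu).
rewrite [in RHS](bigD1 k) //= [1%:M k k]mxE eqxx mul1r [in RHS]big1 ?addr0 => [e|k' hk']; last first.
  by rewrite !mxE eq_sym (negbTE hk') mul0r.
rewrite (bigD1 j) //= unlift_none mul0r add0r.
rewrite (reindex_omap (lift j) (unlift j)) /=; last first.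
  by move=> i hi; case: unliftP hi => [i' ->|->]; rewrite ?eqxx.
apply: etrans (esym e) _; under eq_bigr => k' _ do rewrite mxE mulr_suml.
rewrite exchange_big /=; apply: eq_big => [i|i _]; first by rewrite liftK eqxx
eq_sym neq_lift.
rewrite liftK uG mulr_sumr; apply: eq_bigr => k' _; by rewrite !mxE mulrA.
Qed.

Theorem reduction_relation : exists dl, [/\ relation L u dl, forall j, O (dl j), primary O n (us dl)
  & forall k, Un u L 1 (t k)].
Proof.
suff [j hj] : exists j, dl j != 0.
  exists dl; split=> //; [|exact: relation_primary|by move=> k; exact: (forms_in_span k hj)].
  split=> //; [alg|by exists j|exact: bordered_relation|exact: relation_indep].
apply: contrapT => hno; have hdl0 i : dl i = 0.
  by apply/eqP; apply: contrapT => h; apply: hno; exists i; apply/negP.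
have na : n a by alg.
have [k /(lc_usP dl _ hOO)[c [_ e]]] := relation_primary na.
move/eqP: e; rewrite big1 => [|i _]; last by rewrite hdl0 mulr0.
by rewrite expf_eq0 (negbTE a0) andbF.
Qed.

End ReductionRelation.

(** * Depth of the integral closure *)

Lemma lc_mapP (K : fieldType) (B N : set K) m (u : 'I_m -> K) (l : seq 'I_m) z : submodule B N ->
  lc N [seq u i | i <- l] z <->
    exists x : 'I_m -> K, [/\ forall i, N (x i), forall i, i \notin l -> x i = 0 & z = \sum_i u i * x i].
Proof.
move=> hN; split=> [|[x [hx x0 ->]]]; last first.
  apply: (sm_sum (sm_lc _ hN)) => i _; have [hi|/x0 ->] := boolP (i \in l).
    by apply: (lc_mem hN) => //; exact: map_f.
  by rewrite mulr0; exact: sm0 (sm_lc _ hN).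
elim: l z => [|k l IH] z /=.
  by exists (fun=> 0); split=> // [_|]; [alg|rewrite big1 // => i _;
  rewrite mulr0].
move=> [_ [_ [[w hw ->] /IH[x [hx x0 ->]] ->]]].
exists (fun i => (if i == k then w else 0) + x i); split=> [i|i|].
- apply: (smD hN) => //; case: ifP => // _; alg.
- by rewrite negb_or => /andP[/negbTE -> /x0 ->]; rewrite addr0.
under [in RHS]eq_bigr => i _ do rewrite mulrDr.
rewrite [in RHS]big_split /=; congr (_ + _); rewrite (bigD1 k) //= eqxx big1 ?addr0 // => i /negbTE ->.
by rewrite mulr0.
Qed.

Lemma regular_loc (K : fieldType) (B N X S : set K) x : subring B -> mset B S -> submodule B N ->
  submodule B X -> B x -> regular N X x -> regular (loc N S) (loc X S) x.
Proof.
move=> hB hS hN hX Bx h _ [w [s [Nw Ss ->]]] [z [t [Xz St e]]].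
have [SB _ SM _] := hS; have s0 := mset_neq0 hS Ss; have t0 := mset_neq0 hS St.
have e' : x * (t * w) = s * z.
  move: e; rewrite mulrA => /eqP; rewrite eqr_div // => /eqP e.
  by rewrite mulrCA mulrA mulrC mulrA mulrAC [w * x]mulrC e mulrC.
exists (t * w), (s * t); split; last by rewrite [s * t]mulrC -mulf_div divff // mul1r.
  apply: h; first exact: (smZ hN (SB _ St) Nw).
  rewrite e'; alg.
exact: SM.
Qed.

Section GradedDepth.
Variables (K : fieldType) (L O n : set K) (a b : K) (m : nat) (u dl : 'I_m -> K) (N : set K).
Hypothesis hr : reg2 O n a b.
Hypothesis hrel : relation L u dl.
Hypothesis hOL : O `<=` L.
Hypothesis hf : fractions L O.
Hypothesis hdl : forall j, O (dl j).
Hypothesis hprim : primary O n (us dl).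
Local Notation W := (Wn L u O).
Hypothesis WN : forall i, W i `<=` N.
(* the components of a relation with coefficients in degrees zero and one *)
Hypothesis graded : forall (x : 'I_m -> K) y z o, (forall k, N (x k)) -> N y -> O z -> O o ->
  \sum_k u k * x k + o * y + z = 0 -> exists (D : nat) (xc : 'I_m -> nat -> K) (yc : nat -> K),
    [/\ forall k i, W i (xc k i) /\ (x k = 0 -> xc k i = 0), forall i, W i (yc i),
        forall k, x k = \sum_(i < D) xc k i, y = \sum_(i < D) yc i
      & o * yc 0%N + z = 0 /\ forall i : nat, \sum_k u k * xc k i + o * yc i.+1 = 0].
Let hO := reg2_ring hr.
Let hNO := reg2_noeth hr.
Let hl := reg2_local hr.
Let en := reg2_gens hr.
Let a0 := reg2_neq0 hr.
Let hOO := sm_self hO.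
Let hLf : isfield L. Proof. by case: hrel. Qed.
Let na := reg2_l hr.
Let nb := reg2_r hr.
Let nO := reg2_sub hr.
Let Oa := nO na.
Let Ob := nO nb.
Let hnO : normal_in L O. Proof. by split=> //; exact: (reg2_icl hr). Qed.
Let sW i : submodule O (W i). Proof. exact: (sm_Wn hrel i hO hOL). Qed.

Lemma primary_chart : chart L dl O.
Proof.
split=> // y hy hyj.
have hc c : n c -> exists k : nat, O (c ^+ k * y).
  move=> hc; have [k hk] := hprim hc; exact: (colon_power hO hNO hOO (nO hc) hk hdl hyj).
by have [i hi] := hc _ na; have [j hj] := hc _ nb; exact: (reg2_glue hr hi hj).
Qed.

Lemma primary_generated : generated L u O.
Proof.
have hdO z : z \in us dl -> O z by case/mapP=> j _ ->.
have [l hlen] : exists l, has_length O O (lc O (us dl)) l.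
  apply: (len_finite hO hNO hl); [exact: hNO|alg|exact: (lc_sub hdO hOO)|].
  move=> c w hc hw; have [k hk] := hprim hc; exists k; rewrite mulrC; exact: (smZ (sm_lc _ hOO) hw hk).
by apply: (Wn_generated hr hrel hOL hf hdl (l := l)) => k c; case: hlen => _; exact.
Qed.

Lemma exists_transversal : exists j, ~ scm a O (dl j).
Proof.
apply/existsNP => h; have [k hk] := hprim nb.
have /(reg2_primeX hr Ob (k := k)) : ~ scm a O b; last apply; last first.
  by move: hk; apply: (lc_min (sm_scm a hOO)) => _ y /mapP[j _ ->] hy; rewrite mulrC; exact: (smZ (sm_scm a hOO)).
case: hr => _ _ _ _ [_ hreg] hb; have := hreg 1 (sr1 hO); rewrite mulr1 => /(_ hb).
exact: (a_notin1 hr).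
Qed.

Variable j0 : 'I_m.
Hypothesis hj0 : ~ scm a O (dl j0).
Let dj0 : dl j0 != 0.
Proof. apply: contra_notN hj0 => /eqP ->; exists 0; alg. Qed.

Lemma component_zero (x : 'I_m -> K) : (forall k, O (x k)) -> x j0 = 0 ->
  \sum_k u k * x k = 0 -> forall k, x k = 0.
Proof.
move=> hx hx0 e; have [k||g _ hg] := linear_relation hrel (a := x).
- alg.
- by rewrite -[RHS]e; apply: eq_bigr => k _; rewrite mulrC.
move=> k; move: hx0; rewrite !hg => /eqP; rewrite mulf_eq0 (negbTE dj0) /= => /eqP ->.
by rewrite mulr0.
Qed.

Hypothesis hN : subring N.
Local Notation X l := (lc N [seq u i | i <- l]).
Let hNN := sm_self hN.
Let ON : O `<=` N. Proof. exact: (WN (i := 0)). Qed.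
Let uN k : N (u k). Proof. by apply: (WN (i := 1)); apply: (Un_Wn hO hOL); exact: Un_gen. Qed.
Let sX l : submodule N (X l). Proof. alg. Qed.

(** The list omits [j0] or contains every index, the two cases of [koszul]; the zero diagonal of the
    Koszul matrix gives [y k = 0]. *)
Lemma koszul_in (l : seq 'I_m) i (x : 'I_m -> K) k : j0 \notin l \/ (forall j, j \in l) ->
  (forall j, W i.+1 (x j)) -> (forall j, j \notin l -> x j = 0) -> \sum_j u j * x j = 0 ->
  k \in l -> exists y : 'I_m -> K,
    [/\ forall j, W i (y j), forall j, j \notin l -> y j = 0, y k = 0 & x k = \sum_j u j * y j].
Proof.
move=> hl' hx x0 e hk.
have [|||w [hw _ w0 hxw]] := koszul (n := i) (J := mem l) (x := x) hrel primary_chart primary_generated.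
- by case: hl' => [h|h]; [right; exists j0|left=> j; rewrite /= h].
- alg.
- rewrite big_mkcond -[RHS]e; apply: eq_bigr => j _ /=; case: ifPn => // /x0 ->; by rewrite mulr0.
exists (fun j => if j \in l then w k j else 0); split=> [j|j /negbTE ->//||].
- by case: ifP => _ //; exact: sm0 (sW i).
- by rewrite w0 if_same.
rewrite (hxw _ hk) big_mkcond; apply: eq_bigr => j _ /=; case: ifP; alg.
Qed.

(** Each component of a relation is a Koszul relation. In degree zero its coefficients vanish since
    that at [j0] does; in positive degree the coefficient of [u k0] is a combination of the other
    forms. *)
Lemma form_regular (l : seq 'I_m) k0 : k0 \notin l -> j0 \notin k0 :: l -> regular N (X l) (u k0).
Proof.
move=> hk hj w Nw /(lc_mapP _ _ _ hNN)[x [hx x0 e]].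
pose y k := if k == k0 then - w else x k.
have [|||||D [yc [zc [hyc _ ey _ [_ e1]]]]] := graded (x := y) (y := 0) (z := 0) (o := 0).
- move=> k; rewrite /y; case: ifP => // _; alg.
- alg.
- alg.
- alg.
- rewrite mul0r !addr0 (bigD1 k0) //= {1}/y eqxx mulrN e (bigD1 k0) //= x0 // mulr0 add0r addrC.
  by apply/eqP; rewrite subr_eq0; apply/eqP/eq_bigr => k /negbTE hk'; rewrite /y hk'.
have -> : w = - \sum_(i < D) yc k0 i by rewrite -ey /y eqxx opprK.
apply: (smN hN (sX l)); apply: (sm_sum (sX l)) => -[i _] _ /=.
have {}e1 : \sum_k u k * yc k i = 0 by have := e1 i; rewrite mul0r addr0.
have hy0 k : k \notin k0 :: l -> yc k i = 0.
  rewrite inE negb_or => /andP[h1 h2]; apply: (hyc k i).2; by rewrite /y (negbTE h1) x0.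
case: i e1 hy0 => [|i] e1 hy0.
  rewrite (component_zero (x := fun k => yc k 0%N)) //; [exact: sm0 (sX l)|by move=> k; have [] := hyc k 0%N|].
  exact: hy0.
have [|j||v [hv v0 vk ->]] := koszul_in (l := k0 :: l) (i := i) (x := fun k => yc k i.+1) (k := k0) _ _ hy0 e1.
- by left.
- by have [] := hyc j i.+1.
- alg.
apply/(lc_mapP _ _ _ hNN); exists v; split=> // [j|j hj']; first exact: (WN (hv j)).
by have [->//|h] := eqVneq j k0; apply: v0; rewrite negb_or h.
Qed.

Let s1 := [seq k <- enum 'I_m | k != j0].
Let s1P k : (k \notin s1) = (k == j0). Proof. by rewrite mem_filter mem_enum andbT negbK. Qed.
Let s1_in i (x : 'I_m -> K) : (forall k, W i (x k)) -> x j0 = 0 -> X s1 (\sum_k u k * x k).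
Proof.
move=> hx x0; apply/(lc_mapP _ _ _ hNN); exists x; split=> // k; first exact: (WN (hx k)).
by rewrite s1P => /eqP ->.
Qed.

(** Induction on the degree. In degree one, a power of [dl j0] makes [v] a combination of the [u k]
    over [O], and as [a] does not divide [dl j0] it divides all [x k]. In higher degree, the Koszul
    relations leave the same problem for the coefficient of [u j0] in [v]. *)
Lemma scalar_component i v (x : 'I_m -> K) : W i.+1 v -> (forall k, W i (x k)) -> x j0 = 0 ->
  a * v = \sum_k u k * x k -> X s1 v.
Proof.
elim: i v x => [|i IH] v x hv hx x0 e.
  have [q hq] := Wn_away hrel j0 hnO hdl hv.
  move: hq; rewrite (Un1 hO) => /(lc_usP u _ hOO)[c [hc ec]].
  pose d k := a * (dl j0 * c k - c j0 * dl k) - dl j0 ^+ q.+1 * x k.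
  have Od k : O (d k).
    apply: (srB hO); last by apply: srM => //; [exact: srX|exact: hx].
    alg.
  have ed : forall k, d k = 0.
    apply: component_zero => //; first by rewrite /d x0 mulr0 subr0 [c j0 * _]mulrC subrr mulr0.
    case: hrel => _ _ _ hs _.
    transitivity (a * dl j0 * \sum_k c k * u k - a * c j0 * \sum_k dl k * u k - dl j0 ^+ q.+1 * \sum_k u k * x k).
      rewrite !mulr_sumr -!sumrB; apply: eq_bigr => k _; rewrite /d; ring.
    by rewrite hs -ec -e exprS; ring.
  have hxa k : scm a O (x k).
    have : scm a O (dl j0 ^+ q.+1 * x k).
      exists (dl j0 * c k - c j0 * dl k); first alg.
      by apply/esym/eqP; rewrite -subr_eq0; apply/eqP; exact: ed.
    elim: (q.+1) => [|q' IHq]; first by rewrite mul1r.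
    rewrite exprS -mulrA => /(reg2_prime hr (hdl j0)); case=> [|//|]; last exact: IHq.
    by apply: srM => //; [alg|exact: hx].
  have /choice[y hy] : forall k, exists y, O y /\ x k = a * y by move=> k; have [y h1 h2] := hxa k; exists y.
  have -> : v = \sum_k u k * y k.
    apply: (mulfI a0); rewrite e mulr_sumr; apply: eq_bigr => k _; by rewrite (hy k).2 mulrCA.
  apply: (s1_in (i := 0)) => [k|]; first exact: (hy k).1.
  by have /eqP := (hy j0).2; rewrite x0 eq_sym mulf_eq0 (negbTE a0) => /eqP.
have /(lc_usP u _ (sW _))[c [hc ec]] := primary_generated hv.
pose d k := a * c k - x k.
have hd k : W i.+1 (d k) by apply: (smB hO (sW _)) => //; apply: (smZ (sW _)).
have [|||||y [hy _ y0 ey]] := koszul_in (l := enum 'I_m) (i := i) (x := d) (k := j0).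
- by right=> j; rewrite mem_enum.
- alg.
- by move=> j; rewrite mem_enum.
- transitivity (a * v - \sum_k u k * x k); last by rewrite e subrr.
  by rewrite ec mulr_sumr -sumrB; apply: eq_bigr => k _; rewrite /d; ring.
- by rewrite mem_enum.
have hcj : X s1 (c j0) by apply: IH; rewrite // -ey /d x0 subr0.
rewrite ec (bigD1 j0) //=; apply: (smD (sX s1)); first by rewrite mulrC; exact: (smZ (sX s1)).
rewrite (_ : \sum_(k | k != j0) c k * u k = \sum_k u k * (if k == j0 then 0 else c k)); last first.
  by rewrite [RHS](bigD1 j0) //= eqxx mulr0 add0r; apply: eq_bigr => k /negbTE ->; rewrite mulrC.
apply: (s1_in (i := i.+1)) => [k|]; last by rewrite eqxx.
by case: ifP => _ //; exact: sm0 (sW _).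
Qed.

Lemma scalar_regular : regular N (X s1) a.
Proof.
move=> w Nw /(lc_mapP _ _ _ hNN)[x [hx x0 e]].
have [|||||D [xc [yc [hxc hyc _ -> [e0 e1]]]]] := graded (x := x) (y := w) (z := 0) (o := - a).
- alg.
- alg.
- alg.
- alg.
- by rewrite mulNr e subrr add0r.
apply: (sm_sum (sX s1)) => -[[|i] _] _ /=.
  move/eqP: e0; rewrite addr0 mulf_eq0 oppr_eq0 (negbTE a0) => /eqP ->; exact: sm0 (sX s1).
apply: (scalar_component (hyc i.+1) (x := fun k => xc k i)) => [k||]; first by have [] := hxc k i.
  by have [_ h] := hxc j0 i; apply: h; apply: x0; rewrite s1P.
by apply/esym/eqP; rewrite -subr_eq0 -mulNr; apply/eqP.
Qed.

(** The condition on [u j0] disposes of the components of positive degree through Koszul relations;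
    what remains is the scalar component, where [b] is regular modulo [a]. *)
Lemma socle_component w : N w -> addm (X s1) (scm a N) (b * w) ->
  addm (X s1) (scm a N) (u j0 * w) -> addm (X s1) (scm a N) w.
Proof.
set Y := addm _ _; have sY : submodule N Y by apply: sm_addm => //; exact: sm_scm.
have XY : X s1 `<=` Y by apply: (addml (B := N)); alg.
have aY y : N y -> Y (a * y) by move=> hy; apply: (addmr (sX s1)); exists y.
move=> Nw hbw [_ [_ [/(lc_mapP _ _ _ hNN)[x [hx x0 ->]] [y hy ->] e]]].
pose x' k := if k == j0 then - w else x k.
have [|||||D [xc [yc [hxc hyc ex _ [_ e1]]]]] := graded (x := x') (y := y) (z := 0) (o := a).
- move=> k; rewrite /x'; case: ifP => // _; alg.
- alg.
- alg.
- alg.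
- rewrite addr0 (bigD1 j0) //= {1}/x' eqxx mulrN e (bigD1 j0) //= x0 ?s1P // mulr0 add0r.
  rewrite -[RHS](addNr (\sum_(i | i != j0) u i * x i + a * y)) -addrA; congr (_ + (_ + _)).
  by apply: eq_bigr => k /negbTE hk; rewrite /x' hk.
have hi i : Y (xc j0 i.+1).
  have /(lc_usP u _ (sW _))[c [hc ec]] := primary_generated (hyc i.+2).
  have hW k : W i.+1 (xc k i.+1) by have [] := hxc k i.+1.
  have [|||||v [hv _ v0 ev]] := koszul_in (l := enum 'I_m) (i := i) (x := fun k => xc k i.+1 + a * c k) (k := j0).
  - by right=> j; rewrite mem_enum.
  - by move=> k; apply: (smD (sW _)) => //; exact: (smZ (sW _)).
  - by move=> j; rewrite mem_enum.
  - rewrite -[RHS](e1 i.+1) ec mulr_sumr -big_split; apply: eq_bigr => k _ /=; ring.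
  - by rewrite mem_enum.
  apply: (smDr hN sY (y := a * c j0)); first by apply: aY; exact: WN (hc j0).
  by rewrite ev; apply: XY; exact: (s1_in (i := i)).
have ew : w = - \sum_(i < D) xc j0 i by rewrite -ex /x' eqxx opprK.
case: D ew {ex} => [|D] ew; first by rewrite ew big_ord0 oppr0; alg.
have Ow0 : O (xc j0 0%N) by have [] := hxc j0 0%N.
suff hw0 : Y (xc j0 0%N).
  rewrite ew; apply: (smN hN sY); apply: (sm_sum sY) => -[i hi'] _ /=; case: i hi' => [|i] _ //.
have : Y (b * xc j0 0%N).
  have -> : b * xc j0 0%N = - (b * w) - b * \sum_(i < D) xc j0 i.+1.
    by rewrite ew big_ord_recl; ring.

  alg.
move=> [_ [_ [/(lc_mapP _ _ _ hNN)[x1 [hx1 _ ->]] [y1 hy1 ->] e2]]].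
have [|||||D1 [xc1 [yc1 [_ hyc1 _ _ [e3 _]]]]] := graded (x := x1) (y := y1) (z := - (b * xc j0 0%N)) (o := a).
- alg.
- alg.
- alg.
- alg.
- by rewrite e2 subrr.
case: hr => _ _ _ _ [_ hreg].
have [|z Oz ->] := hreg _ Ow0; last by apply: aY; alg.
exists (yc1 0%N); first exact: (hyc1 0%N).
by apply/esym/eqP; rewrite -subr_eq0; apply/eqP.
Qed.

Variables R P : set K.
Hypotheses (hR : subring R) (hRn : noethm R R) (hP : prime_ideal R P).
Hypotheses (RN : R `<=` N) (Nfg : fgm R N) (OR : O `<=` R).
Hypotheses (nP : n `<=` P) (uP : forall k, P (u k)).
Hypothesis hrad : forall c, P c -> exists k, lc R [:: a, b & us u] (c ^+ k).
Let S := compl R P.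
Let hS : mset R S. Proof. exact: mset_compl. Qed.
Local Notation R' := (loc R S).
Local Notation N' := (loc N S).
Local Notation P' := (loc P S).
Let sN : submodule R N. Proof. exact: submoduleS RN hNN. Qed.
Let sN' : submodule R' N'. Proof. exact: loc_sm. Qed.
Let hR' : subring R'. Proof. exact: loc_subring. Qed.
Let hl' : is_local R' P'. Proof. exact: local_loc. Qed.
Let RR' : R `<=` R'. Proof. exact: sub_loc hS. Qed.
Let PR : P `<=` R. Proof. by case: hP => -[]. Qed.
Let PP' : P `<=` P'. Proof. exact: (sub_loc hS). Qed.
Let hRn' : noethm R' R'. Proof. exact: (loc_noeth hR hS (sm_self hR)). Qed.
Let Nfg' : fgm R' N'. Proof. by have [s ->] := Nfg; exists s; rewrite (loc_lc _ hR hS) //; exact: sm_self. Qed.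
Let sXR l : submodule R (X l). Proof. exact: submoduleS RN (sX l). Qed.
Let locX l : loc (X l) S = lc N' [seq u i | i <- l]. Proof. exact: (loc_lc _ hR hS sN). Qed.

Lemma size_transversal : (size s1).+2 = m.+1.
Proof.
congr _.+1; rewrite size_filter -[RHS](size_enum_ord m) -(count_predC (pred1 j0) (enum 'I_m)).
by rewrite (count_uniq_mem _ (enum_uniq _)) mem_enum.
Qed.

Let depth_forms d l l' : uniq (l ++ l') -> j0 \notin l ++ l' ->
  depth_ge P' N' d (lc N' [seq u i | i <- l ++ l']) ->
  depth_ge P' N' (size l + d) (lc N' [seq u i | i <- l']).
Proof.
elim: l l' => [//|k l IH] l' /= hu hj hd; exists (u k); split; first exact: (PP' (uP k)).
  rewrite -locX; apply: (regular_loc hR hS sN (sXR l') (PR (uP k))); apply: form_regular.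
    by move: hu; rewrite mem_cat negb_or => /andP[/andP[]].
  by move: hj; rewrite !inE mem_cat !negb_or => /and3P[-> _ ->].
have hp : perm_eq (l ++ k :: l') (k :: l ++ l') := permEl (perm_catCA l [:: k] l').
rewrite addmC; apply: (IH (k :: l')); rewrite ?(perm_uniq hp) ?(perm_mem hp) //.
by rewrite (lc_perm sN' (eq_mem_map _ (perm_mem hp))).
Qed.

(** The regular sequence consists of the forms other than [u j0], of [a], and of one element that
    exists by prime avoidance because the socle is zero. *)
Theorem local_depth : depth_ge P' N' m.+1 [set 0].
Proof.
rewrite -size_transversal -addn2; apply: (depth_forms (l := s1) (l' := [::])); rewrite cats0.
- by rewrite filter_uniq // enum_uniq.
- by rewrite s1P.
exists a; split; first exact: (PP' (nP na)).
  by rewrite -locX; apply: (regular_loc hR hS sN (sXR s1) (OR Oa)); exact: scalar_regular.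
set Z := addm _ _.
have eZ : Z = loc (addm (X s1) (scm a N)) S.
  by rewrite /Z addmC [in RHS]addmC; apply/esym; exact: (loc_lc (a :: _) hR hS sN).
have sZ : submodule R' Z by rewrite /Z addmC; alg.
have sY : submodule N (addm (X s1) (scm a N)) by alg.
have [_ hSM _] := hS.
have [|y hy hyr] := regular_exists hR' hRn' hl' Nfg' (L := [:: Z]); last by exists y; split=> //; apply: hyr; left.
move=> _ [<-|//]; split=> // _ [w [s [Nw Ss ->]]] hw.
have clear c : P c -> exists2 t, S t & addm (X s1) (scm a N) (t * (c * w)).
  move=> hc; have := hw _ (PP' hc); rewrite eZ => -[z [t [hz St e]]]; exists t => //.
  have s0 := mset_neq0 hS Ss; have t0 := mset_neq0 hS St.
  have -> : t * (c * w) = s * z.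
    by move: e; rewrite mulrA => /eqP; rewrite eqr_div // mulrC [z * s]mulrC => /eqP.
  by apply: (smZ sY) => //; apply: RN; case: Ss.
have [t1 St1 h1] := clear _ (nP nb); have [t2 St2 h2] := clear _ (uP j0).
have [Rt1 _] := St1; have [Rt2 _] := St2.
have : addm (X s1) (scm a N) (t1 * t2 * w).
  apply: socle_component; first alg.
    rewrite (_ : _ * _ = t2 * (t1 * (b * w))); [alg|ring].
  rewrite (_ : _ * _ = t1 * (t2 * (u j0 * w))); [alg|ring].
rewrite eZ => hh; exists (t1 * t2 * w), (t1 * t2 * s); split=> //.
  by case: hS => _ _ SM _; apply: (SM _ _ (SM _ _ St1 St2) Ss).
by rewrite -mulf_div divff ?mul1r // mulf_neq0 ?(mset_neq0 hS).
Qed.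

(** The elements [a], [b] and all [u k] are one too many; [b] and [u j0] are replaced by their
    difference. *)
Theorem local_primary : exists s, [/\ size s = m.+1, forall x, x \in s -> P' x & primary R' P' s].
Proof.
pose s := [:: a, u j0 - b & [seq u i | i <- s1]].
have hs x : x \in s -> P x.
  have [[_ sP] _ _] := hP.
  rewrite !inE => /or3P[/eqP ->|/eqP ->|/mapP[k _ ->]] //; alg.
exists s; split; first by rewrite /= size_map size_transversal.
  move=> x /hs; alg.
have RR := sm_self hR; have sI := sm_lc s (sm_self hR').
have Ig x : x \in s -> lc R' s x by alg.
have Ia : lc R' s a by apply: Ig; rewrite inE eqxx.
have Iu k : k != j0 -> lc R' s (u k).
  by move=> hk; apply: Ig; rewrite !inE map_f ?orbT // -[_ \in _]negbK s1P.
have Id : lc R' s (u j0 - b) by apply: Ig; rewrite !inE eqxx orbT.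
have OR' x : O x -> R' x by alg.
have uR' k : R' (u k) by alg.
(* Modulo [s] the linear relation reads [dl j0 * b = 0], and [dl j0] is a unit times a power of [b]
   modulo [a]. *)
have [t hb] : exists t, lc R' s (b ^+ t).
  have [t [c [g [Oc nc Og e]]]] := reg2_expand hr (hdl j0) hj0.
  exists t.+1; have c0 := nonmem_neq0 hr nc.
  have -> : b ^+ t.+1 = c^-1 * (dl j0 * b - (g * b) * a).
    by rewrite e exprS; field.
  apply: (smZ sI); first by apply: OR'; exact: (local_inv hr Oc nc).
  apply: (smB hR' sI); last alg.
  have -> : dl j0 * b = - \sum_(k | k != j0) dl k * u k - dl j0 * (u j0 - b).
    case: hrel => _ _ _ hsum _; move: hsum; rewrite (bigD1 j0) //= => /eqP.
    by rewrite addrC addr_eq0 => /eqP ->; ring.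
  apply: (smB hR' sI); last alg.
  by apply: (smN hR' sI); apply: (sm_sum sI) => k hk; apply: (smZ sI); [alg|exact: Iu].
have sR' x : x \in s -> R' x by alg.
apply: (primary_trans hR' hRn' hl' (s := [:: a, b & us u])) => // [x|].
  rewrite !inE => /or3P[/eqP ->|/eqP ->|/mapP[k _ ->]].
  - by split; [alg|exists 1%N; rewrite expr1].
  - by split; [alg|exists t].
  split; first exact: PP' (uP k).
  have [->|hk] := eqVneq k j0; last by exists 1%N; exact: Iu.
  exists t; rewrite -(subrK (b ^+ t) (u j0 ^+ t)); apply: (smD sI) => //.
  rewrite subrXX mulrC; apply: (smZ sI) => //; alg.
move=> _ [c [d [Pc Sd ->]]]; have [k hk] := hrad Pc; exists k.
rewrite expr_div_n -(loc_lc _ hR hS RR); apply: loc_div => //.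
by case: hS => _ S1 SM _; elim: (k) => [|k' IHk]; rewrite // exprS; exact: SM.
Qed.

End GradedDepth.

(** * The polynomial ring and its field of fractions *)

(** Complete integral closedness, written without fractions. *)
Definition completely_closed (D : comNzRingType) := forall c p q : D, c != 0 -> q != 0 ->
  (forall k, exists z, c * p ^+ k = z * q ^+ k) -> exists z, p = z * q.

(* The leading term of [p] is a multiple of that of [q]; subtract and induct on the leading monomial. *)
Lemma mpoly_completely_closed (A : idomainType) r : completely_closed A ->
  completely_closed {mpoly A[r]}.
Proof.
move=> hA c p q c0 q0; elim/mleadrect: p => p IH h.
have [->|p0] := eqVneq p 0; first by exists 0; alg.
have lead k : exists2 z : {mpoly A[r]}, z != 0 & (mlead c + mlead p *+ k = mlead z + mlead q *+ k)%MM /\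
    mleadc c * mleadc p ^+ k = mleadc z * mleadc q ^+ k.
  have [z ez] := h k; have hpk := expf_neq0 k p0; have hqk := expf_neq0 k q0.
  have z0 : z != 0.
    by apply: contraNneq (mulf_neq0 c0 hpk) => z0; rewrite ez z0 mul0r.
  have [lp lq] := (mleadX k p0, mleadX k q0).
  exists z => //; split; first by rewrite -lp -lq -(mleadM c0 hpk) ez mleadM.
  rewrite -!mleadcX -lp -lq -!mleadcM ez; congr (_@_ _).
  by rewrite -(mleadM c0 hpk) ez mleadM.
have hm i : (mlead q i <= mlead p i)%N.
  have [z _ [/(congr1 (fun m : 'X_{1..r} => m i)) e _]] := lead (mlead c i).+1.
  move: e; rewrite !mnmDE !mulmnE; nia.
have [w ew] : exists w, mleadc p = w * mleadc q.
  apply: (hA (mleadc c)); rewrite ?mleadc_eq0 // => k.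
  by have [z _ [_ e]] := lead k; exists (mleadc z).
pose y := w *: 'X_[(mlead p - mlead q)%MM] : {mpoly A[r]}.
have w0 : w != 0 by apply: contraNneq p0 => w0; rewrite -mleadc_eq0 ew w0 mul0r.
have ly : (mlead y = mlead p - mlead q)%MM by rewrite mleadZ // mleadXm.
have y0 : y != 0 by rewrite -mleadc_eq0 ly mcoeffZ mcoeffX eqxx mulr1.
have lyq : mlead (y * q) = mlead p.
  by rewrite mleadM // ly; apply/mnmP => i; rewrite mnmDE mnmBE subnK.
have [e|ne] := eqVneq (p - y * q) 0; first by exists y; apply/eqP; rewrite -subr_eq0 e.
have [|k|z ez] := IH (p - y * q); last by exists (z + y); rewrite mulrDl -ez subrK.
  rewrite lt_neqAle; have := mleadB_le p (y * q); rewrite lyq joinxx => ->; rewrite andbT.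
  apply: contraNneq ne => e; rewrite -mleadc_eq0 e mcoeffB -{2}lyq mleadM // mleadcM ew ly.
  by rewrite mcoeffZ mcoeffX eqxx mulr1 subrr.
have /choice[z hz] := h.
exists (\sum_(i < k.+1) ((-1) ^+ i * z (k - i)%N * y ^+ i) *+ 'C(k, i)).
rewrite exprBn mulr_sumr mulr_suml; apply: eq_bigr => i _.
rewrite mulrnAr mulrnAl; congr (_ *+ _); rewrite exprMn.
have -> : q ^+ k = q ^+ (k - i) * q ^+ i by rewrite -exprD subnK // -ltnS.
transitivity ((-1) ^+ i * y ^+ i * q ^+ i * (c * p ^+ (k - i))); first by ring.
by rewrite hz; ring.
Qed.

(** * Homogeneous components of polynomials *)

Section HomogeneousComponents.
Variables (A : idomainType) (r : nat).
Local Notation S := {mpoly A[r]}.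
Implicit Types p q : S.
Local Notation hc := (@pihomog r A mdeg).

Lemma homogE D p : (msize p <= D)%N -> p = \sum_(d < D) hc d p.
Proof. exact: pihomog_partitionE. Qed.

Lemma hc_sum D (f : nat -> S) d : (forall i, f i \is i.-homog) ->
  hc d (\sum_(i < D) f i) = if (d < D)%N then f d else 0.
Proof.
move=> hf; rewrite raddf_sum /=; case: ltnP => h.
  rewrite (bigD1 (Ordinal h)) //= (pihomog_dE (hf d)) big1 ?addr0 // => i hi.
  by apply: (pihomog_ne0 _ (hf i)).
rewrite big1 // => i _; apply: (pihomog_ne0 _ (hf i)).
by apply: contraTneq h => <-; rewrite -ltnNge.
Qed.

Lemma hc_mul d i p q : q \is i.-homog -> hc (d + i)%N (p * q) = hc d p * q.
Proof.
move=> hq; rewrite {1}(homogE (leqnn (msize p))) mulr_suml raddf_sum /=.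
have hd e : hc e p * q \is (e + i)%N.-homog by apply: dhomogM => //; exact: pihomogP.
have [h|h] := ltnP d (mmeasure mdeg p).
  rewrite (bigD1 (Ordinal h)) //= (pihomog_dE (hd d)) big1 ?addr0 // => k hk.
  by apply: (pihomog_ne0 _ (hd k)); rewrite eqn_add2r.
rewrite big1 => [|k _]; last by apply: (pihomog_ne0 _ (hd k)); rewrite eqn_add2r; apply: contraTneq h => <-; rewrite -ltnNge.
by rewrite [hc d p](_ : _ = 0) ?mul0r // pihomogE big1_seq // => m /andP[/eqP hm /msize_mdeg_lt]; rewrite hm ltnNge h.
Qed.

Lemma hc_mul_lt d i p q : q \is i.-homog -> (d < i)%N -> hc d (p * q) = 0.
Proof.
move=> hq hdi; rewrite (homogE (leqnn (msize p))) mulr_suml raddf_sum /= big1 // => k _.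
apply: (pihomog_ne0 (d := k + i)%N); first by lia.
by apply: dhomogM => //; exact: pihomogP.
Qed.

Lemma hc_high d p : (forall e, (d <= e)%N -> hc e p = 0) -> p = \sum_(i < d) hc i p.
Proof.
move=> h; set D := (d + msize p)%N.
rewrite [LHS](homogE (D := D)); last by rewrite
leq_addl.
by rewrite big_split_ord /= [X in _ + X]big1 ?addr0 // => i _; apply: h; exact:
leq_addr.
Qed.

Lemma top_power D p k : (forall e, (D < e)%N -> hc e p = 0) ->
  hc (D * k)%N (p ^+ k) = hc D p ^+ k /\ forall e, (D * k < e)%N -> hc e (p ^+ k) = 0.
Proof.
move=> h; elim: k => [|k [IH1 IH2]].
  rewrite muln0 !expr0; split; first by rewrite pihomog_dE // dhomog1.
  by move=> e he; apply: (pihomog_ne0 (d := 0%N)); [rewrite eq_sym -lt0n|exact: dhomog1].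
have ep := hc_high (d := D.+1) h.
have main e : (D * k.+1 <= e)%N -> hc e (p ^+ k.+1) = if e == (D * k.+1)%N then hc D p ^+ k.+1 else 0.
  move=> he; rewrite exprSr {2}ep mulr_sumr raddf_sum /= big_ord_recr /= big1 ?add0r => [|i _].
    have hi : (D <= e)%N by lia.
    rewrite -{1}(subnK hi) (hc_mul _ _ (pihomogP _ _ _)).
    case: eqP => [->|ne]; first by rewrite mulnS addKn IH1 exprSr.
    by rewrite IH2 ?mul0r //; lia.
  have hi : (i < D)%N := ltn_ord i; have hi' : (i <= e)%N by lia.
  rewrite -(subnK hi') (hc_mul _ _ (pihomogP _ _ _)) IH2 ?mul0r //.
  by lia.
split; first by rewrite main ?eqxx.
by move=> e he; rewrite main ?(ltnW he) // gtn_eqF.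
Qed.

(* If [c x^k] lies in a graded ring for all [k], then so does [c (hc D x)^k] for the top degree [D]. *)
Lemma almost_integral_components (C : set S) D x c : subring C -> (forall p d, C p -> C (hc d p)) ->
  (forall e, (D <= e)%N -> hc e x = 0) -> c != 0 -> (forall k, C (c *: x ^+ k)) ->
  forall d, exists2 c' : A, c' != 0 & forall k, C (c' *: hc d x ^+ k).
Proof.
move=> hC gC; elim: D x c => [|D IH] x c hx c0 hcx d.
  by exists c => // k; have := hcx k; rewrite (hc_high hx) big_ord0 raddf0.
have top k : C (c *: hc D x ^+ k).
  by have [<- _] := top_power k (p := x) (D := D) hx; rewrite -linearZ; exact: gC.
have [->|hd] := eqVneq d D; first by exists c.
have hd' : hc d (x - hc D x) = hc d x.
  by rewrite raddfB /= (pihomog_ne0 _ (pihomogP _ _ _)) ?subr0 // eq_sym.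
have [|||c' h1 h2] := IH (x - hc D x) (c ^+ 2) _ _ _ d; last by exists c' => // k; rewrite -hd'.
- move=> e; rewrite leq_eqVlt => /orP[/eqP <-|he].
    by rewrite raddfB /= pihomog_id subrr.
  by rewrite raddfB /= hx // (pihomog_ne0 _ (pihomogP _ _ _)) ?subr0 // ltn_eqF.
- exact: expf_neq0.
move=> k; rewrite exprBn scaler_sumr; apply: sr_sum => // i _.
rewrite -scalerMnr -mulr_natr; apply: srM => //; last exact: sr_nat.
rewrite -mulrA scalerAr; apply: srM => //; first alg.
rewrite expr2 -scalerA scalerAr scalerAl; exact: srM.
Qed.

End HomogeneousComponents.

Lemma integral_image (R' : comNzRingType) (K : fieldType) (j : {rmorphism R' -> K}) (X : set R') p :
  injective j -> integral_over (j @` X) (j p) <-> integral_over X p.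
Proof.
move=> j_inj; split=> [[q [mq hq rq]]|[q [mq hq rq]]]; last first.
  exists (map_poly j q); split; first exact: monic_map.
    by move=> i; rewrite coef_map; exists q`_i.
  by rewrite /root horner_map (rootP rq) rmorph0.
have /choice[c hc] : forall i, exists c, X c /\ j c = q`_i by move=> i; have [c h1 h2] := hq i; exists c.
pose q' := \poly_(i < size q) c i.
have eq : map_poly j q' = q.
  apply/polyP => i; rewrite coef_map coef_poly; case: ltnP => hi; first exact: (hc i).2.
  by rewrite raddf0 nth_default.
have sq : size q' = size q.
  apply/eqP; rewrite eqn_leq size_poly /= leqNgt; apply/negP => h.
  have := congr1 (fun f : {poly K} => f`_(size q).-1) eq.
  rewrite coef_map nth_default ?raddf0 => [e|]; last by move: h; case: (size q).
  by move/monicP/eqP: mq; rewrite lead_coefE -e eq_sym oner_eq0.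
have cf i : (i < size q)%N -> q'`_i = c i by move=> hi; rewrite coef_poly hi.
have sq0 : (0 < size q)%N by rewrite lt0n size_poly_eq0 monic_neq0.
exists (q' + \poly_(i < 0) 0); rewrite poly_def big_ord0 addr0; split.
- rewrite monicE lead_coefE sq cf ?ltn_predL //; apply/eqP/j_inj; rewrite (hc _).2 rmorph1.
  by apply/eqP.
- move=> i; have [hi|hi] := ltnP i (size q); first by rewrite cf //; exact: (hc i).1.
  by rewrite nth_default ?sq; have := (hc i).1; rewrite (_ : c i = 0) //;
  apply: j_inj; rewrite (hc i).2 nth_default // rmorph0.
by apply/rootP/j_inj; rewrite -horner_map eq rmorph0; exact: rootP.
Qed.

(** * The polynomial ring inside its field of fractions *)

Section Bridge.
Variables (A : idomainType) (r : nat) (K : fieldType) (j : {rmorphism {mpoly A[r]} -> K}).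
Hypothesis j_inj : injective j.
Hypothesis j_frac : forall z, exists p q, q != 0 /\ z = j p / j q.
Local Notation S := {mpoly A[r]}.
Definition cst : {rmorphism A -> K} := j \o @mpolyC r A.
Local Notation O := (cst @` [set: A]).
Local Notation t := (fun i => j 'X_i).
Let hO : subring O. Proof. by apply: sr_image. Qed.
Let hOO := sm_self hO.

Lemma cst_inj : injective cst.
Proof. by move=> x y /j_inj /(can_inj (@mpolyCK r A)). Qed.

Lemma eval_vars p : j p = (map_mpoly cst p).@[t].
Proof.
rewrite mevalE (perm_big _ (msupp_map_mpoly p cst_inj)) {1}[p]mpolyE raddf_sum /=; apply: eq_bigr => m _.
rewrite mcoeff_map_mpoly -mul_mpolyC rmorphM /=; congr (_ * _).
rewrite mpolyXE_id rmorph_prod; apply: eq_bigr => i _; exact: rmorphXn.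
Qed.

Lemma lift_coefs (q : {mpoly K[r]}) : (forall a, O q@_a) -> exists p : S, map_mpoly cst p = q.
Proof.
move=> hq; have /choice[h hh] : forall a, exists c, cst c = q@_a by move=> a; have [c _ e] := hq a; exists c.
exists (\sum_(m <- msupp q) h m *: 'X_[m]).
rewrite raddf_sum [RHS]mpolyE /=; apply: eq_bigr => m _.
by rewrite map_mpolyZ map_mpolyX -hh.
Qed.

Lemma homog_image d : Un t O d = j @` @Sdeg A r d.
Proof.
apply/seteqP; split=> [z [q hq ->]|_ [p hp <-]]; last first.
  exists (map_mpoly cst p); last exact: eval_vars.
  move=> a; rewrite mcoeff_map_mpoly; split; first alg.
  by move=> ha; rewrite (dhomog_nemf_coeff hp ha) raddf0.
have [a|p ep] := @lift_coefs q; first by have [] := hq a.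
exists p; last by rewrite eval_vars ep.
apply/dhomogP => a ha; apply: contraTeq isT => hd.
have [_ /(_ hd)] := hq a; rewrite -ep mcoeff_map_mpoly => h; move: ha.
by rewrite mcoeff_msupp; case/eqP; apply: cst_inj; rewrite rmorph0.
Qed.

Definition scalar_field : set K := [set x | exists y z, [/\ O y, O z, z != 0 & x = y / z]].
Local Notation L := scalar_field.

Lemma scalar_fieldP : [/\ isfield L, O `<=` L & fractions L O].
Proof.
split; first split.
- split=> [|_ _ [y [z [Oy Oz z0 ->]]] [y' [z' [Oy' Oz' z0' ->]]]|_ _ [y [z [Oy Oz z0 ->]]] [y' [z' [Oy' Oz' z0' ->]]]].
  + exists 1, 1; split; rewrite ?oner_neq0 ?divr1 //; alg.
  + exists (y * z' - y' * z), (z * z'); split; rewrite ?mulf_neq0 //; last by rewrite -mulNr addf_div // mulNr.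
      alg.
    alg.
  + exists (y * y'), (z * z'); split; rewrite ?mulf_neq0 ?mulf_div //; alg.
- move=> _ [y [z [Oy Oz z0 ->]]]; have [->|y0] := eqVneq y 0.
    rewrite mul0r invr0; exists 0, 1; split; rewrite ?oner_neq0 ?mul0r //; alg.
  by exists z, y; rewrite invf_div.
- move=> x Ox; exists x, 1; split; rewrite ?oner_neq0 ?divr1 //; alg.
by move=> _ [y [z [Oy Oz z0 ->]]]; exists z; rewrite mulrCA divff ?mulr1.
Qed.

Lemma vars_indep p : (forall a, L p@_a) -> p.@[t] = 0 -> p = 0.
Proof.
move=> hp e; have [_ _ hf] := scalar_fieldP.
have [d [_ d0 hd]] := common_denominator hO hf hp.
have [a|q eq] := @lift_coefs (d *: p); first by rewrite mcoeffZ.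
have q0 : q = 0 by apply: j_inj; rewrite eval_vars eq mevalZ e mulr0 rmorph0.
move/eqP: eq; rewrite q0 raddf0 eq_sym.
have [//|p0 /eqP h] := eqVneq p 0; case/eqP: d0; apply: contra_eq h => d0.
apply/eqP => /(congr1 (mcoeff (mlead p))); rewrite mcoeffZ mcoeff0 => /eqP.
by rewrite mulf_eq0 (negbTE d0) mleadc_eq0 (negbTE p0).
Qed.

Lemma homog_in_image d p : Un t L d (j p) -> p \is d.-homog.
Proof.
have [[hL _] OL _] := scalar_fieldP.
move=> [q hq e]; have eq : q - map_mpoly cst p = 0.
  apply: vars_indep => [a|]; last by rewrite mevalB -eval_vars -e subrr.
  rewrite mcoeffB mcoeff_map_mpoly; apply: srB => //; first by have [] := hq a.
  alg.
apply/dhomogP => a ha; apply: contraTeq isT => hd.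
have [_ /(_ hd)] := hq a; move/eqP: eq; rewrite subr_eq0 => /eqP ->; rewrite mcoeff_map_mpoly => h.
by move: ha; rewrite mcoeff_msupp; case/eqP; apply: cst_inj; rewrite rmorph0.
Qed.

Lemma completely_closed_image c z : completely_closed A -> c != 0 ->
  (forall k, exists p, j c * z ^+ k = j p) -> exists p, z = j p.
Proof.
move=> hA c0 h; have [p [q [q0 ez]]] := j_frac z.
have jq0 : j q != 0 by rewrite -(rmorph0 j) (inj_eq j_inj).
have [k|w ew] := mpoly_completely_closed hA c0 q0 (p := p).
  have [w hw] := h k; exists w; apply: j_inj; rewrite !rmorphM !rmorphXn /= -hw ez.
  by rewrite expr_div_n; field; exact: expf_neq0.
by exists w; rewrite ez ew rmorphM mulfK.
Qed.

End Bridge.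

(** * Rees algebras *)

Lemma noeth_alg (K : fieldType) (C : set K) m (u : 'I_m -> K) : subring C -> noethm C C ->
  noethm (alg C u) (alg C u).
Proof.
move=> hC hN; have [D [hD DN CD Du Dmin]] : exists D, [/\ subring D, noethm D D, C `<=` D,
    forall x, x \in us u -> D x & forall E, subring E -> C `<=` E -> (forall x, x \in us u -> E x) -> D `<=` E].
  elim: (us u) => [|x s [D [hD DN CD Ds Dmin]]]; first by exists C; split=> // E _ CE _.
  exists (adj D x); split; [exact: sr_adj|exact: noeth_adj|by apply: (subset_trans CD); exact: sub_adj| |].
    move=> y; rewrite inE => /orP[/eqP ->|/Ds]; [exact: adj_gen|exact: sub_adj].
  move=> E hE CE Es; apply: adj_min => //; last alg.
  by apply: Dmin => // y hy; apply: Es; rewrite inE hy orbT.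
suff <- : D = alg C u by [].
apply/seteqP; split.
  by apply: Dmin; [exact: sr_alg|exact: sub_alg|move=> _ /mapP[i _ ->]; exact: alg_gen].
by apply: alg_min => // i; apply: Du; exact: mem_us.
Qed.

Lemma fg_elements_integral (K : fieldType) (B X : set K) s x : subring B -> X = lc B s -> (exists2 y, X y & y != 0) ->
  (forall y, X y -> X (x * y)) -> integral_over B x.
Proof.
move=> hB eX [y Xy y0] h; apply: (int_lc (s := s) hB).
  apply: contrapT => hs; case/eqP: y0; move: Xy; rewrite eX; apply: (lc_min (sm_zero B)) => z w hz _.
  by have [->|z0] := eqVneq z 0; [rewrite mul0r|case: hs; exists z].
move=> z hz; rewrite -eX; apply: h; alg.
Qed.

Lemma Rees_subring (A : idomainType) r (X : set {mpoly A[r]}) : subring (Rees X).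
Proof.
split=> [Y [[hY _ _] _] //|x y hx hy Y hY|x y hx hy Y hY]; have [[_ h1 h2] h3] := hY.
  by apply: h1; [exact: hx|exact: hy].
by apply: h2; [exact: hx|exact: hy].
Qed.

Section ReesAlgebra.
Variables (A : idomainType) (m : set A) (r q : nat) (K : fieldType) (j : {rmorphism {mpoly A[r]} -> K}).
Hypothesis j_inj : injective j.
Hypothesis j_frac : forall z, exists p q, q != 0 /\ z = j p / j q.
Local Notation S := {mpoly A[r]}.
Variables (MS : set S) (G : 'I_q -> S).
Hypothesis G1 : forall i, G i \is 1.-homog.
Hypothesis MSE : forall p, MS p <-> exists c : 'I_q -> A, p = \sum_i c i *: G i.
Hypothesis conductor : forall f, m f -> exists k, forall i, MS (f ^+ k *: 'X_i).
Local Notation c0 := (cst j).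
Local Notation O := (c0 @` [set: A]).
Local Notation n := (c0 @` m).
Local Notation t := (fun i => j 'X_i).
Local Notation L := (scalar_field j).
Local Notation g := (fun i => j (G i)).
Local Notation R := (alg O g).
Local Notation M := (Un g O).
Local Notation N := (iclosure R).
Local Notation hc := (@pihomog r A mdeg).
Implicit Types (p : S) (d : nat).
Let hO : subring O. Proof. by apply: sr_image. Qed.
Let hOO := sm_self hO.
Let hR : subring R. Proof. exact: sr_alg. Qed.
Let hRR := sm_self hR.
Let hRees : subring (Rees MS). Proof. exact: Rees_subring. Qed.
Let OR : O `<=` R. Proof. exact: sub_alg. Qed.
Let MR d : M d `<=` R. Proof. exact: Un_alg. Qed.
Let gt i : Un t O 1 (g i). Proof. by rewrite (homog_image j_inj); exists (G i); first exact: G1. Qed.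
Let sM d : submodule O (M d). Proof. exact: sm_Un. Qed.
Let M0 : M 0 = O. Proof. exact: (Un0 _ hOO). Qed.

Lemma rees_scale a p : Rees MS p -> Rees MS (a *: p).
Proof.
move=> hp; rewrite -mul_mpolyC; apply: (srM hRees) => //.
by move=> X [_ h]; apply: h; left; exists a.
Qed.

Lemma module_image : j @` MS = M 1.
Proof.
rewrite (Un1 hO); apply/seteqP; split=> [_ [p /MSE[c ->] <-]|z /(lc_usP _ _ hOO)[c [hc' ->]]].
  apply/(lc_usP _ _ hOO); exists (fun i => c0 (c i)); split=> [i|]; first alg.
  by rewrite raddf_sum; apply: eq_bigr => i _; rewrite /= -mul_mpolyC rmorphM.
have /choice[c' hc2] : forall i, exists a, c0 a = c i by move=> i; have [a _ e] := hc' i; exists a.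
exists (\sum_i c' i *: G i); first by apply/MSE; exists c'.
by rewrite raddf_sum; apply: eq_bigr => i _; rewrite /= -mul_mpolyC rmorphM
-hc2.
Qed.

Lemma rees_image : j @` (Rees MS) = R.
Proof.
apply/seteqP; split=> [_ [p hp <-]|].
  have : [set p | R (j p)] p.
    apply: hp; split.
      split=> [|x y /= hx hy|x y /= hx hy] /=; rewrite ?rmorph1 ?rmorphB ?rmorphM; [alg|alg|alg].
    move=> x [[a _ <-]|hx]; first by apply: OR.
    by apply: (MR (d := 1)); rewrite -module_image.
  alg.
apply: alg_min; first exact: sr_image.
  move=> _ [a _ <-]; exists a%:MP => //; by move=> X [_ h]; apply: h; left; exists a.
move=> i; exists (G i) => // X [_ h]; apply: h; right; apply/MSE.
exists (fun k => (k == i)%:R); rewrite (bigD1 i) //= eqxx scale1r big1 ?addr0 // => k /negbTE ->.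
by rewrite scale0r.
Qed.

Lemma rees_preimage p : R (j p) -> Rees MS p.
Proof. by rewrite -rees_image => -[p' hp' /j_inj <-]. Qed.

Lemma M_homog d z : M d z -> exists2 p, p \is d.-homog & z = j p.
Proof.
move=> hz; have := Un_trans hO (u := t) gt hz.
by rewrite (homog_image j_inj) => -[p hp <-]; exists p.
Qed.

Lemma rees_components p d : R (j p) -> M d (j (hc d p)).
Proof.
case=> f hf e.
have /choice[P hP] : forall i, exists p, p \is i.-homog /\ M i (j p) /\ j p = (pihomog mdeg i f).@[g].
  move=> i; have hi : M i (pihomog mdeg i f).@[g].
    exists (pihomog mdeg i f) => // a; split; last exact: (dhomog_nemf_coeff (pihomogP _ _ _)).
    rewrite pihomogE raddf_sum /=; apply: (sr_sum hO) => b _; rewrite mcoeffZ mcoeffX.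
    alg.
  by have [p' h1 h2] := M_homog hi; exists p'; rewrite -h2.
have ep : p = \sum_(i < msize f) P i.
  apply: j_inj; rewrite e {1}(homogE (leqnn (msize f))) !raddf_sum.
  by apply: eq_bigr => i _ /=; have [_ [_ e']] := hP i.
rewrite ep hc_sum => [|i]; last by have [] := hP i.
by case: ifP => _; [have [_ []] := hP d|rewrite raddf0; exact: sm0 (sM d)].
Qed.

Lemma M_component d p : M d (j p) <-> Sdeg d p /\ R (j p).
Proof.
split=> [h|[hp hR']]; last by rewrite -(pihomog_dE hp); exact: rees_components.
split; last exact: MR h.
by have [p' hp' /j_inj ->] := M_homog h.
Qed.

Lemma Mpow_image d p : Mpow MS d p <-> M d (j p).
Proof.
rewrite M_component /Mpow; split=> -[h1 h2]; split=> //.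
  by rewrite -rees_image.
exact: rees_preimage.
Qed.

Lemma rees_hc p d : Rees MS p -> Rees MS (hc d p).
Proof. by move=> hp; apply: rees_preimage; apply: (MR (d := d)); apply:
rees_components; rewrite -rees_image. Qed.

Variables (a b : K).
Hypothesis hr : reg2 O n a b.
Hypothesis residue_infinite : forall s : seq K, (forall z, z \in s -> O z) ->
  exists2 c, O c & forall z, z \in s -> ~ n (c - z).
Let hNO := reg2_noeth hr.
Let hl := reg2_local hr.
Let en := reg2_gens hr.
Let na := reg2_l hr.
Let nb := reg2_r hr.
Let nO := reg2_sub hr.
Let a0 := reg2_neq0 hr.
Let hLf : isfield L. Proof. by case: (scalar_fieldP j). Qed.
Let OL : O `<=` L. Proof. by case: (scalar_fieldP j). Qed.
Let hf : fractions L O. Proof. by case: (scalar_fieldP j). Qed.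

Lemma conductor_image c : n c -> exists k : nat, forall i, M 1 (c ^+ k * t i).
Proof.
move=> [f mf <-]; have [k hk] := conductor mf; exists k => i.
by rewrite -module_image; exists (f ^+ k *: 'X_i) => //; rewrite -mul_mpolyC
rmorphM !rmorphXn.
Qed.

Lemma reduction_data : exists (u dl : 'I_r.+1 -> K) (d : nat),
  [/\ forall i, M 1 (u i), M d.+1 `<=` lc (M d) (us u), relation L u dl
    & [/\ forall k, O (dl k), primary O n (us dl) & forall k, Un u L 1 (t k)]].
Proof.
have [|u [hu [d hd]]] := reduction_exists hr residue_infinite gt; first exact: conductor_image na.
have ut i : Un t O 1 (u i) by apply: (Un_trans hO gt).
have [|dl [h1 h2 h3 h4]] := reduction_relation hr hLf OL (vars_indep j_inj) ut; last by exists u, dl, d.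
move=> f nf; have [k hk] := conductor_image nf; exists (k * d.+1)%N, d => i.
rewrite exprM -exprMn; apply: (lcS (N := M d)); first exact: (Un_trans hO gt).
by apply: hd; exact: Un_exp.
Qed.

Lemma scalars_completely_closed : completely_closed A.
Proof.
move=> c x y hc hy h.
have cN (z : A) : z != 0 -> c0 z != 0 by rewrite -(rmorph0 c0) (inj_eq (cst_inj j_inj)).
have Oz z : O (c0 z) by [].
have [|_ [w _ <-] e] := reg2_quot hr (Oz c) (Oz x) (Oz y) (cN _ hc) (cN _ hy).
  by move=> k; have [z hz] := h k; exists (c0 z) => //; rewrite -!rmorphXn -!rmorphM hz mulrC.
by exists w; apply: (cst_inj j_inj); rewrite mulrC rmorphM.
Qed.

(** A finite module stable under [z] provides a common denominator for all powers of [z], and the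
    polynomial ring is completely integrally closed. So integral closure in the field and in the
    polynomial ring agree. *)
Lemma closure_in_polynomials z : N z -> exists p, z = j p.
Proof.
move=> /(int_stable hR)[s s1 hs].
have [c [c0' hc']] : exists c : S, c != 0 /\ forall y, y \in s -> exists p, j c * y = j p.
  elim: (s) => [|y s' [c [hc1 hc2]]]; first by exists 1; rewrite oner_neq0.
  have [p1 [p2 [p20 ->]]] := j_frac y; exists (c * p2); split; first exact: mulf_neq0.
  have jp2 : j p2 != 0 by rewrite -(rmorph0 j) (inj_eq j_inj).
  move=> y'; rewrite inE => /orP[/eqP ->|/hc2[p e]].
    by exists (c * p1); field.
  by exists (p * p2); rewrite !rmorphM mulrAC e.
apply: (completely_closed_image j_inj j_frac scalars_completely_closed c0') => k.
have hk : lc R s (z ^+ k) by elim: k => [|k IH]; rewrite ?exprS; [alg|exact: hs].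
have sX : submodule R [set y | exists p, j c * y = j p].
  split=> [|x y [p e1] [p' e2]|x y]; first by exists 0; rewrite mulr0 rmorph0.
    by exists (p + p'); rewrite mulrDr e1 e2 rmorphD.
  by rewrite -rees_image => -[p _ <-] [p' e]; exists (p * p'); rewrite mulrCA e rmorphM.
move: hk; apply: (lc_min sX) => y w hy Rw; rewrite mulrC; apply: (smZ sX) => //.
exact: hc'.
Qed.

Lemma closure_integral p : N (j p) <-> integral_over (Rees MS) p.
Proof. by rewrite -(integral_image _ p j_inj) rees_image. Qed.

Let am : exists2 f, m f & a = c0 f. Proof. by case: na => f mf <-; exists f. Qed.

Lemma scalar_conductor p : exists2 f : A, f != 0 & Rees MS (f *: p).
Proof.
have [f mf ea] := am; have [k hk] := conductor mf.
have f0 : f != 0 by apply: contraNneq a0 => f0; rewrite ea f0 rmorph0.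
have mono (e : 'X_{1..r}) : Rees MS ((f ^+ k) ^+ mdeg e *: 'X_[e]).
  have -> : (f ^+ k) ^+ mdeg e *: 'X_[e] = \prod_i (f ^+ k *: 'X_i) ^+ e i :> S.
    rewrite mpolyXE_id mdegE expr_sum -mul_mpolyC rmorph_prod /= -big_split /=.
    by apply: eq_bigr => i _; rewrite -mul_mpolyC exprMn rmorphXn.
  apply: (sr_prod hRees) => i _; apply: (srX _ hRees).
  by move=> X [_ h]; apply: h; right.
exists ((f ^+ k) ^+ msize p); first by rewrite !expf_neq0.
rewrite {2}[p]mpolyE scaler_sumr big_seq; apply: (sr_sum hRees) => e /msize_mdeg_lt he.
rewrite scalerA -(subnK (ltnW he)) exprD [_ * p@_e]mulrC mulrA -scalerA; exact: rees_scale.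
Qed.

(** A common scalar denominator [f] of all powers of [p] is inherited, up to a change of scalar, by
    the components, top degree first; over a noetherian ring this implies integrality. *)
Lemma closure_components p d : N (j p) -> N (j (hc d p)).
Proof.
move=> /closure_integral /(int_pow hRees)[k k0 [c [hc1 e]]].
have [f f0 hfp] : exists2 f : A, f != 0 & forall i : nat, (i < k)%N -> Rees MS (f *: p ^+ i).
  elim: (k) => [|k' [f f0 h]]; first by exists 1; rewrite ?oner_neq0.
  have [f' f0' h'] := scalar_conductor (p ^+ k'); exists (f' * f); first exact: mulf_neq0.
  move=> i; rewrite ltnS leq_eqVlt => /orP[/eqP ->|/h hi].
    by rewrite mulrC -scalerA; exact: rees_scale.
  by rewrite -scalerA; exact: rees_scale.
have all i : Rees MS (f *: p ^+ i).
  elim/ltn_ind: i => i IH; have [/hfp//|hi] := ltnP i k.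
  rewrite -(subnK hi) exprD e mulr_sumr scaler_sumr; apply: (sr_sum hRees) => i' _.
  rewrite mulrCA scalerAr -exprD; apply: (srM hRees); first exact: hc1.
  by apply: IH; have := ltn_ord i'; lia.
have [|c' c0' hc'] := almost_integral_components (D := msize p) hRees rees_hc _ f0 all d.
  move=> i hi; rewrite pihomogE big1_seq // => a' /andP[/eqP hm /msize_mdeg_lt].
  by rewrite hm ltnNge hi.
apply: (almost_integral (d := c0 c') hR); first exact: noeth_alg.
  by rewrite -(rmorph0 c0) (inj_eq (cst_inj j_inj)).
move=> i; rewrite -rees_image; exists (c' *: hc d p ^+ i); first exact: hc'.
by rewrite -mul_mpolyC rmorphM rmorphXn.
Qed.

Variables (u dl : 'I_r.+1 -> K) (e : nat).
Hypothesis uM : forall i, M 1 (u i).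
Hypothesis uM_red : M e.+1 `<=` lc (M e) (us u).
Hypothesis hrel : relation L u dl.
Hypothesis dlO : forall k, O (dl k).
Hypothesis dl_primary : primary O n (us dl).
Hypothesis t_span : forall k, Un u L 1 (t k).
Local Notation W := (Wn L u O).
Let sW d : submodule O (W d). Proof. exact: (sm_Wn hrel d hO OL). Qed.
Let hN : subring N. Proof. exact: sr_iclosure. Qed.
Let RN : R `<=` N. Proof. by move=> x; exact: int_base. Qed.

Lemma alg_reduction : alg O u `<=` R.
Proof. by apply: alg_min => // i; apply: (MR (d := 1)). Qed.

(** By the reduction each generator [g i] maps the O[u]-module generated by [M e] into itself, so
    [R] is integral over O[u]. *)
Lemma closure_alg z : N z <-> integral_over (alg O u) z.
Proof.
have hU : subring (alg O u) by exact: sr_alg.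
have OU : O `<=` alg O u by exact: sub_alg.
split; last by apply: int_mono; exact: alg_reduction.
apply: (int_trans hU hR); apply: alg_min.
- exact: sr_iclosure.
- move=> x Ox; apply: int_base => //; alg.
move=> i; have [->|g0] := eqVneq (g i) 0; first exact: int_base hU (sr0 hU).
have [s es] := Un_fg hO g e; apply: (fg_elements_integral (s := s) hU (erefl _)).
  exists (g i ^+ e); last exact: expf_neq0.
  suff : M e (g i ^+ e) by rewrite es; apply: lcS.
  by apply: (Un_exp hO); exact: Un_gen.
have sU : submodule (alg O u) (lc (alg O u) s) := sm_lc s (sm_self hU).
move=> y hy; apply: (lc_min_scale sU hy) => x w hx hw; rewrite mulrA mulrC; apply: (smZ sU hw).
have : lc (M e) (us u) (g i * x).
  by apply: uM_red; apply: (Un_mul1 hO); [exact: Un_gen|rewrite es; exact: lc_gen].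
apply: (lc_min (submoduleS OU sU)) => k v /mapP[i' _ ->] hv; apply: (smZ sU); first exact: alg_gen.
by move: hv; rewrite es; apply: lcS.
Qed.

Lemma W_closure d z : W d z <-> exists2 p, p \is d.-homog & z = j p /\ N z.
Proof.
split=> [hz|[p hp [-> hN']]].
  have [hLz hi] : Un u L d z /\ N z.
    case: d hz => [|d] [] //=.
      by split; [rewrite (Un0 u (sm_self (proj1 hLf))); apply: OL;
      exists x|apply: RN; apply: OR; exists x].
    by split=> //; apply/closure_alg.
  have [p ep] := closure_in_polynomials hi; exists p => //; apply: (homog_in_image j_inj).
  rewrite -ep; apply: (Un_trans (proj1 hLf) _ hLz) => i.
  by apply: (UnSS OL); apply: (Un_trans hO gt).
have hLz : Un u L d (j p).
  apply: (Un_trans (proj1 hLf) t_span); apply: (UnSS OL).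
  by rewrite (homog_image j_inj); exists p.
case: d hp hLz => [|d] hp hLz; last by split=> //; apply/closure_alg.
have : Un t O 0 (j p) by rewrite (homog_image j_inj); exists p.
by rewrite (Un0 _ hOO).
Qed.

Lemma Mbar_image d p : Mbar MS d p <-> W d (j p).
Proof.
rewrite W_closure /Mbar; split=> [[h1 /closure_integral h2]|[p' hp' [/j_inj -> h]]]; first by exists p.
by split=> //; apply/closure_integral.
Qed.

Lemma W_sub d : W d `<=` N.
Proof. by move=> z /W_closure[p _ []]. Qed.

Lemma closure_graded p d : N (j p) -> W d (j (hc d p)).
Proof. by move=> h; apply/W_closure; exists (hc d p); [exact: pihomogP|split=> //; exact: closure_components]. Qed.

Let Wgen := primary_generated hr hrel OL hf dlO dl_primary.
Let ug k : exists2 p, p \is 1.-homog & u k = j p. Proof. exact: M_homog (uM k). Qed.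

Lemma hc0 p : hc 0 p = (p@_0%MM)%:MP.
Proof.
apply/mpolyP => x; rewrite mcoeffC; have [<-|h] := eqVneq 0%MM x; last first.
  by rewrite mulr0 (dhomog_nemf_coeff (pihomogP _ _ _)) // mdeg_eq0 eq_sym.
rewrite mulr1 [in RHS](homogE (leqnSn (msize p))).
rewrite big_ord_recl mcoeffD [X in _ = _ + X](raddf_sum (mcoeff 0%MM)) /= big1 ?addr0 // => i _.
by rewrite (dhomog_nemf_coeff (pihomogP _ _ _) (_ : mdeg 0%MM != bump 0 i)) ?mdeg0.
Qed.

(** As the [u k] have degree one, the degree zero component of the relation involves only [y] and
    [z]. *)
Lemma graded_relation (x : 'I_r.+1 -> K) y z o : (forall k, N (x k)) -> N y -> O z -> O o ->
  \sum_k u k * x k + o * y + z = 0 -> exists (D : nat) (xc : 'I_r.+1 -> nat -> K) (yc : nat -> K),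
    [/\ forall k i, W i (xc k i) /\ (x k = 0 -> xc k i = 0), forall i, W i (yc i),
        forall k, x k = \sum_(i < D) xc k i, y = \sum_(i < D) yc i
      & o * yc 0%N + z = 0 /\ forall i : nat, \sum_k u k * xc k i + o * yc i.+1 = 0].
Proof.
move=> hx hy [z' _ <-] [o' _ <-] e0.
have /choice[p ep] : forall k, exists p, x k = j p by move=> k; exact: closure_in_polynomials (hx k).
have [py epy] := closure_in_polynomials hy.
have /choice[v hv] : forall k, exists v, v \is 1.-homog /\ u k = j v by move=> k; have [v h1 h2] := ug k; exists v.
have e1 : \sum_k p k * v k + o' *: py + z'%:MP = 0.
  apply: j_inj; rewrite !rmorphD rmorph_sum /= -mul_mpolyC rmorphM rmorph0 -[RHS]e0 epy.
  by congr (_ + _ + _); apply: eq_bigr => k _; rewrite rmorphM ep (hv k).2 mulrC.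
pose D := (\sum_k msize (p k) + msize py)%N.
exists D, (fun k i => j (hc i (p k))), (fun i => j (hc i py)); split.
- move=> k i; split=> [|xk0]; first by apply: closure_graded; rewrite -ep.
  by rewrite (_ : p k = 0) ?raddf0 //; apply: j_inj; rewrite -ep rmorph0.
- by move=> i; apply: closure_graded; rewrite -epy.
- move=> k; rewrite ep {1}(@homogE _ _ D (p k)) ?raddf_sum //.
  by rewrite /D (bigD1 k) //= -!addnA leq_addr.
- by rewrite epy {1}(@homogE _ _ D py) ?raddf_sum // leq_addl.
split=> [|i].
  have := congr1 (hc 0) e1; rewrite !raddfD raddf_sum /= big1 => [|k _].
    rewrite add0r linearZ /= [hc 0 _%:MP]pihomog_dE ?raddf0 => [e2|].
      by rewrite -mul_mpolyC in e2; rewrite -rmorphM -[RHS](rmorph0 j) -e2 rmorphD.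
    by rewrite -[_%:MP]mulr1 mul_mpolyC; apply: dhomogZ; exact: dhomog1.
  by apply: hc_mul_lt (hv k).1 _.
have := congr1 (hc i.+1) e1; rewrite !raddfD raddf_sum /= linearZ /=.
rewrite [hc _ _%:MP](pihomog_ne0 (d := 0%N)) //; last first.
  by rewrite -[_%:MP]mulr1 mul_mpolyC; apply: dhomogZ; exact: dhomog1.
rewrite addr0 raddf0 -mul_mpolyC => /(congr1 j); rewrite rmorphD rmorph_sum rmorphM rmorph0 => e2.
rewrite -[RHS]e2; congr (_ + _); apply: eq_bigr => k _; rewrite (hv k).2 mulrC -rmorphM -(hc_mul _ _ (hv k).1) addn1 //.
Qed.

Hypothesis hm : prime_ideal [set: A] m.
Local Notation P := (j @` Rees_max m MS).

Lemma rees_maxE p : Rees_max m MS p <-> Rees MS p /\ m p@_0%MM.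
Proof.
have [[_ sm] _ _] := hm; have m0 := sm0 sm.
have scal c : Rees MS c%:MP by move=> X [_ h]; apply: h; left; exists c.
split.
  have sX : submodule (Rees MS) [set p | Rees MS p /\ m p@_0%MM].
    split=> [|x y [h1 h2] [h3 h4]|x y h1 [h2 h3]] /=; rewrite ?mcoeff0 ?mcoeffD
    ?rmorphM; alg.
  apply: (span_min sX) => x [[c mc <-]|]; first by split=> //; rewrite mcoeffC eqxx mulr1.
  have sY : submodule (@scalars A r) [set p | Rees MS p /\ p@_0%MM = 0].
    split=> [|x1 x2 [h1 h2] [h3 h4]|_ x2 [c _ <-] [h3 h4]] /=; rewrite ?mcoeff0 ?mcoeffD ?rmorphM /=.
    - split=> //; alg.
    - by split; [alg|rewrite h2 h4 addr0].
    - by split; [alg|rewrite h4 mulr0].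
  move=> hx; suff [h1 h2] : [set p | Rees MS p /\ p@_0%MM = 0] x by split; rewrite ?h2.
  move: hx; apply: (span_min sY) => p' [d /= d0 [h1 h2]]; split=> //.
  by apply: (dhomog_nemf_coeff h2 (_ : mdeg 0%MM != d)); rewrite mdeg0 eq_sym -lt0n.
move=> [hp mp]; rewrite (homogE (leqnSn (msize p))).
have sX := @sm_span _ (Rees MS) ((@mpolyC r A @` m) `|` Rees_plus MS).
apply: (sm_sum sX) => -[[|i] hi] _; apply: sub_span.
  by rewrite hc0; left.
right; apply: sub_span; exists i.+1 => //; split; last exact: pihomogP.
exact: rees_hc.
Qed.

Lemma prime_image Q : prime_ideal (Rees MS) Q -> prime_ideal R (j @` Q).
Proof.
move=> [[h1 h2] h3 h4]; rewrite -rees_image; split; first split.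
- move=> _ [y hy <-]; exists y => //; alg.
- exact: sm_image.
- move=> [y hy ey]; have y1 : y = 1 by apply: j_inj; rewrite ey rmorph1.
  by apply: h3; rewrite -y1.
move=> _ _ [y hy <-] [y' hy' <-] [y2 hy2]; rewrite -rmorphM => /j_inj ey.
by move: hy2; rewrite ey => /(h4 _ _ hy hy')[]; [left|right].
Qed.

Lemma max_prime : prime_ideal R P.
Proof.
have [_ m1 hmM] := hm; apply: prime_image; split; first split.
- by move=> p /rees_maxE[].
- exact: sm_span.
- by move=> /rees_maxE[_]; rewrite mcoeff1 eqxx.
move=> p p' hp hp' /rees_maxE[_]; rewrite rmorphM.
by case/hmM => // h'; [left|right]; rewrite rees_maxE.
Qed.
Let PR : P `<=` R. Proof. by case: max_prime => -[]. Qed.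

Lemma max_scalars : n `<=` P.
Proof.
move=> _ [f mf <-]; exists f%:MP => //; apply/rees_maxE; split; last by rewrite mcoeffC eqxx mulr1.
by move=> X [_ h]; apply: h; left; exists f.
Qed.

Lemma max_forms d : M d.+1 `<=` P.
Proof.
move=> z hz; have [p hp ez] := M_homog hz; exists p => //; apply/rees_maxE; split.
  by apply: rees_preimage; rewrite -ez; exact: MR hz.
rewrite (dhomog_nemf_coeff hp (_ : mdeg 0%MM != d.+1)) ?mdeg0 //.
have [[_ sm] _ _] := hm; alg.
Qed.

Lemma max_sub_prime Q : prime_ideal R Q -> (exists k, Q (a ^+ k)) -> (exists k, Q (b ^+ k)) ->
  (forall i, exists k, Q (g i ^+ k)) -> P `<=` Q.
Proof.
move=> hQ [k hk] [k' hk'] hgQ; have [[QR sQ] _ _] := hQ.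
have Qa : Q a := prime_mulX hR hQ (OR (nO na)) hk.
have Qb : Q b := prime_mulX hR hQ (OR (nO nb)) hk'.
have Qg i : Q (g i) by have [k1] := hgQ i; apply: (prime_mulX hR hQ); exact: MR (Un_gen hO g i).
have QM d : M d.+1 `<=` Q.
  rewrite (UnS _ _ hOO); apply: (lc_min (submoduleS OR sQ)) => x y /mapP[i _ ->] hy.
  by rewrite mulrC; apply: (smZ sQ); [exact: MR hy|alg].
move=> _ [p /rees_maxE[hp mp] <-]; rewrite (homogE (leqnSn (msize p))) raddf_sum.
apply: (sm_sum sQ) => -[[|i] hi] _ /=; last first.
  by apply: QM; apply: rees_components; rewrite -rees_image.
have : n (j (hc 0 p)) by rewrite hc0; exists p@_0%MM.
rewrite en; apply: (lc_min (submoduleS OR sQ)) => x y; rewrite !inE => /orP[]/eqP -> Oy; rewrite mulrC;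
  by apply: (smZ sQ) => //; exact: OR.
Qed.

(** By generation in degrees above one, [1] and generators of the degree one part suffice. *)
Lemma closure_fg : fgm R N.
Proof.
have [s es] : fgm O (W 1).
  apply: (noethm_fg hO hNO (Un_fg hO t 1)) => // z /W_closure[p hp [-> _]].
  by rewrite (homog_image j_inj); exists p.
exists (1 :: s); have sR := submoduleS RN (sm_self hN); have sL := sm_lc (1 :: s) hRR.
have W1 d : W d.+1 `<=` lc R (1 :: s).
  elim: d => [|d IH].
    rewrite es; apply: (lc_min (submoduleS OR sL)) => x y hx Oy; apply: (lc_mem hRR); last exact: OR.
    by rewrite inE hx orbT.
  apply: (subset_trans (@Wgen d)); apply: (lc_min (submoduleS OR sL)) => _ y /mapP[k _ ->] hy.
  by apply: (smZ sL); [exact: MR (uM k)|alg].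
apply/seteqP; split; last first.
  apply: (lc_min sR) => x y; rewrite inE mulrC => hx hy; apply: (smZ sR) => //.
  case/orP: hx => [/eqP ->|hx]; first alg.
  apply: (@W_sub 1); alg.
move=> z Nz; have [p ep] := closure_in_polynomials Nz; rewrite ep.
rewrite (homogE (leqnn (msize p))) raddf_sum.
apply: (sm_sum sL) => -[i hi] _ /=; have := closure_graded i (p := p); rewrite -ep => /(_ Nz).
case: i hi => [|i] hi; last exact: W1.
move=> h; rewrite -[j _]mul1r; alg.
Qed.

Local Notation C := (compl R P).
Local Notation R' := (loc R C).
Local Notation N' := (loc N C).
Local Notation P' := (loc P C).
Let hC : mset R C. Proof. exact: mset_compl max_prime. Qed.
Let hRn : noethm R R. Proof. exact: noeth_alg. Qed.
Let sRN : submodule R N. Proof. exact: submoduleS RN (sm_self hN). Qed.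
Let hR' : subring R'. Proof. exact: loc_subring. Qed.
Let hRn' : noethm R' R'. Proof. by exact: loc_noeth. Qed.
Let hl' : is_local R' P'. Proof. exact: local_loc max_prime. Qed.
Let RN' : R' `<=` N'. Proof. exact: loc_sub. Qed.
Let N'fg : fgm R' N'. Proof. by have [s ->] := closure_fg; exists s; rewrite (loc_lc _ hR hC hRR). Qed.

Lemma depth_data : depth_ge P' N' r.+2 [set 0] /\
  exists s, [/\ size s = r.+2, forall x, x \in s -> P' x & primary R' P' s].
Proof.
have [k hk] := exists_transversal hr dl_primary.
have uP k' : P (u k') := max_forms (uM k').
split; first exact: (local_depth hr hrel OL hf dlO dl_primary W_sub graded_relation hk hN hR hRn max_prime RN closure_fg OR max_scalars uP).
apply: (local_primary hr hrel dlO hk hR hRn max_prime OR max_scalars uP).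
move=> c hc; have sI := sm_lc [:: a, b & us u] hRR.
have Ig x : x \in [:: a, b & us u] -> lc R [:: a, b & us u] x by alg.
apply: (radical_power hR hRn) => [|Q hQ hIQ].
  split=> //; apply: lc_sub hRR => x; rewrite !inE => /or3P[/eqP ->|/eqP
  ->|/mapP[k' _ ->]]; alg.
apply: (max_sub_prime hQ) hc.
- exists 1%N; rewrite expr1; apply: hIQ; alg.
- exists 1%N; rewrite expr1; apply: hIQ; alg.
move=> i; exists e.+1; have [[_ sQ] _ _] := hQ.
have : M e.+1 (g i ^+ e.+1) by apply: (Un_exp hO); exact: Un_gen.
move/uM_red; apply: (lc_min (submoduleS OR sQ)) => x y hx hy; rewrite mulrC; apply: (smZ sQ); first exact: MR hy.
by apply: hIQ; apply: Ig; rewrite !inE hx !orbT.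
Qed.

Lemma loc_finite : (forall c w, P c -> N w -> exists k : nat, R (c ^+ k * w)) -> exists v, has_length R' N' R' v.
Proof.
move=> h; apply: (len_finite hR' hRn' hl' N'fg (sm_self hR') RN').
move=> _ _ [c [s [Pc Cs ->]]] [w [s' [Nw Cs' ->]]]; have [k hk] := h c w Pc Nw; exists k.
rewrite expr_div_n mulf_div; apply: loc_div => //; case: hC => _ C1 CM _; apply: (CM _ _ _ Cs').
by elim: (k) => [|k' IH]; rewrite // exprS; exact: CM.
Qed.

Lemma buchsbaum_of_absorbing : (forall c w, P c -> N w -> R (c * w)) -> buchsbaum_local R'.
Proof.
move=> h; have [v hv] : exists v, has_length R' N' R' v.
  by apply: loc_finite => c w hc hw; exists 1%N; exact: h.
have [hd [s [hs1 hs2 hs3]]] := depth_data.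
apply: (buchsbaum_intro hR' hRn' hl' N'fg RN' hv _ hd hs1 hs2 hs3).
move=> _ _ [c [x [Pc Cx ->]]] [w [y [Nw Cy ->]]]; rewrite mulf_div; apply: loc_div; first exact: h.
by case: hC => _ _ CM _; exact: CM.
Qed.

Lemma colon_radical x : (exists k, R (a ^+ k * x)) -> (exists k, R (b ^+ k * x)) ->
  (forall i, exists k, R (g i ^+ k * x)) -> forall c, P c -> exists k : nat, R (c ^+ k * x).
Proof.
move=> [k hk] [k' hk'] hgx c hc.
have hI : ideal R [set c | R c /\ R (c * x)].
  split; first alg.
  split=> [|y z [h1 h2] [h3 h4]|y z h1 [h2 h3]]; split; rewrite ?mul0r ?mulrDl -?mulrA;
    try exact: (sr0 hR); try exact: srD; exact: srM.
have [|k1 [_ h]] := radical_power hR hRn (x := c) hI; last by exists k1.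
move=> Q hQ hIQ; apply: (max_sub_prime hQ) hc.
- exists k; apply: hIQ; split=> //; alg.
- exists k'; apply: hIQ; split=> //; alg.
by move=> i; have [k1 h1] := hgx i; exists k1; apply: hIQ; split=> //; apply: srX => //; exact: MR (Un_gen hO g i).
Qed.

(** The hypothesis on the [g i] and the conductor of the scalars make N/R torsion along [P], hence
    of finite length after localization, so that [buchsbaum_absorb] applies. *)
Lemma absorbing_of_buchsbaum : buchsbaum_local R' ->
  (forall x, W 1 x -> forall i, exists k : nat, R (g i ^+ k * x)) ->
  (forall c x, n c -> W 1 x -> M 1 (c * x)) /\ forall y x, M 1 y -> W 1 x -> M 2 (y * x).
Proof.
move=> hB hW.
have hW1 x : W 1 x -> forall c, P c -> exists k : nat, R (c ^+ k * x).
  move=> hx; have hc c : n c -> exists k : nat, R (c ^+ k * x).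
    move=> /conductor_image[k hk]; exists k.
    have : Un t O 1 x by have /W_closure[p hp [-> _]] := hx; rewrite (homog_image j_inj); exists p.
    rewrite (Un1 hO) => /(lc_usP _ _ hOO)[y [Oy ->]]; rewrite mulr_sumr; apply: (sr_sum hR) => i _.
    by rewrite mulrCA; apply: (srM hR); [alg|exact: MR (hk i)].
  by apply: colon_radical; [exact: hc na|exact: hc nb|exact: hW].
have sX : submodule R [set x | forall c, P c -> exists k : nat, R (c ^+ k * x)].
  split=> [c _|x y hx hy c hc|x y Rx hy c hc]; first by exists 0%N; alg.
    have [[k1 h1] [k2 h2]] := (hx c hc, hy c hc); exists (k1 + k2)%N; rewrite mulrDr exprD -mulrA.
    apply: (srD hR); first by rewrite mulrCA; alg.
    alg.
  have [k h] := hy c hc; exists k; rewrite mulrCA; alg.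
have hWd d : W d `<=` [set x | forall c, P c -> exists k : nat, R (c ^+ k * x)].
  case: d => [x Ox c _|d]; first by exists 0%N; rewrite mul1r; exact: OR.
  elim: d => [//|d IH]; apply: (subset_trans (@Wgen d)).
  apply: (lc_min (submoduleS OR sX)) => _ y /mapP[k _ ->] hy.
  by apply: (smZ sX); [exact: MR (uM k)|alg].
have [v hv] : exists v, has_length R' N' R' v.
  apply: loc_finite => c w hc hw; have [p ep] := closure_in_polynomials hw.
  rewrite ep in hw *; rewrite (homogE (leqnn (msize p))) raddf_sum.
  move: c hc; apply: (sm_sum sX) => i _; apply: (@hWd i); exact: closure_graded.
have [hd [s [hs1 hs2 hs3]]] := depth_data.
have main := buchsbaum_absorb hR' hRn' hl' N'fg RN' hv hB hd hs1 hs2 hs3.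
(* A denominator outside [P] has a constant term outside [m], which is a unit; the component of
   degree [i.+1] of the cleared equation is this unit times [c * x]. *)
have grade c x i : P c -> M i c -> W 1 x -> M i.+1 (c * x).
  move=> Pc Mc hx; have [p hp ep] : exists2 p, p \is i.+1.-homog & c * x = j p.
    have [p1 h1 ->] := M_homog Mc; have /W_closure[p2 h2 [-> _]] := hx.
    by exists (p1 * p2); [rewrite -addn1; exact: dhomogM|rewrite rmorphM].
  have [z [s0 [Rz [Rs nPs] es]]] := main _ _ (sub_loc hC Pc) (sub_loc hC (W_sub hx)).
  have [ps hps ess] : exists2 ps, Rees MS ps & s0 = j ps by move: Rs; rewrite -rees_image => -[ps ? <-]; exists ps.
  have m0 : ~ m ps@_0%MM by move=> h; apply: nPs; exists ps => //; apply/rees_maxE.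
  have s00 : s0 != 0 by apply/eqP => h; apply: nPs; rewrite h; have [[_ /sm0]] := max_prime.
  have h1 : R (j (ps * p)) by rewrite rmorphM -ess -ep es mulrC divfK.
  have h2 := rees_components i.+1 h1; move: h2; rewrite -[i.+1]add0n (hc_mul _ _ hp) hc0 rmorphM -ep add0n.
  have Ou : O (j (ps@_0)%:MP) by [].
  have nu : ~ n (j (ps@_0)%:MP) by move=> [f mf /(cst_inj j_inj) e1]; apply: m0; rewrite -e1.
  move=> h2; have := smZ (sM i.+1) (local_inv hr Ou nu) h2.
  by rewrite mulKf // (nonmem_neq0 hr nu).
split=> [c x nc hx|y x My hx].
  by apply: (grade c x 0%N) => //; [exact: max_scalars|rewrite M0; exact: nO].
by apply: (grade y x 1%N) => //; exact: max_forms My.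
Qed.

Section Condition3.
Hypothesis nW : forall c x, n c -> W 1 x -> M 1 (c * x).
Hypothesis MW : forall y x, M 1 y -> W 1 x -> M 2 (y * x).

Lemma W_M d : W d.+2 `<=` M d.+2.
Proof.
elim: d => [|d IH]; apply: (subset_trans (@Wgen _)); apply: (lc_min (sM _)) => _ y /mapP[k _ ->] hy.
  exact: MW (uM k) hy.
apply: (Un_mul hO (uM k)); alg.
Qed.

Lemma max_W c x : P c -> W 1 x -> R (c * x).
Proof.
move=> [p /rees_maxE[hp mp] <-] hx; rewrite (homogE (leqnSn (msize p))).
rewrite raddf_sum mulr_suml; apply: (sr_sum hR) => -[[|i] hi] _ /=.
  by apply: (MR (d := 1)); apply: nW => //; rewrite hc0; exists p@_0%MM.
have : M i.+1 (j (hc i.+1 p)) by apply: rees_components; rewrite -rees_image.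
rewrite (UnS _ _ hOO) => /(lc_usP _ _ (sM i))[y [hy ->]]; rewrite mulr_suml; apply: (sr_sum hR) => k _.
by rewrite -mulrA; apply: (srM hR); [exact: MR (hy k)|apply: (MR (d := 2)); exact: MW (Un_gen hO g k) hx].
Qed.

Lemma closure_mod_R p d : N (j p) -> d != 1%N -> R (j (hc d p)).
Proof.
move=> hp; have := closure_graded d hp; case: d => [|[|d]] // h _; first exact: OR.
exact: MR (W_M h).
Qed.

Lemma max_closure c w : P c -> N w -> R (c * w).
Proof.
move=> hc hw; have [p ep] := closure_in_polynomials hw; rewrite ep in hw *.
rewrite (homogE (leqnn (msize p))) raddf_sum mulr_sumr; apply: (sr_sum hR) => i _ /=.
have [e1|h] := eqVneq (i : nat) 1%N; last by apply: (srM hR); [exact: PR|exact: closure_mod_R].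
by apply: max_W hc _; rewrite e1; exact: closure_graded.
Qed.

(** An element of [P] outside [Q] multiplies [N] into [R], so both have the same localization at
    [Q]. *)
Lemma normal_off_max Q : prime_ideal R Q -> ~ P `<=` Q -> normal_domain (loc R (compl R Q)).
Proof.
move=> hQ /existsNP[f /not_implyP[Pf nQf]] y z Ry Rz z0 hi; have hS := mset_compl hR hQ.
have [s [Rs nQs] hs] := int_loc hR hS hi.
have s0 : s != 0 by apply/eqP => s0; apply: nQs; rewrite s0; have [[_ /sm0]] := hQ.
have f0 : f != 0 by apply/eqP => f0; apply: nQf; rewrite f0; have [[_ /sm0]] := hQ.
exists (f * (s * (y / z))), (f * s); split; first exact: max_closure.
  case: hS => _ _ SM _; apply: SM; split=> //; alg.
by rewrite [in RHS](mulrA f s) [RHS]mulrAC divff ?mulf_neq0 // mul1r.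
Qed.

End Condition3.

(** [x] maps the finite [R]-module generated by [M l] into itself; this module contains a power of a
    nonzero multiple of a variable, by the conductor. *)
Lemma multiplier_integral x i l : Un t O i x -> (forall y, M l y -> M (l + i)%N (y * x)) -> N x.
Proof.
case: i => [|i] hx h; first by apply: RN; apply: OR; rewrite -(Un0 t hOO).
have [->|x0] := eqVneq x 0; first exact: sr0.
have [k0 _] : exists k : 'I_r, True.
  apply: contrapT => hno; case/eqP: x0; move: hx.
  rewrite (UnS _ _ hOO) => /(lc_usP _ _ (sm_Un t i hOO))[c [_ ->]]; apply: big1 => k _.
  by case: hno.
have [k hk] := conductor_image na; have t0 : t k0 != 0.
  rewrite -(rmorph0 j) (inj_eq j_inj); apply/eqP => /(congr1 (mcoeff U_(k0)%MM)) /eqP.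
  by rewrite mcoeffX eqxx mcoeff0 oner_eq0.
have [s es] := Un_fg hO g l; have sL := sm_lc s hRR.
have sub d : M (l + d)%N `<=` lc R s.
  elim: d => [|d IH]; first by rewrite addn0 es; exact: lcS.
  rewrite addnS (UnS _ _ hOO); apply: (lc_min (submoduleS OR sL)) => _ y /mapP[k1 _ ->] hy.
  by apply: (smZ sL); [exact: MR (Un_gen hO g k1)|alg].
apply: (fg_elements_integral hR (erefl (lc R s))).
  exists ((a ^+ k * t k0) ^+ l); last by rewrite expf_neq0 // mulf_neq0 // expf_neq0.
  by apply: (sub 0%N); rewrite addn0; exact: Un_exp.
move=> y; apply: (lc_min (X := [set y | lc R s (x * y)]) (B := R)).
  split=> [|z z' h1 h2|c z hc1 h1] /=; rewrite ?mulr0 ?mulrDr; alg.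
move=> z w hz Rw /=; rewrite mulrA mulrC; apply: (smZ sL Rw); rewrite mulrC; apply: (sub i.+1); apply: h.
alg.
Qed.

(** By the pigeonhole principle a monomial of degree [(q * k).+1] in the [q] generators is divisible
    by the [k]-th power of one of them. *)
Lemma forms_multiply x : (forall i, exists k, R (g i ^+ k * x)) -> exists l, forall y, M l y -> R (y * x).
Proof.
move=> h; have [k hk] : exists k : nat, forall i, R (g i ^+ k * x).
  have /choice[k hk] := h; exists (\sum_i k i)%N => i; rewrite (bigD1 i) //= addnC exprD -mulrA.
  by apply: (srM hR) => //; apply: srX => //; exact: MR (Un_gen hO g i).
exists (q * k).+1 => y [f hf' ->]; rewrite mevalE mulr_suml big_seq; apply: (sr_sum hR) => v hv.
rewrite -mulrA; apply: (srM hR); first by apply: OR; have [] := hf' v.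
have [i hi] : exists i, (k <= v i)%N.
  apply: contrapT => hno; have : mdeg v = (q * k).+1.
    apply/eqP; apply: contraTT hv => hd; have [_ /(_ hd) h0] := hf' v.
    by rewrite mcoeff_msupp h0 eqxx.
  rewrite mdegE => e1; have : (\sum_(i < q) v i <= \sum_(i < q) k)%N.
    by apply: leq_sum => i _; rewrite leqNgt; apply/negP => hlt; apply: hno; exists i; exact: ltnW.
  by rewrite e1 sum_nat_const card_ord ltnn.
rewrite (bigD1 i) //= -(subnK hi) exprD mulrAC -mulrA -mulrA; apply: (srM hR).
  by apply: srX => //; exact: MR (Un_gen hO g i).
rewrite mulrA mulrC; apply: (srM hR); last exact: hk.
by apply: (sr_prod hR) => i' _; apply: srX => //; exact: MR (Un_gen hO g i').
Qed.

(** The coefficients are divided one at a time, using that [a] does not divide powers of [b]. *)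
Lemma polynomial_glue z k k' : (exists p, a ^+ k * z = j p) -> (exists p, b ^+ k' * z = j p) ->
  exists p, z = j p.
Proof.
move=> [p ep] [p' ep']; have [Oa Ob] := (nO na, nO nb); have [fa mfa ea] := am.
have nab : ~ scm a O (b ^+ k').
  move=> h; apply: (a_notin1 hr); apply: (reg_pow hr (k := k') (sr1 hO)); by rewrite mulr1.
have cE f p1 : j (f *: p1) = c0 f * j p1 by rewrite -mul_mpolyC rmorphM.
have /choice[w hw] : forall x, exists w, p@_x = fa ^+ k * w.
  move=> x; have Op : O (c0 p@_x) by exists p@_x.
  have [|_ [w _ <-] e1] := reg2_primeXl hr (e := k) (srX k' hO Ob) Op nab.
    have e2 : b ^+ k' * j p = a ^+ k * j p' by rewrite -ep -ep' mulrCA.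
    have [fb _ eb] : exists2 f, m f & b = c0 f by case: nb => f mf <-; exists f.
    exists (c0 p'@_x); first alg.
    have e3 : fb ^+ k' *: p = fa ^+ k *: p'.
      by apply: j_inj; rewrite !cE !rmorphXn -ea -eb.
    have := congr1 (mcoeff x) e3; rewrite !mcoeffZ => e4.
    by rewrite ea eb -!rmorphXn -!rmorphM e4.
  by exists w; apply: (cst_inj j_inj); rewrite rmorphM rmorphXn -ea.
exists (\sum_(x <- msupp p) w x *: 'X_[x]); apply: (mulfI (expf_neq0 k a0)).
rewrite ep {1}[p]mpolyE !raddf_sum mulr_sumr; apply: eq_bigr => x _ /=.
by rewrite hw !cE rmorphM rmorphXn -ea mulrA.
Qed.

(** This is what bounds the first local cohomology. The scalars in [P] make [z] a polynomial, and
    the forms in [P] make each component of [z] multiply some power of [M] into a later one. *)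
Lemma torsion_closure z : (forall c, P c -> exists k : nat, R (c ^+ k * z)) -> N z.
Proof.
move=> h; have RJ x : R x -> exists p, x = j p by rewrite -rees_image => -[p _ <-]; exists p.
have [[k1 /RJ h1] [k2 /RJ h2]] := (h _ (max_scalars na), h _ (max_scalars nb)).
have [p ep] := polynomial_glue h1 h2.
have [i|l hz] := @forms_multiply z; first by apply: h; exact: max_forms (Un_gen hO g i).
rewrite ep (homogE (leqnn (msize p))) raddf_sum; apply: (sr_sum hN) => i _ /=.
apply: (multiplier_integral (i := i) (l := l)) => [|y My].
  by rewrite (homog_image j_inj); exists (hc i p) => //; exact: pihomogP.
have [y0 hy0 ey] := M_homog My.
have := hz y My; rewrite ep ey -rmorphM mulrC => /(rees_components (i + l)%N).
by rewrite (hc_mul _ _ hy0) rmorphM mulrC addnC.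
Qed.

Lemma generators_torsion s (f : 'I_s -> S) z : Rees_max m MS = span (Rees MS) (range f) ->
  (forall i, exists k : nat, R (j (f i) ^+ k * z)) -> N z.
Proof.
move=> ef hf'; apply: torsion_closure => c hc.
have Pf i : P (j (f i)) by exists (f i); rewrite // ef; apply: sub_span.
have hI : ideal R [set c | R c /\ R (c * z)].
  split; first alg.
  split=> [|x y [h1 h2] [h3 h4]|x y h1 [h2 h3]]; split; rewrite ?mul0r ?mulrDl -?mulrA;
    try exact: (sr0 hR); try exact: srD; exact: srM.
have [|k1 [_ h]] := radical_power hR hRn (x := c) hI; last by exists k1.
move=> Q hQ hIQ; have [[_ sQ] _ _] := hQ; rewrite -rees_image in sQ.
have [p hp <-] := hc; suff [] : [set p | Rees MS p /\ Q (j p)] p by [].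
move: hp; rewrite ef; apply: (span_min (sm_preimage hRees sQ)) => _ [i _ <-].
have Rf := PR (Pf i); split; first exact: rees_preimage.
have [k hk] := hf' i; apply: (prime_mulX hR (k := k) hQ Rf).
apply: hIQ; split=> //; alg.
Qed.

Lemma hc_prod d p p' : hc d (p * p') = \sum_(i < d.+1) hc (d - i)%N p * hc i p'.
Proof.
rewrite {1}(@homogE _ _ (d.+1 + msize p')%N p') ?leq_addl //.
rewrite mulr_sumr raddf_sum big_split_ord /= [X in _ + X]big1 ?addr0 => [|i _].
  apply: eq_bigr => i _; rewrite -{1}(subnK (ltn_ord i : (i <= d)%N)) hc_mul //; exact: pihomogP.
by apply: hc_mul_lt (pihomogP _ _ _) _; rewrite leq_addr.
Qed.

(** Normality is given at graded primes only, hence the passage to the largest graded ideal in [Q].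
    It is prime: for two elements outside, the product of their first components outside [Q] is the
    only term outside [Q] in a component of the product. *)
Lemma graded_core Q : prime_ideal R Q -> graded_prime MS [set p | Rees MS p /\ forall d, Q (j (hc d p))].
Proof.
move=> hQ; have [[QR sQ] Q1 hQM] := hQ; have Q0 := sm0 sQ.
have RJ d p : Rees MS p -> R (j (hc d p)).
  by rewrite -rees_image; exists (hc d p) => //; exact: rees_hc.
split; last first.
  move=> p d [hp hd]; split=> [|d']; first exact: rees_hc.
  have [<-|h] := eqVneq d d'; first by rewrite pihomog_id.
  by rewrite (pihomog_ne0 h) ?rmorph0 //; exact: pihomogP.
split; first split.
- alg.
- split=> [|p p' [h1 h2] [h3 h4]|p p' h1 [h2 h3]].
  + by split=> [|d]; [alg|rewrite !raddf0].
  + split=> [|d]; first exact: (srD hRees).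
    rewrite pihomogD rmorphD; alg.
  split=> [|d]; first exact: (srM hRees).
  rewrite hc_prod rmorph_sum; apply: (sm_sum sQ) => i _; rewrite rmorphM.
  by apply: (smZ sQ) => //; exact: RJ.
- by move=> [_ /(_ 0%N)]; rewrite pihomog_dE ?dhomog1 // rmorph1.
move=> p p' hp hp' [_ hpp]; apply: contrapT => /not_orP[h1 h2].
have least (p1 : S) : Rees MS p1 -> ~ [set p | Rees MS p /\ forall d, Q (j (hc d p))] p1 ->
    exists d, ~ Q (j (hc d p1)) /\ forall d', (d' < d)%N -> Q (j (hc d' p1)).
  move=> hp1 hn; have /existsNP[d0 hd0] : ~ forall d, Q (j (hc d p1)) by move=> h; apply: hn.
  elim/ltn_ind: d0 hd0 => d0 IH hd0.
  have [h|/existsNP[d' /not_implyP[hd' h']]] := pselect (forall d', (d' < d0)%N -> Q (j (hc d' p1))).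
    by exists d0.
  exact: IH hd' h'.
have [[d [hd hd'] ] [d1 [hd1 hd1']]] := (least _ hp h1, least _ hp' h2).
have := hpp (d + d1)%N; rewrite hc_prod rmorph_sum.
have hi : (d1 < (d + d1).+1)%N by rewrite ltnS leq_addl.
rewrite (bigD1 (Ordinal hi)) //= addnK rmorphM => h.
have : Q (j (hc d p) * j (hc d1 p')).
  apply: (smDr hR sQ _ h); apply: (sm_sum sQ) => i hne; rewrite rmorphM.
  have [lt|le] := ltnP i d1; first by apply: (smZ sQ); [exact: RJ|exact: hd1'].
  rewrite mulrC; apply: (smZ sQ); first exact: RJ.
  have : (i : nat) != d1 by [].
  by move=> hne'; apply: hd'; move: (ltn_ord i) le hne'; lia.
by case/(hQM _ _ (RJ _ _ hp) (RJ _ _ hp')).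
Qed.

(** If no power of [g i] multiplied [x] into [R], a prime [Q] above the denominators of [x] would
    miss those powers. At its graded core [R] is normal, so some [s] outside the core multiplies [x]
    into [R]; as [x] is homogeneous, all components of [s] do, and they lie in [Q]. *)
Lemma multiplier_of_normal :
  (forall Q, graded_prime MS Q -> ~ Rees_plus MS `<=` Q -> normal_domain (localization R (j @` Q))) ->
  forall x, W 1 x -> forall i, exists k : nat, R (g i ^+ k * x).
Proof.
move=> hN1 x hx i; apply: contrapT => hno.
have [p0 hp0 [ex Nx]] : exists2 p, p \is 1.-homog & x = j p /\ N x by have /W_closure[p h1 [h2 h3]] := hx; exists p.
have hI : ideal R [set c | R c /\ R (c * x)].
  split; first alg.
  split=> [|z y [h1 h2] [h3 h4]|z y h1 [h2 h3]]; split; rewrite ?mul0r ?mulrDl -?mulrA;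
    try exact: (sr0 hR); try exact: srD; exact: srM.
have Rg : R (g i) := MR (Un_gen hO g i).
have [|||Q [hQ hIQ hgQ]] := prime_avoid hR hRn (S := [set y | exists k : nat, y = g i ^+ k]) hI.
- by exists 0%N.
- by move=> _ _ [k1 ->] [k2 ->]; exists (k1 + k2)%N; rewrite exprD.
- by move=> y [_ h] [k ey]; apply: hno; exists k; rewrite -ey.
have hG := graded_core hQ; set Q' := [set p | _] in hG; have [hQ' _] := hG.
have hS : mset R (compl R (j @` Q')) := mset_compl hR (prime_image hQ').
have [k hk] : exists k : nat, R (a ^+ k * x).
  have [k hk] := conductor_image na; exists k.
  have : Un t O 1 x by rewrite (homog_image j_inj); exists p0.
  rewrite (Un1 hO) => /(lc_usP _ _ hOO)[y [Oy ->]]; rewrite mulr_sumr; apply: (sr_sum hR) => i' _.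
  by rewrite mulrCA; apply: (srM hR); [alg|exact: MR (hk i')].
have hak := expf_neq0 k a0; have Rak : R (a ^+ k) by apply: srX => //; exact: OR (nO na).
have exk : x = (a ^+ k * x) / a ^+ k by rewrite mulrC mulKf.
have [||||z [s [Rz Rs nQs es]]] := hN1 Q' hG _ (a ^+ k * x) (a ^+ k) _ _ hak.
- move=> h; apply: (hgQ (g i)); last by exists 1%N.
  have [|_ /(_ 1%N)] := h (G i); last by rewrite (pihomog_dE (G1 i)).
  by apply: sub_span; exists 1%N => //; apply/Mpow_image; exact: Un_gen.
- by rewrite localizationE; exact: (sub_loc hS).
- by rewrite localizationE; exact: (sub_loc hS).
- by rewrite -exk localizationE; apply: int_mono Nx; exact: (sub_loc hS).
rewrite -exk in es; have s0 := mset_neq0 hS (conj Rs nQs).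
have [ps hps eps] : exists2 ps, Rees MS ps & s = j ps by move: Rs; rewrite -rees_image => -[ps ? <-]; exists ps.
apply: nQs; exists ps => //; split=> // d; apply: hIQ.
split; first by rewrite -rees_image; exists (hc d ps) => //; exact: rees_hc.
have : R (j (ps * p0)) by rewrite rmorphM -eps -ex es mulrC divfK.
by move=> /(rees_components (d + 1)%N) /MR; rewrite (hc_mul _ _ hp0) rmorphM -ex.
Qed.

Lemma closure_of_M d z : M d z -> W d z.
Proof.
move=> hz; apply/W_closure; have [p hp ez] := M_homog hz; exists p => //; split=> //.
by apply: RN; exact: MR hz.
Qed.

Local Notation condition3 := ((forall a x, m a -> Mbar MS 1 x -> MS (a *: x)) /\
  mulset (@scalars A r) MS (Mbar MS 1) = Mpow MS 2).

Lemma module_M1 p : MS p <-> M 1 (j p).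
Proof. by rewrite -module_image; split=> [h|[p' h /j_inj <-]] //. Qed.

Lemma condition3P : condition3 <->
  (forall c x, n c -> W 1 x -> M 1 (c * x)) /\ (forall y x, M 1 y -> W 1 x -> M 2 (y * x)).
Proof.
have cE f p : j (f *: p) = c0 f * j p by rewrite -mul_mpolyC rmorphM.
split=> [[h1 h2]|[h1 h2]]; split.
- move=> _ x [f mf <-] hx; have /W_closure[p _ [ex _]] := hx; rewrite ex -cE; apply/module_M1.
  by apply: h1 => //; apply/Mbar_image; rewrite -ex.
- move=> y x hy hx; have /W_closure[p _ [ex _]] := hx; have [p' _ ey] := M_homog hy.
  rewrite ex ey -rmorphM; apply/Mpow_image; rewrite -h2; apply: sub_span; exists p'; first by apply/module_M1; rewrite -ey.
  by exists p => //; apply/Mbar_image; rewrite -ex.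
- move=> f p mf /Mbar_image hp; apply/module_M1; rewrite cE; apply: h1 => //; by exists f.
apply/seteqP; split.
  apply: span_min => [|_ [p /module_M1 hp [p' /Mbar_image hp' <-]]]; last first.
    by apply/Mpow_image; rewrite rmorphM; exact: h2.
  split=> [|p p' /Mpow_image hp /Mpow_image hp'|_ p [f _ <-] /Mpow_image hp]; apply/Mpow_image.
  - by rewrite rmorph0; exact: sm0 (sM 2).
  - by rewrite rmorphD; exact: (smD (sM 2)).
  - by rewrite rmorphM; apply: (smZ (sM 2)).
move=> p /Mpow_image; rewrite (UnS _ _ hOO) => /(lc_usP _ _ (sM 1))[c [hc1 ep]].
have /choice[c' hc'] : forall i, exists c', MS c' /\ c i = j c'.
  by move=> i; have [c' _ ec] := M_homog (hc1 i); exists c'; split=> //; apply/module_M1; rewrite -ec.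
have -> : p = \sum_i G i * c' i.
  by apply: j_inj; rewrite ep rmorph_sum; apply: eq_bigr => i _; rewrite (hc' i).2 mulrC rmorphM.
apply: (sm_sum (sm_span _ _)) => i _; apply: sub_span; exists (G i); first by apply/module_M1; exact: Un_gen.
by exists (c' i) => //; apply/Mbar_image; rewrite -(hc' i).2; exact: closure_of_M (hc1 i).
Qed.

Local Notation buchsbaum := (buchsbaum_local (localization (j @` Rees MS) P)).
Local Notation proj_normal := (forall Q, graded_prime MS Q -> ~ (Rees_plus MS `<=` Q) ->
  normal_domain (localization (j @` Rees MS) (j @` Q))).

Theorem equivalences : [/\ condition3 -> [/\ buchsbaum, ratliff_rush MS = Mbar MS 1 & proj_normal],
  buchsbaum -> ratliff_rush MS = Mbar MS 1 -> condition3 & buchsbaum -> proj_normal -> condition3].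
Proof.
rewrite rees_image localizationE; split.
- move=> /condition3P[nW MW]; split.
  + by apply: buchsbaum_of_absorbing; exact: max_closure.
  + apply/seteqP; split=> p; last first.
      move=> /Mbar_image hp; have [hp1 _] : Mbar MS 1 p by apply/Mbar_image.
      split=> //; exists 1%N => // y /Mpow_image hy; apply/Mpow_image.
      by rewrite mulrC rmorphM; exact: MW.
    move=> [p1 [l l0 h]]; split=> //; apply/closure_integral.
    apply: (multiplier_integral (i := 1) (l := l)) => [|y hy]; first by rewrite (homog_image j_inj); exists p.
    have [y0 _ ey] := M_homog hy; rewrite ey -rmorphM mulrC addn1; apply/Mpow_image; apply: h.
    by apply/Mpow_image; rewrite -ey.
  move=> Q [hQ _] hQ'; rewrite localizationE; apply: (normal_off_max nW MW (prime_image hQ)).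
  move=> h; apply: hQ' => x hx; have [|x' hx' /j_inj <- //] := h (j x).
  by exists x => //; apply: sub_span; right.
- move=> hB hRR'; apply/condition3P; apply: absorbing_of_buchsbaum => // x hx i.
  have /W_closure[p _ [ex _]] := hx; have : Mbar MS 1 p by apply/Mbar_image; rewrite -ex.
  rewrite -hRR' => -[_ [l _ h]]; exists l; rewrite ex -rmorphXn -rmorphM mulrC; apply: (MR (d := l.+1)).
  apply/Mpow_image; apply: h; apply/Mpow_image; rewrite rmorphXn.
  by apply: (Un_exp hO); exact: Un_gen.
move=> hB hPN; apply/condition3P; apply: absorbing_of_buchsbaum => //.
exact: multiplier_of_normal.
Qed.

Lemma Mpow1 p : Mpow MS 1 p <-> MS p.
Proof. by rewrite Mpow_image module_M1. Qed.

Theorem consequences : condition3 -> [/\ forall d, (2 <= d)%N -> Mbar MS d = Mpow MS d,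
    forall d p, Mbar MS d p -> d != 1%N -> Rees MS p,
    forall c p, Rees_max m MS c -> Mbar MS 1 p -> Rees MS (c * p)
  & forall s (f : 'I_s -> S) z, Rees_max m MS = span (Rees MS) (range f) ->
      (forall i, exists k : nat, (j @` Rees MS) (j (f i) ^+ k * z)) ->
      exists p, z = j p /\ forall d, Mbar MS d (hc d p)].
Proof.
move=> /condition3P[nW MW]; have W2 d p : (2 <= d)%N -> W d (j p) -> M d (j p).
  by case: d => [|[|d]] // _; exact: W_M.
split.
- move=> d d2; apply/seteqP; split=> p; first by move=> /Mbar_image /(W2 d p d2) /Mpow_image.
  by move=> /Mpow_image /closure_of_M /Mbar_image.
- move=> d p /Mbar_image hp hd; apply: rees_preimage; case: d hp hd => [|[|d]] // hp _; first exact: OR.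
  by apply: (MR (d := d.+2)); exact: W2.
- move=> y p hy /Mbar_image hp; have Py : P (j y) by exists y.
  by apply: rees_preimage; rewrite rmorphM; exact: max_W.
move=> s f z ef; rewrite rees_image => /(generators_torsion ef) hz.
have [p ep] := closure_in_polynomials hz; exists p; split=> // d.
by apply/Mbar_image; apply: closure_graded; rewrite -ep.
Qed.

End ReesAlgebra.

(** * Local cohomology and conclusion *)

Lemma fraction_quotient (D : idomainType) (z : {fraction D}) :
  exists p q : D, q != 0 /\ z = @FracField.tofrac D p / @FracField.tofrac D q.
Proof.
elim/quotW: z => x; exists \n_x, \d_x; have d0 := denom_ratioP x; split=> //.
have h : @FracField.tofrac D \d_x != 0 by rewrite tofrac_eq0.
apply: (mulIf h); rewrite divfK //.
rewrite -[LHS]/(FracField.mul _ _) !piE; apply/eqmodP; rewrite /= FracField.equivfE.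
by rewrite !numden_Ratio ?mulf_neq0 ?oner_neq0 // !mulr1 mulrC.
Qed.

(** * Cech cocycles in terms of the integral closure *)

Section CechCohomology.
Variables (A : idomainType) (m : set A) (r : nat) (MS : set {mpoly A[r]}) (s : nat) (f : 'I_s -> {mpoly A[r]}).
Local Notation S := {mpoly A[r]}.
Local Notation j := (@FracField.tofrac S).
Local Notation hc := (@pihomog r A mdeg).
Local Notation d0 := (@cech_d0 A r s).
Hypothesis hRees : subring (Rees MS).
Hypothesis Mpow1 : forall p, Mpow MS 1 p <-> MS p.
Hypothesis closure_rees : forall d p, Mbar MS d p -> d != 1%N -> Rees MS p.
Hypothesis max_closure : forall c p, Rees_max m MS c -> Mbar MS 1 p -> Rees MS (c * p).
Hypothesis torsion : forall z : {fraction S}, Rees_max m MS = span (Rees MS) (range f) ->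
  (forall i, exists k : nat, (j @` Rees MS) (j (f i) ^+ k * z)) ->
  exists p, z = j p /\ forall d, Mbar MS d (hc d p).
Hypothesis max_neq0 : exists2 c, Rees_max m MS c & c != 0.
Hypothesis hf : homogeneous_generators m MS f.
Let jf0 i : j (f i) != 0. Proof. by rewrite tofrac_eq0; have [h _] := hf; have [] := h i. Qed.

Let i0 : exists i : 'I_s, True.
Proof.
apply: contrapT => hno; have [c hc' /eqP] := max_neq0; apply.
have [_ e] := hf; move: hc'; rewrite e; apply: (span_min (sm_zero _)) => _ [i _ <-].
by case: hno.
Qed.

(** [p] is the fraction [f i * p / f i], whose numerator is in the Rees algebra because [f i] is in
    the maximal ideal. *)
Let const_deg p : Mbar MS 1 p -> cech_Z1_deg MS f 1 (d0 p).
Proof.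
move=> hp; have [h e] := hf; have [p1 _] := hp.
have hfp i : Rees MS (f i * p).
  by apply: max_closure hp; rewrite e; apply: sub_span.
have ep i : j p = j (f i * p) / j (f i) ^+ 1 by rewrite expr1 tofracM mulrC mulKf.
split; first split.
- by move=> i; exists (f i * p), 1%N; split; [alg|exact: ep].
- by move=> i i' _; rewrite /cech_d1 subrr.
move=> i; have [_ [n [_ hn]]] := h i; exists (f i * p), n, n.+1, 1%N; split=> //.
  by split; rewrite // -[n.+1]addn1; exact: dhomogM.
  by rewrite mul1n -add1n.
exact: ep.
Qed.

Let const_in_B p : MS p -> Mbar MS 1 p -> cech_B1_deg MS f 1 (d0 p).
Proof. by move=> /Mpow1[hp _] hp'; split; [exists p|have [] := const_deg hp']. Qed.

Let Mbar0 : Mbar MS 1 0.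
Proof.
split; first exact: dhomog0.
exists 'X; split; [exact: monicX| |by rewrite /root hornerX].
move=> i; rewrite coefX; alg.
Qed.

Let zero_in_B : cech_B1_deg MS f 1 0.
Proof.
have -> : 0 = d0 0 by [].
by apply: const_in_B Mbar0; apply/Mpow1; split; [alg|exact: dhomog0].
Qed.

(** All localizations lie in one field, so a cocycle has the same entry everywhere, and powers of
    all generators of the maximal ideal carry this entry into the Rees algebra. *)
Let cocycle_const z : cech_Z1 MS f z -> exists p, z = d0 p /\ forall d, Mbar MS d (hc d p).
Proof.
have [k _] := i0; move=> [hz hz1]; have ez i : z i = z k.
  have h (i1 i2 : 'I_s) : (i1 < i2)%N -> z i2 = z i1 by move=> /hz1/eqP; rewrite subr_eq0 => /eqP.
  by case: (ltngtP i k) => [/h|/h|/val_inj ->].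
have [_ e] := hf; have [i|p [ep hp]] := torsion e (z := z k).
  rewrite -(ez i); have [a [l [Ra ->]]] := hz i; exists l, a => //.
  by rewrite mulrC divfK //; exact: expf_neq0 (jf0 i).
by exists p; split=> //; apply: funext => i; rewrite ez.
Qed.

Lemma cohomology_concentrated : H1_concentrated MS f 1.
Proof.
move=> z /cocycle_const[p [-> hp]]; exists (d0 (hc 1 p)); first exact: const_deg.
exists (p - hc 1 p); last by rewrite /cech_d0 tofracB.
have -> : p - hc 1 p = \sum_(d < (msize p).+2 | d != 1%N :> nat) hc d p.
  rewrite {1}(@homogE _ _ ((msize p).+2) p); last by rewrite 2?ltnW.
  by rewrite (bigD1 (Ordinal (isT : (1 < (msize p).+2)%N))) //= addrAC subrr add0r.
by apply: sr_sum => // d hd; exact: closure_rees hd.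
Qed.

Lemma cohomology_iso : H1_deg_iso MS f 1 (Mbar MS 1) MS.
Proof.
have [k _] := i0; exists (d0); split.
- by [].
- move=> p p' _ _; rewrite (_ : _ - _ = 0) //; apply: funext => i.
  by rewrite /cech_d0 tofracD subrr.
- move=> a p _; rewrite (_ : _ - _ = 0) //; apply: funext => i.
  by rewrite /cech_d0 -mul_mpolyC tofracM subrr.
- move=> p hp; split=> [[[p' hp' /(congr1 (fun h => h k)) /eqP]]|hp']; last exact: const_in_B.
  by rewrite tofrac_eq => /eqP e _; apply/Mpow1; rewrite -e; split=> //; rewrite e; have [] := hp.
move=> y [/cocycle_const[p [-> hp]] hdeg]; exists (hc 1 p) => //.
suff -> : hc 1 p = p by rewrite subrr.
(* A power of [f k] times [p] is homogeneous of the degree expected for degree one, so [p] has no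
   other component. *)
have [a [d [l [k' [fd [_ al] el ep]]]]] := hdeg k.
have ea : p * f k ^+ k' = a.
  by apply/eqP; rewrite -tofrac_eq tofracM tofracXn [j p]ep divfK ?expf_neq0.
have hd d' : d' != 1%N -> hc d' p = 0.
  move=> hd'; have := hc_mul d' p (dhomogMn k' fd); rewrite ea (pihomog_ne0 _ al).
    move/esym/eqP; rewrite mulf_eq0 expf_eq0; have [h _] := hf.
    by have [/negbTE -> _] := h k; rewrite andbF orbF => /eqP.
  by apply: contraNneq hd' => e; move: el; lia.
rewrite [RHS](@homogE _ _ ((msize p).+2) p); last by rewrite 2?ltnW.
rewrite (bigD1 (Ordinal (isT : (1 < (msize p).+2)%N))) //= big1 ?addr0 // => d' hd'; exact: hd.
Qed.

End CechCohomology.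

Section Conclusion.
Variables (A : idomainType) (m : set A).
Hypothesis regA : regular_local [set: A] m 2.
Variables (M : lmodType A) (r : nat) (e : 'I_r -> dual (dual M)).
Hypothesis basis_e : free_basis e.
Local Notation S := {mpoly A[r]}.

Definition linear_form (v : 'rV[A]_r) : S := \sum_i v 0 i *: 'X_i.

Lemma linear_formD a v w : linear_form (a *: v + w) = a *: linear_form v + linear_form w.
Proof.
rewrite /linear_form scaler_sumr -big_split; apply: eq_bigr => i _.
by rewrite !mxE scalerDl scalerA.
Qed.

Lemma inSE p : inS e p <-> exists x, p = linear_form (coords basis_e x).
Proof.
split=> [[x [c [ex ->]]]|[x ->]].
  exists x; rewrite (coords_uniq basis_e (v := \row_i c i)).
    by apply: eq_bigr => i _; rewrite mxE.
  by rewrite ex; apply: eq_bigr => i _; rewrite mxE.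
by exists x, (fun i => coords basis_e x 0 i); split=> //; exact: coordsP.
Qed.

Lemma inS_generated : fin_gen M -> exists (q : nat) (G : 'I_q -> S),
  (forall i, G i \is 1.-homog) /\ forall p, inS e p <-> exists c : 'I_q -> A, p = \sum_i c i *: G i.
Proof.
move=> [q [x hx]]; exists q, (fun i => linear_form (coords basis_e (x i))); split=> [i|p].
  by apply: rpred_sum => k _; apply: rpredZ; rewrite dhomogX; apply/eqP; exact: mdeg1.
have hsum (c : 'I_q -> A) :
    linear_form (coords basis_e (\sum_i c i *: x i)) = \sum_i c i *: linear_form (coords basis_e (x i)).
  pose h y := linear_form (coords basis_e y).
  have hl a y z : h (a *: y + z) = a *: h y + h z by rewrite /h coords_linear linear_formD.
  have h0 : h 0 = 0 by have := hl 1 0 0; rewrite !scale1r addr0 => /esym/eqP;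
  rewrite -subr_eq0 addrK => /eqP.
  elim/big_rec2: _ => [//|i y z _ <-]; exact: hl.
rewrite inSE; split=> [[y ->]|[c ->]]; last by exists (\sum_i c i *: x i).
by have [c ->] := hx y; exists c.
Qed.

Lemma inS_conductor f : m f -> exists k : nat, forall i, inS e (f ^+ k *: 'X_i).
Proof.
move=> mf; have [k hk] := conductor_power basis_e regA mf; exists k => i.
apply/inSE; have [x _ ex] := hk (delta_mx 0 i); exists x; rewrite ex /linear_form.
rewrite (bigD1 i) //= !mxE !eqxx mulr1 big1 ?addr0 // => l hl.
by rewrite !mxE (negbTE hl) mulr0 scale0r.
Qed.

Lemma residue_avoid (K : fieldType) (c : {rmorphism A -> K}) : injective c -> infinite_residue_field m ->
  forall s : seq K, (forall z, z \in s -> (c @` [set: A]) z) ->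
  exists2 x, (c @` [set: A]) x & forall z, z \in s -> ~ (c @` m) (x - z).
Proof.
move=> c_inj hinf s hs; apply: contrapT => hno; apply: hinf.
have [hB _ [[[_ sm] _ _] _] _ _] := regA.
have [s' es] : exists s', s = map c s'.
  elim: s hs {hno} => [|z s IH] hs; first by exists [::].
  have [|s' ->] := IH; first by move=> y hy; apply: hs; rewrite inE hy orbT.
  by have [|x _ <-] := hs z; [rewrite inE eqxx|exists (x :: s')].
apply: (@sub_finite_set _ _ [set [set a + x | x in m] | a in [set` s']]); last exact/finite_image/finite_seq.
move=> _ [a _ <-]; have [z [zs hz]] : exists z, z \in s' /\ m (a - z).
  apply: contrapT => hno'; apply: hno; exists (c a); first alg.
  rewrite es => _ /mapP[z zs ->] [x mx]; rewrite -rmorphB => /c_inj ex.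
  by apply: hno'; exists z; rewrite -ex.
exists z => //; apply/seteqP; split=> _ [x mx <-].
  exists (x - (a - z)); first exact: (smB hB sm).
  ring.
exists (x + (a - z)); first exact: (smD sm).
ring.
Qed.

End Conclusion.

Theorem theorem5p1 (A : idomainType) (m : set A)
  (regA : regular_local [set: A] m 2)
  (resA : infinite_residue_field m)
  (M : lmodType A) (fgM : fin_gen M) (tfM : torsion_free M)
  (M_neq0 : exists x : M, x != 0)
  (r : nat) (e : 'I_r -> dual (dual M)) (basis_e : free_basis e) :
  let MS := inS e in
  let cond1 := Rees_buchsbaum m MS /\ ratliff_rush MS = Mbar MS 1 in
  let cond2 := Rees_buchsbaum m MS /\ Proj_normal MS in
  let cond3 :=
    (forall a x, m a -> Mbar MS 1 x -> MS (a *: x)) /\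
    mulset (@scalars A r) MS (Mbar MS 1) = Mpow MS 2 in
  [/\ cond1 <-> cond2, cond2 <-> cond3
    & cond3 ->
      (forall (s : nat) (f : 'I_s -> {mpoly A[r]}),
         homogeneous_generators m MS f ->
         H1_concentrated MS f 1 /\ H1_deg_iso MS f 1 (Mbar MS 1) MS) /\
      (forall n : nat, (2 <= n)%N -> Mbar MS n = Mpow MS n)].
Proof.
pose j := (@FracField.tofrac {mpoly A[r]} : {rmorphism {mpoly A[r]} -> {fraction {mpoly A[r]}}}).
have j_inj : injective j by move=> p p' /eqP; rewrite tofrac_eq => /eqP.
have j_frac := @fraction_quotient {mpoly A[r]} : forall z, exists p q, q != 0 /\ z = j p / j q.
have [q [G [G1 GE]]] := inS_generated basis_e fgM; have cond f := inS_conductor regA basis_e (f := f).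
have c_inj := cst_inj j_inj; have [a [b hr]] := image_reg2 c_inj regA.
have hm : prime_ideal [set: A] m.
  have [hB /(noetherianE hB) hN hl _ _] := regA; exact: local_prime hB hN hl.
have [u [dl [d [h1 h2 h3 [h4 h5 h6]]]]] := reduction_data j_inj G1 GE cond hr (residue_avoid regA c_inj resA).
have [E1 E2 E3] := equivalences j_inj j_frac G1 GE cond hr h1 h2 h3 h4 h5 h6 hm.
move=> MS cond1 cond2 cond3; split.
- split=> -[hB h]; first by have [] := E1 (E2 hB h).
  by have [] := E1 (E3 hB h).
- split=> [[hB h]|h]; first exact: E3 hB h.
  by have [] := E1 h.
move=> h; have [C1 C2 C3 C4] := consequences j_inj j_frac G1 GE cond hr h1 h2 h3 h4 h5 h6 hm h.
split=> // s f hf; have Mp1 := Mpow1 j_inj G1 GE.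
have max0 : exists2 c, Rees_max m MS c & c != 0.
  have [_ _ hl en [a0 _]] := hr; have : (cst j @` m) a by rewrite en; apply: lc_gen; [case: hr|rewrite inE eqxx].
  move=> [x mx ex]; exists x%:MP; first by apply: sub_span; left; exists x.
  by apply: contraNneq a0 => x0; rewrite -ex /cst /= x0 rmorph0.
split.
- exact: (cohomology_concentrated (Rees_subring _) C2 C3 (fun z => @C4 s f z) max0 hf).
- exact: (cohomology_iso (Rees_subring _) Mp1 C3 (fun z => @C4 s f z) max0 hf).
Qed.
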